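(* Let $(a_k)_{k\ge 0}$ and $(b_k)_{k\ge 0}$ be two mutually independent sequences, each consisting of i.i.d. standard Gaussian random variables. For $n\ge 1$ let $Z_n$ be the number of zeros on $[0,2\pi]$ of the process $$h_n(x)=\frac{1}{\sqrt n}\sum_{k=0}^{n-1}\bigl(a_k\cos(kx)+b_k\sin(kx)\bigr).$$ Then, as $n\to+\infty$, $$\frac{Z_n-\mathbb E[Z_n]}{\sqrt{\mathrm{Var}(Z_n)}}\longrightarrow\mathcal N(0,1)\quad\text{in distribution}.$$ Moreover, for every $p\ge 2$ there is a constant $C_p$ such that for every positive integer $n$ and every $\omega>0$, $$\mathbb P\bigl(|Z_n-\mathbb E[Z_n]|\ge n\omega\bigr)\le\frac{C_p}{(\sqrt n\,\omega)^p}.$$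
   Context: $\mathcal N(0,1)$ is the standard Gaussian distribution. *)

(* Defs.v *)
From HB Require Import structures.
From mathcomp Require Import all_boot all_order all_algebra finmap lra.
From mathcomp Require Import all_classical all_reals all_analysis measurable_realfun.

Set Implicit Arguments.
Unset Strict Implicit.
Unset Printing Implicit Defensive.

Import Order.TTheory GRing.Theory Num.Theory.
Import numFieldNormedType.Exports.

Local Open Scope classical_set_scope.
Local Open Scope ring_scope.

Section independence.
Context d (T : measurableType d) (R : realType) (P : probability T R).

Definition mutually_independent (I : choiceType) (X : I -> {RV P >-> R}) :=
  forall (J : {fset I}) (B : I -> set R), (forall i, measurable (B i)) ->
    P (\bigcap_(i in [set` J]) X i @^-1` B i) =
    (\prod_(i <- J) P (X i @^-1` B i))%E.

Definition sigma_of (I : choiceType) (X : I -> {mfun T >-> R}) : set (set T) :=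
  <<s \bigcup_i preimage_set_system setT (X i) (@measurable _ R) >>.

Definition independent_families (I J : choiceType)
    (X : I -> {RV P >-> R}) (Y : J -> {RV P >-> R}) :=
  forall A B : set T, sigma_of X A -> sigma_of Y B ->
    P (A `&` B) = (P A * P B)%E.

(* The laws are compared on Borel sets only: off them the values of
   [distribution] and [normal_prob] carry no meaning. *)
Definition std_gaussian (X : {RV P >-> R}) :=
  forall B : set R, measurable B -> distribution P X B = normal_prob 0 1 B.

Definition iid_std_gaussian (X : nat -> {RV P >-> R}) :=
  mutually_independent X /\ forall k, std_gaussian (X k).

Definition cvg_in_distribution (X : nat -> {RV P >-> R})
    (mu : probability (measurableTypeR R) R) :=
  forall f : R -> R, continuous f -> bounded_fun f ->
    ('E_P[f \o X n] @[n --> \oo] --> \int[mu]_x (f x)%:E)%E.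

End independence.

Arguments mutually_independent {d T R} P {I} X.
Arguments independent_families {d T R} P {I J} X Y.
Arguments std_gaussian {d T R} P X.
Arguments iid_std_gaussian {d T R} P X.
Arguments cvg_in_distribution {d T R} P X mu.

(* An infinite zero set is given the value 0, as [fine +oo = 0].  For a
   trigonometric polynomial this happens only if the polynomial is identically
   zero, which for the random polynomials below is a null event. *)
Definition nb_zeros (R : realType) (f : R -> R) : R :=
  fine (counting [set x : R | 0 <= x <= pi *+ 2 /\ f x = 0]).

Section zero_count.
Context d (T : measurableType d) (R : realType).
Variables (h : R -> T -> R).
Hypothesis mh : forall x, measurable_fun setT (h x).
Hypothesis ch : forall w, continuous (h ^~ w).

Let E (p q : R) := [set w | exists2 x, p <= x <= q & h x w = 0].

Let mE p q : measurable (E p q).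
Proof.
have [pq|qp] := leP p q; last first.
  suff -> : E p q = set0 by exact: measurable0.
  apply/seteqP; split => // w [x /andP[px xq] _].
  by move: (le_trans px xq); rewrite leNgt qp.
pose cl (y : R) := Num.min q (Num.max p y).
have clI y : p <= cl y <= q.
  by rewrite /cl le_min pq le_max lexx /= ge_min lexx.
have clE y : p <= y <= q -> cl y = y.
  by case/andP => py yq; rewrite /cl (max_r py) (min_r yq).
have clc : continuous cl.
  move=> y; apply: (@continuous_min _ _ (cst q) (fun y => Num.max p y)).
    exact: cst_continuous.
  apply: (@continuous_max _ _ (cst p) id); first exact: cst_continuous.
  by [].
have -> : E p q = \bigcap_l \bigcup_(r : rat)
    [set w | `|h (cl (ratr r)) w| < l.+1%:R^-1].
  apply/seteqP; split => w /=.
    case=> x xpq hx l _.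
    pose O : set R := [set y | `|h (cl y) w| < l.+1%:R^-1].
    have oO : open O.
      rewrite (_ : O = (fun y => `|h (cl y) w|) @^-1` [set z | z < l.+1%:R^-1])//.
      apply: open_comp; last exact: open_lt.
      move=> y _; apply: (@continuous_comp _ _ _ (h ^~ w \o cl) Num.norm).
        by apply: (@continuous_comp _ _ _ cl); [exact: clc|exact: ch].
      exact: norm_continuous.
    have [r [Or [r' _ r'E]]] : O `&` [set ratr r | r in [set: rat]] !=set0.
      apply: dense_rat => //; exists x.
      by rewrite /O/= clE// hx normr0 invr_gt0.
    by exists r' => //=; rewrite r'E.
  move=> H.
  have [c cI cmin] : exists2 c, c \in `[p, q] &
      forall t, t \in `[p, q] -> `|h c w| <= `|h t w|.
    apply: (@EVT_min _ (fun x => `|h x w|)) => //.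
    apply: continuous_subspaceT => y.
    apply: (@continuous_comp _ _ _ (h ^~ w) Num.norm); first exact: ch.
    exact: norm_continuous.
  exists c; first by rewrite in_itv/= in cI.
  apply/eqP; rewrite -normr_le0 leNgt; apply/negP => hc0.
  have [l hl] : exists l : nat, l.+1%:R^-1 < `|h c w|.
    exists (Num.truncn `|h c w|^-1).
    by rewrite invf_plt ?posrE// truncnS_gt.
  have [r _ /=] := H l I; apply/negP; rewrite -leNgt.
  by rewrite (le_trans (ltW hl))// cmin// in_itv/= clI.
apply: bigcapT_measurable => l; apply: bigcupT_measurable_rat => r.
rewrite -[X in measurable X]setTI.
have mr : measurable_fun setT
    (fun w => `|h (cl (ratr r)) w| < l.+1%:R^-1 : bool).
  apply: measurable_fun_ltr; last exact: measurable_cst.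
  by apply: measurableT_comp => //; exact: mh.
rewrite (_ : [set w | _] = (fun w => `|h (cl (ratr r)) w| < l.+1%:R^-1) @^-1`
  [set true]); first exact: mr.
by apply/seteqP; split => w.
Qed.

Let A m j := \bigcup_l E (Num.max 0 (j%:R / m.+1%:R))
  (Num.min (pi *+ 2) (j.+1%:R / m.+1%:R - l.+1%:R^-1)).

Let AE m j w : A m j w <-> exists x : R, [/\ 0 <= x <= pi *+ 2, h x w = 0 &
  j%:R / m.+1%:R <= x < j.+1%:R / m.+1%:R].
Proof.
split.
  case=> l _ [x]; rewrite ge_max le_min => /andP[/andP[x0 jx] /andP[x2 xl]] hx.
  exists x; rewrite x0 x2 jx; split => //=.
  by rewrite (le_lt_trans xl)// ltrBlDr ltrDl invr_gt0.
case=> x [/andP[x0 x2] hx /andP[jx xj]].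
exists (Num.truncn (j.+1%:R / m.+1%:R - x)^-1) => //; exists x => //.
rewrite ge_max le_min x0 jx x2/= lerBrDr -lerBrDl.
by rewrite ltW// invf_plt ?posrE ?subr_gt0// truncnS_gt.
Qed.

Let Z w := [set x : R | 0 <= x <= pi *+ 2 /\ h x w = 0].

(* [S m] counts the cells of length 1/(m+1) that contain a zero; the
   number of zeros is the supremum of [S m] over [m]. *)
Let S m w : \bar R := (\sum_(j < (m.+1 * m.+1)%N) (\1_(A m j) w)%:E)%E.

Let SE m w :
  S m w = (#|[set j : 'I_(m.+1 * m.+1)%N | `[< A m j w >]]%SET|%:R)%:E.
Proof.
rewrite /S sumEFin -sum1_card natr_sum [in RHS]big_mkcond/=; congr EFin.
apply: eq_bigr => j _; rewrite finset.in_set indicE.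
by case: asboolP => [Aj|nAj]; [rewrite mem_set|rewrite memNset].
Qed.

Let floor_sep m (i j : nat) (x : R) : i%:R / m.+1%:R <= x < i.+1%:R / m.+1%:R ->
  j%:R / m.+1%:R <= x < j.+1%:R / m.+1%:R -> i = j.
Proof.
rewrite !ler_pdivrMr// !ltr_pdivlMr// => /andP[ix xi] /andP[jx xj].
have := le_lt_trans ix xj; have := le_lt_trans jx xi.
by rewrite !ltr_nat !ltnS => ji ij; apply/eqP; rewrite eqn_leq ij.
Qed.

Let S_le m w : (S m w <= counting (Z w))%E.
Proof.
rewrite SE /counting; case: asboolP => [fZ|]; last by rewrite leey.
rewrite lee_fin ler_nat.
have /choice[f fP] : forall j : 'I_(m.+1 * m.+1)%N, exists x : R, A m j w ->
    [/\ 0 <= x <= pi *+ 2, h x w = 0 & j%:R / m.+1%:R <= x < j.+1%:R / m.+1%:R].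
  move=> j; have [/AE[x Hx]|nA] := pselect (A m j w); first by exists x.
  by exists 0.
set J := [set j | _]%SET.
have JA j : j \in J -> A m j w by rewrite finset.in_set => /asboolP.
have finj : {in J &, injective f}.
  move=> i j /JA/fP[_ _ Hi] /JA/fP[_ _ Hj] fij; apply/val_inj/(floor_sep Hi).
  by rewrite fij.
rewrite cardE -(size_map f); apply: uniq_leq_size.
  rewrite map_inj_in_uniq ?enum_uniq// => i j.
  by rewrite !mem_enum; exact: finj.
move=> y /mapP[j]; rewrite mem_enum => /JA/fP[x2 hx _] ->.
by rewrite in_fset_set// inE.
Qed.

Let S_ge w (F : {fset R}) : [set` F] `<=` Z w ->
  exists m, ((#|` F|)%:R%:E <= S m w)%E.
Proof.
move=> FZ.
pose M : R := \sum_(x <- F) \sum_(y <- F) `|x - y|^-1.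
have M_ge x y : x \in F -> y \in F -> `|x - y|^-1 <= M.
  move=> xF yF; rewrite /M (big_fsetD1 x)//= (big_fsetD1 y)//=.
  rewrite -addrA lerDl addr_ge0//; first exact: sumr_ge0.
  by apply: sumr_ge0 => i _; exact: sumr_ge0.
have M0 : 0 <= M by apply: sumr_ge0 => i _; exact: sumr_ge0.
pose m := Num.truncn (M + pi *+ 2).
have mM : M + pi *+ 2 < m.+1%:R by exact: truncnS_gt.
exists m; rewrite SE lee_fin ler_nat.
have pi0 : 0 <= pi *+ 2 :> R by rewrite mulrn_wge0// pi_ge0.
have FP x : x \in F -> exists j : 'I_(m.+1 * m.+1)%N,
    j%:R / m.+1%:R <= x < j.+1%:R / m.+1%:R.
  move=> xF; have [/andP[x0 x2] _] := FZ _ xF.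
  have xm0 : 0 <= x * m.+1%:R by rewrite mulr_ge0.
  have jm : (Num.truncn (x * m.+1%:R) < m.+1 * m.+1)%N.
    rewrite -(ltr_nat R) natrM (@le_lt_trans _ _ (x * m.+1%:R)) ?truncn_le//.
    by rewrite ltr_pM2r// (le_lt_trans _ mM)// (le_trans x2)// lerDr.
  exists (Ordinal jm); rewrite /= ler_pdivrMr// ltr_pdivlMr//.
  by apply/andP; split; [rewrite truncn_le|exact: truncnS_gt].
have /choice[g gP] : forall x, exists j : 'I_(m.+1 * m.+1)%N, x \in F ->
    j%:R / m.+1%:R <= x < j.+1%:R / m.+1%:R.
  move=> x; have [xF|xF] := boolP (x \in F); last by exists ord0.
  by have [j jP] := FP x xF; exists j.
have ginj : {in F &, injective g}.
  move=> x y xF yF gxy; apply/eqP/negPn/negP => xy.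
  have := gP x xF; have := gP y yF; rewrite gxy.
  rewrite !ler_pdivrMr// !ltr_pdivlMr// => /andP[jy yj] /andP[jx xj].
  have : `|x - y| * m.+1%:R < 1.
    rewrite -[m.+1%:R]ger0_norm// -normrM mulrBl ltr_norml; apply/andP; split.
      by rewrite -natr1 in yj; lra.
    by rewrite -natr1 in xj; lra.
  apply/negP; rewrite -leNgt -ler_pdivrMl ?normr_gt0 ?subr_eq0//.
  by rewrite mulr1 (le_trans (M_ge _ _ xF yF))// ltW// (le_lt_trans _ mM)// lerDl.
rewrite [leqRHS]cardE -(size_map g); apply: uniq_leq_size.
  by rewrite map_inj_in_uniq.
move=> y /mapP[x xF ->]; rewrite mem_enum finset.in_set; apply/asboolP/AE.
by exists x; have [? ?] := FZ _ xF; split => //; exact: gP.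
Qed.

Lemma measurable_nb_zeros : measurable_fun setT (fun w => nb_zeros (h ^~ w)).
Proof.
have mS : measurable_fun setT (fun w => esups (S ^~ w) 0).
  apply: measurable_fun_esups => m.
  apply: emeasurable_sum => j; apply/measurable_EFinP.
  apply: measurable_indic; apply: bigcupT_measurable => l; exact: mE.
rewrite /nb_zeros; apply: measurableT_comp => //.
apply: eq_measurable_fun mS => w _.
rewrite /esups /sdrop/= -/(Z w); apply/eqP.
rewrite eq_le; apply/andP; split.
  by apply: ge_ereal_sup => _ [m _ <-]; exact: S_le.
rewrite /counting; case: asboolP => [fZ|iZ].
  have [|m Hm] := @S_ge w (fset_set (Z w)); first by rewrite fset_setK.
  by apply: (le_trans Hm); apply: ereal_sup_ubound; exists m.
rewrite leye_eq; apply/eqP/eqyP => r r0.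
have [F FZ nF] := infinite_set_fset (Num.truncn r).+1 iZ.
have [m Hm] := S_ge FZ.
apply: (@le_trans _ _ (S m w)); last by apply: ereal_sup_ubound; exists m.
apply: le_trans Hm; rewrite lee_fin (le_trans (ltW (truncnS_gt r)))//.
by rewrite ler_nat.
Qed.

End zero_count.

Section trigonometric_zeros.
Context d (T : measurableType d) (R : realType).
Variables (a b : nat -> {mfun T >-> R}) (n : nat).

Definition trig_process (x : R) (w : T) : R :=
  (Num.sqrt n%:R)^-1 *
  \sum_(k < n) (a k w * cos (k%:R * x) + b k w * sin (k%:R * x)).

Definition trig_zeros (w : T) : R := nb_zeros (trig_process ^~ w).

Lemma measurable_trig_zeros : measurable_fun setT trig_zeros.
Proof.
apply: measurable_nb_zeros => [x|w].
  apply: measurable_funM => //; apply: measurable_sum => k.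
  by apply: measurable_funD; apply: measurable_funM.
have cm (k : nat) : continuous ( *%R k%:R : R -> R) by exact: mulrl_continuous.
have cc (k : nat) : continuous (cos \o *%R k%:R : R -> R).
  by move=> x; apply: continuous_comp; [exact: cm|exact: continuous_cos].
have cs (k : nat) : continuous (sin \o *%R k%:R : R -> R).
  by move=> x; apply: continuous_comp; [exact: cm|exact: continuous_sin].
move=> x; apply: cvgMl_tmp; apply: cvg_big => [|k _]; first exact: add_continuous.
by apply: cvgD; apply: cvgMl_tmp; [exact: cc|exact: cs].
Qed.

HB.instance Definition _ := isMeasurableFun.Build _ _ _ _ trig_zeros
  measurable_trig_zeros.

End trigonometric_zeros.

Section standardization.
Context d (T : measurableType d) (R : realType) (P : probability T R).
Variable X : {RV P >-> R}.

Definition standardize (w : T) : R :=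
  (X w - fine 'E_P[X]) / Num.sqrt (fine 'V_P[X]).

Lemma measurable_standardize : measurable_fun setT standardize.
Proof. by apply: measurable_funM => //; apply: measurable_funB. Qed.

HB.instance Definition _ := isMeasurableFun.Build _ _ _ _ standardize
  measurable_standardize.

End standardization.

Arguments standardize {d T R} P X w.

(* Main.v *)
(** The coefficient vector is standard Gaussian, [h] is stationary, and the zeros are approximated
by the number [N_Q] of sign changes on the grid of mesh [2 pi/(n Q)]. Replacing [k] adjacent cells by
one loses only pairs of sign changes, so the levels [Q = 8 2^k] telescope. At each level the cells split
into [Q] classes of blocks [(h(t-s), h(t), h(t+s))] whose times differ by multiples of [2 pi/n]; the
blocks of a class form a frame with an absolute constant, and a Gaussian semigroup argument gives a
generalised Hoelder inequality, hence exponential moments for each level. Summing the levels up to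
[Q ~ n^(1/3)] bounds the tails, since the zeros missed beyond that mesh need [h] and [h'] to be
simultaneously small. The variance is at least [c n] by the Hammersley-Chapman-Robbins inequality for
a rescaling of half of the coefficients. For fixed [Q], [N_Q] is approximated in [L^2] by a smooth
function [f] of the Gaussian vector; interpolating along the semigroup, and applying the Poincare
inequality to [|grad f|^2], shows that [f] is nearly Gaussian when [grad f] is bounded and has a small
Lipschitz constant. *)

Require Import Defs.
From HB Require Import structures.
From mathcomp Require Import all_boot all_order all_algebra.
From mathcomp Require Import all_classical all_reals all_analysis.
From mathcomp Require Import measurable_realfun ring lra zify.
From mathcomp Require complex.

Set Implicit Arguments.
Unset Strict Implicit.
Unset Printing Implicit Defensive.

Import Order.TTheory GRing.Theory Num.Theory.
Import numFieldNormedType.Exports.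

Local Open Scope classical_set_scope.
Local Open Scope ring_scope.

(** The obstacle is uniformity in the mesh. At mesh 2 pi/(n Q) the Q classes of cells can only be
    separated by convexity, which costs a factor Q^2; this is affordable because a pair of sign
    changes inside one cell has probability O(Q^-3), so the correction at level Q has variance
    O(n/Q), summable over dyadic Q. Within a class the three vectors of a block become collinear as
    Q grows, but both frame bounds scale alike when expressed by value, first and second difference,
    hence the absolute constant 2160. Exponential moments at the scale 1/sqrt n are carried up to Q
    of order n^(1/3), where the remaining bias n Q^(-3/2) is of order sqrt n. All semigroup
    arguments are discrete: N steps of variance 1/N with an error N^(-3/2) each, so nothing is
    differentiated under the integral. For the variance, rescaling all coefficients would leave the
    zeros fixed; rescaling the low frequencies alone shifts the mean square frequency. Convergence
    in law is tested on cosines and extended to continuous functions by Bernstein polynomials in a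
    slow sine, with a second moment bound in place of tightness. *)

Notation msr := (measurable_fun [set: _]).
Notation bdd f M := (forall x, is_true (`|f x| <= M)).
Notation le_via x := (@le_trans _ _ x).

Lemma eq_ler (R : numDomainType) (x y : R) : x = y -> x <= y.
by move=> ->. Qed.

Lemma sqr_normr (R : realDomainType) (x : R) : `|x|^+2 = x^+2.
by rewrite real_normK ?num_real. Qed.

Lemma ler_normB_via (R : numDomainType) (x y z : R) : `|x| + `|y| <= z -> `|x-y| <= z.
exact/le_trans/ler_normB. Qed.

Lemma ler_normD_via (R : numDomainType) (x y z : R) : `|x| + `|y| <= z -> `|x+y| <= z.
exact/le_trans/ler_normD. Qed.

Ltac mR := repeat first [exact: measurable_cst | exact: measurable_id
 | exact: measurable_fst | exact: measurable_snd | assumption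
 | apply: measurable_funD | apply: measurable_funB | apply: measurable_funM
 | apply: measurable_funX ].

(** * Expectations of real functions: linearity, domination, Jensen, Cauchy-Schwarz *)

Section expectation.
Context d (T : measurableType d) (R : realType) (mu : probability T R).
Implicit Types f g : T -> R.

Definition Ex f : R := \int[mu]_x f x.

Definition intg f := mu.-integrable setT (EFin \o f).

Lemma intg_meas f : intg f -> msr f.
by move=> /integrableP[/measurable_EFinP]. Qed.

Lemma intg_le f g : msr f -> (forall x, `|f x| <= g x) ->
 intg g -> intg f.
move=> mf fg; apply: le_integrable => //; first exact/measurable_EFinP.
by move=> x _; rewrite /= lee_fin (le_trans (fg x))// ler_norm.
Qed.

Lemma intg_cst c : intg (fun=> c).
exact: finite_measure_integrable_cst. Qed.

Lemma intg_bounded f (M : R) : msr f -> bdd f M ->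
 intg f.
by move=> mf fM; apply: (intg_le mf fM); exact: intg_cst. Qed.

Lemma intgD f g : intg f -> intg g -> intg (fun x => f x+g x).
by move=> If Ig; exact: (integrableD measurableT If Ig). Qed.

Lemma intgZ c f : intg f -> intg (fun x => c*f x).
by move=> If; exact: (integrableZl measurableT c If). Qed.

Lemma intgB f g : intg f -> intg g -> intg (fun x => f x-g x).
by move=> If Ig; exact: (integrableB measurableT If Ig). Qed.

Lemma intg_sum I (s : seq I) (P : pred I) (f : I -> T -> R) :
 (forall i, P i -> intg (f i)) -> intg (fun x => \sum_(i <- s | P i) f i x).
move=> If; rewrite /intg.
rewrite (_ : _ \o _ = (fun x => \sum_(i <- s | P i) (f i x)%:E)%E).
 exact: (@integrable_sum _ _ _ mu setT measurableT I s P (fun i x => (f i x)%:E)).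
by apply/funext => x /=; rewrite sumEFin.
Qed.

Lemma intg_abs f : intg f -> intg (fun x => `|f x|).
by move=> If; exact: integrable_norm. Qed.

Lemma Ex_eq f g : f =1 g -> Ex f = Ex g.
by move=> fg; congr Ex; exact/funext. Qed.

Lemma ExD f g : intg f -> intg g -> Ex (fun x => f x+g x) = Ex f+Ex g.
by move=> If Ig; exact: RintegralD. Qed.

Lemma ExB f g : intg f -> intg g -> Ex (fun x => f x-g x) = Ex f-Ex g.
by move=> If Ig; exact: RintegralB. Qed.

Lemma ExZ c f : intg f -> Ex (fun x => c*f x) = c*Ex f.
by move=> If; exact: RintegralZl. Qed.

Lemma ExN f : intg f -> Ex (fun x => - f x) = - Ex f.
move=> If; rewrite -[RHS]mulN1r -ExZ//.
by apply: Ex_eq => x; rewrite mulN1r.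
Qed.

Lemma Ex_cst c : Ex (fun=> c) = c.
by rewrite /Ex Rintegral_cst//= (@probability_setT _ _ _ mu) mulr1. Qed.

Lemma Ex_sum I (s : seq I) (P : pred I) (f : I -> T -> R) :
 (forall i, intg (f i)) ->
 Ex (fun x => \sum_(i <- s | P i) f i x) = \sum_(i <- s | P i) Ex (f i).
move=> If; elim: s => [|i s IH].
 by rewrite big_nil -[RHS](Ex_cst 0); apply: Ex_eq => x; rewrite big_nil.
rewrite big_cons -IH; case: ifPn => Pi.
 rewrite -ExD//; last exact: intg_sum.
 by apply: Ex_eq => x; rewrite big_cons Pi.
by apply: Ex_eq => x; rewrite big_cons (negbTE Pi).
Qed.

Lemma Ex_le f g : intg f -> intg g -> (forall x, f x <= g x) -> Ex f <= Ex g.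
by move=> If Ig fg; apply: le_Rintegral. Qed.

Lemma Ex_ge0 f : (forall x, 0 <= f x) -> 0 <= Ex f.
by move=> f0; apply: Rintegral_ge0. Qed.

Lemma Ex_abs f : intg f -> `|Ex f| <= Ex (fun x => `|f x|).
by move=> If; exact: le_normr_Rintegral. Qed.

Lemma Ex_abs_le f g : msr f -> intg g ->
 (forall x, `|f x| <= g x) -> `|Ex f| <= Ex g.
move=> mf Ig fg; have If := intg_le mf fg Ig.
by apply: (le_trans (Ex_abs If)); apply: Ex_le => //; exact: intg_abs.
Qed.

Lemma Ex_bound f (M : R) : msr f -> bdd f M ->
 `|Ex f| <= M.
move=> mf fM; rewrite -[leRHS](Ex_cst M).
by apply: Ex_abs_le => //; exact: intg_cst.
Qed.

Lemma Ex_between f (m M : R) : msr f -> (forall x, m <= f x <= M) ->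
 m <= Ex f <= M.
move=> mf fM; have If : intg f.
 apply: (@intg_bounded f (`|m| + `|M|)) => // x.
 have /andP[h1 h2] := fM x; rewrite ler_norml.
 have := ler_norm M; have := ler_norm (- m); rewrite normrN => h3 h4.
 apply/andP; split; last by have := ler_norm (- M); have := normr_ge0 m; lra.
 by have := normr_ge0 M; lra.
rewrite -{1}(Ex_cst m) -{1}(Ex_cst M).
by apply/andP; split; apply: Ex_le => //;
 [exact: intg_cst|move=> x; have /andP[] := fM x
 |exact: intg_cst|move=> x; have /andP[] := fM x].
Qed.

Lemma Ex_cvg (f_ : nat -> T -> R) f (M : R) : (forall k, msr (f_ k)) ->
 msr f -> (forall k x, `|f_ k x| <= M) ->
 {ae mu, forall x, f_ k x @[k --> \oo] --> f x} ->
 Ex (f_ k) @[k --> \oo] --> Ex f.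
move=> mf_ mf fM cf.
have h1 : {ae mu, forall x, setT x -> (f_ k x)%:E @[k --> \oo] --> (f x)%:E}.
 by apply: filterS cf => x cx _; apply: cvg_EFin => //; exact: nearW.
have h2 : {ae mu, forall x (k : nat), setT x -> (`|(f_ k x)%:E| <= M%:E)%E}.
 by apply: aeW => x k _; rewrite /= lee_fin.
have [If _ cE] := @dominated_convergence _ _ _ mu setT measurableT
 (fun k x => (f_ k x)%:E) (EFin \o f) (cst M%:E)
 (fun k => (measurable_EFinP _ _).2 (mf_ k)) ((measurable_EFinP _ _).2 mf)
 h1 (intg_cst M) h2.
apply: fine_cvg; rewrite fineK//.
exact: integrable_fin_num If.
Qed.

Lemma Ex_indic (A : set T) : measurable A -> Ex \1_A = fine (mu A).
by move=> mA; rewrite /Ex /Rintegral integral_indic// setIT. Qed.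

Lemma ae_Ex_eq f g : msr f -> msr g ->
 {ae mu, forall x, f x = g x} -> Ex f = Ex g.
move=> mf mg fg; rewrite /Ex /Rintegral; congr fine.
apply: ae_eq_integral => //; [exact/measurable_EFinP|exact/measurable_EFinP|].
by apply: filterS fg => x -> _.
Qed.

Lemma Ex_sqr_le f (M : R) : msr f -> bdd f M ->
 Ex f^+2 <= Ex (fun x => f x^+2).
move=> mf fM; set m := Ex f.
have If : intg f := intg_bounded mf fM.
have If2 : intg (fun x => f x^+2).
 apply: (@intg_bounded _ (M^+2)) => [|x]; first exact: measurable_funX.
 by rewrite normrX lerXn2r// ?nnegrE// (le_trans _ (fM x)).
have : 0 <= Ex (fun x => (f x-m)^+2) by apply: Ex_ge0 => x; exact: sqr_ge0.
rewrite (_ : Ex _ = Ex (fun x => f x^+2)-m^+2) ?subr_ge0//.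
rewrite (@Ex_eq _ (fun x => (f x^+2-(m *+ 2)*f x)+m^+2)); last first.
 by move=> x; ring.
have ImZ : intg (fun x => m *+ 2*f x) by exact: intgZ.
rewrite (ExD (intgB If2 ImZ) (intg_cst _)) (ExB If2 ImZ) ExZ// Ex_cst -/m; ring.
Qed.

Lemma Ex_CS f g (M : R) : msr f -> msr g ->
 bdd f M -> intg (fun x => g x^+2) -> intg g ->
 Ex (fun x => f x * g x)^+2 <= Ex (fun x => f x^+2)*Ex (fun x => g x^+2).
move=> mf mg fM Ig2 Ig.
have If2 : intg (fun x => f x^+2).
 apply: (@intg_bounded _ (M^+2)) => [|x]; first exact: measurable_funX.
 by rewrite normrX lerXn2r// ?nnegrE// (le_trans _ (fM x)).
have Ifg : intg (fun x => f x * g x).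
 apply: (@intg_le _ (fun x => M * `|g x|)) => [|x|].
 - exact: measurable_funM.
 - by rewrite normrM ler_wpM2r.
 - by apply: intgZ; exact: intg_abs.
set A := Ex (fun x => f x^+2); set B := Ex (fun x => g x^+2).
set C := Ex (fun x => f x * g x).
(* Nonnegativity of E (s f - t g)^2. It is used at (C, A + 1) when B = 0, where it reads 0 <= - C^2
   (A + 2), and at (B, C) otherwise. *)
have Q (s t : R) : 0 <= s^+2*A-(s * t *+ 2)*C+t^+2*B.
 rewrite /A /B /C -!ExZ// -ExB ?intgZ// -ExD ?intgZ//; last first.
  by apply: intgB; exact: intgZ.
 apply: Ex_ge0 => x; rewrite (_ : _+_ = (s*f x-t * g x)^+2) ?sqr_ge0//.
 by ring.
have A0 : 0 <= A by apply: Ex_ge0 => x; exact: sqr_ge0.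
have B0 : 0 <= B by apply: Ex_ge0 => x; exact: sqr_ge0.
have [B00|Bn0] := eqVneq B 0.
 rewrite B00 mulr0.
 have := Q C (A+1); rewrite B00 mulr0 addr0 => h.
 have : 0 <= - (C^+2*(A+2)) by move: h; congr (_ <= _); ring.
 by rewrite oppr_ge0 pmulr_lle0//; lra.
have Bp : 0 < B by rewrite lt_neqAle eq_sym Bn0.
have := Q B C; rewrite -subr_ge0 => h.
have h' : 0 <= B*(A*B-C^+2) by move: h; congr (_ <= _); ring.
by move: h'; rewrite pmulr_rge0// subr_ge0.
Qed.

End expectation.

Notation intg_bnd M := (@intg_bounded _ _ _ _ _ M).
Arguments Ex {d T R} mu f.
Arguments intg {d T R} mu f.

(** * Automation for measurability, integrability and sign conditions *)

Ltac measurable_leaf0 := first [ exact: normr_measurable | exact: measurable_expR | exact: (continuous_measurable_fun (@continuous_cos _)) | exact: (continuous_measurable_fun (@continuous_sin _)) ].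
Ltac measurable_leaf := measurable_leaf0.
Ltac measurable_rule := fail.
Ltac intg_leaf := exact: intg_cst.
Ltac side_condition := lazymatch goal with
 | |- measurable_fun _ ?F => first
  [ assumption | match goal with H : forall _, measurable_fun _ _ |- _ => exact: H end
  | lazymatch F with
   | fun _ => ?c => exact: measurable_cst
   | fun x => (_ - _)%R => apply: measurable_funB; side_condition
   | fun x => (_ + _)%R => apply: measurable_funD; side_condition
   | fun x => (_ * _)%R => apply: measurable_funM; side_condition
   | fun x => (_ ^+ _)%R => apply: measurable_funX; side_condition
   | fun x => bigop.body _ _ _ => apply: measurable_sum; intros; side_condition
   | _ => first [ exact: measurable_id | exact: measurable_fst | exact: measurable_snd | exact: measurable_cst | solve [measurable_leaf] | (first [ apply: measurable_funD | apply: measurable_funB | apply: measurable_funM | apply: measurable_funX | apply: measurable_sum | measurable_rule ]; intros; side_condition)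
    | match F with fun x => ?F (@?G x) =>
    apply: (@measurableT_comp _ _ _ _ _ _ F _ G); [solve [assumption | measurable_leaf | (match goal with H : forall _, measurable_fun _ _ |- _ => exact: H end)]|side_condition] end ]
   end ]
 | |- intg _ _ => first [ assumption | (match goal with H : forall _, intg _ _ |- _ => exact: H end) | intg_leaf | (first [ apply: intgD | apply: intgB | apply: intgZ | apply: intg_sum ]; intros; side_condition) ]
 | |- is_true (0 <= ?e) => first
  [ assumption | apply: ltW; assumption
  | match goal with H : forall _, is_true (0 <= _) |- _ => exact: H end
  | lazymatch e with
   | Num.norm _ => exact: normr_ge0
   | (_ ^+ _)%R => first [ exact: sqr_ge0 | apply: exprn_ge0; side_condition ]
   | (_ * _)%R => apply: mulr_ge0; side_condition
   | (_ + _)%R => apply: addr_ge0; side_condition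
   | (_^-1)%R => rewrite invr_ge0; side_condition
   | (_ *+ _)%R => first [ exact: ler0n | apply: mulrn_wge0; side_condition ]
   | bigop.body _ _ _ => apply: sumr_ge0; intros; side_condition
   | _ => first [ exact: ler01 | exact: sqrtr_ge0 | exact: expR_ge0 | exact: pi_ge0
     | (first [ apply: mulr_ge0 | apply: addr_ge0 | apply: exprn_ge0 | apply: sumr_ge0 | apply: Ex_ge0 ]; intros; side_condition)
     | (rewrite invr_ge0; side_condition) | apply: ltW; side_condition ]
   end ]
 | |- is_true (0 < ?e) => first
  [ assumption | match goal with H : forall _, is_true (0 < _) |- _ => exact: H end
  | lazymatch e with
   | (_ ^+ _)%R => apply: exprn_gt0; side_condition
   | (_ * _)%R => apply: mulr_gt0; side_condition
   | (_ + _)%R => apply: addr_gt0; side_condition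
   | (_^-1)%R => rewrite invr_gt0; side_condition
   | (_ *+ _)%R => first [ exact: ltr0n | apply: addr_gt0; side_condition ]
   | Num.sqrt _ => rewrite sqrtr_gt0; side_condition
   | _ => first [ exact: ltr01 | exact: expR_gt0 | exact: pi_gt0
     | (first [ apply: mulr_gt0 | apply: addr_gt0 | apply: exprn_gt0 ]; side_condition) | (rewrite invr_gt0; side_condition) | (rewrite sqrtr_gt0; side_condition) ]
   end ]
 end.

#[global] Hint Extern 0 (measurable_fun _ _) => solve [side_condition] : core.
#[global] Hint Extern 0 (is_true (0 <= _)) => solve [side_condition] : core.
#[global] Hint Extern 0 (is_true (0 < _)) => solve [side_condition] : core.
#[global] Hint Extern 0 (is_true (in_mem _ _)) => solve [rewrite nnegrE; side_condition | rewrite posrE; side_condition] : core.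
#[global] Hint Extern 0 (is_true (negb _)) => solve [apply: lt0r_neq0; side_condition] : core.
#[global] Hint Extern 0 (intg _ _) => solve [side_condition] : core.

(** * Fubini for bounded functions and equality of laws *)

Section fubini_bounded.
Context d1 d2 (T1 : measurableType d1) (T2 : measurableType d2) (R : realType).
Variables (m1 : probability T1 R) (m2 : probability T2 R).
Implicit Types f : T1*T2 -> R.

Lemma intg_prod_bounded f (M : R) : msr f ->
 bdd f M -> (m1 \x m2)%E.-integrable setT (EFin \o f).
by move=> mf fM; exact: (@intg_bounded _ _ _ (m1 \x m2)%E f M). Qed.

Lemma msr_curry1 f x : msr f ->
 msr (fun y => f (x, y)).
by move=> mf; apply: measurableT_comp mf _; exact: pair1_measurable. Qed.

Lemma measurable_curry2 f y : msr f ->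
 msr (fun x => f (x, y)).
by move=> mf; apply: measurableT_comp mf _; exact: pair2_measurable. Qed.

Lemma Ex_prodE f : (m1 \x m2)%E.-integrable setT (EFin \o f) ->
 (forall x, intg m2 (fun y => f (x, y))) ->
 Ex (m1 \x m2)%E f = Ex m1 (fun x => Ex m2 (fun y => f (x, y))).
move=> If If2; rewrite /Ex /Rintegral -integral12_prod_meas1//; congr fine.
apply: eq_integral => x _; rewrite /fubini_F fineK//.
exact: integrable_fin_num (If2 x).
Qed.

Lemma msr_Ex_snd f (M : R) : msr f ->
 bdd f M -> msr (fun x => Ex m2 (fun y => f (x, y))).
move=> mf fM; have If := intg_prod_bounded mf fM.
have mF := measurable_fubini_F If.
exact: (@measurableT_comp _ _ _ _ _ _ fine).
Qed.

Lemma Ex_prod f (M : R) : msr f -> bdd f M ->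
 Ex (m1 \x m2)%E f = Ex m1 (fun x => Ex m2 (fun y => f (x, y))).
move=> mf fM; apply: Ex_prodE; first exact: intg_prod_bounded mf fM.
by move=> x; apply: (intg_bnd M) => //; exact: msr_curry1.
Qed.

Lemma Ex_swap f (M : R) : msr f -> bdd f M ->
 Ex m1 (fun x => Ex m2 (fun y => f (x, y))) =
 Ex m2 (fun y => Ex m1 (fun x => f (x, y))).
move=> mf fM; have If := intg_prod_bounded mf fM.
rewrite -(Ex_prod mf fM) /Ex /Rintegral -integral21_prod_meas1//; congr fine.
apply: eq_integral => y _; rewrite /fubini_G fineK//.
apply: integrable_fin_num => //.
by apply: (intg_bnd M) => //; exact: measurable_curry2.
Qed.

End fubini_bounded.

Section eqlaw.
Context d1 d2 d3 (T1 : measurableType d1) (T2 : measurableType d2)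
 (T3 : measurableType d3) (R : realType).
Variables (m1 : probability T1 R) (m2 : probability T2 R).

(** Equality of the laws of [phi] and [psi], tested on bounded functions only: this is the form that
    Fubini computations deliver. [eqlaw_intg] extends it to integrable functions. *)
Definition eqlaw (phi : T1 -> T3) (psi : T2 -> T3) :=
 forall (f : T3 -> R) (M : R), msr f -> bdd f M ->
 Ex m1 (f \o phi) = Ex m2 (f \o psi).

Lemma eqlaw_measure phi psi A : msr phi -> msr psi ->
 eqlaw phi psi -> measurable A -> m1 (phi @^-1` A) = m2 (psi @^-1` A).
move=> mphi mpsi E mA.
have m1A : measurable (phi @^-1` A) by rewrite -[X in measurable X]setTI; exact: mphi.
have m2A : measurable (psi @^-1` A) by rewrite -[X in measurable X]setTI; exact: mpsi.
have := E \1_A 1 (measurable_indic mA).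
rewrite (_ : \1_A \o phi = \1_(phi @^-1` A))// (_ : \1_A \o psi = \1_(psi @^-1` A))//.
rewrite !Ex_indic// => /(_ _) H.
rewrite -(fineK (fin_num_measure m1 _ m1A)) -(fineK (fin_num_measure m2 _ m2A)) H// => x.
by rewrite indicE; case: (_ \in _); rewrite ?normr1 ?normr0.
Qed.

Lemma eqlaw_ge0_integral phi psi (f : T3 -> \bar R) :
 msr phi -> msr psi ->
 eqlaw phi psi -> msr f -> (forall x, 0 <= f x)%E ->
 (\int[m1]_x f (phi x) = \int[m2]_x f (psi x))%E.
move=> mphi mpsi E mf f0.
have H1 := @ge0_integral_pushforward _ _ _ _ R phi mphi m1 setT f.
have H2 := @ge0_integral_pushforward _ _ _ _ R psi mpsi m2 setT f.
transitivity (\int[pushforward m1 phi]_y f y)%E; first by rewrite H1.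
transitivity (\int[pushforward m2 psi]_y f y)%E; last by rewrite H2.
apply: eq_measure_integral => A mA _; exact: eqlaw_measure.
Qed.

Lemma eqlaw_intg phi psi (f : T3 -> R) :
 msr phi -> msr psi ->
 eqlaw phi psi -> msr f -> intg m2 (f \o psi) ->
 intg m1 (f \o phi) /\ Ex m1 (f \o phi) = Ex m2 (f \o psi).
move=> mphi mpsi E mf I2.
have I1 : intg m1 (f \o phi).
 apply/integrableP; split.
  by apply/measurable_EFinP; exact: measurableT_comp.
 have /integrableP[_] := I2; rewrite /=.
 rewrite (eqlaw_ge0_integral mphi mpsi E (f := fun y => (`|f y|%R)%:E))//.
 by apply/measurable_EFinP.
split => //; rewrite /Ex /Rintegral; congr fine.
have mEf : msr (EFin \o f) by exact/measurable_EFinP.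
rewrite [LHS](_ : _ = \int[pushforward m1 phi]_y (f y)%:E)%E; last first.
 by rewrite (integral_pushforward mphi mEf).
rewrite [RHS](_ : _ = \int[pushforward m2 psi]_y (f y)%:E)%E; last first.
 by rewrite (integral_pushforward mpsi mEf).
apply: eq_measure_integral => A mA _; exact: eqlaw_measure.
Qed.

End eqlaw.
Arguments eqlaw {d1 d2 d3 T1 T2 T3 R}.

(** * Invariance of Lebesgue measure under shifts and plane rotations *)

Section lebesgue_affine.
Variable R : realType.
Notation gR := (measurableTypeR R).
Notation mu := (@lebesgue_measure R).
Local Open Scope ereal_scope.

Lemma lebesgue_measure_shift (c : R) (A : set gR) : measurable A ->
 mu ((fun x : gR => x+c)%R @^-1` A) = mu A.
have mf : msr (fun x : gR => (x+c)%R : gR) by [].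
move=> mA; apply/esym.
apply: (@lebesgue_measure_unique R (pushforward mu (fun x : gR => (x+c)%R : gR))) => //.
move=> X [[a b]] _ <-; rewrite /pushforward.
change (mu `](a, b).1, (a, b).2] =
 mu ((fun x : gR => (x+c)%R : gR) @^-1` `](a, b).1, (a, b).2]%classic)).
rewrite /= (_ : (fun x => x+c)%R @^-1` _ = `](a-c)%R, (b-c)%R]%classic); last first.
 by apply/seteqP; split => x /=; rewrite !in_itv/= ltrBlDr lerBrDr.
rewrite !lebesgue_measure_itv/= !lte_fin ltrD2r.
by case: ifP => // _; rewrite -!EFinB; congr EFin; ring.
Qed.

Lemma ge0_integral_shift (c : R) (f : gR -> \bar R) : msr f ->
 (forall x, 0 <= f x) -> \int[mu]_x f (x+c)%R = \int[mu]_x f x.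
move=> mf f0.
have mc : msr (fun x : gR => (x+c)%R : gR) by [].
have H := @ge0_integral_pushforward _ _ _ _ R _ mc mu setT f.
transitivity (\int[pushforward mu (fun x : gR => (x+c)%R : gR)]_y f y).
 by rewrite H.
by apply: eq_measure_integral => A mA _; exact: lebesgue_measure_shift.
Qed.

(** A rotation is a product of three shears, with parameters a, s, a where a = - s/(1+c) is minus
    the tangent of the half angle; c >= 0 keeps 1+c away from 0. A shear is a translation on every
    line parallel to an axis, so shift invariance and Tonelli suffice. *)
Lemma ge0_integral_rotation (c s : R) (f : gR * gR -> \bar R) :
 (0 <= c)%R -> (c^+2+s^+2 = 1)%R -> msr f ->
 (forall x, 0 <= f x) ->
 \int[mu]_x \int[mu]_y f (c*x-s*y, s*x+c*y)%R =
 \int[mu]_x \int[mu]_y f (x, y).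
move=> c0 cs mf f0.
pose a := (- s/(1+c))%R.
have c1 : (1+c != 0)%R by rewrite gt_eqF; lra.
have shx (g : gR * gR -> \bar R) (t : R) : msr g -> (forall x, 0 <= g x) ->
  \int[mu]_x \int[mu]_y g (x+t*y, y)%R = \int[mu]_x \int[mu]_y g (x, y).
 move=> mg g0.
 have mg' : msr (fun p : gR * gR => g (p.1+t * p.2, p.2)%R) by apply: measurableT_comp mg _; apply: measurable_fun_pair.
 rewrite (@fubini_tonelli _ _ _ _ _ mu mu (fun p : gR * gR => g (p.1+t * p.2, p.2)%R) mg'); last by move=> p; exact: g0.
 rewrite (@fubini_tonelli _ _ _ _ _ mu mu g mg g0).
 apply: eq_integral => y _; rewrite -(@ge0_integral_shift (t*y) (fun x => g (x, y)))//.
 exact: measurableT_comp mg _.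
have shy (g : gR * gR -> \bar R) (t : R) : msr g -> (forall x, 0 <= g x) ->
  \int[mu]_x \int[mu]_y g (x, y+t*x)%R = \int[mu]_x \int[mu]_y g (x, y).
 move=> mg g0; apply: eq_integral => x _.
 rewrite -(@ge0_integral_shift (t*x) (fun y => g (x, y)))//.
 exact: measurableT_comp mg _.
have mx t : msr (fun p : gR * gR => (p.1+t * p.2, p.2)%R) by exact: measurable_fun_pair.
have my t : msr (fun p : gR * gR => (p.1, p.2+t * p.1)%R) by exact: measurable_fun_pair.
have m1 := measurableT_comp mf (mx a).
have m2 := measurableT_comp m1 (my s).
have E1 := shx f a mf f0.
have E2 := shy (f \o (fun p : gR * gR => (p.1+a * p.2, p.2)%R)) s m1 (fun=> f0 _).
have E3 := shx ((f \o (fun p : gR * gR => (p.1+a * p.2, p.2)%R)) \o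
 (fun p : gR * gR => (p.1, p.2+s * p.1)%R)) a m2 (fun=> f0 _).
apply: etrans E1; apply: etrans E2; apply: etrans E3.
apply: eq_integral => x _; apply: eq_integral => y _ /=; congr f.
have aE : (a*(1+c) = - s)%R by rewrite /a divfK.
have asE : (a*s = c-1)%R by apply: (mulIf c1); rewrite mulrAC aE; move: cs; rewrite !expr2 => ?; lra.
have e1 : (a+a*(1+s*a) = - s)%R by rewrite (mulrC s) asE -aE; ring.
congr (_, _); apply/eqP; rewrite -subr_eq0; apply/eqP.
 transitivity (x*(c-1-a*s)+y*(- s-(a+a*(1+s*a))))%R; first by ring.
 by rewrite e1 asE; ring.
transitivity (y*(c-1-a*s))%R; first by ring.
by rewrite asE; ring.
Qed.

End lebesgue_affine.

(** * The standard Gaussian on the line and its rotation invariance *)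

Section gauss1.
Variable R : realType.
Notation gR := (measurableTypeR R).
Notation mu := (@lebesgue_measure R).

Definition idR : gR -> R := idfun.
HB.instance Definition _ := isMeasurableFun.Build _ _ gR R idR (@measurable_id _ gR setT).

(** [normal_prob] lives on [measurableTypeR R]; its image under the identity is a probability on [R]
    with the measurable structure that products and tuples use. *)
Definition gam : probability R R := distribution (normal_prob (0 : R) 1 : probability gR R) idR.

Definition npdf (x : R) : R := normal_pdf 0 1 x.

Lemma npdfE x : npdf x = (Num.sqrt (pi *+ 2))^-1*expR (- (x^+2/2)).
rewrite /npdf normal_pdfE ?oner_neq0// /normal_peak /normal_fun expr1n mul1r subr0.
by congr (_*expR _); rewrite mulNr.
Qed.

(** Change of variables with the Radon-Nikodym density, which agrees almost everywhere with the
    normal density because both have the same integrals over measurable sets. *)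
Lemma ge0_integral_normal (f : gR -> \bar R) : msr f ->
 (forall x, 0 <= f x)%E ->
 (\int[normal_prob (0 : R) 1]_x f x = \int[mu]_x (f x*(npdf x)%:E))%E.
move=> mf f0.
pose nu : {finite_measure set gR -> \bar R} := normal_prob (0 : R) 1 : probability gR R.
have numu : nu `<< mu by exact: normal_prob_dominates.
have H := Radon_Nikodym_SigmaFinite.change_of_variables numu f0 measurableT mf.
rewrite -[LHS]H; apply: ae_eq_integral => //.
- apply: emeasurable_funM => //.
 exact: (measurable_int _ (Radon_Nikodym_SigmaFinite.f_integrable numu)).
- apply: emeasurable_funM => //; apply/measurable_EFinP.
 exact: measurable_normal_pdf.
have : ae_eq mu setT (Radon_Nikodym_SigmaFinite.f nu mu) (fun x => (npdf x)%:E).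
 apply: integral_ae_eq => //.
 - exact: Radon_Nikodym_SigmaFinite.f_integrable.
 - by apply/measurable_EFinP; exact: measurable_normal_pdf.
 - by move=> A _ mA; rewrite -Radon_Nikodym_SigmaFinite.f_integral.
by apply: filterS => x /[apply] ->.
Qed.

Lemma ge0_integral_gam (f : R -> \bar R) : msr f ->
 (forall x, 0 <= f x)%E ->
 (\int[gam]_x f x = \int[mu]_x (f x*(npdf x)%:E))%E.
move=> mf f0; rewrite -(ge0_integral_normal (f := f))//.
exact: (@ge0_integral_distribution _ _ _ _ _ (normal_prob (0 : R) 1 : probability gR R) idR f).
Qed.

(** The joint density depends on x^2 + y^2 only, so the rotation of Lebesgue measure carries
    over. *)
Lemma gam_rotation (c s : R) (f : R*R -> \bar R) :
 0 <= c -> c^+2+s^+2 = 1 -> msr f ->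
 (forall x, 0 <= f x)%E ->
 (\int[gam]_x \int[gam]_y f (c*x-s*y, s*x+c*y)%R =
 \int[gam]_x \int[gam]_y f (x, y))%E.
move=> c0 cs mf f0.
have E (g : R*R -> \bar R) : msr g -> (forall x, 0 <= g x)%E ->
  (\int[gam]_x \int[gam]_y g (x, y) = \int[mu]_x \int[mu]_y
    (g (x, y)*((npdf x)%:E*(npdf y)%:E)))%E.
 move=> mg g0.
 have mg1 (x : R) : msr (fun y => g (x, y)) by exact: measurableT_comp mg _.
 rewrite ge0_integral_gam; last 2 first.
 - exact: (@measurable_fun_fubini_tonelli_F _ _ R R R gam g mg g0).
 - by move=> x; exact: integral_ge0.
 apply: eq_integral => x _; rewrite ge0_integral_gam//.
 rewrite -ge0_integralZr//.
 - by apply: eq_integral => y _; rewrite -muleA [((npdf y)%:E*_)%E]muleC.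
 - apply: emeasurable_funM => //.
  by apply/measurable_EFinP; exact: measurable_normal_pdf.
 - by move=> y _; rewrite mule_ge0// lee_fin normal_pdf_ge0.
 - by rewrite lee_fin normal_pdf_ge0.
have mrot : msr (fun p : R*R => (c * p.1-s * p.2, s * p.1+c * p.2)) by apply: measurable_fun_pair; first by apply: measurable_funB.
have mfr := measurableT_comp mf mrot.
rewrite (E (fun p => f (c * p.1-s * p.2, s * p.1+c * p.2)) mfr (fun=> f0 _)) (E f mf f0).
have mF : msr (fun p : gR * gR => (f p*((npdf p.1)%:E*(npdf p.2)%:E))%E).
 apply: emeasurable_funM => //.
 by apply: emeasurable_funM; apply/measurable_EFinP; apply: (@measurableT_comp _ _ _ _ _ _ npdf) => //; exact: measurable_normal_pdf.
rewrite -(@ge0_integral_rotation R c s _ c0 cs mF); last first.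
 by move=> p; rewrite !mule_ge0// lee_fin normal_pdf_ge0.
apply: eq_integral => x _; apply: eq_integral => y _ /=; congr (_*_)%E.
rewrite -!EFinM !npdfE; congr EFin.
rewrite mulrACA [RHS]mulrACA -!expRD; congr (_*expR _).
rewrite -!opprD -!mulrDl; congr (- (_/_)).
transitivity ((c^+2+s^+2)*(x^+2+y^+2)); first by rewrite cs mul1r.
by ring.
Qed.

Lemma gam_rot (c s : R) (f : R*R -> R) (M : R) :
 0 <= c -> c^+2+s^+2 = 1 -> msr f ->
 bdd f M ->
 Ex gam (fun x => Ex gam (fun y => f (c*x-s*y, s*x+c*y))) =
 Ex gam (fun x => Ex gam (fun y => f (x, y))).
move=> c0 cs mf fM.
have mrot : msr (fun p : R*R => (c * p.1-s * p.2, s * p.1+c * p.2)) by apply: measurable_fun_pair; first by apply: measurable_funB.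
have mfr := measurableT_comp mf mrot.
(* The rotation is known for nonnegative integrands; f + M is one, and the constant is removed at
   the end. *)
have [g [mg g0 gM fE]] : exists g : R*R -> R, [/\ msr g,
  forall x, 0 <= g x, forall x, `|g x| <= M *+ 2 & forall x, f x = g x-M].
 exists (fun x => f x+M); split => [||x|x].
 - by [].
 - by move=> x; have := fM x; rewrite ler_norml => /andP[]; lra.
 - have := fM x; rewrite !ler_norml => /andP[h1 h2].
  by apply/andP; split; rewrite mulr2n; lra.
 - by rewrite addrK.
have Eg (h : R*R -> R) : msr h -> (forall x, 0 <= h x) ->
  (forall x, `|h x| <= M *+ 2) ->
  ((Ex gam (fun x => Ex gam (fun y => h (x, y))))%:E =
   \int[gam]_x \int[gam]_y (h (x, y))%:E)%E.
 move=> mh h0 hM.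
 have I2 x : intg gam (fun y => h (x, y)) by apply: (intg_bnd (M *+ 2)) => //; exact: msr_curry1.
 have I1 : intg gam (fun x => Ex gam (fun y => h (x, y))).
  apply: (intg_bnd (M *+ 2)) => [|x].
   exact: (@msr_Ex_snd _ _ _ _ _ gam gam h (M *+ 2) mh hM).
  by apply: Ex_bound => //; exact: msr_curry1.
 rewrite {1}/Ex /Rintegral fineK; last exact: integrable_fin_num I1.
 apply: eq_integral => x _; rewrite /Ex /Rintegral fineK//.
 exact: integrable_fin_num (I2 x).
have mgr := measurableT_comp mg mrot.
have key : Ex gam (fun x => Ex gam (fun y => g (c*x-s*y, s*x+c*y))) =
 Ex gam (fun x => Ex gam (fun y => g (x, y))).
 apply: EFin_inj; rewrite (Eg _ mg g0 gM).
 rewrite (Eg (fun p => g (c * p.1-s * p.2, s * p.1+c * p.2)) mgr (fun=> g0 _) (fun=> gM _)).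
 by apply: (@gam_rotation c s (EFin \o g)) => //; exact/measurable_EFinP.
have B (h : R*R -> R) : msr h -> (forall x, `|h x| <= M *+ 2) ->
 Ex gam (fun x => Ex gam (fun y => h (x, y)-M)) =
 Ex gam (fun x => Ex gam (fun y => h (x, y)))-M.
 move=> mh hM.
 have Ih x : intg gam (fun y => h (x, y)) by apply: (intg_bnd (M *+ 2)) => //; exact: msr_curry1.
 rewrite -[in RHS](Ex_cst gam M) -ExB; last exact: intg_cst.
  by apply: Ex_eq => x; rewrite (ExB (Ih x) (intg_cst _ _)) Ex_cst.
 apply: (intg_bnd (M *+ 2)) => [|x].
  exact: (@msr_Ex_snd _ _ _ _ _ gam gam h (M *+ 2) mh hM).
 by apply: Ex_bound => [|y]; [exact: msr_curry1|exact: hM].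
transitivity (Ex gam (fun x => Ex gam (fun y => g (c*x-s*y, s*x+c*y)-M))).
 by apply: Ex_eq => x; apply: Ex_eq => y.
rewrite (B (fun p => g (c * p.1-s * p.2, s * p.1+c * p.2)) mgr (fun=> gM _)) key -(B g mg gM).
by apply: Ex_eq => x; apply: Ex_eq => y.
Qed.

End gauss1.
Arguments gam {R}.

(** * Exponential, polynomial and second moments in dimension one *)

Section gauss1_facts.
Variable R : realType.
Implicit Types (t c s : R).

Lemma msr_expR_sq t : msr (fun x : R => expR (- (t*x^+2/2))).
by apply: measurableT_comp => //; apply: measurableT_comp.
Qed.

(** The integrand times the density is (1+t)^(-1/2) times the density of variance 1/(1+t). Negative
    t > -1 is allowed and gives exponential moments of x^2. *)
Lemma integral_gam_exp t : 0 < 1+t ->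
 (\int[gam]_x (expR (- (t*x^+2/2)))%:E = ((Num.sqrt (1+t))^-1)%:E)%E.
move=> t0; rewrite ge0_integral_gam; last 2 first.
- by apply/measurable_EFinP; exact: msr_expR_sq.
- by [].
pose sg := (Num.sqrt (1+t))^-1.
have s0 : 0 < Num.sqrt (1+t) by [].
have sg0 : sg != 0 by [].
have sg2 : sg^+2 = (1+t)^-1 by rewrite exprVn sqr_sqrtr// ltW.
have t1 : 1+t != 0 by [].
transitivity (\int[lebesgue_measure]_x (sg%:E*(normal_pdf 0 sg x)%:E))%E.
 apply: eq_integral => x _; rewrite -!EFinM npdfE normal_pdfE// /normal_peak /normal_fun.
 congr EFin; rewrite subr0 sg2 mulrCA -expRD.
 have -> : - (t*x^+2/2) + - (x^+2/2) = - x^+2/((1+t)^-1 *+ 2) by field.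
 rewrite mulrA; congr (_*_).
 rewrite -mulrnAr sqrtrM ?ltW// sqrtrV ?ltW// invfM invrK mulrA.
 by rewrite mulVf ?mul1r// gt_eqF.
rewrite ge0_integralZl//; last 3 first.
- by apply/measurable_EFinP; exact: measurable_normal_pdf.
- by move=> x _; rewrite lee_fin normal_pdf_ge0.
- by rewrite lee_fin invr_ge0 ltW.
by rewrite integral_normal_pdf mule1.
Qed.

Lemma intg_gam_exp t : 0 < 1+t -> intg gam (fun x : R => expR (- (t*x^+2/2))).
move=> t0; apply/integrableP; split.
 by apply/measurable_EFinP; exact: msr_expR_sq.
under eq_integral do rewrite /= ger0_norm ?expR_ge0//.
by rewrite integral_gam_exp// ltry.
Qed.

Lemma Ex_gam_exp t : 0 < 1+t ->
 Ex gam (fun x : R => expR (- (t*x^+2/2))) = (Num.sqrt (1+t))^-1.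
by move=> t0; rewrite /Ex /Rintegral integral_gam_exp. Qed.

(** Domination by the exponential at t = -1/2: with y = (1+x^2)/4, the power y^k is at most k! exp
    y. *)
Lemma intg_gam_poly k : intg gam (fun x : R => (1+x^+2)^+k).
pose C : R := 4^+k*k`!%:R*expR (4^-1).
have I : intg gam (fun x : R => C*expR (- (- 2^-1*x^+2/2))) by apply: intgZ; apply: intg_gam_exp; lra.
apply: (intg_le _ _ I).
- by [].
- move=> x; rewrite ger0_norm => //.
 have -> : C*expR (- (- 2^-1*x^+2/2)) =
  4^+k*k`!%:R*expR ((1+x^+2)/4) by rewrite /C -mulrA -expRD; congr (_*expR _); field.
 have y0 : 0 <= (1+x^+2)/4 :> R by [].
 have -> : (1+x^+2)^+k = 4^+k*((1+x^+2)/4)^+k by rewrite -exprMn; congr (_^+_); field.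
 rewrite -mulrA ler_pM2l ?exprn_gt0//.
 rewrite -ler_pdivrMl ?fact_gt0// mulrC.
 case: k {C I} => [|k]; last first.
  by apply: le_trans (expR_ge1Dxn k y0); rewrite lerDr.
 by rewrite expr0 fact0 divr1 (le_trans _ (expR_ge1Dx _))// lerDl.
Qed.

Lemma intg_gam_le (f : R -> R) (C : R) k : msr f ->
 (forall x, `|f x| <= C*(1+x^+2)^+k) -> intg gam f.
by move=> mf fC; apply: (intg_le mf fC); apply: intgZ; exact: intg_gam_poly. Qed.

(** With r the norm of (a, b), the rotation of cosine a/r and sine -b/r turns r x into a x + b y;
    the degenerate case r = 0 is separate. *)
Lemma gam_comb (a b : R) (phi : R -> R) (M : R) : 0 <= a -> msr phi ->
 bdd phi M ->
 Ex gam (fun x => Ex gam (fun y => phi (a*x+b*y))) =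
 Ex gam (fun x => phi (Num.sqrt (a^+2+b^+2)*x)).
move=> a0 mphi phiM; set r := Num.sqrt _.
have r2 : r^+2 = a^+2+b^+2 by rewrite sqr_sqrtr// addr_ge0 sqr_ge0.
have [r0|rn0] := eqVneq r 0.
 have [a00 b00] : a = 0 /\ b = 0.
  move: r2; rewrite r0 expr0n/= => /esym/eqP.
  by rewrite paddr_eq0 ?sqr_ge0// !sqrf_eq0 => /andP[/eqP-> /eqP->].
 rewrite a00 b00 r0; apply: Ex_eq => x; rewrite !mul0r -[RHS](Ex_cst gam).
 by apply: Ex_eq => y; rewrite mul0r addr0.
have rp : 0 < r by rewrite lt_neqAle eq_sym rn0 sqrtr_ge0.
have mf : msr (fun p : R*R => phi (r * p.1)) by [].
have H h1 h2 := @gam_rot R (a/r) (- (b/r)) (fun p => phi (r * p.1)) M h1 h2 mf.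
transitivity (Ex gam (fun x => Ex gam (fun y => phi (r*(a/r*x - - (b/r)*y))))).
 by apply: Ex_eq => x; apply: Ex_eq => y; congr phi; field.
have h1 : 0 <= a/r by [].
have h2 : (a/r)^+2+(- (b/r))^+2 = 1 by rewrite sqrrN !expr_div_n -mulrDl -r2 divff// expf_neq0.
by rewrite (H h1 h2 (fun=> phiM _)); apply: Ex_eq => x /=; rewrite Ex_cst.
Qed.

Lemma Ex_gam_opp (phi : R -> R) (M : R) : msr phi ->
 bdd phi M -> Ex gam (fun x => phi (- x)) = Ex gam phi.
move=> mphi phiM.
have := @gam_comb 0 (- 1) phi M (lexx _) mphi phiM.
rewrite expr0n/= add0r sqrrN expr1n sqrtr1 => H.
transitivity (Ex gam (fun x => phi (1*x))); last first.
 by apply: Ex_eq => x; rewrite mul1r.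
rewrite -H -[LHS](Ex_cst gam); apply: Ex_eq => x.
by apply: Ex_eq => y; rewrite mul0r add0r mulN1r.
Qed.

Lemma intg_gam_id : intg gam (fun x : R => x).
apply: (@intg_gam_le _ 1 1) => // x; rewrite mul1r expr1 -normr_id.
have := sqr_ge0 (`|x| - 1); rewrite sqrrB1 -normrX normr_id [X in _ <= X](_ : _ =
 (1+x^+2) - `|x| *+ 2); last by rewrite ger0_norm ?sqr_ge0//; ring.
by have := normr_ge0 x; rewrite mulr2n; lra.
Qed.

Lemma intg_gam_sq : intg gam (fun x : R => x^+2).
apply: (@intg_gam_le _ 1 1) => [|x] => //.
by rewrite mul1r expr1 ger0_norm ?sqr_ge0// lerDr.
Qed.

Lemma Ex_gam_id : Ex gam (fun x : R => x) = 0.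
have E : eqlaw (gam (R := R)) (gam (R := R)) (fun x => - x) idfun.
 by move=> f M mf fM; exact: Ex_gam_opp mf fM.
have mo : msr (fun x : R => - x) by exact: measurableT_comp.
have mi : msr (idfun : R -> R) by [].
have [_ H] := @eqlaw_intg _ _ _ _ _ _ R gam gam (fun x : R => - x) idfun idfun mo mi E mi intg_gam_id.
have := ExN intg_gam_id; move: H; rewrite /comp/= => ->; lra.
Qed.

(** The second moment is minus twice the derivative at t = 0 of E exp(-t x^2/2) = (1+t)^(-1/2).
    Elementary bounds on the exponential replace the derivative: for 0 < t <= 1 they give 1 - t <= m
    <= 1 + t q with q the fourth moment, and t is then made small. *)
Lemma Ex_gam_sq : Ex gam (fun x : R => x^+2) = 1.
set m := Ex _ _; set q := Ex gam (fun x : R => (x^+2)^+2).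
have I2 := intg_gam_sq.
have I4 : intg gam (fun x : R => (x^+2)^+2).
 apply: (@intg_gam_le _ 1 2) => [|x] => //.
 rewrite mul1r ger0_norm ?sqr_ge0// lerXn2r ?sqr_ge0//.
 by rewrite lerDr.
have q0 : 0 <= q by [].
have exp_le (y : R) : 0 <= y -> expR (- y) <= 1-y+y^+2.
 move=> y0; rewrite expRN; have h := expR_ge1Dx y.
 have y1 : 0 < 1+y by lra.
 apply: (le_via (1+y)^-1); first by rewrite lef_pV2// posrE expR_gt0.
 rewrite -[leLHS]mul1r ler_pdivrMr// -subr_ge0 (_ : _-1 = y^+3); last by ring.
 by [].
have key (t : R) : 0 < t <= 1 -> 1-t <= m /\ m <= 1+t*q.
 move=> /andP[t0 t1]; have t10 : 0 < 1+t by lra.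
 pose r : R := (Num.sqrt (1+t))^-1.
 have r0 : 0 < r by [].
 have r2 : r^+2*(1+t) = 1 by rewrite exprVn sqr_sqrtr ?mulVf ?gt_eqF// ltW.
 have rE : (1-r)*(1+r) = t*r^+2 by move: r2; rewrite !expr2 => ?; lra.
 have r1 : r <= 1 by nra.
 have I2' : intg gam (fun x : R => t/2*x^+2) by exact: intgZ.
 have I4' : intg gam (fun x : R => (t/2)^+2*(x^+2)^+2) by exact: intgZ.
 have IB : intg gam (fun x : R => 1-t/2*x^+2) by apply: intgB => //; exact: intg_cst.
 have EB : Ex gam (fun x : R => 1-t/2*x^+2) = 1-t/2 * m by rewrite (ExB (intg_cst _ _) I2') (ExZ _ I2) Ex_cst.
 have lo : 1-t/2 * m <= r.
  rewrite /r -(Ex_gam_exp t10) -EB; apply: Ex_le => //; first exact: intg_gam_exp.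
  move=> x; have := expR_ge1Dx (- (t*x^+2/2)).
  by congr (_ <= _); ring.
 have hi : r <= 1-t/2 * m+(t/2)^+2*q.
  rewrite /r -(Ex_gam_exp t10) -EB -(ExZ _ I4) -ExD//.
  apply: Ex_le; [exact: intg_gam_exp|exact: intgD|].
  move=> x; have y0 : 0 <= t*x^+2/2.
   by [].
  by apply: le_trans (exp_le _ y0) _; apply: eq_ler; field.
 have r20 : 0 < r^+2 by [].
 have h1 : 1-r <= t/2.
  have : 0 <= r^+2*(t-2*(1-r)).
   have -> : r^+2*(t-2*(1-r)) = (1-r)^+2*(1+2*r) by rewrite mulrBr (mulrC (r^+2) t) -rE; ring.
   by [].
  by rewrite pmulr_rge0; lra.
 have h2 : t*(1-t) <= (1-r)*2.
  have h3 : t*(1-t) <= t*r^+2.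
   rewrite ler_pM2l// -subr_ge0.
   have -> : r^+2-(1-t) = r^+2 * t^+2 by transitivity (r^+2-(1-t)*(r^+2*(1+t))); [rewrite r2; ring|ring].
   by [].
  by apply: (le_trans h3); rewrite -rE ler_wpM2l; lra.
 split; first by rewrite -(ler_pM2l t0); nra.
 by rewrite -(ler_pM2l t0); nra.
apply/eqP; rewrite eq_le; apply/andP; split; rewrite leNgt; apply/negP => hm.
 pose t := Num.min 1 ((m-1)/(q+1)/2).
 have q1 : 0 < q+1 by lra.
 have e0 : 0 < (m-1)/(q+1)/2 by rewrite !divr_gt0// subr_gt0.
 have t0 : 0 < t <= 1 by rewrite /t lt_min ltr01 e0 ge_min lexx.
 have [_] := key t t0; apply/negP; rewrite -ltNge.
 have tq : t*(q+1) <= (m-1)/2.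
  have : t <= (m-1)/(q+1)/2 by rewrite /t ge_min lexx orbT.
  by rewrite -(ler_pM2r q1) => /le_trans; apply; rewrite mulrAC divfK.
 by have /andP[tp _] := t0; nra.
have t0 : 0 < Num.min 1 ((1-m)/2) <= 1 by rewrite lt_min ltr01 ge_min lexx/= andbT divr_gt0// subr_gt0.
have [+ _] := key _ t0; apply/negP; rewrite -ltNge.
have : Num.min 1 ((1-m)/2) <= (1-m)/2 by rewrite ge_min lexx orbT.
by move=> ?; lra.
Qed.

Lemma gam_set1 (x : R) : gam [set x] = 0%E.
rewrite /gam /distribution /pushforward/= /idR preimage_id.
have /null_content_dominatesP H := @normal_prob_dominates R 0 1.
by apply: H; [exact: measurable_set1|exact: lebesgue_measure_set1].
Qed.

End gauss1_facts.

(** * The Gaussian measure on tuples and the laws of its linear images *)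

Section gaussN.
Variable R : realType.

Definition consT n (p : R*n.-tuple R) : n.+1.-tuple R := [tuple of p.1 :: p.2].

Lemma measurable_consT n : msr (@consT n).
exact: measurable_cons. Qed.

Lemma measurable_consT_comp d (T : measurableType d) n (f : T -> R) (g : T -> n.-tuple R) :
 msr f -> msr g ->
 msr (fun p => consT (f p, g p)).
exact: measurable_cons. Qed.

HB.instance Definition _ n := isMeasurableFun.Build _ _ _ _ (@consT n) (@measurable_consT n).

(** One coordinate is prepended at a time, so that identities in dimension n follow by induction
    from [Ex_gaussS] and the one-dimensional facts. *)
Fixpoint gauss (n : nat) : probability (n.-tuple R) R :=
 match n with
 | 0 => \d_[tuple]
 | n.+1 => distribution (gam \x gauss n)%E (@consT n)
 end.

Lemma Ex_gauss0 (f : 0.-tuple R -> R) : msr f ->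
 Ex (gauss 0) f = f [tuple].
move=> mf; rewrite /Ex /Rintegral integral_dirac//; last exact/measurable_EFinP.
by rewrite diracT mul1e.
Qed.

Lemma eqlaw_gaussS n : eqlaw (gauss n.+1) (gam \x gauss n)%E idfun (@consT n).
move=> f M mf fM; rewrite /Ex /Rintegral; congr fine.
rewrite (integral_distribution (X := @consT n) (f := EFin \o f))//.
 exact/measurable_EFinP.
apply: (intg_bnd M) => //.
exact: measurableT_comp mf _.
Qed.

Lemma Ex_gaussS n (f : n.+1.-tuple R -> R) (M : R) : msr f ->
 bdd f M ->
 Ex (gauss n.+1) f = Ex gam (fun t => Ex (gauss n) (fun x => f (consT (t, x)))).
move=> mf fM; rewrite [LHS](eqlaw_gaussS mf fM).
rewrite (@Ex_prod _ _ _ _ _ _ _ (f \o @consT n) M)// => [|x]; last exact: fM.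
exact: measurableT_comp mf _.
Qed.

Lemma tnth_cons0 n t (x : n.-tuple R) : tnth (consT (t, x)) ord0 = t.
by []. Qed.

Lemma tnth_consS n t (x : n.-tuple R) i : tnth (consT (t, x)) (lift ord0 i) = tnth x i.
exact: tnthS. Qed.

Definition dot n (u : 'I_n -> R) (x : n.-tuple R) : R := \sum_i u i * tnth x i.

Definition nsq n (x : n.-tuple R) : R := \sum_i tnth x i^+2.

Definition vlin n (a : R) (x : n.-tuple R) (b : R) (y : n.-tuple R) : n.-tuple R :=
 [tuple a * tnth x i+b * tnth y i | i < n].

Lemma tnth_vlin n a x b y (i : 'I_n) : tnth (vlin a x b y) i = a * tnth x i+b * tnth y i.
by rewrite tnth_mktuple. Qed.

Lemma dot_vlin n (u : 'I_n -> R) a x b y : dot u (vlin a x b y) = a * dot u x+b * dot u y.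
rewrite /dot !mulr_sumr -big_split/=; apply: eq_bigr => i _.
by rewrite tnth_vlin; ring.
Qed.

Lemma dot_cons n (u : 'I_n.+1 -> R) t x :
 dot u (consT (t, x)) = u ord0 * t+dot (fun i => u (lift ord0 i)) x.
rewrite /dot big_ord_recl tnth_cons0; congr (_+_).
by apply: eq_bigr => i _; rewrite tnth_consS.
Qed.

Lemma vlin_cons n a t (x : n.-tuple R) b t' y :
 vlin a (consT (t, x)) b (consT (t', y)) = consT (a * t+b * t', vlin a x b y).
apply: eq_from_tnth => i; rewrite tnth_vlin.
by case: (unliftP ord0 i) => [j ->|->]; rewrite ?tnth_consS ?tnth_cons0// tnth_vlin.
Qed.

Lemma msr_dot n (u : 'I_n -> R) : msr (dot u).
by apply: measurable_sum => i; apply: measurable_funM => //; exact: measurable_tnth.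
Qed.

Lemma msr_vlin d (T : measurableType d) n a (f : T -> n.-tuple R) b g :
 msr f -> msr g ->
 msr (fun p => vlin a (f p) b (g p)).
move=> mf mg; apply/measurable_fun_tnthP => i.
rewrite (_ : _ \o _ = fun p => a * tnth (f p) i+b * tnth (g p) i); last first.
 by apply/funext => p /=; rewrite tnth_vlin.
apply: measurable_funD; apply: measurable_funM => //.
 exact: (measurableT_comp (measurable_tnth i) mf).
exact: (measurableT_comp (measurable_tnth i) mg).
Qed.

End gaussN.

Notation EG n := (Ex (@gauss _ n)).
Notation IG n := (intg (@gauss _ n)).
Arguments gauss {R} n.

Section gaussN_law.
Variable R : realType.

(** Once the order of integration is exchanged, the tails combine by the induction hypothesis and
    the two first coordinates by [gam_comb]. *)
Lemma gauss_semigroup n (c s : R) (f : n.-tuple R -> R) (M : R) :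
 0 <= c -> c^+2+s^+2 = 1 -> msr f ->
 bdd f M ->
 EG n (fun z => EG n (fun z' => f (vlin c z s z'))) = EG n f.
move=> c0 cs; elim: n f => [|n IH] f mf fM.
 rewrite Ex_gauss0; last first.
  rewrite (_ : (fun _ => _) = (fun=> f [tuple])) => //.
  apply/funext => z; rewrite -[RHS](Ex_cst (gauss 0)).
  by apply: Ex_eq => z'; congr f; rewrite [LHS]tuple0.
 rewrite -[LHS](Ex_cst (gauss 0)) [RHS]Ex_gauss0// Ex_gauss0//.
 rewrite -[RHS](Ex_cst (gauss 0)); apply: Ex_eq => z'.
 by congr f; rewrite [LHS]tuple0.
pose F (p : n.+1.-tuple R*n.+1.-tuple R) := f (vlin c p.1 s p.2).
have mF : msr F by apply: measurableT_comp mf _; apply: msr_vlin.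
have mc1 (z : n.+1.-tuple R) : msr (fun z' => F (z, z')).
 exact: msr_curry1.
rewrite (@Ex_gaussS _ _ _ M); last 2 first.
- exact: (@msr_Ex_snd _ _ _ _ _ (gauss n.+1) (gauss n.+1) F M mF (fun=> fM _)).
- by move=> z; apply: Ex_bound => //; exact: mc1.
transitivity (Ex gam (fun t => Ex gam (fun t' => EG n (fun x =>
  EG n (fun x' => f (consT (c * t+s * t', vlin c x s x'))))))).
 apply: Ex_eq => t.
 pose G (p : n.-tuple R*R*n.-tuple R) :=
  f (consT (c * t+s * p.1.2, vlin c p.1.1 s p.2)).
 have mG : msr G.
  apply: (measurableT_comp mf); apply: measurable_consT_comp.
   apply: measurable_funD; apply: measurable_funM => //.
   exact: (measurableT_comp measurable_snd measurable_fst).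
  apply: msr_vlin => //.
  exact: (measurableT_comp measurable_fst measurable_fst).
 have mG1 := @msr_Ex_snd _ _ _ _ _ (gauss n \x gam)%E (gauss n) G M mG (fun=> fM _).
 rewrite (@Ex_swap _ _ _ _ _ gam (gauss n) (fun q => EG n (fun x' => G ((q.2, q.1), x'))) M); last 2 first.
 - apply: (@measurableT_comp _ _ _ _ _ _ (fun x => EG n (fun y => G (x, y))) _ (fun q : R*n.-tuple R => (q.2, q.1))) => //.
  exact: measurable_fun_pair.
 - move=> q; apply: Ex_bound => [|x']; last exact: fM.
  exact: (@msr_curry1 _ _ _ _ _ G (q.2, q.1) mG).
 apply: Ex_eq => x; rewrite (Ex_gaussS (mc1 (consT (t, x))) (fun=> fM _)).
 by apply: Ex_eq => t'; apply: Ex_eq => x'; rewrite /G /F vlin_cons.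
pose phi (t : R) := EG n (fun x => f (consT (t, x))).
have mfc : msr (fun p : R*n.-tuple R => f (consT p)) by exact: measurableT_comp mf _.
have mphi : msr phi.
 exact: (@msr_Ex_snd _ _ _ _ _ gam (gauss n) (fun p => f (consT p)) M).
have mfc1 t : msr (fun x : n.-tuple R => f (consT (t, x))).
 exact: (msr_curry1 t mfc).
have phiM t : `|phi t| <= M by apply: Ex_bound.
rewrite (Ex_gaussS mf fM) -/phi.
transitivity (Ex gam (fun t => Ex gam (fun t' => phi (c * t+s * t')))).
 apply: Ex_eq => t; apply: Ex_eq => t'.
 exact: (IH (fun x => f (consT (c * t+s * t', x)))).
rewrite (gam_comb s c0 mphi phiM) cs sqrtr1.
by apply: Ex_eq => t; rewrite mul1r.
Qed.

(** The triple (a, b, g) is the Cholesky factor of the Gram matrix of u and v. In the induction the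
    new coordinate brings a third independent Gaussian, and two plane rotations restore the
    triangular form. *)
Lemma gauss_pair n (u v : 'I_n -> R) : exists abc : R*R*R,
 [/\ 0 <= abc.1.1, abc.1.1^+2 = \sum_i u i^+2,
   abc.1.1*abc.1.2 = \sum_i u i*v i,
   0 <= abc.2 & abc.1.2^+2+abc.2^+2 = \sum_i v i^+2] /\
 forall (f : R*R -> R) (M : R), msr f -> bdd f M ->
 EG n (fun x => f (dot u x, dot v x)) =
 Ex gam (fun x => Ex gam (fun y => f (abc.1.1*x, abc.1.2*x+abc.2*y))).
elim: n u v => [|n IH] u v.
 exists (0, 0, 0); rewrite /= !big_ord0; split; first by split => //; ring.
 move=> f M mf fM; have d0 (w : 'I_0 -> R) x : dot w x = 0 by rewrite /dot big_ord0.
 rewrite (@Ex_eq _ _ _ _ _ (fun=> f (0, 0))) ?Ex_cst; last by move=> x; rewrite !d0.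
 rewrite -[LHS](Ex_cst gam); apply: Ex_eq => x.
 by rewrite -[LHS](Ex_cst gam); apply: Ex_eq => y; rewrite !mul0r addr0.
have [[[a b] g] [[/= a0 aE abE g0 bgE] H]] := IH (fun i => u (lift ord0 i)) (fun i => v (lift ord0 i)).
pose u0 := u ord0; pose v0 := v ord0; pose a' := Num.sqrt (a^+2+u0^+2).
have a'2 : a'^+2 = a^+2+u0^+2 by rewrite sqr_sqrtr// addr_ge0 sqr_ge0.
have a'0 : 0 <= a' by [].
(* The rotation that sends the column (a, u0) to (a', 0). It sends (b, v0) to (b', w), and a second
   rotation merges w with g into g'. *)
have [c [s [c0 cs acs acs0]]] : exists c s : R, [/\ 0 <= c, c^+2+s^+2 = 1,
  a*c+u0*s = a' & - a*s+u0*c = 0].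
 have [a'00|a'n0] := eqVneq a' 0.
  have [a00 u00] : a = 0 /\ u0 = 0.
   move: a'2; rewrite a'00 expr0n/= => /esym/eqP.
   by rewrite paddr_eq0 ?sqr_ge0// !sqrf_eq0 => /andP[/eqP-> /eqP->].
  by exists 1, 0; rewrite a00 u00 a'00; split => //; ring.
 have a'p : 0 < a' by rewrite lt_neqAle eq_sym a'n0.
 exists (a/a'), (u0/a'); split => //.
 - by rewrite !expr_div_n -mulrDl -a'2 divff// expf_neq0.
 - by apply: (mulIf a'n0); rewrite -expr2 a'2; field.
 - by field.
pose b' := b*c+v0*s; pose w := - b*s+v0*c; pose g' := Num.sqrt (g^+2+w^+2).
have g'2 : g'^+2 = g^+2+w^+2 by rewrite sqr_sqrtr// addr_ge0 sqr_ge0.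
exists (a', b', g'); split.
 rewrite /= !big_ord_recl -/u0 -/v0 -aE -abE -bgE; split => //.
 - by rewrite a'2 addrC.
 - have e1 : u0*v0+a*b = (c^+2+s^+2)*(u0*v0+a*b) by rewrite cs mul1r.
  rewrite e1 -[X in X*b']acs /b'.
  transitivity ((a*c+u0*s)*(b*c+v0*s)+(- a*s+u0*c)*(- b*s+v0*c)).
   by rewrite acs0 mul0r addr0.
  by ring.
 - rewrite g'2 /b' /w.
  transitivity ((c^+2+s^+2)*(b^+2+v0^+2)+g^+2); first by ring.
  by rewrite cs; ring.
move=> f M mf fM /=.
have ml (p q : R*R -> R) : msr p -> msr q ->
  msr (fun z => f (p z, q z)).
 by move=> mp mq; apply: (measurableT_comp mf); exact: measurable_fun_pair.
have md : msr (fun x : n.+1.-tuple R => f (dot u x, dot v x)) by apply: (measurableT_comp mf); apply: measurable_fun_pair; exact: msr_dot.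
rewrite (Ex_gaussS md (fun=> fM _)).
pose K (p : R*R*R) := f (u0 * p.1.1+a * p.1.2, v0 * p.1.1+(b * p.1.2+g * p.2)).
have m11 : msr (fun p : R*R*R => p.1.1).
 exact: (measurableT_comp measurable_fst measurable_fst).
have m12 : msr (fun p : R*R*R => p.1.2).
 exact: (measurableT_comp measurable_snd measurable_fst).
have mK : msr K.
 apply: (measurableT_comp mf); apply: measurable_fun_pair.
  by [].
 apply: measurable_funD; first exact: measurable_funM.
 by [].
transitivity (Ex gam (fun t => Ex gam (fun x => Ex gam (fun y => K ((t, x), y))))).
 apply: Ex_eq => t.
 have mft : msr (fun q : R*R => f (u0 * t+q.1, v0 * t+q.2)) by exact: ml.
 rewrite -(H (fun q => f (u0 * t+q.1, v0 * t+q.2)) M mft (fun=> fM _)).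
 by apply: Ex_eq => x; rewrite !dot_cons.
have mK1 := @msr_Ex_snd _ _ _ _ _ (gam \x gam)%E gam K M mK (fun=> fM _).
have KM q : `|Ex gam (fun y => K (q, y))| <= M by apply: Ex_bound => [|y]; [exact: msr_curry1|exact: fM].
rewrite (@Ex_swap _ _ _ _ _ gam gam (fun q => Ex gam (fun y => K (q, y))) M mK1 KM).
have mK2 : msr (fun q : R*R => Ex gam (fun y => K ((q.2, q.1), y))).
 apply: (@measurableT_comp _ _ _ _ _ _ (fun q => Ex gam (fun y => K (q, y))) _ (fun q : R*R => (q.2, q.1))) => //.
 exact: measurable_fun_pair.
have rot := @gam_rot R c s (fun q => Ex gam (fun y => K ((q.2, q.1), y))) M c0 cs mK2 (fun=> KM _).
rewrite -rot; apply: Ex_eq => x.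
have mpsi : msr (fun z : R => f (a'*x, b'*x+z)) by apply: (measurableT_comp mf); apply: measurable_fun_pair.
have := @gam_comb R g w (fun z => f (a'*x, b'*x+z)) M g0 mpsi (fun=> fM _).
rewrite -/g' => <-.
rewrite (@Ex_swap _ _ _ _ _ gam gam (fun p => f (a'*x, b'*x+(g * p.1+w * p.2))) M); last 2 first.
- by apply: ml; mR.
- by [].
apply: Ex_eq => y; apply: Ex_eq => z; rewrite /K /=; congr (f (_, _)).
 transitivity ((a*c+u0*s)*x+(- a*s+u0*c)*y); first by ring.
 by rewrite acs acs0 mul0r addr0.
by rewrite /b' /w; ring.
Qed.

Lemma gauss_linear n (u : 'I_n -> R) (f : R -> R) (M : R) :
 msr f -> bdd f M ->
 EG n (fun x => f (dot u x)) =
 Ex gam (fun x => f (Num.sqrt (\sum_i u i^+2)*x)).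
move=> mf fM; have [[[a b] g] [[/= a0 aE _ _ _] H]] := gauss_pair u u.
have mf1 : msr (fun p : R*R => f p.1) by [].
rewrite (H _ M mf1)// -aE sqrtr_sqr ger0_norm//.
by apply: Ex_eq => x /=; rewrite Ex_cst.
Qed.

End gaussN_law.

Ltac measurable_leaf1 := first [ measurable_leaf0 | exact: msr_dot ].
Ltac measurable_leaf ::= measurable_leaf1.
Ltac measurable_rule ::= first [ apply: msr_vlin ].

(** * Derivatives and one-sided Taylor bounds *)

Section calculus.
Variable R : realType.
Implicit Types (f g df : R -> R) (x y a b : R).

Definition der f x a := is_derive x 1 f a.

Lemma der_eq f x a b : der f x a -> a = b -> der f x b.
by move=> h <-. Qed.

Lemma der_cst c x : der (fun=> c) x 0.
exact: is_derive_cst. Qed.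

Lemma der_id x : der (fun t => t) x 1.
exact: is_derive_id. Qed.

Lemma der_add f g x a b : der f x a -> der g x b -> der (fun t => f t+g t) x (a+b).
by move=> hf hg; exact: (@is_deriveD _ _ _ f g). Qed.

Lemma der_sub f g x a b : der f x a -> der g x b -> der (fun t => f t-g t) x (a-b).
by move=> hf hg; exact: (@is_deriveB _ _ _ f g). Qed.

Lemma der_opp f x a : der f x a -> der (fun t => - f t) x (- a).
by move=> hf; exact: (@is_deriveN _ _ _ f). Qed.

Lemma der_mul f g x a b : der f x a -> der g x b ->
 der (fun t => f t * g t) x (f x*b+g x*a).
by move=> hf hg; exact: (@is_deriveM _ _ f g). Qed.

Lemma der_scale c f x a : der f x a -> der (fun t => c*f t) x (c*a).
by move=> hf; exact: (@is_deriveZ _ _ _ f c). Qed.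

Lemma der_exp n f x a : der f x a -> der (fun t => f t^+n) x (n%:R*f x^+n.-1*a).
move=> hf; have := @is_deriveX R R f n x 1 a hf.
by rewrite (_ : f^+n = (fun t => f t^+n))//; apply/funext => t; rewrite fctE.
Qed.

Lemma der_comp f g x a b : der f x a -> der g (f x) b -> der (fun t => g (f t)) x (b*a).
move=> hf hg; exact: (@is_derive1_comp R g f x b a hg hf).
Qed.

Lemma der_expR f x a : der f x a -> der (fun t => expR (f t)) x (expR (f x)*a).
by move=> hf; apply: der_comp hf _; exact: is_derive_expR. Qed.

Lemma der_cos f x a : der f x a -> der (fun t => cos (f t)) x (- sin (f x)*a).
by move=> hf; apply: der_comp hf _; exact: is_derive_cos. Qed.

Lemma der_sin f x a : der f x a -> der (fun t => sin (f t)) x (cos (f x)*a).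
by move=> hf; apply: der_comp hf _; exact: is_derive_sin. Qed.

Lemma der_ln f x a : 0 < f x -> der f x a -> der (fun t => ln (f t)) x ((f x)^-1*a).
by move=> f0 hf; apply: der_comp hf _; exact: is_derive1_ln. Qed.

Lemma der_inv f x a : f x != 0 -> der f x a -> der (fun t => (f t)^-1) x (- (f x ^- 2)*a).
move=> f0 hf; have h := @is_deriveV R f x a 1 f0 hf.
by [].
Qed.

Lemma der_continuous f x a : der f x a -> {for x, continuous f}.
move=> hf; apply: differentiable_continuous; apply/derivable1_diffP.
by case: hf.
Qed.

Lemma der_sum n (f : 'I_n -> R -> R) x (a : 'I_n -> R) :
 (forall i, der (f i) x (a i)) -> der (fun t => \sum_i f i t) x (\sum_i a i).
move=> h; have := @is_derive_sum _ _ _ n f x 1 a h.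
by rewrite (_ : \sum_i f i = (fun t => \sum_i f i t))//; apply/funext => t; rewrite fct_sumE.
Qed.

Lemma mvt f df a b : a <= b -> (forall x, a <= x <= b -> der f x (df x)) ->
 exists2 c, a <= c <= b & f b-f a = df c*(b-a).
move=> ab h; have [] := @MVT_segment R f df a b ab.
- by move=> x; rewrite in_itv/= => /andP[/ltW h1 /ltW h2]; apply: h; rewrite h1.
- apply: derivable_within_continuous => x; rewrite in_itv/= => hx.
 by case: (h x hx).
by move=> c; rewrite in_itv/= => hc E; exists c.
Qed.

Lemma der_nondecr f df a b : a <= b -> (forall x, a <= x <= b -> der f x (df x)) ->
 (forall x, a <= x <= b -> 0 <= df x) -> f a <= f b.
move=> ab h h0; have [c hc E] := mvt ab h.
by rewrite -subr_ge0 E mulr_ge0 ?h0// subr_ge0.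
Qed.

Lemma expR_ge2 x : 0 <= x -> 1+x+x^+2/2 <= expR x.
move=> x0; rewrite -subr_ge0.
have := @der_nondecr (fun t => expR t-(1+t+t^+2/2)) (fun t => expR t-(1+t)) 0 x x0.
rewrite expR0 expr0n/= mul0r !addr0 subrr; apply.
 move=> t _; apply: der_eq; first apply: der_sub.
 - by apply: der_expR; exact: der_id.
 - apply: der_add; first by apply: der_add; [exact: der_cst|exact: der_id].
  apply: (@der_eq (fun t => t^+2/2)); first (apply: der_mul; [apply: der_exp; exact: der_id|exact: der_cst]).
  by reflexivity.
 - by rewrite /=; field.
by move=> t _; rewrite subr_ge0 expR_ge1Dx.
Qed.

Lemma expRN_le2 x : 0 <= x -> expR (- x) <= 1-x+x^+2/2.
move=> x0; rewrite expRN; have h := expR_ge2 x0.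
have p0 : 0 < 1+x+x^+2/2 by have := sqr_ge0 x; lra.
apply: (le_via (1+x+x^+2/2)^-1).
 by rewrite lef_pV2// posrE expR_gt0.
rewrite -[leLHS]mul1r ler_pdivrMr// -subr_ge0.
have -> : (1-x+x^+2/2)*(1+x+x^+2/2)-1 = (x^+2)^+2/4 by field.
by [].
Qed.

Lemma expR_le1 x : 0 <= x -> expR x <= 1+x*expR x.
move=> x0; have := expR_ge1Dx (- x); rewrite expRN => h.
have e0 := expR_gt0 x; rewrite -lerBlDr -(ler_pM2r (x := (expR x)^-1)) ?invr_gt0//.
by rewrite mulrBl mulfV ?gt_eqF// mul1r -mulrA mulfV ?gt_eqF// mulr1.
Qed.

Lemma expR_le2 x : 0 <= x -> expR x <= 1+x+x^+2*expR x.
move=> x0; have := expR_le1 x0 => h.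
have : x*expR x <= x*(1+x*expR x) by exact: ler_wpM2l.
by rewrite mulrDr mulr1 mulrA -expr2; lra.
Qed.

(** For x >= 0 the difference of the two sides has derivative (1 + x + x^2 e^x - e^x) + (2 x^2 +
    x^3) e^x, whose first bracket is nonnegative by [expR_le2]. For x < 0 the bound [expRN_le2]
    suffices. *)
Lemma expR_le3 x : expR x <= 1+x+x^+2/2 + `|x|^+3*expR `|x|.
have [x0|x0] := leP 0 x; last first.
 rewrite ltr0_norm; have := @expRN_le2 (- x); rewrite opprK sqrrN oppr_ge0 ltW// => /(_ isT) h.
 have : 0 <= (- x)^+3*expR (- x) by rewrite mulr_ge0 ?expR_ge0// exprn_ge0// oppr_ge0 ltW.
 by lra.
rewrite ger0_norm// -subr_ge0.
pose f (t : R) := 1+t+t^+2/2+t^+3*expR t-expR t.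
have := @der_nondecr f (fun t => (1+t+t^+2*expR t-expR t)+(2 * t^+2+t^+3)*expR t) 0 x x0.
have -> : f 0 = 0 by rewrite /f expR0 !expr0n/= mul0r !mul0r !addr0 subrr.
apply.
 move=> t _; rewrite /f; apply: der_eq; first apply: der_sub.
 - apply: der_add; last by apply: der_mul; [apply: der_exp; exact: der_id|apply: der_expR; exact: der_id].
  apply: der_add; first by apply: der_add; [exact: der_cst|exact: der_id].
  by apply: (@der_mul (fun t => t^+2)); [apply: der_exp; exact: der_id|exact: der_cst].
 - by apply: der_expR; exact: der_id.
 - by rewrite /=; field.
move=> t /andP[t0 _]; apply: addr_ge0; first by rewrite subr_ge0 expR_le2.
by [].
Qed.

(** The function t - t^2/2 + t^3/3 - ln(1+t) has derivative t^3/(1+t), so its minimum over t > -1 is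
    its value 0 at t = 0. *)
Lemma ln_le3 (w : R) : -1 < w -> ln (1+w) <= w-w^+2/2 + `|w|^+3.
move=> w1.
pose f (t : R) := t-t^+2/2+t^+3/3-ln (1+t).
pose df (t : R) := t^+3/(1+t).
have fd (t : R) : -1 < t -> der f t (df t).
 move=> t1; have t10 : 0 < 1+t by lra.
 rewrite /f /df; apply: der_eq; first apply: der_sub.
 - apply: der_add.
   apply: der_sub; first exact: der_id.
   by apply: (@der_mul (fun t => t^+2)); [apply: der_exp; exact: der_id|exact: der_cst].
  by apply: (@der_mul (fun t => t^+3)); [apply: der_exp; exact: der_id|exact: der_cst].
 - exact: (der_ln (f := fun t => 1+t) t10 (der_add (der_cst 1 t) (der_id t))).
 - by rewrite /=; field.
have f0 : f 0 = 0 by rewrite /f addr0 ln1 !expr0n/= !mul0r; ring.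
suff : 0 <= f w.
 rewrite /f => h; have : w^+3/3 <= `|w|^+3.
  have := ler_norm (w^+3); rewrite normrX => h3.
  have : 0 <= `|w|^+3 by [].
  by lra.
 by lra.
have [w0|w0] := leP 0 w.
 rewrite -f0; apply: (der_nondecr w0) => [t /andP[t0 _]|t /andP[t0 _]].
  by apply: fd; lra.
 by [].
have := @der_nondecr (fun t => - f t) (fun t => - df t) w 0 (ltW w0).
rewrite f0 oppr0 oppr_le0; apply.
 by move=> t /andP[tw _]; apply: der_opp; apply: fd; lra.
move=> t /andP[tw t0]; rewrite /df oppr_ge0.
rewrite pmulr_lle0; first by rewrite exprn_odd_le0.
by rewrite invr_gt0; lra.
Qed.

(** This bound and the next three are obtained in turn, each by integrating the preceding one,
    starting from cos <= 1. *)
Lemma sin_lex x : 0 <= x -> sin x <= x.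
move=> x0; rewrite -subr_ge0.
have := @der_nondecr (fun t => t-sin t) (fun t => 1-cos t) 0 x x0.
rewrite sin0 subrr; apply => [t _|t _] => //.
apply: der_eq; first by apply: der_sub; [exact: der_id|apply: der_sin; exact: der_id].
by rewrite mulr1.
Qed.

Lemma cos_ge2 x : 1-x^+2/2 <= cos x.
wlog x0 : x/0 <= x.
 move=> H; have [x0|/ltW x0] := leP 0 x; first exact: H.
 by have := H (- x); rewrite oppr_ge0 cosN sqrrN; apply.
rewrite -subr_ge0.
have := @der_nondecr (fun t => cos t-(1-t^+2/2)) (fun t => t-sin t) 0 x x0.
rewrite cos0 expr0n/= mul0r subr0 subrr; apply => [t _|t /andP[t0 _]].
 apply: der_eq; first apply: der_sub.
 - by apply: der_cos; exact: der_id.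
 - apply: der_sub; first exact: der_cst.
  by apply: (@der_mul (fun t => t^+2)); [apply: der_exp; exact: der_id|exact: der_cst].
 - by rewrite /=; field.
by rewrite subr_ge0 sin_lex.
Qed.

Lemma sin_ge3 x : 0 <= x -> x-x^+3/6 <= sin x.
move=> x0; rewrite -subr_ge0.
have := @der_nondecr (fun t => sin t-(t-t^+3/6)) (fun t => cos t-(1-t^+2/2)) 0 x x0.
rewrite sin0 expr0n/= mul0r subr0 subrr; apply => [t _|t _].
 apply: der_eq; first apply: der_sub.
 - by apply: der_sin; exact: der_id.
 - apply: der_sub; first exact: der_id.
  by apply: (@der_mul (fun t => t^+3)); [apply: der_exp; exact: der_id|exact: der_cst].
 - by rewrite /=; field.
by rewrite subr_ge0 cos_ge2.
Qed.

Lemma cos_le4 x : cos x <= 1-x^+2/2+x^+4/24.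
wlog x0 : x/0 <= x.
 move=> H; have [x0|/ltW x0] := leP 0 x; first exact: H.
 have := H (- x); rewrite oppr_ge0 cosN sqrrN => /(_ x0).
 by rewrite -[(- x)^+4]exprnN_even || rewrite (_ : (- x)^+4 = x^+4)//; ring.
rewrite -subr_ge0.
have := @der_nondecr (fun t => 1-t^+2/2+t^+4/24-cos t) (fun t => sin t-(t-t^+3/6)) 0 x x0.
rewrite cos0 !expr0n/= !mul0r subr0 addr0 subrr; apply => [t _|t /andP[t0 _]].
 apply: der_eq; first apply: der_sub.
 - apply: der_add.
   apply: der_sub; first exact: der_cst.
   by apply: (@der_mul (fun t => t^+2)); [apply: der_exp; exact: der_id|exact: der_cst].
  by apply: (@der_mul (fun t => t^+4)); [apply: der_exp; exact: der_id|exact: der_cst].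
 - by apply: der_cos; exact: der_id.
 - by rewrite /=; field.
by rewrite subr_ge0 sin_ge3.
Qed.

Lemma sin_norm_le x : `|sin x| <= `|x|.
have [x0|x0] := leP 0 x.
 rewrite (ger0_norm x0) ler_norml sin_lex// andbT.
 have [x1|x1] := leP x 1; last by have := sin_geN1 x; lra.
 by have := sin_ge3 x0; have : x^+3 <= x; [rewrite exprS ler_piMr// exprn_ile1|lra].
rewrite (ltr0_norm x0) -normrN -sinN.
have xp : 0 <= - x by lra.
rewrite ler_norml sin_lex// andbT.
have [x1|x1] := leP (- x) 1; last by have := sin_geN1 (- x); lra.
by have := sin_ge3 xp; have : (- x)^+3 <= - x; [rewrite exprS ler_piMr// exprn_ile1|lra].
Qed.

End calculus.

Ltac nneg := repeat match goal with |- is_true (0 <= _) => first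
 [ assumption | (apply: ltW; assumption) | exact: ler0n | exact: ler01
 | exact: expR_ge0 | exact: normr_ge0 | exact: sqr_ge0 | exact: sqrtr_ge0
 | apply: exprn_ge0 | rewrite invr_ge0 | apply: mulr_ge0 | apply: addr_ge0
 | (apply: sumr_ge0 => ? _) ] end.

(** * A polynomial weight that dominates linear forms and the squared norm *)

Section weights.
Variables (R : realType) (n : nat).
Notation tp := (n.-tuple R).
Implicit Types (z y h x : tp) (u : 'I_n -> R).

(** A product rather than a sum over the coordinates, so that its powers factor and their integrals
    reduce to dimension one. The Taylor errors along the semigroup are dominated by powers of
    [wt]. *)
Definition wt z : R := \prod_i (1+tnth z i^+2).

Lemma wt_fac_ge1 z i : 1 <= 1+tnth z i^+2.
by rewrite lerDl sqr_ge0. Qed.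

Lemma prod_ge1 (I : Type) (s : seq I) (P : pred I) (F : I -> R) :
 (forall i, 1 <= F i) -> 1 <= \prod_(i <- s | P i) F i.
move=> h; elim/big_rec : _ => // i x _ x1.
by rewrite -[leLHS]mulr1 ler_pM// ler01.
Qed.

Lemma wt_ge1 z : 1 <= wt z.
by apply: prod_ge1 => i; exact: wt_fac_ge1. Qed.

Lemma wt_gt0 z : 0 < wt z. exact: lt_le_trans (wt_ge1 z). Qed.

Lemma sq_le_wt z i : 1+tnth z i^+2 <= wt z.
rewrite /wt (bigD1 i)//= ler_peMr ?sqr_ge0//.
by apply: prod_ge1 => j; exact: wt_fac_ge1.
Qed.

Lemma tnth_le_wt z i : `|tnth z i| <= wt z.
apply: le_trans (sq_le_wt z i); set t := tnth z i.
have := sqr_ge0 (`|t| - 1); have := normr_ge0 t.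
by rewrite -(sqr_normr t); nra.
Qed.

Lemma nsq_le_wt z : nsq z <= n%:R*wt z.
rewrite mulr_natl -[X in _ *+ X](card_ord n) -sumr_const; apply: ler_sum => i _.
by apply: le_trans (sq_le_wt z i); rewrite lerDr.
Qed.

Lemma nsq_ge0 z : 0 <= nsq z.
by []. Qed.

Lemma dot_le_wt u z : `|dot u z| <= (\sum_i `|u i|)*wt z.
rewrite mulr_suml; apply: le_trans (ler_norm_sum _ _ _) _; apply: ler_sum => i _.
by rewrite normrM ler_wpM2l ?tnth_le_wt.
Qed.

Lemma msr_wt : msr wt.
rewrite /wt.
have mE (s : seq 'I_n) : msr (fun z : tp => \prod_(i <- s) (1+tnth z i^+2)).
 elim: s => [|i s IH].
  rewrite (_ : (fun z : tp => _) = fun=> 1) => //.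
  by apply/funext => z; rewrite big_nil.
 rewrite (_ : (fun z : tp => _) = fun z => (1+tnth z i^+2)*\prod_(i <- s) (1+tnth z i^+2)).
  apply: measurable_funM => //; apply: measurable_funD => //.
  by apply: measurable_funX; exact: measurable_tnth.
 by apply/funext => z; rewrite big_cons.
by [].
Qed.

End weights.

Section weights_integrable.
Variable R : realType.

Lemma integral_wt_lty n k : (\int[gauss n]_z ((@wt R n z)^+k)%:E < +oo)%E.
have mw m : msr (fun z : m.-tuple R => (wt z^+k)%:E) by apply/measurable_EFinP; apply: measurable_funX; exact: msr_wt.
have w0 m (z : m.-tuple R) : (0 <= (wt z^+k)%:E)%E by rewrite lee_fin exprn_ge0// ltW// wt_gt0.
elim: n => [|n IH].
 rewrite integral_dirac => //.
 by rewrite diracT mul1e ltry.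
have mi : msr (idfun : n.+1.-tuple R -> n.+1.-tuple R) by [].
rewrite (eqlaw_ge0_integral mi (@measurable_consT R n) (@eqlaw_gaussS R n) (mw n.+1) (w0 n.+1)).
have mc : msr (fun p : R*n.-tuple R => (wt (consT p)^+k)%:E) by exact: (measurableT_comp (mw n.+1)).
rewrite (fubini_tonelli1 _ mc); last by move=> p; exact: w0.
have cE (t : R) (x : n.-tuple R) : ((wt (consT (t, x))^+k)%:E = ((1+t^+2)^+k)%:E*(wt x^+k)%:E)%E.
 rewrite -EFinM -exprMn; congr (_^+_)%:E; rewrite /wt big_ord_recl tnth_cons0.
 by congr (_*_); apply: eq_bigr => i _; rewrite tnth_consS.
set I := (\int[gauss n]_z _)%E in IH.
have I0 : (0 <= I)%E by apply: integral_ge0 => z _.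
rewrite (_ : (\int[_]_x _)%E = (\int[gam]_t (((1+t^+2)^+k)%:E*I))%E); last first.
 apply: eq_integral => t _; rewrite /fubini_F -ge0_integralZl//.
 - exact: eq_integral => x _.
 - by rewrite lee_fin exprn_ge0// addr_ge0 sqr_ge0.
rewrite ge0_integralZr//.
- have := intg_gam_poly R k => /integrableP[_] /=.
 under eq_integral do rewrite ger0_norm ?exprn_ge0 ?addr_ge0 ?sqr_ge0//.
 by move=> h; rewrite lte_mul_pinfty ?integral_ge0//; [move=> x _; rewrite lee_fin exprn_ge0// addr_ge0// sqr_ge0| rewrite ge0_fin_numE//; apply: integral_ge0 => x _; rewrite lee_fin exprn_ge0// addr_ge0// sqr_ge0].
- by apply/measurable_EFinP.
- by move=> x _; rewrite lee_fin exprn_ge0// addr_ge0 sqr_ge0.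
Qed.

Lemma intg_wt n k : IG n (fun z => @wt R n z^+k).
apply/integrableP; split.
 by apply/measurable_EFinP; apply: measurable_funX; exact: msr_wt.
rewrite (_ : (\int[_]_x _)%E = (\int[gauss n]_z ((@wt R n z)^+k)%:E)%E); first exact: integral_wt_lty.
by apply: eq_integral => z _; rewrite /= ger0_norm// exprn_ge0// ltW// wt_gt0.
Qed.

Lemma intg_wt_le n k (f : n.-tuple R -> R) (C : R) : msr f ->
 (forall z, `|f z| <= C*wt z^+k) -> IG n f.
by move=> mf fC; apply: (intg_le mf fC); apply: intgZ; exact: intg_wt. Qed.

Lemma eqlaw_dot n (u : 'I_n -> R) :
 eqlaw (gauss n) (gam (R := R)) (dot u) (fun x => Num.sqrt (\sum_i u i^+2)*x).
by move=> f M mf fM; exact: gauss_linear mf fM. Qed.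

Lemma Ex_dot_gam n (u : 'I_n -> R) (f : R -> R) : msr f ->
 intg gam (fun x => f (Num.sqrt (\sum_i u i^+2)*x)) ->
 IG n (fun z => f (dot u z)) /\
 EG n (fun z => f (dot u z)) = Ex gam (fun x => f (Num.sqrt (\sum_i u i^+2)*x)).
move=> mf If; have ms : msr (fun x : R => Num.sqrt (\sum_i u i^+2)*x).
 by [].
exact: (eqlaw_intg (msr_dot u) ms (@eqlaw_dot n u) mf If).
Qed.

Lemma intg_dot n (u : 'I_n -> R) : IG n (dot u).
apply: (@intg_wt_le n 1 _ (\sum_i `|u i|)) => //.
by move=> z; rewrite expr1 dot_le_wt.
Qed.

Lemma Ex_dot n (u : 'I_n -> R) : EG n (dot u) = 0.
have [_ ->] := @Ex_dot_gam n u (fun x => x) (@measurable_id _ R setT) (intgZ _ (intg_gam_id R)).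
by rewrite (ExZ _ (intg_gam_id R)) Ex_gam_id mulr0.
Qed.

Lemma Ex_dot_sq n (u : 'I_n -> R) :
 IG n (fun z => dot u z^+2) /\
 EG n (fun z => dot u z^+2) = \sum_i u i^+2.
set s := \sum_i _; have s0 : 0 <= s by apply: sumr_ge0 => i _; exact: sqr_ge0.
have E (x : R) : (Num.sqrt s*x)^+2 = s*x^+2 by rewrite exprMn sqr_sqrtr.
have [||I ->] := @Ex_dot_gam n u (fun x => x^+2).
- by [].
- rewrite (_ : (fun x => _) = fun x => s*x^+2); last by apply/funext => x; rewrite E.
 by apply: intgZ; exact: intg_gam_sq.
split => //; transitivity (Ex gam (fun x : R => s*x^+2)); first by apply: Ex_eq => x; rewrite E.
by rewrite (ExZ _ (intg_gam_sq R)) Ex_gam_sq mulr1.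
Qed.

End weights_integrable.

(** * Heat semigroup steps and functions with a quadratic Taylor remainder *)

Section averaging.
Variables (R : realType) (n : nat).
Notation tp := (n.-tuple R).
Implicit Types (z y h x : tp) (u : 'I_n -> R) (f g : tp -> R) (e s : R).

(** One step of variance e^2 of the heat semigroup. *)
Definition avg e f y : R := EG n (fun z => f (vlin 1 y e z)).

(** The heat semigroup at time s^2, evaluated at the origin: s = 0 gives f(0), s = 1 the Gaussian
    expectation, and [Ew_avg] trades a step of averaging for time. The combination with [0 z] only
    expresses the multiple s z. *)
Definition Ew s f : R := EG n (fun z => f (vlin s z 0 z)).

Lemma msr_shift e y f : msr f ->
 msr (fun z => f (vlin 1 y e z)).
by [].
Qed.

Lemma msr_scl s f : msr f ->
 msr (fun z => f (vlin s z 0 z)).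
by [].
Qed.

Lemma msr_avg e f (M : R) : msr f -> bdd f M ->
 msr (avg e f).
move=> mf fM.
have mF : msr (fun p : tp * tp => f (vlin 1 p.1 e p.2)) by [].
exact: (@msr_Ex_snd _ _ _ _ _ (gauss n) (gauss n) (fun p => f (vlin 1 p.1 e p.2)) M mF (fun=> fM _)).
Qed.

Lemma avg_bound e f (M : R) y : msr f -> bdd f M ->
 `|avg e f y| <= M.
by move=> mf fM; apply: Ex_bound => //; exact: msr_shift. Qed.

Lemma avg_between e f (m M : R) y : msr f -> (forall x, m <= f x <= M) ->
 m <= avg e f y <= M.
by move=> mf fM; apply: Ex_between => //; exact: msr_shift. Qed.

Lemma Ew0 f : msr f -> Ew 0 f = f [tuple 0 | i < n].
move=> mf; rewrite -[RHS](Ex_cst (gauss n)); apply: Ex_eq => z; congr f.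
by apply: eq_from_tnth => i; rewrite tnth_vlin tnth_mktuple !mul0r addr0.
Qed.

Lemma Ew1 f : Ew 1 f = EG n f.
apply: Ex_eq => z; congr f; apply: eq_from_tnth => i.
by rewrite tnth_vlin mul1r mul0r addr0.
Qed.

Lemma Ew_avg s e f (M : R) : 0 <= s -> msr f -> bdd f M ->
 Ew s (avg e f) = Ew (Num.sqrt (s^+2+e^+2)) f.
move=> s0 mf fM; set r := Num.sqrt _.
have r2 : r^+2 = s^+2+e^+2 by rewrite sqr_sqrtr// addr_ge0 sqr_ge0.
have [r0|rn0] := eqVneq r 0.
 have [-> ->] : s = 0 /\ e = 0.
  move: r2; rewrite r0 expr0n/= => /esym/eqP.
  by rewrite paddr_eq0 ?sqr_ge0// !sqrf_eq0 => /andP[/eqP-> /eqP->].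
 rewrite r0 Ew0; last exact: (msr_avg _ mf fM).
 rewrite Ew0// -[RHS](Ex_cst (gauss n)); apply: Ex_eq => z; congr f.
 by apply: eq_from_tnth => i; rewrite tnth_vlin tnth_mktuple mul0r mul1r addr0.
have rp : 0 < r by rewrite lt_neqAle eq_sym rn0 sqrtr_ge0.
have h1 : 0 <= s/r by [].
have h2 : (s/r)^+2+(e/r)^+2 = 1 by rewrite !expr_div_n -mulrDl -r2 divff// expf_neq0.
have := gauss_semigroup h1 h2 (msr_scl r mf) (fun=> fM _).
rewrite -/(Ew r f) => <-; apply: Ex_eq => z; apply: Ex_eq => z'; congr f.
apply: eq_from_tnth => i; rewrite !tnth_vlin; field.
by [].
Qed.

Lemma Ew_le s f g (M : R) : msr f -> msr g ->
 bdd f M -> bdd g M ->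
 (forall x, f x <= g x) -> Ew s f <= Ew s g.
move=> mf mg fM gM fg; apply: Ex_le => //.
 exact: (intg_bnd M).
exact: (intg_bnd M).
Qed.

(** A first order expansion with gradient sum_l xi_l U_l and remainder K |h|^2. No derivative is
    mentioned, so the class is stable under averaging with the same K, and the gradient stays in the
    span of the vectors U_l. *)
Definition C11 d (U : 'I_d -> 'I_n -> R) f (xi : 'I_d -> tp -> R) (K : R) :=
 [/\ msr f, (forall l, msr (xi l)),
  bdd f K, (forall l x, `|xi l x| <= K) &
  (forall y h, `|f (vlin 1 y 1 h)-f y-\sum_l xi l y * dot (U l) h| <= K*nsq h)].

Lemma vlin_comm y e z h : vlin 1 (vlin 1 y 1 h) e z = vlin 1 (vlin 1 y e z) 1 h.
by apply: eq_from_tnth => i; rewrite !tnth_vlin; ring. Qed.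

Lemma C11_avg d (U : 'I_d -> 'I_n -> R) f xi (K : R) e : C11 U f xi K ->
 C11 U (avg e f) (fun l => avg e (xi l)) K.
move=> [mf mxi fK xiK rem]; split.
- exact: msr_avg mf fK.
- by move=> l; exact: (msr_avg _ (mxi l) (xiK l)).
- by move=> x; exact: avg_bound.
- by move=> l x; exact: avg_bound.
move=> y h.
have If x : IG n (fun z => f (vlin 1 x e z)) by exact: (intg_bnd K).
have Ixi l x : IG n (fun z => xi l (vlin 1 x e z)) by exact: (intg_bnd K).
have IS : IG n (fun z => \sum_l dot (U l) h*xi l (vlin 1 y e z)) by apply: intg_sum => l _; apply: intgZ.
have -> : avg e f (vlin 1 y 1 h)-avg e f y-\sum_l avg e (xi l) y * dot (U l) h =
 EG n (fun z => f (vlin 1 (vlin 1 y 1 h) e z)-f (vlin 1 y e z) -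
  \sum_l dot (U l) h*xi l (vlin 1 y e z)).
 rewrite ExB//; last exact: intgB.
 rewrite ExB// Ex_sum; last by move=> l; apply: intgZ.
 by congr (_-_); apply: eq_bigr => l _; rewrite ExZ// mulrC.
apply: Ex_bound.
 apply: measurable_funB; last exact: intg_meas IS.
 exact: measurable_funB.
move=> z; rewrite vlin_comm.
have := rem (vlin 1 y e z) h; congr (`|_-_| <= _).
by apply: eq_bigr => l _; rewrite mulrC.
Qed.

End averaging.

(** * A Hoelder inequality for functions of nearly orthogonal blocks *)

Section gen_hoelder.
Variable R : realType.

(** A second order expansion of prod_j (1+w_j)^(1/p), where w_j is a relative increment of size b
    and q_j its linear part, exact up to b^2. The error D b^3 is valid for all b >= 0, small or not,
    so that it can be integrated over all Gaussian increments. *)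
Lemma hoelder_pointwise m (p W : R) : 0 < p -> 0 < W -> exists2 D : R, 0 <= D &
 forall (w q : 'I_m -> R) (b : R), 0 <= b ->
 (forall j, [/\ -1 < w j, w j <= W, `|w j| <= b, `|q j| <= b & `|w j-q j| <= b^+2]) ->
 expR (\sum_j ln (1+w j)/p) <=
 1+\sum_j w j/p-\sum_j q j^+2/(2 * p)+(\sum_j q j)^+2/(2 * p^+2)+D*b^+3.
move=> p0 W0; pose a := m%:R/p.
have a0 : 0 <= a by [].
have sumle (F : 'I_m -> R) (B : R) : (forall j, F j <= B) -> \sum_j F j/p <= a*B.
 move=> h; rewrite /a mulrAC -mulr_suml ler_pM2r ?invr_gt0//.
 by rewrite mulr_natl -[X in _ *+ X](card_ord m) -sumr_const; exact: ler_sum.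
pose D := 2*a+6*a^+2+27*a^+3*expR (3*a)+expR (a*W).
exists D.
 by [].
move=> w q b b0 H.
set S := \sum_j w j/p; set Q2 := \sum_j q j^+2/(2 * p).
pose Q := \sum_j q j/p.
have QE : (\sum_j q j)^+2/(2 * p^+2) = Q^+2/2 by rewrite /Q -mulr_suml exprMn exprVn; field.
rewrite QE.
have lnw j : ln (1+w j) <= w j by apply: le_ln1Dx; case: (H j).
(* For b > 1 nothing is expanded: every term is bounded crudely by a multiple of b^3, the left side
   through w_j <= W. *)
have [b1|b1] := ltP 1 b.
 have T1 : \sum_j ln (1+w j)/p <= a*W by apply: sumle => j; case: (H j) => _ wW _ _ _; exact: le_trans (lnw j) wW.
 have S1 : - S <= a*b.
  rewrite /S -sumrN; under eq_bigr do rewrite -mulNr.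
  by apply: sumle => j; case: (H j) => _ _+_ _; rewrite ler_norml => /andP[]; lra.
 have Q21 : Q2 <= a*b^+2.
  rewrite /Q2; have -> : \sum_j q j^+2/(2 * p) = \sum_j (q j^+2/2)/p.
   by apply: eq_bigr => j _; field.
  apply: sumle => j; case: (H j) => _ _ _ hq _.
  have : q j^+2 <= b^+2 by rewrite -(sqr_normr (q j)) lerXn2r.
  by have := sqr_ge0 (q j); lra.
 have b13 : b <= b^+3 by rewrite exprS ler_peMr// exprn_ege1// ltW.
 have b23 : b^+2 <= b^+3 by rewrite [leRHS]exprS ler_peMl ?sqr_ge0// ltW.
 have b31 : 1 <= b^+3 by rewrite exprn_ege1// ltW.
 have e1 : expR (\sum_j ln (1+w j)/p) <= expR (a*W)*b^+3.
  apply: (le_via (expR (a*W))); first by rewrite ler_expR.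
  by rewrite ler_peMr// expR_ge0.
 have h1 : a*b <= a*b^+3 by exact: ler_wpM2l.
 have h2 : a*b^+2 <= a*b^+3 by exact: ler_wpM2l.
 have h3 : 0 <= (6*a^+2+27*a^+3*expR (3*a))*b^+3 by [].
 by have := sqr_ge0 Q; rewrite /D; lra.
(* For b <= 1 the exponent is at most T by [ln_le3]; T^2 is compared with the square of its linear
   part Q, and [expR_le3] expands exp T. *)
pose T := \sum_j (w j-w j^+2/2 + `|w j|^+3)/p.
have le1 : \sum_j ln (1+w j)/p <= T.
 apply: ler_sum => j _; rewrite ler_pM2r ?invr_gt0//.
 by apply: ln_le3; case: (H j).
have hw j : `|w j| <= b by case: (H j).
have hq j : `|q j| <= b by case: (H j).
have hwq j : `|w j-q j| <= b^+2 by case: (H j).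
have b2 : b^+2 <= b by rewrite expr2 ler_piMl.
have b3 : b^+3 <= b^+2 by rewrite exprS ler_piMl.
have w3 j : `|w j|^+3 <= b^+3 by rewrite lerXn2r.
have w2 j : w j^+2 <= b^+2 by rewrite -(sqr_normr (w j)) lerXn2r.
have sumabs (F : 'I_m -> R) (B : R) : bdd F B -> `|\sum_j F j/p| <= a*B.
 move=> h; apply: le_trans (ler_norm_sum _ _ _) _.
 rewrite (eq_bigr (fun j => `|F j| / p)); first exact: sumle.
 by move=> j _; rewrite normrM [`|p^-1|]gtr0_norm// invr_gt0.
have Tn : `|T| <= a*(3*b).
 apply: sumabs => j; apply: ler_normD_via.
 rewrite [`| `|_|^+3|]ger0_norm ?exprn_ge0//.
 apply: le_trans (lerD (ler_normB _ _) (lexx _)) _.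
 rewrite [`|w j^+2/2|]ger0_norm ?sqr_ge0//.
 by have := w3 j; have := w2 j; have := hw j; lra.
have Qn : `|Q| <= a*b by exact: sumabs.
have TQ : `|T-Q| <= a*(3*b^+2).
 rewrite /T /Q -sumrB; under eq_bigr do rewrite -mulrBl.
 apply: sumabs => j.
 rewrite (_ : _-_ = (w j-q j)-w j^+2/2 + `|w j|^+3); last by ring.
 apply: ler_normD_via.
 rewrite [`| `|_|^+3|]ger0_norm ?exprn_ge0//.
 apply: le_trans (lerD (ler_normB _ _) (lexx _)) _.
 rewrite [`|w j^+2/2|]ger0_norm ?sqr_ge0//.
 by have := w3 j; have := w2 j; have := hwq j; have := sqr_ge0 b; lra.
have TS : T <= S-Q2+2*a*b^+3.
 have -> : S-Q2 = \sum_j (w j-q j^+2/2)/p by rewrite /S /Q2 -sumrB; apply: eq_bigr => j _; field.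
 rewrite -lerBlDl -sumrB (_ : 2*a*b^+3 = a*(2*b^+3)); last by ring.
 under eq_bigr do rewrite -mulrBl.
 apply: sumle => j.
 have : q j^+2-w j^+2 <= 2*b^+3.
  rewrite subr_sqr; apply: le_trans (ler_norm _) _; rewrite normrM.
  rewrite (_ : 2*b^+3 = b^+2*(b+b)); last by ring.
  apply: ler_pM => //; first by rewrite distrC.
  by apply: ler_normD_via; exact: lerD.
 by have := w3 j; lra.
have T2 : T^+2 <= Q^+2+12*a^+2*b^+3.
 rewrite -lerBlDl subr_sqr; apply: le_trans (ler_norm _) _; rewrite normrM.
 rewrite (_ : 12*_*_ = a*(3*b^+2)*(a*(3*b)+a*b)); last by ring.
 apply: ler_pM => //; apply: ler_normD_via; exact: lerD.
have T3 : `|T|^+3*expR `|T| <= 27*a^+3*expR (3*a)*b^+3.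
 rewrite (_ : _*b^+3 = (a*(3*b))^+3*expR (3*a)); last by ring.
 apply: ler_pM; rewrite ?expR_ge0//.
  by rewrite lerXn2r ?nnegrE// mulr_ge0 mulr_ge0.
 rewrite ler_expR; apply: le_trans Tn _.
 rewrite (_ : a*(3*b) = 3*a*b); last by ring.
 exact: ler_piMr.
have e0 : 0 <= expR (a*W)*b^+3 by [].
have := expR_le3 T; have : expR (\sum_j ln (1+w j)/p) <= expR T by rewrite ler_expR.
by rewrite /D; lra.
Qed.

Section step.
Variables (n m d : nat) (U : 'I_m -> 'I_d -> 'I_n -> R) (p c K : R).
Hypotheses (p0 : 0 < p) (c0 : 0 < c) (cK : c <= K).
Hypothesis frame : forall a : 'I_m -> 'I_d -> R,
 \sum_i (\sum_j \sum_l a j l*U j l i)^+2 <=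
 p*\sum_j \sum_i (\sum_l a j l*U j l i)^+2.
Notation tp := (n.-tuple R).

(** The bounds c and K are common to all factors and survive averaging, so the error constant of
    [hoelder_step] is the same at every step of the iteration. *)
Definition hoelder_class (g : 'I_m -> tp -> R) :=
 exists xi : 'I_m -> 'I_d -> tp -> R,
 forall j, C11 (U j) (g j) (xi j) K /\ (forall x, c <= g j x).

Lemma hoelder_class_avg g e : hoelder_class g -> hoelder_class (fun j => avg e (g j)).
move=> [xi H]; exists (fun j l => avg e (xi j l)) => j; have [C cg] := H j.
split; first exact: C11_avg.
move=> x; have [mg _ gK _ _] := C.
have hb z : c <= g j z <= K by rewrite cg (le_trans (ler_norm _) (gK _)).
by have /andP[] := @avg_between R n e (g j) c K x mg hb.
Qed.

(** The product of the powers g_j(x)^(1/p). *)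
Definition hprod (g : 'I_m -> tp -> R) x := expR (\sum_j ln (g j x)/p).

Lemma hprod_bound g : hoelder_class g ->
 msr (hprod g) /\ forall x, `|hprod g x| <= expR (m%:R * `|ln K| / p).
move=> [xi H]; split.
 apply: measurableT_comp => //; apply: measurable_sum => j.
 have [[mg _ _ _ _] _] := H j.
 by apply: measurable_funM; [exact: measurableT_comp|exact: measurable_cst].
move=> x; rewrite ger0_norm ?expR_ge0// ler_expR -mulr_suml ler_pM2r ?invr_gt0//.
rewrite mulr_natl -[X in _ *+ X](card_ord m) -sumr_const; apply: ler_sum => j _.
have [[_ _ gK _ _] cg] := H j.
apply: le_trans (ler_norm _); rewrite ler_ln ?posrE.
- exact: le_trans (ler_norm _) (gK x).
- exact: lt_le_trans c0 (cg x).
- exact: lt_le_trans c0 cK.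
Qed.

(** In the expansion around the averaged factors the linear terms have mean zero. The quadratic
    terms have mean e^2/2 times |sum_j v_j|^2/p^2 - sum_j |v_j|^2/p, where v_j is the gradient of
    g_j at y divided by the averaged value; the frame bound makes this nonpositive, and only the
    cubic error remains. *)
Lemma hoelder_step : exists2 D : R, 0 <= D & forall g e y, hoelder_class g -> 0 < e <= 1 ->
 avg e (hprod g) y <= expR (D*e^+3)*hprod (fun j => avg e (g j)) y.
have K0 : 0 < K by exact: lt_le_trans c0 cK.
have W0 : 0 < K/c by [].
have [D0 D00 PW] := @hoelder_pointwise m p (K/c) p0 W0.
pose A := K/c*\sum_j \sum_l \sum_i `|U j l i|.
pose M k := EG n (fun z => @wt R n z^+k).
pose N := K*n%:R*(1+M 1%N).
have M0 k : 0 <= M k by apply: Ex_ge0 => z; rewrite exprn_ge0// ltW// wt_gt0.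
have A0 : 0 <= A by [].
have N0 : 0 <= N/c by [].
pose B := A+N/c+1; have B1 : 1 <= B by rewrite /B; lra.
have B0 : 0 <= B by [].
exists (D0*B^+3 * M 3%N); first by [].
move=> g e y [xi H] /andP[e0 e1].
have mg j : msr (g j) by case: (H j) => -[].
have gK j x : g j x <= K by apply: le_trans (ler_norm _) _; case: (H j) => -[].
have cg j x : c <= g j x by case: (H j).
have gp j x : 0 < g j x by exact: lt_le_trans c0 (cg j x).
pose av j := avg e (g j) y.
have cav j : c <= av j by have /andP[] : c <= avg e (g j) y <= K by apply: avg_between => // x; rewrite cg gK.
have ap j : 0 < av j by exact: lt_le_trans c0 (cav j).
have an j : av j != 0 by rewrite gt_eqF.
have ic j : (av j)^-1 <= c^-1 by rewrite lef_pV2 ?posrE.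
pose al j l := xi j l y/av j.
pose v j i := \sum_l al j l*U j l i.
(* Increments relative to the averaged value [av j], not to g_j(y), so that w_j has mean exactly
   zero. *)
pose w j (z : tp) := g j (vlin 1 y e z)/av j-1.
pose q j (z : tp) := e * dot (v j) z.
have dv j z : dot (v j) z = (\sum_l xi j l y * dot (U j l) z)/av j.
 rewrite /dot /v mulr_suml; under eq_bigr do rewrite mulr_suml.
 rewrite exchange_big/=; apply: eq_bigr => l _.
 by rewrite mulr_sumr mulr_suml; apply: eq_bigr => i _; rewrite /al; ring.
have vA j : \sum_i `|v j i| <= A.
 apply: (le_via (\sum_i \sum_l K/c * `|U j l i|)).
  apply: ler_sum => i _; apply: le_trans (ler_norm_sum _ _ _) _.
  apply: ler_sum => l _; rewrite normrM ler_wpM2r// normrM normfV (gtr0_norm (ap j)).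
  by apply: ler_pM => //; case: (H j) => -[].
 rewrite exchange_big/=; under eq_bigr do rewrite -mulr_sumr.
 by rewrite -mulr_sumr /A ler_pM2l// (bigD1 j)//= lerDl; apply: sumr_ge0.
have rem j z : `|g j (vlin 1 y e z)-g j y-av j*q j z| <= K*n%:R*e^+2*wt z.
 pose h := vlin e z 0 z.
 have -> : vlin 1 y e z = vlin 1 y 1 h by apply: eq_from_tnth => i; rewrite !tnth_vlin; ring.
 have -> : av j*q j z = \sum_l xi j l y * dot (U j l) h.
  rewrite /q dv mulrCA [av j*_]mulrC divfK// mulr_sumr; apply: eq_bigr => l _.
  by rewrite dot_vlin mul0r addr0 mulrCA.
 have : `|g j (vlin 1 y 1 h)-g j y-\sum_l xi j l y * dot (U j l) h| <= K*nsq h by case: (H j) => -[].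
 have -> : nsq h = e^+2*nsq z.
  by rewrite /nsq mulr_sumr; apply: eq_bigr => i _; rewrite tnth_vlin mul0r addr0 exprMn.
 move=> /le_trans; apply; rewrite (_ : K*n%:R*e^+2*wt z = K*(e^+2*(n%:R*wt z))); last by ring.
 by rewrite ler_pM2l// ler_pM2l ?exprn_gt0//; exact: nsq_le_wt.
have Ig j : IG n (fun z => g j (vlin 1 y e z)).
 apply: (intg_bnd K); first exact: msr_shift.
 by move=> z; rewrite gtr0_norm.
have Iq j : IG n (q j) by apply: intgZ; exact: intg_dot.
have Eq_ j : EG n (q j) = 0 by rewrite ExZ ?Ex_dot ?mulr0//; exact: intg_dot.
have Ix j : IG n (fun z => g j (vlin 1 y e z)-g j y) by apply: intgB; [|exact: intg_cst].
have avy j : `|av j-g j y| <= K*n%:R*e^+2 * M 1%N.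
 have -> : av j-g j y = EG n (fun z => g j (vlin 1 y e z)-g j y-av j*q j z).
  rewrite ExB//; last exact: intgZ.
  by rewrite ExZ// Eq_ mulr0 subr0 ExB ?Ex_cst//; exact: intg_cst.
 have I1 : IG n (fun z : tp => K*n%:R*e^+2*wt z^+1) by apply: intgZ; exact: intg_wt.
 rewrite -ExZ; last exact: intg_wt.
 by apply: Ex_abs_le I1 _ => [|z]; [apply: intg_meas; apply: intgB => //; exact: intgZ|rewrite expr1; exact: rem].
have wt0 (z : tp) : 0 <= wt z by rewrite ltW// wt_gt0.
have wq j z : `|w j z-q j z| <= N/c*e^+2*wt z.
 have -> : w j z-q j z = ((g j (vlin 1 y e z)-g j y-av j*q j z)-(av j-g j y))/av j.
  by rewrite /w; field.
 rewrite normrM normfV (gtr0_norm (ap j)) (_ : _*wt z = N*e^+2*wt z/c); last by ring.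
 apply: ler_pM => //; apply: ler_normB_via; apply: le_trans (lerD (rem j z) (avy j)) _.
 rewrite (_ : N*_*_ = K*n%:R*e^+2*wt z+K*n%:R*e^+2 * M 1%N*wt z); last by rewrite /N; ring.
 by rewrite lerD2l ler_peMr// wt_ge1.
have ew1 (z : tp) : 0 <= e*wt z by exact: mulr_ge0 (ltW e0) _.
have qb j z : `|q j z| <= A*(e*wt z).
 rewrite normrM gtr0_norm// mulrCA ler_pM2l//; apply: le_trans (dot_le_wt _ _) _.
 by rewrite ler_pM2r ?wt_gt0.
(* The common size of all increments: since wt >= 1, it dominates w_j and q_j, and its square
   dominates w_j - q_j. *)
pose b (z : tp) := B*(e*wt z).
have b0 z : 0 <= b z by [].
have ew2 (z : tp) : e^+2*wt z <= e*wt z by rewrite ler_pM2r ?wt_gt0// expr2 ler_piMl// ltW.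
have Hpw z j : [/\ -1 < w j z, w j z <= K/c, `|w j z| <= b z, `|q j z| <= b z & `|w j z-q j z| <= b z^+2].
 have hwq := wq j z; have hq := qb j z.
 split.
 - by rewrite /w; have : 0 < g j (vlin 1 y e z)/av j; [exact: divr_gt0|lra].
 - rewrite /w; have : g j (vlin 1 y e z)/av j <= K/c by rewrite ler_pM// ltW.
  by lra.
 - have : `|w j z| <= `|w j z-q j z| + `|q j z|.
   by rewrite -{1}(subrK (q j z) (w j z)); exact: ler_normD.
  have := ler_wpM2l N0 (ew2 z); rewrite mulrA.
  by rewrite /b /B; have := ew1 z; lra.
 - by apply: le_trans hq _; rewrite /b ler_wpM2r// /B; lra.
 - apply: le_trans hwq _; rewrite /b exprMn -mulrA; apply: ler_pM => //.
  + by apply: (le_via B); [rewrite /B; lra|rewrite expr2 ler_peMl].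
  + by rewrite exprMn ler_pM2l ?exprn_gt0// expr2 ler_peMr// wt_ge1.
pose G0 := hprod (fun j => avg e (g j)) y.
have G00 : 0 < G0 by exact: expR_gt0.
have fE z : hprod g (vlin 1 y e z) = G0*expR (\sum_j ln (1+w j z)/p).
 rewrite /G0 /hprod -expRD -big_split/=; congr expR; apply: eq_bigr => j _.
 rewrite -mulrDl -lnM ?posrE//; last by have [] := Hpw z j; lra.
 by congr (ln _/_); rewrite /w -/(av j); field.
have Iw j : IG n (w j).
 rewrite (_ : w j = fun z => (av j)^-1 * g j (vlin 1 y e z)-1); last first.
  by apply/funext => z; rewrite /w mulrC.
 by apply: intgB; [exact: intgZ|exact: intg_cst].
have Ew_ j : EG n (w j) = 0.
 rewrite (@Ex_eq _ _ _ _ _ (fun z => (av j)^-1 * g j (vlin 1 y e z)-1)) => [|z]; last by rewrite /w mulrC.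
 by rewrite ExB ?ExZ ?Ex_cst// ?intgZ//; [rewrite -[Ex _ _]/(av j) mulVf// subrr|exact: intg_cst].
have Iq2 (u : 'I_n -> R) : IG n (fun z => dot u z^+2) by have [] := Ex_dot_sq u.
pose V (a : 'I_n -> R) := \sum_i a i^+2.
pose sv i := \sum_j v j i.
have sq z : \sum_j q j z = e * dot sv z.
 rewrite /q -mulr_sumr; congr (_*_); rewrite /dot /sv exchange_big/=.
 by apply: eq_bigr => i _; rewrite mulr_suml.
have fr : V sv <= p*\sum_j V (v j) by exact: (frame al).
have I3 : IG n (fun z : tp => D0*(B*e)^+3*wt z^+3) by apply: intgZ; exact: intg_wt.
pose RHS (z : tp) := 1+\sum_j p^-1*w j z-\sum_j (e^+2/(2 * p)) * dot (v j) z^+2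
 + (e^+2/(2 * p^+2)) * dot sv z^+2+D0*(B*e)^+3*wt z^+3.
have I4 : IG n (fun z => 1+\sum_j p^-1*w j z).
 by apply: intgD; [exact: intg_cst|apply: intg_sum => j _; exact: intgZ].
have I5 : IG n (fun z => \sum_j (e^+2/(2 * p)) * dot (v j) z^+2).
 by apply: intg_sum => j _; apply: intgZ.
have I6 : IG n (fun z => (e^+2/(2 * p^+2)) * dot sv z^+2) by exact: intgZ.
have IR : IG n RHS.
 by apply: intgD => //; apply: intgD => //; apply: intgB.
have mF : msr (fun z => expR (\sum_j ln (1+w j z)/p)).
 apply: measurableT_comp => //; apply: measurable_sum => j.
 apply: measurable_funM; last exact: measurable_cst.
 by apply: measurableT_comp.
have le_pw z : expR (\sum_j ln (1+w j z)/p) <= RHS z.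
 apply: le_trans (PW (w ^~ z) (q ^~ z) (b z) (b0 z) (Hpw z)) _.
 rewrite sq; apply: eq_ler; rewrite /RHS.
 congr (_+_-_+_+_).
 - by apply: eq_bigr => j _; rewrite mulrC.
 - by apply: eq_bigr => j _; rewrite /q; field; rewrite gt_eqF.
 - by field; rewrite gt_eqF.
 - by rewrite /b; ring.
have IF : IG n (fun z => expR (\sum_j ln (1+w j z)/p)).
 by apply: intg_le IR => // z; rewrite ger0_norm ?expR_ge0.
have ER : EG n RHS <= 1+D0*B^+3 * M 3%N*e^+3.
 rewrite /RHS ExD//; last by apply: intgD => //; exact: intgB.
 rewrite ExD//; last exact: intgB.
 rewrite ExB// ExD; [|exact: intg_cst|by apply: intg_sum => j _; exact: intgZ].
 rewrite Ex_cst !Ex_sum; [|by move=> j; exact: intgZ|by move=> j; exact: intgZ].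
 rewrite [X in _+X <= _]ExZ; last exact: intg_wt.
 have E2 u C : EG n (fun z : tp => C * dot u z^+2) = C*V u.
  by rewrite (ExZ _ (Iq2 u)) (proj2 (Ex_dot_sq _)).
 rewrite big1 => [|j _]; last by rewrite (ExZ _ (Iw j)) Ew_ mulr0.
 rewrite (eq_bigr _ (fun j _ => E2 (v j) _)) E2 -mulr_sumr -/(M 3%N).
 have : e^+2/(2 * p^+2)*V sv <= e^+2/(2 * p)*\sum_j V (v j).
  have -> : e^+2/(2 * p)*\sum_j V (v j) = e^+2/(2 * p^+2)*(p*\sum_j V (v j)).
   by field; rewrite gt_eqF.
  by rewrite ler_wpM2l.
 rewrite (_ : D0*(B*e)^+3 * M _ = D0*B^+3 * M 3%N*e^+3); last by ring.
 by lra.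
have -> : avg e (hprod g) y = G0*EG n (fun z => expR (\sum_j ln (1+w j z)/p)).
 by rewrite -ExZ//; apply: Ex_eq => z; rewrite fE.
rewrite mulrC ler_pM2r//.
by apply: le_trans (Ex_le IF IR le_pw) _; apply: le_trans ER (expR_ge1Dx _).
Qed.

(** One averaging is moved from the product onto its factors, which stay in the class; the induction
    hypothesis covers the remaining time. *)
Lemma hoelder_iter : exists2 D : R, 0 <= D & forall N g e, hoelder_class g -> 0 < e <= 1 ->
 Ew (Num.sqrt (N%:R*e^+2)) (hprod g) <=
 expR (N%:R*(D*e^+3)) *
 expR (\sum_j ln (Ew (Num.sqrt (N%:R*e^+2)) (g j))/p).
have [D D0 step] := hoelder_step; exists D => //; elim=> [|N IH] g e cg e01.
 rewrite !mul0r sqrtr0 expR0 mul1r Ew0; last by case: (hprod_bound cg).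
 rewrite /hprod ler_expR; apply: ler_sum => j _; rewrite Ew0//.
 by have [xi /(_ j)[[]]] := cg.
have sE : Num.sqrt (N.+1%:R*e^+2) = Num.sqrt (Num.sqrt (N%:R*e^+2)^+2+e^+2).
 rewrite sqr_sqrtr => //.
 by rewrite -natr1 mulrDl mul1r.
set s := Num.sqrt (N%:R*_) in IH sE *.
have s0 : 0 <= s by [].
have [mh hb] := hprod_bound cg.
have cag := hoelder_class_avg e cg.
have [mha hab] := hprod_bound cag.
rewrite sE -(@Ew_avg R n s e _ _ s0 mh hb).
have K1 : 0 < expR (D*e^+3) by [].
apply: (le_via (Ew s (fun y => expR (D*e^+3)*hprod (fun j => avg e (g j)) y))).
 apply: (@Ew_le _ _ s _ _ (expR (D*e^+3)*expR (m%:R * `|ln K| / p))).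
 - exact: msr_avg mh hb.
 - by [].
 - move=> x; apply: le_trans (avg_bound e x mh hb) _.
  rewrite ler_peMl ?expR_ge0// -expR0 ler_expR mulr_ge0//.
  by case/andP : e01 => e0 _; rewrite exprn_ge0// ltW.
 - by move=> x; rewrite normrM (gtr0_norm K1) ler_pM2l.
 - by move=> x; exact: step.
rewrite /Ew ExZ; last first.
 exact: (intg_bnd (expR (m%:R * `|ln K| / p)) (msr_scl s mha) (fun=> hab _)).

rewrite -/(Ew s (hprod (fun j => avg e (g j)))) -natr1 mulrDl mul1r expRD.
rewrite [_*expR (D*_)]mulrC -mulrA.
apply: (ler_wpM2l (ltW K1)); apply: le_trans (IH _ _ cag e01) _.
apply: ler_wpM2l; first exact: expR_ge0.
rewrite ler_expR; apply: ler_sum => j _; rewrite -/(Ew _ (g j)).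
by have [xi /(_ j)[[mg _ gK _ _] _]] := cg; rewrite (@Ew_avg R n s e _ _ s0 mg gK).
Qed.

Lemma small_step (D delta : R) : 0 < delta ->
 exists N, D*(Num.sqrt N.+1%:R)^-1 <= delta.
move=> d0; have [|Dp] := leP D 0.
 move=> D0; exists 0%N; apply: (le_via 0) => //.
 by rewrite mulr_le0_ge0// invr_ge0 sqrtr_ge0.
exists (Num.truncn ((D / delta)^+2)).
rewrite ler_pdivrMr ?sqrtr_gt0//.
rewrite -ler_pdivrMl// mulrC -[leLHS]ger0_norm ?ltW//.
by rewrite -sqrtr_sqr ltr_sqrt// truncnS_gt.
Qed.

(** With e = (N+1)^(-1/2) the N+1 steps reach time 1, and the accumulated error exponent D e
    vanishes as N grows. *)
Lemma generalized_hoelder g : hoelder_class g ->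
 EG n (hprod g) <= expR (\sum_j ln (EG n (g j))/p).
move=> cg; have [D D0 iter] := hoelder_iter.
set Y := Ex _ _; set X := expR _.
have X0 : 0 < X by [].
have H N : Y <= expR (D*(Num.sqrt N.+1%:R)^-1)*X.
 pose e : R := (Num.sqrt N.+1%:R)^-1.
 have s0 : 0 < Num.sqrt N.+1%:R :> R by [].
 have e0 : 0 < e by [].
 have e1 : e <= 1 by rewrite invf_le1// -[leLHS]sqrtr1 ler_wsqrtr// ler1n.
 have e2 : N.+1%:R*e^+2 = 1 by rewrite exprVn sqr_sqrtr// divff.
 have e01 : 0 < e <= 1 by rewrite e0 e1.
 have := iter N.+1 g e cg e01; rewrite e2 sqrtr1 Ew1.
 rewrite (_ : N.+1%:R*(D*e^+3) = N.+1%:R*e^+2*(D*e)); last by ring.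
 rewrite e2 mul1r.
 suff E : expR (\sum_j ln (Ew 1 (g j))/p) = X by rewrite E; apply.
 by rewrite /X; congr expR; apply: eq_bigr => j _; rewrite Ew1.
rewrite leNgt; apply/negP => XY.
have Y0 : 0 < Y by exact: lt_trans XY.
have l0 : 0 < ln Y-ln X by rewrite subr_gt0 ltr_ln.
have [N hN] := @small_step D ((ln Y-ln X)/2) (divr_gt0 l0 (ltr0n _ 2)).
have := H N; rewrite leNgt => /negP; apply.
rewrite -[ltRHS]lnK ?posrE// -[X in _*X < _]lnK ?posrE// -expRD ltr_expR; lra.
Qed.

End step.
End gen_hoelder.

Ltac measurable_leaf2 := first [ measurable_leaf1 | exact: msr_wt ].
Ltac measurable_leaf ::= measurable_leaf2.
Ltac measurable_rule ::= first [ apply: msr_vlin | apply: msr_shift | apply: msr_scl ].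
Ltac intg_leaf ::= first [ exact: intg_cst | exact: intg_dot | exact: intg_wt ].

(** * Closure properties of the smooth class *)

Section finite_cauchy_schwarz.
Variables (R : realType) (I : finType).

Lemma sum_CS (a b : I -> R) :
 (\sum_i a i*b i)^+2 <= (\sum_i a i^+2)*(\sum_i b i^+2).
set V := \sum_i a i^+2; set W := \sum_i b i^+2; set D := \sum_i _.
have V0 : 0 <= V by nneg.
have [V0'|Vn] := eqVneq V 0.
 have a0 i : a i = 0.
  by apply/eqP; rewrite -sqrf_eq0; apply/eqP; move: i isT; apply/psumr_eq0P.
 by rewrite /D big1 ?expr0n ?mulr_ge0//= => i _; rewrite a0 mul0r.
have Vp : 0 < V by rewrite lt_def Vn.
have : 0 <= \sum_i (V*b i-D*a i)^+2 by nneg.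
have -> : \sum_i (V*b i-D*a i)^+2 = V*(V*W-D^+2).
 rewrite (eq_bigr (fun i => V^+2*b i^+2-2*V*D*(a i*b i)+D^+2*a i^+2)).
  by rewrite big_split sumrB/= -!mulr_sumr -/V -/W -/D; ring.
 by move=> i _; ring.
by rewrite pmulr_rge0// subr_ge0.
Qed.

End finite_cauchy_schwarz.

Section taylor.
Variable R : realType.

Lemma taylor1_norm (f df : R -> R) (L : R) : (forall x, der f x (df x)) ->
 bdd df L -> forall a b, `|f b-f a| <= L * `|b-a|.
move=> hf hL.
have H a b : a <= b -> `|f b-f a| <= L * `|b-a|.
 by move=> ab; have [c _ ->] := mvt ab (fun x _ => hf x); rewrite normrM ler_wpM2r.
move=> a b; have [ab|/ltW ab] := leP a b; first exact: H.
by rewrite distrC (distrC b); exact: H.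
Qed.

Lemma taylor2_norm (f df ddf : R -> R) (L : R) : (forall x, der f x (df x)) ->
 (forall x, der df x (ddf x)) -> bdd ddf L ->
 forall a b, `|f b-f a-df a*(b-a)| <= L*(b-a)^+2.
move=> hf hdf hL a b.
have L0 : 0 <= L by exact: le_trans (normr_ge0 _) (hL 0).
pose g t := f t-df a * t.
have hg x : der g x (df x-df a).
 apply: der_eq; first by apply: der_sub; [exact: hf|apply: der_scale; exact: der_id].
 by ring.
have E : f b-f a-df a*(b-a) = g b-g a by rewrite /g; ring.
have H c : (a <= c <= b) || (b <= c <= a) -> `|df c-df a| <= L * `|b-a|.
 move=> cab; apply: le_trans (taylor1_norm hdf hL a c) _; apply: ler_wpM2l => //.
 case/orP : cab => /andP[h1 h2].
  by rewrite !ger0_norm ?subr_ge0 ?(le_trans h1)// lerB.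
 by rewrite !ler0_norm ?subr_le0 ?(le_trans h1)// lerN2 lerB.
rewrite E -(sqr_normr (b-a)) expr2 mulrA.
have [ab|/ltW ab] := leP a b.
 have [c hc ->] := mvt ab (fun x _ => hg x).
 by rewrite normrM ler_wpM2r// H// hc.
rewrite distrC (distrC b); have [c hc ->] := mvt ab (fun x _ => hg x).
by rewrite normrM ler_wpM2r// (distrC a) H// hc orbT.
Qed.

End taylor.

Section C11_calculus.
Variables (R : realType) (n d : nat) (U : 'I_d -> 'I_n -> R).
Notation tp := (n.-tuple R).
Implicit Types (f g : tp -> R) (xi : 'I_d -> tp -> R) (K : R) (y h : tp).

Lemma dot_CS (u : 'I_n -> R) h : dot u h^+2 <= (\sum_i u i^+2)*nsq h.
exact: sum_CS. Qed.

Lemma C11_ge0 f xi K : C11 U f xi K -> 0 <= K.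
by move=> [_ _ /(_ [tuple 0 | i < n])+_ _]; exact: le_trans. Qed.

Lemma C11_le f xi K K' : K <= K' -> C11 U f xi K -> C11 U f xi K'.
move=> KK [mf mx fK xK r]; split => //.
- by move=> x; exact: le_trans (fK x) KK.
- by move=> l x; exact: le_trans (xK l x) KK.
- by move=> y h; apply: le_trans (r y h) _; rewrite ler_wpM2r// nsq_ge0.
Qed.

(** For |h| <= 1 this comes from the expansion, for |h| > 1 from the bound on f. *)
Lemma C11_diff_sq f xi K : C11 U f xi K ->
 exists2 A : R, 0 <= A & forall y h, (f (vlin 1 y 1 h)-f y)^+2 <= A*nsq h.
move=> C; have K0 := C11_ge0 C; have [mf mx fK xK r] := C.
pose V := \sum_l \sum_i U l i^+2.
pose A1 := d%:R*K^+2*V.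
exists (2*A1+4*K^+2) => //.
move=> y h; set D := f _-_; pose S := \sum_l xi l y * dot (U l) h.
have N0 := nsq_ge0 h.
have S2 : S^+2 <= A1*nsq h.
 apply: le_trans (sum_CS _ _) _; rewrite /A1 -mulrA; apply: ler_pM => //.
  rewrite mulr_natl -[X in _ *+ X](card_ord d) -sumr_const; apply: ler_sum => l _.
  by rewrite -(sqr_normr (xi l y)) lerXn2r.
 by rewrite /V mulr_suml; apply: ler_sum => l _; exact: dot_CS.
have DS : `|D-S| <= K*nsq h by exact: r.
have D1 : `|D| <= 2*K by apply: ler_normB_via; have := fK (vlin 1 y 1 h); have := fK y; lra.
have [N1|N1] := leP (nsq h) 1.
 have h1 : (D-S)^+2 <= K^+2*nsq h.
  rewrite -(sqr_normr (D-S)).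
  apply: (le_via ((K*nsq h)^+2)).
   exact: lerXn2r.
  by rewrite exprMn ler_wpM2l ?sqr_ge0// expr2 ler_piMl.
 have := sqr_ge0 (D-S-S); have -> : D^+2 = (D-S)^+2+S^+2+2*((D-S)*S) by ring.
 have := mulr_ge0 (sqr_ge0 K) N0; lra.
have h2 : D^+2 <= 4*K^+2.
 rewrite -(sqr_normr D) (_ : 4*K^+2 = (2*K)^+2); last by ring.
 exact: lerXn2r.
apply: le_trans h2 _; rewrite -[leLHS]mulr1; apply: ler_pM; [by nneg|by []| |exact: ltW].
by rewrite lerDr.
Qed.

Definition gsm f := exists xi K, C11 U f xi K.

Lemma gsm_cst (c : R) : gsm (fun=> c).
exists (fun _ _ => 0), `|c|; split => //.
- by move=> l x; rewrite normr0.
- move=> y h; rewrite subrr big1 ?subr0 ?normr0 => //.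
 by move=> l _; rewrite mul0r.
Qed.

Lemma gsm_add f g : gsm f -> gsm g -> gsm (fun x => f x+g x).
move=> [xi [K [mf mx fK xK r]]] [xi' [K' [mf' mx' fK' xK' r']]].
exists (fun l x => xi l x+xi' l x), (K+K'); split.
- by [].
- by [].
- by move=> x; apply: ler_normD_via; exact: lerD.
- by move=> l x; apply: ler_normD_via; exact: lerD.
move=> y h; have -> : \sum_l (xi l y+xi' l y) * dot (U l) h =
 \sum_l xi l y * dot (U l) h+\sum_l xi' l y * dot (U l) h.
 by rewrite -big_split; apply: eq_bigr => l _; rewrite mulrDl.
rewrite [X in `|X|](_ : _ = (f (vlin 1 y 1 h)-f y-\sum_l xi l y * dot (U l) h) +
 (g (vlin 1 y 1 h)-g y-\sum_l xi' l y * dot (U l) h)); last by ring.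
by apply: ler_normD_via; rewrite mulrDl; exact: lerD.
Qed.

(** The chain rule. Since f takes values in [-K, K], only the bounds of psi on that interval enter,
    which admits unbounded psi such as squares and exponentials. *)
Lemma gsm_comp f (psi dpsi : R -> R) : gsm f ->
 msr psi -> msr dpsi ->
 (forall M, exists L : R, forall a b, `|a| <= M -> `|b| <= M ->
   [/\ `|psi a| <= L, `|dpsi a| <= L &
     `|psi b-psi a-dpsi a*(b-a)| <= L*(b-a)^+2]) ->
 gsm (fun x => psi (f x)).
move=> [xi [K C]] mpsi mdpsi H; have K0 := C11_ge0 C.
have [A A0 hA] := C11_diff_sq C.
have [mf mx fK xK r] := C; have [L hL] := H K.
have L0 : 0 <= L.
 have /hL := fK [tuple 0 | i < n].
 by move=> /(_ _ (fK [tuple 0 | i < n]))[+ _ _]; exact: le_trans.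
exists (fun l x => dpsi (f x)*xi l x), (L+L*K+L*A).
have LK0 : 0 <= L*K by [].
have LA0 : 0 <= L*A by [].
split => //.
- by move=> x; have [+ _ _] := hL _ _ (fK x) (fK x); lra.
- move=> l x; have [_ h _] := hL _ _ (fK x) (fK x).
 rewrite normrM; have : `|dpsi (f x)| * `|xi l x| <= L*K by exact: ler_pM.
 by lra.
move=> y h; have [_ hd hT] := hL _ _ (fK y) (fK (vlin 1 y 1 h)).
rewrite (eq_bigr (fun l => dpsi (f y)*(xi l y * dot (U l) h))); last by move=> l _; ring.
rewrite -mulr_sumr; set S := \sum_l _.
rewrite [X in `|X|](_ : _ = (psi (f (vlin 1 y 1 h))-psi (f y)-dpsi (f y)*(f (vlin 1 y 1 h)-f y))
 + dpsi (f y)*(f (vlin 1 y 1 h)-f y-S)); last by ring.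
apply: ler_normD_via; have N0 := nsq_ge0 h.
have h1 : L*(f (vlin 1 y 1 h)-f y)^+2 <= L*(A*nsq h) by exact: ler_wpM2l.
have h2 : `|dpsi (f y)*(f (vlin 1 y 1 h)-f y-S)| <= L*(K*nsq h) by rewrite normrM; apply: ler_pM.
have h3 : 0 <= L*nsq h by [].
by lra.
Qed.

Lemma gsm_sqr f : gsm f -> gsm (fun x => f x^+2).
move=> Gf; apply: (@gsm_comp f (fun t => t^+2) (fun t => 2 * t) Gf).
- by [].
- by [].
move=> M; exists (M^+2+2 * `|M| + 1) => a b aM bM.
have M0 := le_trans (normr_ge0 _) aM.
have h : a^+2 <= M^+2 by rewrite -(sqr_normr a) lerXn2r.
split.
- by rewrite ger0_norm ?sqr_ge0//; have := normr_ge0 M; lra.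
- by rewrite normrM (ger0_norm (ler0n _ 2)) (ger0_norm M0); have := sqr_ge0 M; lra.
- rewrite [X in `|X|](_ : _ = (b-a)^+2); last by ring.
 by rewrite ger0_norm ?sqr_ge0// ler_peMl ?sqr_ge0// lerDr.
Qed.

Lemma gsm_scale (c : R) f : gsm f -> gsm (fun x => c*f x).
move=> Gf; apply: (@gsm_comp f (fun t => c * t) (fun=> c) Gf).
- by [].
- by [].
move=> M; exists (`|c| * `|M| + `|c|) => a b aM bM; split.
- rewrite normrM; have : `|c| * `|a| <= `|c| * `|M|.
  by apply: ler_wpM2l => //; apply: le_trans aM (ler_norm _).
 by have := normr_ge0 c; lra.
- by rewrite lerDr.
- rewrite [X in `|X|](_ : _ = 0); last by ring.
 by rewrite normr0.
Qed.

(** Polarisation: f g = ((f+g)^2 - (f-g)^2)/4. *)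
Lemma gsm_mul f g : gsm f -> gsm g -> gsm (fun x => f x * g x).
move=> Gf Gg.
have H1 := gsm_sqr (gsm_add Gf Gg); have H2 := gsm_sqr (gsm_add Gf (gsm_scale (-1) Gg)).
have H := gsm_add (gsm_scale (4^-1) H1) (gsm_scale (- 4^-1) H2).
rewrite (_ : (fun x => f x * g x) = (fun x => 4^-1*(f x+g x)^+2 + - 4^-1*(f x + -1 * g x)^+2))//.
by apply/funext => x; field.
Qed.

Lemma gsm_sum m (f : 'I_m -> tp -> R) : (forall j, gsm (f j)) -> gsm (fun x => \sum_j f j x).
move=> Gf.
have H (s : seq 'I_m) : gsm (fun x => \sum_(j <- s) f j x).
 elim: s => [|j s IH].
  rewrite (_ : (fun x => _) = fun=> 0); first exact: gsm_cst.
  by apply/funext => x; rewrite big_nil.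
 rewrite (_ : (fun x => _) = fun x => f j x+\sum_(j <- s) f j x); first exact: gsm_add.
 by apply/funext => x; rewrite big_cons.
by [].
Qed.

Lemma gsm_expR f : gsm f -> gsm (fun x => expR (f x)).
move=> Gf; apply: (@gsm_comp f _ expR Gf) => // M.
exists (expR `|M| + expR (3 * `|M|)) => a b aM bM.
have e0 := expR_ge0 (3 * `|M|); have e1 := expR_ge0 `|M|.
have eM : expR a <= expR `|M| by rewrite ler_expR; apply: le_trans (ler_norm _) _; apply: le_trans aM (ler_norm _).
split.
- by rewrite ger0_norm ?expR_ge0//; lra.
- by rewrite ger0_norm ?expR_ge0//; lra.
have -> : expR b-expR a-expR a*(b-a) = expR a*(expR (b-a)-1-(b-a)) by rewrite -[in expR b](subrK a b) expRD; ring.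
rewrite normrM ger0_norm ?expR_ge0//.
set t := b-a.
have t1 : `|t| <= 2 * `|M| by apply: ler_normB_via; have := ler_norm M; lra.
have ht : `|expR t-1-t| <= t^+2*expR `|t|.
 rewrite ger0_norm; last by rewrite -addrA -opprD subr_ge0 expR_ge1Dx.
 have [t0|t0] := leP 0 t; first by rewrite ger0_norm//; have := expR_le2 t0; lra.
 have := @expRN_le2 _ (- t); rewrite opprK => /(_ _)/le_trans h.
 have : expR t <= 1 - - t+(- t)^+2/2 by apply: h; lra.
 have : t^+2*1 <= t^+2*expR `|t| by apply: ler_wpM2l; [exact: sqr_ge0|rewrite -expR0 ler_expR].
 by have := sqr_ge0 t; rewrite sqrrN; lra.
have h1 : expR a * `|expR t-1-t| <= expR `|M|*(t^+2*expR (2 * `|M|)).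
 apply: ler_pM => //; apply: le_trans ht _; apply: ler_wpM2l => //.
 by rewrite ler_expR.
apply: le_trans h1 _.
have -> : expR `|M|*(t^+2*expR (2 * `|M|)) = expR (3 * `|M|) * t^+2 by rewrite mulrCA -expRD mulrC; congr (expR _*_); ring.
by apply: ler_wpM2r; [exact: sqr_ge0|lra].
Qed.

Lemma gsm_dot (l : 'I_d) (psi dpsi : R -> R) (L : R) :
 msr psi -> msr dpsi ->
 bdd psi L -> bdd dpsi L ->
 (forall a b, `|psi b-psi a-dpsi a*(b-a)| <= L*(b-a)^+2) ->
 gsm (fun x => psi (dot (U l) x)).
move=> mpsi mdpsi h1 h2 h3.
have L0 : 0 <= L by exact: le_trans (normr_ge0 _) (h1 0).
pose V := \sum_i U l i^+2; have V0 : 0 <= V by nneg.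
exists (fun l' x => if l' == l then dpsi (dot (U l) x) else 0), (L+L*V).
have LV : 0 <= L*V by [].
split.
- by [].
- move=> l'; case: eqVneq => _; last exact: measurable_cst.
 by [].
- by move=> x; apply: le_trans (h1 _) _; lra.
- move=> l' x; case: eqVneq => _; last by rewrite normr0; lra.
 by apply: le_trans (h2 _) _; lra.
move=> y h; rewrite (bigD1 l)//= eqxx big1; last first.
 by move=> l' /negPf ->; rewrite mul0r.
rewrite addr0 dot_vlin !mul1r.
have := h3 (dot (U l) y) (dot (U l) y+dot (U l) h); rewrite (addrC (dot (U l) y)) addrK => H.
apply: le_trans H _; have : L * dot (U l) h^+2 <= L*(V*nsq h).
 by apply: ler_wpM2l => //; exact: dot_CS.
by have := mulr_ge0 L0 (nsq_ge0 h); lra.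
Qed.

End C11_calculus.

Lemma near_forall_fin (T : Type) (F : set_system T) {FF : Filter F} (I : finType)
  (P : I -> T -> Prop) :
 (forall j, \forall x \near F, P j x) -> \forall x \near F, forall j, P j x.
move=> H.
have Hs (s : seq I) : \forall x \near F, forall j, j \in s -> P j x.
 elim: s => [|i s IH]; first by apply: filterE.
 apply: filterS2 (H i) IH => x Pi Ps j; rewrite in_cons => /orP[/eqP->//|].
 exact: Ps.
by apply: filterS (Hs (index_enum I)) => x h j; apply: h.
Qed.

(** * Exponential moments of sums of block functions *)

Section block_functions.
Variables (R : realType) (n d : nat).
Notation tp := (n.-tuple R).

(** Bounded almost sure limits of smooth functions of the block. Indicators of sign changes are not
    smooth but are of this kind, as limits of sigmoids. *)
Definition blockfn (U : 'I_d -> 'I_n -> R) (f : tp -> R) :=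
 [/\ msr f, bdd f 1 &
 exists g : nat -> tp -> R, [/\ (forall k, gsm U (g k)), (forall k x, `|g k x| <= 1) &
  {ae gauss n, forall x, g k x @[k --> \oo] --> f x}]].

Lemma gsm_meas (U : 'I_d -> 'I_n -> R) f : gsm U f -> msr f.
by case=> xi [K []]. Qed.

Variables (m : nat) (U : 'I_m -> 'I_d -> 'I_n -> R) (p : R).
Hypothesis p0 : 0 < p.
Hypothesis frame : forall a : 'I_m -> 'I_d -> R,
 \sum_i (\sum_j \sum_l a j l*U j l i)^+2 <=
 p*\sum_j \sum_i (\sum_l a j l*U j l i)^+2.

Lemma hoelder_exp_gsm (t : R) (g : 'I_m -> tp -> R) :
 (forall j, gsm (U j) (g j)) -> (forall j x, `|g j x| <= 1) ->
 EG n (fun x => expR (\sum_j t * g j x)) <=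
 expR (\sum_j ln (EG n (fun x => expR (p*(t * g j x))))/p).
move=> gs g1.
pose G j x := expR (p*(t * g j x)).
have gG j : gsm (U j) (G j) by apply: gsm_expR; apply: gsm_scale; exact: gsm_scale.
have /choice[xi /choice[K HK]] := gG.
pose c := expR (- (p * `|t|)).
have cG j x : c <= G j x.
 rewrite ler_expR -mulrN ler_pM2l//.
 have h : `|t * g j x| <= `|t| by rewrite normrM ler_piMr.
 by move: h; rewrite ler_norml => /andP[].
pose K0 := \sum_j `|K j| + c.
have cK : c <= K0 by rewrite /K0 lerDr.
have c0 : 0 < c by [].
have cls : hoelder_class U c K0 G.
 exists xi => j; split => //.
 apply: C11_le (HK j); apply: le_trans (ler_norm _) _.
 rewrite /K0 (bigD1 j)//= -addrA lerDl; apply: addr_ge0; last exact: ltW.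
 by [].
have := generalized_hoelder p0 c0 cK frame cls.
rewrite (_ : hprod p G = fun x => expR (\sum_j t * g j x))//.
apply/funext => x; rewrite /hprod; congr expR; apply: eq_bigr => j _.
by rewrite expRK; field.
Qed.

(** The smooth case, where the Hoelder factors are exp(p t g_j), passes to the limit on both sides
    by dominated convergence. *)
Lemma hoelder_exp (t : R) (f : 'I_m -> tp -> R) : (forall j, blockfn (U j) (f j)) ->
 EG n (fun x => expR (\sum_j t*f j x)) <=
 expR (\sum_j ln (EG n (fun x => expR (p*(t*f j x))))/p).
move=> bf.
have /choice[g Hg] : forall j, exists g : nat -> tp -> R,
  [/\ (forall k, gsm (U j) (g k)), (forall k x, `|g k x| <= 1) &
  {ae gauss n, forall x, g k x @[k --> \oo] --> f j x}] by move=> j; case: (bf j).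
have mg j k : msr (g j k) by case: (Hg j) => /(_ k)/gsm_meas.
have g1 j k x : `|g j k x| <= 1 by case: (Hg j).
have mf j : msr (f j) by case: (bf j).
have f1 j x : `|f j x| <= 1 by case: (bf j).
have H k : EG n (fun x => expR (\sum_j t * g j k x)) <=
 expR (\sum_j ln (EG n (fun x => expR (p*(t * g j k x))))/p) by apply: hoelder_exp_gsm => [j|j x//]; case: (Hg j).
have bnd (a b : R) : `|b| <= 1 -> `|expR (a*b)| <= expR `|a|.
 move=> b1; rewrite ger0_norm ?expR_ge0// ler_expR; apply: le_trans (ler_norm _) _.
 by rewrite normrM ler_piMr.
have cvs x : (forall j, g j k x @[k --> \oo] --> f j x) ->
  expR (\sum_j t * g j k x) @[k --> \oo] --> expR (\sum_j t*f j x).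
 move=> h; apply: continuous_cvg; first exact: continuous_expR.
 apply: cvg_big => [|j _]; first exact: add_continuous.
 by apply: cvgM; [exact: cvg_cst|exact: h].
have cv1 : EG n (fun x => expR (\sum_j t * g j k x)) @[k --> \oo] -->
  EG n (fun x => expR (\sum_j t*f j x)).
 have aeall : {ae gauss n, forall x, forall j, g j k x @[k --> \oo] --> f j x} by apply: near_forall_fin => j; case: (Hg j).
 apply: (@Ex_cvg _ _ _ _ _ _ (expR (m%:R * `|t|))).
 - by move=> k; apply: measurableT_comp => //; apply: measurable_sum => j; apply: measurable_funM.
 - by [].
 - move=> k x; rewrite ger0_norm ?expR_ge0// ler_expR; apply: le_trans (ler_norm _) _.
  apply: le_trans (ler_norm_sum _ _ _) _.
  rewrite mulr_natl -[X in _ *+ X](card_ord m) -sumr_const; apply: ler_sum => j _.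
  by rewrite normrM ler_piMr.
 - exact: filterS aeall => x.
have cv2 j : EG n (fun x => expR (p*(t * g j k x))) @[k --> \oo] -->
  EG n (fun x => expR (p*(t*f j x))).
 apply: (@Ex_cvg _ _ _ _ _ _ (expR `|p * t|)).
 - by move=> k; apply: measurableT_comp => //; do 2 apply: measurable_funM => //.
 - by [].
 - by move=> k x; rewrite mulrA; exact: bnd.
 - case: (Hg j) => _ _; apply: filterS => x h.
  apply: continuous_cvg; first exact: continuous_expR.
  by apply: cvgM; [exact: cvg_cst|apply: cvgM => //; exact: cvg_cst].
have pos j : 0 < EG n (fun x => expR (p*(t*f j x))).
 apply: (@lt_le_trans _ _ (expR (- `|p * t|))) => //.
 rewrite -[leLHS](Ex_cst (gauss n)); apply: Ex_le; first exact: intg_cst.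
  apply: (intg_bnd (expR `|p * t|)).
   by [].
  by move=> x; rewrite mulrA; exact: bnd.
 move=> x; rewrite ler_expR mulrA.
 have h : `|p * t*f j x| <= `|p * t| by rewrite normrM ler_piMr.
 by move: h; rewrite ler_norml => /andP[].
apply: ler_cvg_to cv1 _ _; last by near=> k; exact: H.
apply: continuous_cvg; first exact: continuous_expR.
apply: cvg_big => [|j _]; first exact: add_continuous.
apply: cvgM; last exact: cvg_cst.
by apply: continuous_cvg (cv2 j); exact: continuous_ln.
Unshelve. all: by end_near.
Qed.

End block_functions.

(** * Moment generating function and variance of sums over several classes *)

Section mgf.
Variables (R : realType) (n d m Q : nat) (U : 'I_Q.+1 -> 'I_m -> 'I_d -> 'I_n -> R) (p v : R).
Notation tp := (n.-tuple R).
Hypothesis p0 : 0 < p.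
Hypothesis frame : forall q (a : 'I_m -> 'I_d -> R),
 \sum_i (\sum_j \sum_l a j l*U q j l i)^+2 <=
 p*\sum_j \sum_i (\sum_l a j l*U q j l i)^+2.
Variable f : 'I_Q.+1 -> 'I_m -> tp -> R.
Hypothesis bf : forall q j, blockfn (U q j) (f q j).
Hypothesis fv : forall q j, EG n (fun x => f q j x^+2) <= v.

Let mf q j : msr (f q j). by case: (bf q j). Qed.
Let f1 q j x : `|f q j x| <= 1. by case: (bf q j). Qed.
Let If q j : IG n (f q j).
exact: (intg_bounded _ (mf q j) (f1 q j)). Qed.

Definition cnt x : R := \sum_q \sum_j (f q j x-EG n (f q j)).

Lemma expR_le_quad (x : R) : `|x| <= 1 -> expR x <= 1+x+x^+2.
move=> x1; have [x0|x0] := leP 0 x.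
 (* For 0 <= x <= 1: exp(-x) lies above its cubic Taylor polynomial, and the product of that
    polynomial with 1 + x + x^2 is at least 1. *)
 have h : expR x*(1-x+x^+2/2-x^+3/6) <= 1.
  rewrite -[X in _ <= X](expRxMexpNx_1 x) ler_pM2l ?expR_gt0//.
  pose k (t : R) := expR (- t)-(1-t+t^+2/2-t^+3/6).
  have dk t : der k t (- expR (- t)-(- 1+t-t^+2/2)).
   apply: der_eq.
    apply: der_sub; first by apply: der_expR; apply: der_opp; exact: der_id.
    apply: der_sub; last first.
     by rewrite (_ : (fun t : R => t^+3/6) = (fun t => 6^-1 * t^+3)); [apply: der_scale; apply: der_exp; exact: der_id|apply/funext => s; rewrite mulrC].
    apply: der_add; last first.
     by rewrite (_ : (fun t : R => t^+2/2) = (fun t => 2^-1 * t^+2)); [apply: der_scale; apply: der_exp; exact: der_id|apply/funext => s; rewrite mulrC].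
    by apply: der_sub; [exact: der_cst|exact: der_id].
   by rewrite /=; field.
  have := @der_nondecr _ k _ 0 x x0 (fun t _ => dk t).
  rewrite /k oppr0 expR0 => H; suff : 1-(1+0+0^+2/2-0^+3/6) <= k x.
   by rewrite /k expr0n expr0n/=; lra.
  apply: H => t /andP[t0 _]; have := @expRN_le2 _ t t0; lra.
 have P : 0 < 1-x+x^+2/2-x^+3/6.
  have x1' : x <= 1 by move: x1; rewrite ger0_norm.
  have : x^+3 <= x^+2 by rewrite exprS ler_piMl// sqr_ge0.
  have : 0 <= (1-x)^+2 by [].
  have := sqr_ge0 x; nra.
 rewrite -(ler_pM2r P); apply: le_trans h _.
 have x1' : x <= 1 by move: x1; rewrite ger0_norm.
 have -> : (1+x+x^+2)*(1-x+x^+2/2-x^+3/6) =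
  1+x^+2*(2^-1-(2/3)*x+x^+2/3-x^+3/6) by field.
 rewrite lerDl mulr_ge0 ?sqr_ge0//.
 have : x^+3 <= x^+2 by rewrite exprS ler_piMl// sqr_ge0.
 by nra.
have := @expRN_le2 _ (- x); rewrite opprK sqrrN => /(_ _)/le_trans h.
have : expR x <= 1 - - x+x^+2/2 by apply: h; lra.
by have := sqr_ge0 x; lra.
Qed.

(** Within a class the generalised Hoelder inequality reduces the moment generating function to
    those of single summands at the parameter p t, each controlled by e^x <= 1 + x + x^2. *)
Lemma mgf_class q (t : R) : `|p * t| <= 2^-1 ->
 EG n (fun x => expR (t*\sum_j (f q j x-EG n (f q j)))) <=
 expR (m%:R*(p * t^+2*v)).
move=> pt.
pose e j := EG n (f q j).
have e1 j : `|e j| <= 1 by exact: Ex_bound.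
have bndE x : `|expR (\sum_j t*f q j x)| <= expR (m%:R * `|t|).
 rewrite ger0_norm ?expR_ge0// ler_expR; apply: le_trans (ler_norm _) _.
 apply: le_trans (ler_norm_sum _ _ _) _.
 rewrite mulr_natl -[X in _ *+ X](card_ord m) -sumr_const; apply: ler_sum => j _.
 by rewrite normrM ler_piMr.
have IE : IG n (fun x => expR (\sum_j t*f q j x)).
 apply: (intg_bounded _ _ bndE); apply: measurableT_comp => //; apply: measurable_sum => j.
 exact: measurable_funM.
have -> : EG n (fun x => expR (t*\sum_j (f q j x-EG n (f q j)))) =
 expR (- \sum_j t*e j)*EG n (fun x => expR (\sum_j t*f q j x)).
 rewrite -ExZ//; apply: Ex_eq => x; rewrite -expRD; congr expR.
 by rewrite -!mulr_sumr sumrB; ring.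
apply: (le_via (expR (- \sum_j t*e j) *
 expR (\sum_j ln (EG n (fun x => expR (p*(t*f q j x))))/p))).
 apply: ler_wpM2l => //.
 exact: (hoelder_exp p0 (frame q)) => j.
rewrite -expRD ler_expR -sumrN -big_split/=.
rewrite [leRHS]mulr_natl -[X in _ *+ X](card_ord m) -sumr_const; apply: ler_sum => j _.
pose Y x := p * t*(f q j x-e j).
have Yb x : `|Y x| <= 1.
 rewrite normrM; apply: (le_via (2^-1*2)); last by lra.
 apply: ler_pM => //; apply: ler_normB_via.
 by have := f1 q j x; have := e1 j; lra.
have mY : msr Y by apply: measurable_funM; [exact: measurable_cst|apply: measurable_funB; [exact: mf|exact: measurable_cst]].
have If2 : IG n (fun x => f q j x^+2).
 apply: (intg_bnd 1); first exact: measurable_funX.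
 by move=> x; rewrite normrX exprn_ile1.
have IY : IG n Y by apply: (intg_bounded _ mY Yb).
have IY2 : IG n (fun x => Y x^+2).
 apply: (intg_bnd 1) => //.
 by move=> x; rewrite normrX exprn_ile1.
have EY : EG n Y = 0.
 rewrite /Y ExZ; last by apply: intgB => //; exact: intg_cst.
 by rewrite ExB ?Ex_cst ?subrr ?mulr0//; exact: intg_cst.
have EY2 : EG n (fun x => Y x^+2) <= (p * t)^+2*v.
 have -> : EG n (fun x => Y x^+2) =
  (p * t)^+2*(EG n (fun x => f q j x^+2)-e j^+2).
  transitivity (EG n (fun x => (p * t)^+2*(f q j x^+2-2*e j*f q j x+e j^+2))).
   by apply: Ex_eq => x; rewrite /Y; ring.
  rewrite ExZ; last by apply: intgD; [apply: intgB => //; exact: intgZ|exact: intg_cst].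
  rewrite ExD; [|by apply: intgB => //; exact: intgZ|exact: intg_cst].
  by rewrite ExB//; [rewrite ExZ// Ex_cst -/(e j); ring|exact: intgZ].
 apply: ler_wpM2l => //.
 by have := sqr_ge0 (e j); have := fv q j; lra.
have IeY : IG n (fun x => expR (Y x)).
 apply: (intg_bnd (expR 1)) => //.
 move=> x; rewrite ger0_norm ?expR_ge0// ler_expR.
 exact: le_trans (ler_norm _) (Yb x).
have M : EG n (fun x => expR (Y x)) <= expR ((p * t)^+2*v).
 apply: le_trans (expR_ge1Dx _).
 have I1 : IG n (fun x => 1+Y x) by apply: intgD => //; exact: intg_cst.
 apply: le_trans (Ex_le IeY (intgD I1 IY2) (fun x => expR_le_quad (Yb x))) _.
 rewrite ExD// ExD ?Ex_cst ?EY ?addr0//; [by rewrite lerD2l|exact: intg_cst].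
have EE : EG n (fun x => expR (p*(t*f q j x))) =
  expR (p * t*e j)*EG n (fun x => expR (Y x)).
 rewrite -ExZ//; apply: Ex_eq => x; rewrite -expRD; congr expR.
 by rewrite /Y; ring.
have EYp : 0 < EG n (fun x => expR (Y x)).
 apply: (@lt_le_trans _ _ 1) => //; rewrite -[leLHS](Ex_cst (gauss n)).
 have := @Ex_le _ _ _ (gauss n) (fun x => 1+Y x) (fun x => expR (Y x)).
 move=> /(_ (intgD (intg_cst _ _) IY) IeY (fun x => expR_ge1Dx _)).
 by rewrite ExD ?EY ?addr0//; exact: intg_cst.
rewrite EE lnM ?expR_gt0// expRK mulrDl.
have : ln (EG n (fun x => expR (Y x)))/p <= (p * t)^+2*v/p by apply: ler_wpM2r => //; rewrite -[leRHS]expRK ler_ln ?posrE// expR_gt0.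
have -> : p * t*e j/p = t*e j by field.
have -> : (p * t)^+2*v/p = p * t^+2*v by field.
by lra.
Qed.

Lemma expR_convex_mean (a : 'I_Q.+1 -> R) :
 expR ((\sum_q a q)/Q.+1%:R) <= (\sum_q expR (a q))/Q.+1%:R.
set A := (\sum_q a q)/_.
have h q : expR A*(1+(a q-A)) <= expR (a q).
 apply: le_trans (_ : _ <= expR A*expR (a q-A)) _.
  by apply: ler_wpM2l; [exact: expR_ge0|exact: expR_ge1Dx].
 by rewrite -expRD addrC subrK.
rewrite ler_pdivlMr//; have : \sum_q expR A*(1+(a q-A)) <= \sum_q expR (a q).
 exact: ler_sum => q _.
rewrite -mulr_sumr big_split sumrB/= !sumr_const card_ord.
have -> : \sum_q a q = A *+ Q.+1 by rewrite -mulr_natr /A divfK.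
by rewrite subrr addr0.
Qed.

Lemma cnt_meas : msr cnt.
by apply: measurable_sum => q; apply: measurable_sum => j; apply: measurable_funB.
Qed.

Lemma cnt_bound x : `|cnt x| <= (Q.+1 * m)%:R*2.
apply: le_trans (ler_norm_sum _ _ _) _.
rewrite natrM -mulrA mulr_natl -[X in _ *+ X](card_ord Q.+1) -sumr_const; apply: ler_sum => q _.
apply: le_trans (ler_norm_sum _ _ _) _.
rewrite mulr_natl -[X in _ *+ X](card_ord m) -sumr_const; apply: ler_sum => j _.
apply: ler_normB_via.
have : `|EG n (f q j)| <= 1 by exact: Ex_bound.
by have := f1 q j x; lra.
Qed.

Lemma intg_exp_cnt (lam : R) : IG n (fun x => expR (lam*cnt x)).
apply: (intg_bnd (expR (`|lam|*((Q.+1 * m)%:R*2)))).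
 by apply: measurableT_comp => //; apply: measurable_funM => //; exact: cnt_meas.
move=> x; rewrite ger0_norm ?expR_ge0// ler_expR; apply: le_trans (ler_norm _) _.
by rewrite normrM ler_wpM2l// cnt_bound.
Qed.

(** No independence between classes is available, so they are separated by convexity alone: the
    exponential of a mean is at most the mean of the exponentials. The parameter is multiplied by
    the number of classes, which appears squared in the exponent. *)
Lemma mgf_count (lam : R) : p*(Q.+1%:R * `|lam|) <= 2^-1 ->
 EG n (fun x => expR (lam*cnt x)) <=
 expR (m%:R * p*Q.+1%:R^+2*v * lam^+2).
move=> hl; set C := _ * lam^+2.
have Q0 : 0 < Q.+1%:R :> R by [].
pose t := Q.+1%:R * lam.
pose Y q x := expR (t*\sum_j (f q j x-EG n (f q j))).
have IY q : IG n (Y q).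
 apply: (intg_bnd (expR (`|t|*(m%:R*2)))).
  apply: measurableT_comp => //; apply: measurable_funM => //; apply: measurable_sum => j.
  exact: measurable_funB.
 move=> x; rewrite ger0_norm ?expR_ge0// ler_expR; apply: le_trans (ler_norm _) _.
 rewrite normrM ler_wpM2l//; apply: le_trans (ler_norm_sum _ _ _) _.
 rewrite mulr_natl -[X in _ *+ X](card_ord m) -sumr_const; apply: ler_sum => j _.
 apply: ler_normB_via.
 have : `|EG n (f q j)| <= 1 by exact: Ex_bound.
 by have := f1 q j x; lra.
apply: (le_via (EG n (fun x => Q.+1%:R^-1*\sum_q Y q x))).
 apply: Ex_le; [exact: intg_exp_cnt|by apply: intgZ; apply: intg_sum => q _|].
 move=> x; rewrite [leRHS]mulrC; apply: le_trans (expR_convex_mean _).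
 rewrite ler_expR -mulr_sumr -/(cnt x) /t; apply: eq_ler.
 by field.
rewrite ExZ; last by apply: intg_sum => q _.
rewrite Ex_sum// ler_pdivrMl//.
rewrite [leRHS]mulr_natl -[X in _ *+ X](card_ord Q.+1) -sumr_const; apply: ler_sum => q _.
apply: le_trans (mgf_class q _) _.
 by rewrite normrM (gtr0_norm p0) /t normrM (gtr0_norm Q0).
by rewrite ler_expR /C /t; apply: eq_ler; ring.
Qed.

(** Comparison of the moment generating function at lam and -lam with 2 + y^2 <= e^y + e^(-y): the
    upper bound is at most 2 + 4 C lam^2 as soon as C lam^2 <= 1. *)
Lemma var_count : EG n (fun x => cnt x^+2) <= 4*(m%:R * p*Q.+1%:R^+2*v).
set C := m%:R * p*Q.+1%:R^+2*v.
(* v bounds a second moment, hence is nonnegative, unless there is no summand. *)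
have v0 : 0 <= v \/ m%:R = 0 :> R.
 have [m0|m0] := posnP m; first by right; rewrite m0.
 by left; apply: le_trans (fv ord0 (Ordinal m0)).
have C0 : 0 <= C.
 by case: v0 => [v0|m0]; [rewrite /C; nneg|rewrite /C m0 !mul0r].
(* lam = 1/D is small enough both for [mgf_count] and for C lam^2 <= 1. *)
pose D := 2*(p*Q.+1%:R)+C+1.
have pQ : 0 < p*Q.+1%:R by [].
have D0 : 0 < D by rewrite /D; lra.
pose lam := D^-1.
have lD : lam*D = 1 by rewrite /lam mulVf// gt_eqF.
have hl : p*(Q.+1%:R * `|lam|) <= 2^-1.
 rewrite gtr0_norm// mulrA; have : 0 <= (C+1) * lam by apply: mulr_ge0.
 by move: lD; rewrite /D; lra.
have hl' : p*(Q.+1%:R * `|- lam|) <= 2^-1 by rewrite normrN.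
have Cl : C * lam^+2 <= 1.
 have h1 : C * lam <= 1.
  have : 0 <= (2*(p*Q.+1%:R)+1) * lam by [].
  by move: lD; rewrite /D; lra.
 have h2 : lam <= 1.
  have : 0 <= (2*(p*Q.+1%:R)+C) * lam by [].
  by move: lD; rewrite /D; lra.
 by rewrite expr2 mulrA; apply: mulr_ile1.
have M1 := mgf_count hl; have M2 := mgf_count hl'.
rewrite sqrrN in M2; rewrite -/C in M1 M2.
have I2 : IG n (fun x => cnt x^+2).
 apply: (intg_bnd (((Q.+1 * m)%:R*2)^+2)).
  by apply: measurable_funX; exact: cnt_meas.
 by move=> x; rewrite normrX lerXn2r ?cnt_bound//.
have ch (y : R) : 2+y^+2 <= expR y+expR (- y).
 wlog y0 : y/0 <= y.
  move=> H; have [y0|/ltW y0] := leP 0 y; first exact: H.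
  by have := H (- y); rewrite oppr_ge0 => /(_ y0); rewrite sqrrN opprK; lra.
 pose k (t : R) := expR t+expR (- t)-t^+2.
 have dk t : der k t (expR t-expR (- t)-2 * t).
  apply: der_eq.
   apply: der_sub; last by apply: der_exp; exact: der_id.
   by apply: der_add; [apply: der_expR; exact: der_id|apply: der_expR; apply: der_opp; exact: der_id].
  by rewrite /=; ring.
 have := @der_nondecr _ k _ 0 y y0 (fun t _ => dk t).
 rewrite /k oppr0 expR0 expr0n/= => H.
 suff : 1+1-0 <= expR y+expR (- y)-y^+2 by lra.
 by apply: H => t /andP[t0 _]; have := expR_ge2 t0; have := @expRN_le2 _ t t0; lra.
have M3 : 2+lam^+2*EG n (fun x => cnt x^+2) <= 2*expR (C * lam^+2).
 have I3 : IG n (fun x => lam^+2*cnt x^+2) by exact: intgZ.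
 rewrite -(ExZ _ I2) -{1}(Ex_cst (gauss n) 2) -ExD//; last exact: intg_cst.
 apply: (le_via (EG n (fun x => expR (lam*cnt x)+expR (- lam*cnt x)))).
  apply: Ex_le; first by apply: intgD => //; exact: intg_cst.
   by apply: intgD; exact: intg_exp_cnt.
  by move=> x; rewrite -exprMn mulNr; exact: ch.
 by rewrite ExD; [lra|exact: intg_exp_cnt|exact: intg_exp_cnt].
have := @expR_le_quad (C * lam^+2); rewrite ger0_norm// => /(_ Cl) E1.
have E2 : (C * lam^+2)^+2 <= C * lam^+2 by rewrite expr2 ler_piMl.
have : lam^+2*EG n (fun x => cnt x^+2) <= lam^+2*(4*C) by lra.
by rewrite ler_pM2l.
Qed.

End mgf.

(** * Trigonometric vectors: covariance, orthogonality, Plancherel *)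

Section trig_vectors.
Variable R : realType.

Lemma sum_split2 n (F : 'I_(n+n) -> R) :
 \sum_i F i = \sum_k (F (lshift n k)+F (rshift n k)).
by rewrite big_split_ord big_split. Qed.

(** The vector whose scalar product with (a_0, ..., a_{n-1}, b_0, ..., b_{n-1}) is sum_k w_k (a_k
    cos kt + b_k sin kt). *)
Definition trig n (w : 'I_n -> R) (t : R) (i : 'I_(n+n)) : R :=
 match fintype.split i with
 | inl k => w k*cos (k%:R * t)
 | inr k => w k*sin (k%:R * t)
 end.

Lemma trig_lshift n (w : 'I_n -> R) t k : trig w t (lshift n k) = w k*cos (k%:R * t).
by rewrite /trig (unsplitK (inl k)). Qed.

Lemma trig_rshift n (w : 'I_n -> R) t k : trig w t (rshift n k) = w k*sin (k%:R * t).
by rewrite /trig (unsplitK (inr k)). Qed.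

Definition covf n (w : 'I_n -> R) (t : R) : R := \sum_k w k^+2*cos (k%:R * t).

Lemma trig_inner n (w : 'I_n -> R) t s :
 \sum_i trig w t i * trig w s i = covf w (t-s).
rewrite sum_split2; apply: eq_bigr => k _.
by rewrite !trig_lshift !trig_rshift mulrBr cosB; ring.
Qed.

Lemma trig_nsq n (w : 'I_n -> R) t : \sum_i trig w t i^+2 = covf w 0.
by have := trig_inner w t t; rewrite subrr => <-; apply: eq_bigr => i _; rewrite expr2. Qed.

Lemma covf0 n (w : 'I_n -> R) : covf w 0 = \sum_k w k^+2.
by apply: eq_bigr => k _; rewrite mulr0 cos0 mulr1. Qed.

Lemma covfN n (w : 'I_n -> R) t : covf w (- t) = covf w t.
by apply: eq_bigr => k _; rewrite mulrN cosN. Qed.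

Lemma dirichlet_sum n (th : R) :
 2*sin (th/2)*(\sum_(k < n) cos (k%:R * th)) = sin (n%:R * th-th/2)+sin (th/2).
elim: n => [|n IH]; first by rewrite big_ord0 mulr0 mul0r sub0r sinN addNr.
rewrite big_ord_recr/= mulrDr IH.
have -> : n.+1%:R * th-th/2 = n%:R * th+th/2 by rewrite -natr1; field.
by rewrite sinB sinD; ring.
Qed.

Lemma sum_cos_root n l : (0 < l < n)%N ->
 \sum_(k < n) cos (k%:R*((pi : R) *+ 2*(l%:R/n%:R))) = 0.
move=> /andP[l0 ln]; set th := _*(l%:R/_).
have n0' : (0 < n)%N by exact: leq_trans ln.
have n0 : 0 < n%:R :> R by rewrite ltr0n.
have th2 : th/2 = pi*(l%:R/n%:R) by rewrite /th -mulr_natl; field.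
have s0 : 0 < sin (th/2).
 rewrite th2; apply: sin_gt0_pi; rewrite mulr_gt0 ?divr_gt0 ?ltr0n//=.
 by rewrite -[ltRHS]mulr1 ltr_pM2l ?pi_gt0// ltr_pdivrMr// mul1r ltr_nat.
have nth : n%:R * th = (pi *+ 2) *+ l by rewrite -mulr_natr /th; field.
have E : sin ((pi *+ 2) *+ l-th/2) = - sin (th/2) by rewrite addrC (periodicn (@sinD2pi R)) sinN.
have := dirichlet_sum n th; rewrite nth E addNr => /eqP.
rewrite mulf_eq0 => /orP[|/eqP//]; rewrite mulf_eq0 pnatr_eq0/= => /eqP s00.
by rewrite s00 ltxx in s0.
Qed.

Definition wunit n : 'I_n -> R := fun=> (Num.sqrt n%:R)^-1.

Definition mesh n (t0 : R) (j : 'I_n) : R := t0+pi *+ 2*(j%:R/n%:R).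

Lemma wunit_sq n k : (0 < n)%N -> @wunit n k^+2 = n%:R^-1.
by move=> n0; rewrite /wunit exprVn sqr_sqrtr. Qed.

(** The covariance is a Dirichlet sum, which vanishes at 2 pi l/n for 0 < l < n: the unit vectors
    along a mesh of step 2 pi/n are orthonormal. *)
Lemma mesh_orth n t0 (i j : 'I_n) : (0 < n)%N ->
 covf (@wunit n) (mesh t0 i-mesh t0 j) = (i == j)%:R.
move=> n0; have nR : 0 < n%:R :> R by rewrite ltr0n.
have E (t : R) : covf (@wunit n) t = n%:R^-1*\sum_(k < n) cos (k%:R * t) by rewrite mulr_sumr; apply: eq_bigr => k _; rewrite wunit_sq.
have H (a b : 'I_n) : (b < a)%N -> covf (@wunit n) (mesh t0 a-mesh t0 b) = 0.
 move=> ba; rewrite E /mesh.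
 have -> : t0+pi *+ 2*(a%:R/n%:R)-(t0+pi *+ 2*(b%:R/n%:R)) =
  pi *+ 2*((a-b)%:R/n%:R) by rewrite (natrB _ (ltnW ba)); ring.
 rewrite sum_cos_root ?mulr0// subn_gt0 ba/=.
 exact: leq_ltn_trans (leq_subr _ _) (ltn_ord a).
case: (ltngtP i j) => ij.
- by rewrite -opprB covfN H//; case: eqVneq ij => [->|]//; rewrite ltnn.
- by rewrite H//; case: eqVneq ij => [->|]//; rewrite ltnn.
- rewrite (val_inj ij) subrr eqxx E.
 rewrite (eq_bigr (fun=> 1)); last by move=> k _; rewrite mulr0 cos0.
 by rewrite sumr_const card_ord -mulr_natr mul1r mulVf// gt_eqF.
Qed.

(** Expanding the squares produces the covariances at mesh differences, and these form the identity
    matrix by [mesh_orth]. *)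
Lemma plancherel n t0 (X : 'I_n -> R) : (0 < n)%N ->
 \sum_(k < n) n%:R^-1*((\sum_j X j*cos (k%:R * mesh t0 j))^+2 +
  (\sum_j X j*sin (k%:R * mesh t0 j))^+2) = \sum_j X j^+2.
move=> n0.
rewrite (eq_bigr (fun k : 'I_n => \sum_i \sum_j X i*X j *
  (@wunit n k^+2*cos (k%:R*(mesh t0 i-mesh t0 j))))); last first.
 move=> k _; rewrite !expr2 !big_distrlr/= -big_split/= mulr_sumr.
 apply: eq_bigr => i _; rewrite -big_split/= mulr_sumr; apply: eq_bigr => j _.
 by rewrite -expr2 wunit_sq// mulrBr cosB; ring.
rewrite exchange_big/=; apply: eq_bigr => i _; rewrite exchange_big/=.
rewrite (bigD1 i)//= -mulr_sumr -/(covf (@wunit n) _) mesh_orth// eqxx mulr1 -expr2.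
rewrite big1 ?addr0// => j ji.
by rewrite -mulr_sumr -/(covf (@wunit n) _) mesh_orth// eq_sym (negPf ji) mulr0.
Qed.

Lemma one_minus_cos_bounds (x : R) : 0 <= x <= 1 ->
 11/24*x^+2 <= 1-cos x <= x^+2/2.
move=> /andP[x0 x1]; have h1 := cos_ge2 x; have h2 := cos_le4 x.
have : x^+4 <= x^+2 by rewrite (exprD x 2 2) ler_piMr ?sqr_ge0// expr2 mulr_ile1.
by move=> h3; apply/andP; split; lra.
Qed.

(** The points t1 <= 1/32 and t2 >= 1/4 are separated, so the two values of the affine function A -
    y t determine A and y stably. *)
Lemma pair_lower (A y t1 t2 : R) : 0 <= t1 <= 32^-1 -> 4^-1 <= t2 <= 2^-1 ->
 A^+2+y^+2 <= 45*((A-y * t1)^+2+(A-y * t2)^+2).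
move=> /andP[h1 h2] /andP[h3 h4]; set a := A-y * t1; set b := A-y * t2.
have hy : 49/1024*y^+2 <= (a-b)^+2.
 have -> : (a-b)^+2 = (t2-t1)^+2*y^+2 by rewrite /a /b; ring.
 apply: ler_wpM2r => //.
 rewrite (_ : 49/1024 = (7/32)^+2 :> R); last by field.
 by apply: lerXn2r; rewrite ?nnegrE; lra.
have hab : (a-b)^+2 <= 2*(a^+2+b^+2) by have := sqr_ge0 (a+b); lra.
have hA : A^+2 <= 2*a^+2+2*(y * t1)^+2.
 have -> : A = a+y * t1 by rewrite /a; ring.
 by have := sqr_ge0 (a-y * t1); lra.
have ht : (y * t1)^+2 <= y^+2/1024.
 rewrite exprMn; apply: ler_wpM2l => //.
 rewrite (_ : 1024^-1 = 32^-1^+2 :> R); last by field.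
 exact: lerXn2r.
have := sqr_ge0 a; have := sqr_ge0 b; lra.
Qed.

(** * The frame constant of three-point blocks *)

Section frame.
Variables (n : nat) (s t0 X : R).
Hypotheses (n4 : (4 <= n)%N) (s0 : 0 < s) (XE : X = n%:R*s) (ns : X <= 1).

Let n0 : (0 < n)%N. exact: leq_trans n4. Qed.
Let nR : 0 < n%:R :> R. by rewrite ltr0n. Qed.
Let X0 : 0 < X. by rewrite XE mulr_gt0. Qed.
Let c (k : nat) : R := 1-cos (k%:R*s).
Let z (k : nat) : R := sin (k%:R*s).

Let ksX (k : nat) : (k < n)%N -> 0 <= k%:R*s <= X.
move=> kn; rewrite mulr_ge0 ?(ltW s0)//= XE ler_pM2r// ler_nat.
exact: ltnW.
Qed.

Let ks1 (k : nat) : (k < n)%N -> 0 <= k%:R*s <= 1.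
by move=> /ksX/andP[-> h]/=; exact: le_trans h ns. Qed.

Let cb (k : nat) : (k < n)%N -> 0 <= c k <= X^+2/2.
move=> kn; have /andP[h1 h2] := one_minus_cos_bounds (ks1 kn).
have /andP[h3 h4] := ksX kn.
have h5 : (k%:R*s)^+2 <= X^+2 by apply: lerXn2r.
have := sqr_ge0 (k%:R*s); rewrite /c; move=> h6; apply/andP; split; lra.
Qed.

Let zb (k : nat) : (k < n)%N -> z k^+2 <= X^+2.
move=> kn; have /andP[h3 h4] := ksX kn.
rewrite -(sqr_normr (z k)); apply: lerXn2r; rewrite ?(ltW X0)//.
by apply: le_trans (sin_norm_le _) _; rewrite ger0_norm.
Qed.

Let clow (k : nat) : (k*4 <= n)%N -> (k < n)%N -> c k <= X^+2/32.
move=> k4 kn; have /andP[h1 h2] := one_minus_cos_bounds (ks1 kn).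
have /andP[h3 _] := ksX kn.
have h : k%:R*s <= X/4.
 rewrite XE mulrAC ler_pM2r// ler_pdivlMr//.
 by rewrite -natrM ler_nat.
have h5 : (k%:R*s)^+2 <= (X/4)^+2 by apply: lerXn2r.
by rewrite /c; move: h5; rewrite expr_div_n (_ : 4^+2 = 16 :> R); [lra|ring].
Qed.

Let khigh (k : nat) : (3*n <= k*4)%N -> 3/4*X <= k%:R*s.
move=> h; rewrite XE mulrA ler_pM2r//.
have : (3*n)%:R <= (k*4)%:R :> R by rewrite ler_nat.
by rewrite !natrM; lra.
Qed.

Let chigh (k : nat) : (3*n <= k*4)%N -> (k < n)%N -> X^+2/4 <= c k.
move=> k4 kn; have /andP[h1 h2] := one_minus_cos_bounds (ks1 kn).
have h := khigh k4.
have h5 : (3/4*X)^+2 <= (k%:R*s)^+2.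
 have X34 : 0 <= 3/4*X by [].
 exact: lerXn2r.
rewrite /c; move: h5; rewrite exprMn (_ : (3/4)^+2 = 9/16 :> R); last by field.
by have := sqr_ge0 X; lra.
Qed.

Let zhigh (k : nat) : (3*n <= k*4)%N -> (k < n)%N -> X^+2/3 <= z k^+2.
move=> k4 kn; have h := khigh k4; have /andP[h0 h1] := ks1 kn.
have := sin_ge3 h0; set x := k%:R*s in h h0 h1 *; move=> hs.
have x3 : x^+3 <= x by rewrite exprS -[leRHS]mulr1; apply: ler_wpM2l => //; rewrite expr2 mulr_ile1.
have h2 : 5/8*X <= z k by rewrite /z -/x; lra.
have : (5/8*X)^+2 <= z k^+2.
 by apply: lerXn2r => //; rewrite nnegrE; apply: le_trans h2; rewrite mulr_ge0 ?(ltW X0).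
rewrite exprMn (_ : (5/8)^+2 = 25/64 :> R); last by field.
by have := sqr_ge0 X; lra.
Qed.

(** Seen from the centre of the block, the k-th frequency carries the pair (A - sg c_k, de z_k),
    with c_k of order (ks)^2 and z_k of order ks. A low frequency k < floor(n/4) paired with n-1-k
    separates A from sg by [pair_lower], and the high one controls de. The constant is 45 for a
    pair, times 8 from n <= 8 floor(n/4), times 2 because the sum over pairs is twice the sum over
    frequencies. *)
Lemma block_lower (A sg de : R) :
 A^+2+(sg*X^+2)^+2+(de*X)^+2 <=
 720*\sum_(k < n) n%:R^-1*((A-sg*c k)^+2+(de*z k)^+2).
pose G (k : nat) := (A-sg*c k)^+2+(de*z k)^+2.
set T := A^+2+_+_.
have G0 k : 0 <= G k by [].
have T0 : 0 <= T by [].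
have X2 : 0 < X^+2 by [].
have pr (k : nat) : (k < n %/ 4)%N -> T/45 <= G k+G (n-k.+1)%N.
 move=> kq.
 have k4 : (k.+1*4 <= n)%N by rewrite (leq_trans (leq_mul kq (leqnn 4)))// leq_divM.
 have k4' : (k*4 <= n)%N by rewrite (leq_trans _ k4)// leq_mul2r leqnSn orbT.
 have kn : (k < n)%N by rewrite (leq_trans _ k4)// leq_pmulr.
 have hk : (3*n <= (n-k.+1)*4)%N.
  rewrite mulnBl leq_subRL ?(leq_trans k4)// ?leq_pmulr//.
  by rewrite (mulnC n 4) -[X in (_ <= X*_)%N]/(1+3)%N mulnDl mul1n leq_add2r.
 have hn : (n-k.+1 < n)%N by rewrite ltn_subrL.
 have h1 := clow k4' kn; have /andP[h2 _] := cb kn.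
 have h3 := chigh hk hn; have /andP[_ h4] := cb hn.
 have h5 := zhigh hk hn.
 have := @pair_lower A (sg*X^+2) (c k/X^+2) (c (n-k.+1)%N/X^+2).
 have E (v : R) : sg*X^+2*(v/X^+2) = sg*v by field.
 rewrite !E !ler_pdivrMr// !ler_pdivlMr// mul0r h2/= => h.
 have {}h := h _ _.
 have h6 : (de*X)^+2 <= 3*(de*z (n-k.+1)%N)^+2 by rewrite !exprMn; have := ler_wpM2l (sqr_ge0 de) h5; lra.
 have h7 := sqr_ge0 (de*z k); have h8 := sqr_ge0 (de*z (n-k.+1)%N).
 rewrite /T /G.
 have {}h : A^+2+(sg*X^+2)^+2 <=
  45*((A-sg*c k)^+2+(A-sg*c (n-k.+1)%N)^+2) by apply: h; [lra|apply/andP; split; lra].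
 by lra.
have S2 : 2*\sum_(k < n) G k = \sum_(k < n) (G k+G (n-k.+1)%N).
 have E : \sum_(k < n) G (n-k.+1)%N = \sum_(k < n) G k by rewrite [RHS](reindex_inj rev_ord_inj).
 by rewrite [RHS]big_split/= E; ring.
have S3 : (n %/ 4)%:R*(T/45) <= \sum_(k < n) (G k+G (n-k.+1)%N).
 have qn : (n %/ 4 <= n)%N by exact: leq_div.
 rewrite (big_ord_widen_cond _ (fun=> true) (fun k => (G k+G (n-k.+1)%N)) (leqnn n)).
 apply: (le_via (\sum_(k < n | (k < n %/ 4)%N) T/45)).
  by rewrite -(big_ord_widen n (fun=> T/45) qn) sumr_const card_ord mulr_natl.
 rewrite big_mkcond [leRHS]big_mkcond/=; apply: ler_sum => k _.
 by case: ifP => [/pr|_]; rewrite ltn_ord//= addr_ge0.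
have q8 : n%:R <= (n %/ 4)%:R*8 :> R.
 rewrite -natrM ler_nat {1}(divn_eq n 4) (_ : (n %/ 4*8 = n %/ 4*4+n %/ 4*4)%N).
  rewrite leq_add2l; apply: (@leq_trans 4); first by rewrite ltnW// ltn_mod.
  by rewrite leq_pmull// divn_gt0.
 by rewrite -mulnDr.
rewrite -mulr_sumr mulrCA ler_pdivlMl//.
have : n%:R*T <= (n %/ 4)%:R*8*T by exact: ler_wpM2r.
rewrite -[X in _ <= 720*X]/(\sum_(k < n) G k).
by lra.
Qed.

Lemma sq_sub_add (a b d : R) : (a-b+d)^+2 <= 3*(a^+2+b^+2+d^+2).
by have := sqr_ge0 (a+b); have := sqr_ge0 (a-d); have := sqr_ge0 (b+d); lra.
Qed.

Definition blockU (j : 'I_n) (l : 'I_3) := trig (@wunit n) (mesh t0 j+l%:R*s).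

Let s' := t0+s.
Let i0 : 'I_3 := ord0.
Let i1 : 'I_3 := @Ordinal 3 1 isT.
Let i2 : 'I_3 := @Ordinal 3 2 isT.

Let blk (a : 'I_3 -> R) (j : 'I_n) (k : 'I_n) :
 [/\ \sum_l a l*blockU j l (lshift n k) = (Num.sqrt n%:R)^-1 *
  ((a i0+a i1+a i2-(a i0+a i2)*c k)*cos (k%:R * mesh s' j) +
   (a i0-a i2)*z k*sin (k%:R * mesh s' j)) &
  \sum_l a l*blockU j l (rshift n k) = (Num.sqrt n%:R)^-1 *
  ((a i0+a i1+a i2-(a i0+a i2)*c k)*sin (k%:R * mesh s' j) -
   (a i0-a i2)*z k*cos (k%:R * mesh s' j))].
have E0 : mesh t0 j + i0%:R*s = mesh s' j-s by rewrite /mesh /s' /=; ring.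
have E1 : mesh t0 j + i1%:R*s = mesh s' j by rewrite /mesh /s' /=; ring.
have E2 : mesh t0 j + i2%:R*s = mesh s' j+s by rewrite /mesh /s' /=; ring.
have S3 (F : 'I_3 -> R) : \sum_l F l = F i0+F i1+F i2 by rewrite !big_ord_recl big_ord0 addr0 addrA; congr (F _+F _+F _); exact/val_inj.
by split; rewrite S3 /blockU E0 E1 E2; move: (mesh s' j) => M; rewrite ?trig_lshift ?trig_rshift /wunit ?(mulrBr k%:R) ?(mulrDr k%:R)
 ?cosB ?cosD ?sinB ?sinD /c /z; ring.
Qed.

(** The vectors of a block become collinear as s tends to 0, so both sides are compared with the sum
    over j of A^2 + (sg X^2)^2 + (de X)^2, that is value, second and first difference at their
    natural scales. [block_lower] bounds each term by 720 times the squared norm of its block.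
    Plancherel bounds the squared norm of the full sum by 3 times the sum of the terms, since c_k <=
    X^2 and |z_k| <= X. The product 2160 does not depend on s. *)
Lemma trig_frame (a : 'I_n -> 'I_3 -> R) :
 \sum_i (\sum_j \sum_l a j l*blockU j l i)^+2 <=
 2160*\sum_j \sum_i (\sum_l a j l*blockU j l i)^+2.
pose A j := a j i0+a j i1+a j i2.
pose sg j := a j i0+a j i2.
pose de j := a j i0-a j i2.
pose W := (Num.sqrt n%:R)^-1 : R.
have W2 : W^+2 = n%:R^-1 by exact: (@wunit_sq n (Ordinal n0) n0).
have low : \sum_j (A j^+2+(sg j*X^+2)^+2+(de j*X)^+2) <=
  720*\sum_j \sum_i (\sum_l a j l*blockU j l i)^+2.
 rewrite mulr_sumr; apply: ler_sum => j _.
 apply: le_trans (block_lower _ _ _) _; apply: ler_wpM2l => //.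
 rewrite sum_split2; apply: ler_sum => k _.
 have [-> ->] := blk (a j) j k; rewrite -/W -/(A j) -/(sg j) -/(de j) !exprMn W2 -mulrDr.
 set C := cos _; set S := sin _.
 rewrite ler_pM2l ?invr_gt0//; apply: eq_ler.
 have : C^+2+S^+2 = 1 by exact: cos2Dsin2.
 set u := A j-_; set v := _*z k => CS.
 have -> : (u*C+v*S)^+2+(u*S-v*C)^+2 = (u^+2+v^+2)*(C^+2+S^+2) by ring.
 by rewrite CS mulr1 /v exprMn.
pose P (Y : 'I_n -> R) (k : 'I_n) := \sum_j Y j*cos (k%:R * mesh s' j).
pose S (Y : 'I_n -> R) (k : 'I_n) := \sum_j Y j*sin (k%:R * mesh s' j).
have pl Y : \sum_k n%:R^-1*(P Y k^+2+S Y k^+2) = \sum_j Y j^+2 by exact: plancherel.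
have pl' (Y : 'I_n -> R) (b : 'I_n -> R) (B : R) : (forall k, b k^+2 <= B) ->
  \sum_k n%:R^-1*((b k*P Y k)^+2+(b k*S Y k)^+2) <= B*\sum_j Y j^+2.
 move=> hb; rewrite -pl mulr_sumr; apply: ler_sum => k _.
 rewrite mulrCA ler_pM2l ?invr_gt0// !exprMn -mulrDr; apply: ler_wpM2r => //.
have up : \sum_i (\sum_j \sum_l a j l*blockU j l i)^+2 <=
  3*\sum_j (A j^+2+(sg j*X^+2)^+2+(de j*X)^+2).
 apply: (le_via (3*(\sum_k n%:R^-1*(P A k^+2+S A k^+2) +
   \sum_(k < n) n%:R^-1*((c k*P sg k)^+2+(c k*S sg k)^+2) +
   \sum_(k < n) n%:R^-1*((z k*P de k)^+2+(z k*S de k)^+2)))); last first.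
  rewrite ler_pM2l// !big_split/= pl; apply: lerD; first apply: lerD => //.
   apply: le_trans (pl' sg (fun k => c k) (X^+4) _) _.
    move=> k; have /andP[h1 h2] := cb (ltn_ord k).
    rewrite (exprM X 2 2); apply: lerXn2r; rewrite ?sqr_ge0//.
    by apply: le_trans h2 _; have := sqr_ge0 X; lra.
   by rewrite mulr_sumr; apply: ler_sum => j _; rewrite exprMn -exprM mulrC.
  apply: le_trans (pl' de (fun k => z k) (X^+2) _) _.
   by move=> k; exact: zb.
  by rewrite mulr_sumr; apply: ler_sum => j _; rewrite exprMn mulrC.
 rewrite -!big_split/= mulr_sumr sum_split2; apply: ler_sum => k _.
 have -> : \sum_j \sum_l a j l*blockU j l (lshift n k) = W*(P A k-c k*P sg k+z k*S de k).
  rewrite /P /S !mulr_sumr -sumrB -big_split/= mulr_sumr; apply: eq_bigr => j _.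
  by have [-> _] := blk (a j) j k; rewrite -/W -/(A j) -/(sg j) -/(de j); ring.
 have -> : \sum_j \sum_l a j l*blockU j l (rshift n k) = W*(S A k-c k*S sg k + - (z k*P de k)).
  rewrite /P /S !mulr_sumr -sumrB -sumrN -big_split/= mulr_sumr; apply: eq_bigr => j _.
  by have [_ ->] := blk (a j) j k; rewrite -/W -/(A j) -/(sg j) -/(de j); ring.
 rewrite !exprMn W2 -!mulrDr mulrCA ler_pM2l ?invr_gt0//.
 have := sq_sub_add (P A k) (c k*P sg k) (z k*S de k).
 have := sq_sub_add (S A k) (c k*S sg k) (- (z k*P de k)).
 by rewrite sqrrN !exprMn; lra.
apply: le_trans up _; have := low; lra.
Qed.

End frame.

(** Each class is an isometry by Plancherel, and the Q classes are added by Cauchy-Schwarz. *)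
Lemma mesh_upper n Q (t : 'I_Q -> R) (cf : 'I_Q -> 'I_n -> R) : (0 < n)%N ->
 \sum_i (\sum_q \sum_j cf q j * trig (@wunit n) (mesh (t q) j) i)^+2 <=
 Q%:R*\sum_q \sum_j cf q j^+2.
move=> n0.
have E q : \sum_i (\sum_j cf q j * trig (@wunit n) (mesh (t q) j) i)^+2 = \sum_j cf q j^+2.
 rewrite -[RHS](plancherel (t q))// sum_split2; apply: eq_bigr => k _.
 rewrite -(wunit_sq k n0) mulrDr -!exprMn !mulr_sumr; congr (_^+2+_^+2).
  by apply: eq_bigr => j _; rewrite trig_lshift mulrCA.
 by apply: eq_bigr => j _; rewrite trig_rshift mulrCA.
rewrite -(eq_bigr _ (fun q _ => E q)) exchange_big/= mulr_sumr; apply: ler_sum => i _.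
have := sum_CS (fun=> 1) (fun q => \sum_j cf q j * trig (@wunit n) (mesh (t q) j) i).
rewrite (eq_bigr (fun q => \sum_j cf q j * trig (@wunit n) (mesh (t q) j) i)); last by move=> q _; rewrite mul1r.
by rewrite expr1n sumr_const card_ord -[1 *+ Q]/(Q%:R).
Qed.

End trig_vectors.

(** * Signs and the angular law of two Gaussian forms *)

Section sign.
Variable R : realType.
Implicit Types x y z : R.

(** Never 0: a zero argument counts as positive, so that products of signs are always 1 or -1. *)
Definition sgr x : R := if x < 0 then -1 else 1.

Lemma sgr_norm x : `|sgr x| = 1.
by rewrite /sgr; case: ifP; rewrite ?normrN normr1. Qed.

Lemma msr_sgr : msr sgr.
apply: measurable_fun_ifT => //.
exact: measurable_fun_ltr.
Qed.

Lemma sgrN x : x != 0 -> sgr (- x) = - sgr x.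
move=> x0; rewrite /sgr oppr_lt0; case: ltgtP x0; rewrite ?opprK//.
Qed.

Lemma sgr_pmul a x : 0 < a -> sgr (a*x) = sgr x.
by move=> a0; rewrite /sgr pmulr_rlt0. Qed.

(** A nonnegative combination has the common sign of x and y when they agree; otherwise exactly one
    of the steps from x to z and from z to y changes sign. *)
Lemma sgr_between a b x y z : 0 <= a -> 0 <= b -> 0 < a+b -> z = a*x+b*y ->
 1-sgr x*sgr y = (1-sgr x*sgr z)+(1-sgr z*sgr y).
move=> a0 b0 ab zE; rewrite /sgr; case: (ltP x 0) => hx; case: (ltP y 0) => hy; last 1 first.
- have -> : (z < 0) = false by apply/negbTE; rewrite -leNgt zE addr_ge0// mulr_ge0.
 by ring.
- have -> : z < 0.
  have h1 : a*x <= 0 by rewrite mulr_ge0_le0// ltW.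
  have h2 : b*y <= 0 by rewrite mulr_ge0_le0// ltW.
  have [a00|an] := eqVneq a 0.
   have : b*y < 0 by rewrite pmulr_rlt0; lra.
   by rewrite zE; lra.
  have : a*x < 0 by rewrite pmulr_rlt0// lt_def an.
  by rewrite zE; lra.
 by ring.
- by case: ifP => _; ring.
- by case: ifP => _; ring.
Qed.

End sign.

Section additive_linear.
Variables (R : realType) (P : R -> R) (L : R).
Hypotheses (L0 : 0 < L)
 (PD : forall a b, 0 <= a <= L -> 0 <= b -> a+b < 2*L -> P (a+b) = P a+P b)
 (P0 : forall a, 0 <= a < 2*L -> 0 <= P a) (PL : P L = 1).

Let dist_le (u v w : R) : u <= v -> 0 <= u -> w <= v -> 0 <= w -> `|w-u| <= v.
by move=> h1 h2 h3 h4; rewrite ler_norml; apply/andP; split; lra. Qed.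

(** Cauchy's functional equation: nonnegativity makes P monotone on [0, L], and comparison with the
    multiples of L/(N+1) determines P(t) up to 1/(N+1). *)
Lemma additive_linear th : 0 <= th < 2*L -> P th = th/L.
have H0 : P 0 = 0.
 have := @PD 0 0; rewrite lexx addr0 (ltW L0) mulr_gt0// => /(_ isT isT isT) h.
 by lra.
have H t : 0 <= t <= L -> P t = t/L.
 move=> /andP[t0 tL].
 have HN N : `|P t-t/L| <= N.+1%:R^-1.
  have N0 : 0 < N.+1%:R :> R by [].
  pose de := L/N.+1%:R.
  have de0 : 0 < de by [].
  have Nde : N.+1%:R * de = L by rewrite /de mulrC divfK// gt_eqF.
  have deL : de <= L by rewrite /de ler_pdivrMr// ler_peMr ?ler1n.
  have Pj (j : nat) : (j <= N.+1)%N -> P (j%:R * de) = j%:R*P de.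
   elim: j => [|j IH] jN; first by rewrite !mul0r.
   have jde : j.+1%:R * de <= L by rewrite -Nde ler_pM2r// ler_nat.
   rewrite -natr1 mulrDl mul1r addrC PD ?IH 1?ltnW//.
   - by ring.
   - by rewrite (ltW de0).
   - by move: jde; rewrite -natr1; lra.
  have Pde : P de = N.+1%:R^-1.
   by have := Pj N.+1 (leqnn _); rewrite Nde PL => h; rewrite -[LHS](mulKf (x := N.+1%:R)) -?h ?mulr1// gt_eqF.
  pose j := Num.truncn (t / de).
  have td0 : 0 <= t / de by [].
  have j1 : j%:R * de <= t by rewrite -ler_pdivlMr// truncn_le.
  have j2 : t < j.+1%:R * de by rewrite -ltr_pdivrMr// truncnS_gt.
  have jN : (j <= N.+1)%N.
   have h : j%:R <= t / de by rewrite truncn_le.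
   rewrite -(ler_nat R); apply: le_trans h _.
   by rewrite ler_pdivrMr// Nde.
  pose b := t-j%:R * de.
  have b0 : 0 <= b by rewrite subr_ge0.
  have bde : b < de by move: j2; rewrite -natr1 /b; lra.
  have Pt : P t = j%:R*P de+P b.
   have jd0 : 0 <= j%:R * de by [].
   have -> : t = j%:R * de+b by rewrite /b; ring.
   rewrite PD ?Pj//; last by rewrite /b; lra.
   by rewrite jd0 (le_trans j1).
  have Pb0 : 0 <= P b by apply: P0; rewrite b0/=; lra.
  have Pbd : P b <= P de.
   have -> : de = b+(de-b) by ring.
   rewrite [leRHS]PD; [|by rewrite b0/=; lra|lra|lra].
   by rewrite lerDl; apply: P0; apply/andP; split; lra.
  have tE : t/L = j%:R/N.+1%:R+b/L.
   have -> : t/L = (j%:R * de+b)/L by rewrite /b; congr (_/_); ring.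
   by rewrite mulrDl /de; congr (_+_); field; rewrite !gt_eqF.
  have bL : b/L <= N.+1%:R^-1 by rewrite ler_pdivrMr// mulrC -/de ltW.
  have bL0 : 0 <= b/L by [].
  rewrite Pt tE Pde; rewrite Pde in Pbd.
  have -> : j%:R/N.+1%:R+P b-(j%:R/N.+1%:R+b/L) = P b-b/L by ring.
  exact: dist_le.

 apply/eqP; rewrite -subr_eq0 -normr_eq0 eq_le normr_ge0 andbT leNgt; apply/negP => h.
 have [N hN] : exists N, N.+1%:R^-1 < `|P t-t/L|.
  exists (Num.truncn `|P t-t/L|^-1).
  by rewrite invf_plt ?posrE// truncnS_gt.
 by have := HN N; rewrite leNgt hN.
move=> /andP[t0 t2]; have [tL|Lt] := leP th L; first by rewrite H ?t0.
have -> : th = L+(th-L) by ring.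
rewrite PD; [|by rewrite lexx ltW|lra|lra].
rewrite PL H; last by apply/andP; split; lra.
by field.
Qed.

End additive_linear.

Section angular_law.
Variable R : realType.
Notation gg := (gam (R := R) \x gam (R := R))%E.

Let mlin (a b : R) : msr (fun p : R*R => a * p.1+b * p.2).
by []. Qed.

Let sc (a b : R) (p : R*R) := sgr (a * p.1+b * p.2).

Let msc a b : msr (sc a b).
exact: (measurableT_comp (@msr_sgr R)). Qed.

Let Iss a b a' b' : intg gg (fun p => sc a b p*sc a' b' p).
apply: (intg_bnd 1); first exact: measurable_funM.
by move=> p; rewrite normrM !sgr_norm mulr1.
Qed.

Let E2 a b a' b' : Ex gg (fun p => sc a b p*sc a' b' p) =
 Ex gam (fun x => Ex gam (fun y => sc a b (x, y)*sc a' b' (x, y))).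
apply: (@Ex_prod _ _ _ _ _ gam gam (fun p => sc a b p*sc a' b' p) 1).
 exact: measurable_funM.
by move=> p; rewrite normrM !sgr_norm mulr1.
Qed.

Definition qang (th : R) := Ex gg (fun p => sc 1 0 p*sc (cos th) (sin th) p).

Let qang_rot a b : 0 <= a <= pi/2 ->
 Ex gg (fun p => sc (cos a) (sin a) p*sc (cos (a+b)) (sin (a+b)) p) = qang b.
move=> /andP[a0 a2].
have ca : 0 <= cos a by apply: cos_ge0_pihalf; apply/andP; split; have := @pi_gt0 R; lra.
have bd c d c' d' p : `|sc c d p*sc c' d' p| <= 1 by rewrite normrM !sgr_norm mulr1.
rewrite E2 /qang E2.
have h : cos a^+2+(- sin a)^+2 = 1 by rewrite sqrrN cos2Dsin2.
have mm : msr (fun p => sc 1 0 p*sc (cos b) (sin b) p) by exact: measurable_funM.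
rewrite -(gam_rot ca h mm (fun p => bd _ _ _ _ p)).
apply: Ex_eq => x; apply: Ex_eq => y; rewrite /sc/=; congr (sgr _*sgr _); first by ring.
by rewrite cosD sinD; ring.
Qed.

Lemma sgr_neq0_ae : {ae gam (R := R), forall x, x != 0}.
exists [set 0]; split; [exact: measurable_set1|exact: gam_set1|].
by move=> x /= /negP; rewrite negbK => /eqP.
Qed.

Lemma Ex_sgr : Ex (gam (R := R)) (@sgr R) = 0.
have h := @Ex_gam_opp R (@sgr R) 1 (@msr_sgr R) (fun x => _).
have {}h : Ex gam (fun x : R => sgr (- x)) = Ex gam (@sgr R) by apply: h => x; rewrite sgr_norm.
have I : intg gam (@sgr R) by apply: (intg_bnd 1) => [|x]; [exact: msr_sgr|rewrite sgr_norm].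
have : Ex gam (fun x : R => sgr (- x)) = - Ex gam (@sgr R).
 rewrite -ExN//; apply: ae_Ex_eq.
 - exact: (measurableT_comp (@msr_sgr R)).
 - by apply: measurableT_comp => //; exact: msr_sgr.
 - by apply: filterS sgr_neq0_ae => x; exact: sgrN.
by rewrite h; lra.
Qed.

Lemma qang_pihalf : qang (pi/2) = 0.
rewrite /qang cos_pihalf sin_pihalf E2.
rewrite -[RHS](Ex_cst gam); apply: Ex_eq => x.
rewrite (@Ex_eq _ _ _ _ _ (fun y => sgr x*sgr y)); last first.
 by move=> y; rewrite /sc/= !mul0r !mul1r add0r addr0.
rewrite ExZ ?Ex_sgr ?mulr0//.
by apply: (intg_bnd 1) => [|y]; [exact: msr_sgr|rewrite sgr_norm].
Qed.

Lemma qang_le1 th : qang th <= 1.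
apply: le_trans (ler_norm _) _; apply: Ex_bound; first exact: measurable_funM.
by move=> p; rewrite normrM !sgr_norm mulr1.
Qed.

(** The direction of angle a is a nonnegative combination of those of angles 0 and a+b, with weights
    sin b/sin(a+b) and sin a/sin(a+b), so [sgr_between] applies pointwise; a rotation brings the
    second step back to angle 0. *)
Lemma qang_add a b : 0 <= a <= pi/2 -> 0 <= b -> a+b < pi ->
 1-qang (a+b) = (1-qang a)+(1-qang b).
move=> ha b0 ab; have /andP[a0 a2] := ha.
have sa : 0 <= sin a.
 have [->|an] := eqVneq a 0; first by rewrite sin0.
 by apply/ltW/sin_gt0_pi; rewrite lt_def an a0/=; have := @pi_gt0 R; lra.
have sb : 0 <= sin b.
 have [->|bn] := eqVneq b 0; first by rewrite sin0.
 by apply/ltW/sin_gt0_pi; rewrite lt_def bn b0/=; lra.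
have [ab0|abn] := eqVneq (a+b) 0.
 have -> : a = 0 by lra.
 have -> : b = 0 by lra.
 rewrite addr0; suff -> : qang 0 = 1 by rewrite subrr addr0.
 rewrite /qang -[RHS](Ex_cst gg); apply: Ex_eq => p.
 by rewrite cos0 sin0 -expr2 -(sqr_normr _) sgr_norm expr1n.
have sab : 0 < sin (a+b) by apply: sin_gt0_pi; rewrite ab lt_def abn addr_ge0.
have I1 : intg gg (fun=> 1) by exact: intg_cst.
rewrite -(qang_rot b ha) /qang.
have X (f : R*R -> R) : intg gg f -> 1-Ex gg f = Ex gg (fun p => 1-f p).
 by move=> If; rewrite ExB// Ex_cst.
rewrite !X// -ExD; [|exact: intgB|exact: intgB].
apply: Ex_eq => p; apply: (@sgr_between _ (sin b/sin (a+b)) (sin a/sin (a+b))).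
- by [].
- by [].
- rewrite -mulrDl divr_gt0// lt_def addr_ge0// andbT paddr_eq0//.
 apply/negP => /andP[/eqP sb0 /eqP sa0]; move: sab; rewrite sinD sb0 sa0; lra.
- have cs := cos2Dsin2 b.
 rewrite mul1r mul0r addr0; apply: (mulfI (x := sin (a+b))) => //.
 rewrite [RHS](_ : _ = sin b * p.1+sin a*(cos (a+b) * p.1+sin (a+b) * p.2)); last first.
  by field.
 have h := cos2Dsin2 a; rewrite sinD cosD; apply/eqP; rewrite -subr_eq0 [X in X == 0](_ : _ =
  sin b * p.1*(cos a^+2+sin a^+2-1)); last by ring.
 by rewrite h subrr mulr0.
Qed.

(** 1 - qang is additive and nonnegative, and equals 1 at pi/2 by independence and symmetry. *)
Lemma qangE th : 0 <= th < pi -> qang th = 1-2 * th/pi.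
move=> hth; have p0 := @pi_gt0 R.
have := @additive_linear R (fun t => 1-qang t) (pi/2) (divr_gt0 p0 (ltr0n _ 2)).
have -> : 2*(pi/2) = pi :> R by field.
move=> /(_ (fun a b => @qang_add a b)) h.
have := h _ _ th hth; rewrite qang_pihalf subr0 => {}h.
have <- : 1-(1-qang th) = qang th by ring.
rewrite h//; last by move=> a _; rewrite subr_ge0 qang_le1.
by congr (_-_); rewrite invf_div; ring.
Qed.

(** The end point lies outside the range of [qangE]. The two forms are opposite there, and sgr(-x) =
    - sgr x fails only at x = 0, a null event. *)
Lemma qang_pi : qang pi = -1.
rewrite /qang cospi sinpi E2.
rewrite -[RHS](Ex_cst (gam (R := R))); apply: ae_Ex_eq.
- apply: (@msr_Ex_snd _ _ _ _ _ gam gam (fun p => sc 1 0 p*sc (-1) 0 p) 1); first exact: measurable_funM.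
 by move=> p; rewrite normrM !sgr_norm mulr1.
- by [].
apply: filterS sgr_neq0_ae => x x0.
rewrite -[RHS](Ex_cst (gam (R := R))); apply: Ex_eq => y.
rewrite /sc/= !mul0r !addr0 mul1r mulN1r sgrN// mulrN -expr2.
by rewrite -(sqr_normr _) sgr_norm expr1n.
Qed.

(** Sheppard's formula: the reduction of [gauss_pair] turns the two forms, up to positive factors,
    into those of angles 0 and acos rho. *)
Lemma sign_corr n (u v : 'I_n -> R) (V : R) : 0 < V ->
 \sum_i u i^+2 = V -> \sum_i v i^+2 = V ->
 EG n (fun x => sgr (dot u x)*sgr (dot v x)) =
 1-2*acos ((\sum_i u i*v i)/V)/pi.
move=> V0 uV vV; have p0 := @pi_gt0 R.
have [[[a b] g] [[/= a0 aE abE g0 bgE] H]] := gauss_pair u v.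
rewrite uV in aE; rewrite vV in bgE; rewrite -abE.
have an : a != 0 by apply/eqP => a00; move: V0; rewrite -aE a00 expr0n/= ltxx.
have ap : 0 < a by rewrite lt_def an.
set rho := a*b/V.
have rE : rho = b/a by rewrite /rho -aE; field.
have r1 : -1 <= rho <= 1.
 rewrite -ler_norml -(ler_pXn2r (n := 2))// expr1n sqr_normr//.
 rewrite rE expr_div_n ler_pdivrMr ?exprn_gt0// mul1r aE -bgE lerDl; exact: sqr_ge0.
pose th := acos rho.
have cth : cos th = b/a by rewrite -rE acosK// in_itv.
have sth : sin th = g/a.
 rewrite sin_acos// rE expr_div_n.
 have -> : 1-b^+2/a^+2 = (g/a)^+2 by rewrite expr_div_n -[1](divff (x := a^+2)) ?expf_neq0// -mulrBl; congr (_/_); lra.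
 by rewrite sqrtr_sqr ger0_norm// divr_ge0.
have E : EG n (fun x => sgr (dot u x)*sgr (dot v x)) = qang th.
 have mf : msr (fun p : R*R => sgr p.1*sgr p.2) by apply: measurable_funM; apply: (measurableT_comp (@msr_sgr R)).
 have bf (p : R*R) : `|sgr p.1*sgr p.2| <= 1 by rewrite normrM !sgr_norm mulr1.
 rewrite (H _ 1 mf bf) /qang E2.
 apply: Ex_eq => x; apply: Ex_eq => y; rewrite /= sgr_pmul//; congr (_*_).
  by rewrite /sc/= mul1r mul0r addr0.
 rewrite /sc/= cth sth -(sgr_pmul (b/a*x+g/a*y) ap); congr sgr.
 by field.
rewrite E -/th; have [thpi|thpi] := ltP th pi.
 by rewrite qangE// thpi acos_ge0.
have -> : th = pi by apply/eqP; rewrite eq_le thpi acos_lepi.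
by rewrite qang_pi -mulrA divff ?gt_eqF//; ring.
Qed.

(** The fourth order upper bound on cos is inverted in two rounds: it first gives acos rho <= 2 tau,
    and this controls the fourth order term. *)
Lemma acos_upper (rho tau : R) : 0 <= tau <= 1/2 -> -1 <= rho <= 1 ->
 1-tau^+2/2 <= rho -> acos rho <= tau+tau^+3.
move=> /andP[t0 t2] r1 hr; set th := acos rho.
have th0 : 0 <= th by exact: acos_ge0.
have thp : th <= pi by exact: acos_lepi.
have cth : cos th = rho by rewrite acosK// in_itv.
have p2 := @pi_ge2 R.
have t4 : tau^+4 <= tau^+2/4.
 rewrite (exprD tau 2 2); have h : tau^+2 <= 1/4.
  by rewrite (_ : 1/4 = (1/2)^+2); [apply: lerXn2r; rewrite ?nnegrE; lra|field].
 by have := ler_wpM2l (sqr_ge0 tau) h; lra.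
have th2 : th <= 2 * tau.
 rewrite leNgt; apply/negP => h.
 have : cos th < cos (2 * tau) by rewrite ltr_cos ?in_itv/=; [|apply/andP; split; lra|apply/andP; split; lra].
 have := cos_le4 (2 * tau); rewrite cth !exprMn (_ : 2^+2 = 4 :> R); last by ring.
 rewrite (_ : 2^+4 = 16 :> R); last by ring.
 by have := sqr_ge0 tau; lra.
have h1 : th^+2 <= tau^+2+th^+4/12.
 by have := cos_le4 th; rewrite cth; lra.
have h2 : th^+4 <= 16 * tau^+4.
 rewrite (_ : 16 * tau^+4 = (2 * tau)^+4); last by ring.
 exact: lerXn2r.
have h3 : th^+2 <= (tau+tau^+3)^+2.
 have -> : (tau+tau^+3)^+2 = tau^+2+2 * tau^+4+tau^+6 by ring.
 by have : 0 <= tau^+6 by [nneg]; have : 0 <= tau^+4 by [nneg]; lra.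
have t3 : 0 <= tau+tau^+3 by [].
by rewrite -(ler_pXn2r (n := 2)).
Qed.

(** The lower bound on cos gives tau^2 - 2 D <= th^2 for th = acos rho; when th < tau, th^2 <= tau
    th makes this linear. *)
Lemma acos_lower (rho tau D : R) : 0 < tau -> 0 <= D -> -1 <= rho <= 1 ->
 rho <= 1-tau^+2/2+D -> tau-2*D/tau <= acos rho.
move=> t0 D0 r1 hr; set th := acos rho.
have th0 : 0 <= th by exact: acos_ge0.
have cth : cos th = rho by rewrite acosK// in_itv.
have h1 : tau^+2-2*D <= th^+2 by have := cos_ge2 th; rewrite cth; lra.
have [h|th_lt] := leP tau th.
 by have : 0 <= 2*D/tau by [rewrite divr_ge0 ?mulr_ge0// ltW]; lra.
have : tau*(tau-2*D/tau) <= tau * th; last by rewrite ler_pM2l.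
have -> : tau*(tau-2*D/tau) = tau^+2-2*D by field.
have : th^+2 <= tau * th by rewrite expr2 ler_wpM2r// ltW.
by lra.
Qed.

End angular_law.

Ltac measurable_leaf3 := first [ measurable_leaf2 | exact: msr_sgr ].
Ltac measurable_leaf ::= measurable_leaf3.

(** * Zeros against sign changes for a smooth function on a grid *)

Section zeros_deterministic.
Variable R : realType.
Implicit Types (a b t x y c K : R) (f : nat -> R -> R).

Lemma ivt_zero (h dh : R -> R) a b : a <= b -> (forall t, der h t (dh t)) ->
 h a*h b <= 0 -> exists2 c, a <= c <= b & h c = 0.
move=> ab hd hab.
have ch : {within `[a, b], continuous h} by apply: continuous_subspaceT => t; exact: der_continuous (hd t).
have [|c cab hc] := @IVT R h a b 0 ab ch; last by exists c.
by rewrite ge_min le_max; case: (leP (h a) 0) => h1; case: (leP (h b) 0) => h2 //=; nra.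
Qed.

(** An increasing list of m+1 zeros, with indices 0 to m. *)
Definition zlist (h : R -> R) a b m (z : nat -> R) :=
 [/\ forall i, (i <= m)%N -> a <= z i <= b, forall i, (i < m)%N -> z i < z i.+1 &
   forall i, (i <= m)%N -> h (z i) = 0].

Lemma rolle_list (h dh : R -> R) a b m z : (forall t, der h t (dh t)) ->
 zlist h a b m.+1 z -> exists z', zlist dh a b m z'.
move=> hd [zab zlt zh].
have /choice[z' Hz'] : forall i, exists y, (i <= m)%N -> z i < y < z i.+1 /\ dh y = 0.
 move=> i; have [im|im] := leqP i m; last by exists 0.
 have lt := zlt i im.
 have [c cI hc] : exists2 c, c \in `]z i, z i.+1[ & h (z i.+1)-h (z i) = dh c*(z i.+1-z i).
  apply: (@MVT R h dh) => // [t _|]; first exact: hd.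
  by apply: continuous_subspaceT => t; exact: der_continuous (hd t).
 exists c => _; split; first by move: cI; rewrite in_itv.
 move: hc; rewrite !zh//; last exact: ltnW.
 rewrite subrr => /esym/eqP; rewrite mulf_eq0 => /orP[/eqP//|].
 by rewrite subr_eq0 gt_eqF.
exists z'; split=> i im.
- have [/andP[h1 h2] _] := Hz' i im.
 have /andP[h3 _] := zab i (leqW im); have /andP[_ h4] := zab i.+1 im.
 by rewrite (le_trans h3 (ltW h1)) (le_trans (ltW h2) h4).
- have [/andP[_ h1] _] := Hz' i (ltnW im); have [/andP[h2 _] _] := Hz' i.+1 im.
 exact: lt_trans h1 h2.
- by case: (Hz' i im).
Qed.

Lemma small_from_zero (g dg : R -> R) c B a b z0 t : 0 <= c ->
 (forall s, der g s (c * dg s)) -> a <= z0 <= b -> g z0 = 0 ->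
 (forall s, a <= s <= b -> `|dg s| <= B) -> a <= t <= b -> `|g t| <= c*(b-a)*B.
move=> c0 hd /andP[z1 z2] gz hB /andP[t1 t2].
have B0 : 0 <= B by apply: le_trans (hB z0 _); rewrite // z1.
have key x y : a <= x -> x <= y -> y <= b -> `|g y-g x| <= c*(b-a)*B.
 move=> ax xy yb; have [e /andP[e1 e2] ->] := mvt xy (fun s _ => hd s).
 rewrite !normrM (ger0_norm c0) -!mulrA; apply: ler_wpM2l => //.
 rewrite mulrC; apply: ler_pM => //.
  by rewrite ger0_norm ?subr_ge0// lerB.
 by apply: hB; rewrite (le_trans ax e1) (le_trans e2 yb).
have [tz|/ltW zt] := leP t z0.
 by have := key t z0 t1 tz z2; rewrite gz sub0r normrN.
by have := key z0 t z1 zt t2; rewrite gz subr0.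
Qed.

(** Here f_i is the i-th derivative divided by c^i. From m+1 zeros Rolle's theorem gives a zero of
    each f_i with i <= m, and integrating down from f_{m+1} gains a factor c (b - a) each time. *)
Lemma zlist_small f c K a b m z : 0 < c -> (forall i t, der (f i) t (c*f i.+1 t)) ->
 zlist (f 0%N) a b m z -> (forall t, a <= t <= b -> `|f m.+1 t| <= K) ->
 forall t, a <= t <= b -> `|f 0%N t| <= (c*(b-a))^+m.+1*K.
move=> c0; elim: m f z => [|m IH] f z hd hz hK t tab.
 rewrite expr1; have [zab _ zh] := hz.
 exact: (small_from_zero (ltW c0) (hd 0%N) (zab 0%N isT) (zh 0%N isT) hK tab).
have [z' [h1 h2 h3]] := rolle_list (hd 0%N) hz.
have hz' : zlist (f 1%N) a b m z'.
 split=> // i im; have /eqP := h3 i im.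
 by rewrite mulf_eq0 gt_eqF//= => /eqP.
have H := IH (fun i => f i.+1) z' (fun i => hd i.+1) hz' hK.
have [zab _ zh] := hz; rewrite exprS -mulrA.
exact: (small_from_zero (ltW c0) (hd 0%N) (zab 0%N isT) (zh 0%N isT) H tab).
Qed.

Definition scf x y : R := (1-sgr x*sgr y)/2.

Lemma scf01 x y : scf x y = (sgr x != sgr y)%:R.
rewrite /scf /sgr; case: ifP => _; case: ifP => _; rewrite ?eqxx//=; first by field.
- rewrite (_ : (-1 == 1 :> R) = false)/=; last by apply: lt_eqF; lra.
 by field.
- rewrite (_ : (1 == -1 :> R) = false)/=; last by apply: gt_eqF; lra.
 by field.
- by field.
Qed.

Lemma scf_opp (p u v : R) : 0 < p*(0-u) -> 0 < p*(v-0) -> scf u v = 1.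
move=> m1 m2; rewrite scf01 /sgr; case: (ltP u 0) => h1; case: (ltP v 0) => h2.
- by exfalso; have [p0|p0] := leP 0 p; nra.
- by rewrite (_ : (-1 != 1 :> R) = true)//; lra.
- by rewrite (_ : (1 != -1 :> R) = true)//; lra.
- by exfalso; have [p0|p0] := leP 0 p; nra.
Qed.

Lemma sgr_neq_le0 (u v : R) : sgr u != sgr v -> u*v <= 0.
rewrite /sgr; case: (ltP u 0) => h1; case: (ltP v 0) => h2; rewrite ?eqxx//= => _; nra.
Qed.

Section cells.
Variables (f : nat -> R -> R) (c : R) (m : nat) (s : seq R).
Hypotheses (c0 : 0 < c) (hd : forall i t, der (f i) t (c*f i.+1 t)) (m0 : (0 < m)%N).

Definition cpt (i : nat) : R := i%:R*(pi *+ 2/m%:R).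
Notation h := (f 0%N).
Notation de := ((pi : R) *+ 2/m%:R).

Hypotheses (nz : forall i, (i <= m)%N -> h (cpt i) != 0) (us : uniq s)
 (sP : forall x, x \in s <-> (0 <= x <= pi *+ 2 /\ h x = 0)).

Let mR0 : 0 < m%:R :> R. by rewrite ltr0n. Qed.
Let de0 : 0 < de. by []. Qed.
Let cptS i : cpt i.+1 = cpt i+de. by rewrite /cpt -natr1; ring. Qed.
Let cpt_m : cpt m = pi *+ 2. by rewrite /cpt mulrC divfK// gt_eqF. Qed.
Let cpt_ge0 i : 0 <= cpt i. by []. Qed.
Let cpt_le i j : (i <= j)%N -> cpt i <= cpt j.
by move=> ij; rewrite /cpt ler_pM2r// ler_nat. Qed.

Definition incell (i : nat) : pred R := fun x => cpt i < x < cpt i.+1.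
Definition zc (i : nat) := seq.filter (incell i) s.

Let incell_ex x : x \in s -> \sum_(i < m) (incell i x : nat) = 1%N.
move=> /sP[/andP[x0 x2] hx].
pose i := Num.truncn (x / de).
have xd0 : 0 <= x / de by [].
have h1 : cpt i <= x by rewrite /cpt -ler_pdivlMr// truncn_le.
have h2 : x < cpt i.+1 by rewrite /cpt -ltr_pdivrMr// truncnS_gt.
have im : (i < m)%N.
 have im' : (i <= m)%N.
  rewrite -(ler_nat R) -(ler_pM2r de0); apply: le_trans h1 _.
  by apply: le_trans x2 _; have := cpt_m; rewrite /cpt => ->.
 rewrite ltn_neqAle im' andbT; apply/eqP => iE.
 have xE : x = cpt m by apply/eqP; rewrite eq_le -{2}iE h1 cpt_m x2.
 by have := nz (leqnn m); rewrite -xE hx eqxx.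
have h3 : cpt i < x.
 rewrite lt_def h1 andbT; apply/eqP => xE.
 by have := nz (ltnW im); rewrite -xE hx eqxx.
rewrite (bigD1 (Ordinal im))//= /incell h3 h2 big1// => j ji.
apply/eqP; rewrite eqb0; apply/negP => /andP[j1 j2].
case: (ltngtP i j) => ij.
- by have := lt_trans (le_lt_trans (cpt_le ij) j1) h2; rewrite ltxx.
- by have := lt_trans (le_lt_trans (cpt_le ij) h3) j2; rewrite ltxx.
- by move: ji; rewrite -val_eqE/= ij eqxx.
Qed.

Lemma sum_zc : \sum_(i < m) size (zc i) = size s.
have H (s' : seq R) : {subset s' <= s} -> \sum_(i < m) size (seq.filter (incell i) s') = size s'.
 elim: s' => [|x s' IH] ss; first by rewrite big1.
 rewrite (eq_bigr (fun i : 'I_m => (incell i x+size (seq.filter (incell i) s'))%N)); last first.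
  by move=> i _ /=; case: ifP.
 rewrite big_split/= incell_ex ?IH//; last by apply: ss; rewrite mem_head.
 by move=> y ys; apply: ss; rewrite in_cons ys orbT.
exact: H.
Qed.

Lemma mem_zc i x : (i < m)%N -> (x \in zc i) = (incell i x && (h x == 0)).
move=> im; rewrite mem_filter; case: (boolP (incell i x)) => //= /andP[h1 h2].
apply/idP/eqP => [/sP[]//|hx]; apply/sP; split => //.
rewrite (le_trans (cpt_ge0 i) (ltW h1))/= -cpt_m.
exact: le_trans (ltW h2) (cpt_le im).
Qed.

Lemma sc_le_zc i : (i < m)%N -> scf (h (cpt i)) (h (cpt i.+1)) <= (size (zc i))%:R.
move=> im; rewrite scf01; case: eqP => [_|/eqP ne] => //.
have ab : cpt i <= cpt i.+1 by exact: cpt_le.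
have [|y /andP[y1 y2] hy] := ivt_zero ab (hd 0%N).
 exact: sgr_neq_le0.
rewrite ler_nat -has_predT; apply/hasP; exists y => //.
rewrite mem_zc// hy eqxx andbT; apply/andP; split.
 rewrite lt_def y1 andbT; apply/eqP => yE.
 by have := nz (ltnW im); rewrite -yE hy eqxx.
rewrite lt_def y2 andbT; apply/eqP => yE.
by have := nz im; rewrite yE hy eqxx.
Qed.

(** Cells where h is small at both ends; only these can hide zeros from the sign count. *)
Definition badc (K : R) (i : nat) := (`|h (cpt i)| <= K) && (`|h (cpt i.+1)| <= K).

Let cell_sub i t : (i < m)%N -> cpt i <= t <= cpt i.+1 -> 0 <= t <= pi *+ 2.
move=> im /andP[t1 t2]; rewrite (le_trans (cpt_ge0 i) t1) (le_trans t2)//.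
by rewrite -cpt_m; exact: cpt_le.
Qed.

(** If a cell contains a zero of h and a zero of its derivative, two integrations give |h| <= (c
    de)^2 K on it, and the cell is bad. Otherwise h is strictly monotone on the cell, and a zero
    inside is unique and comes with a sign change. *)
Lemma zc_le_sc K i : (i < m)%N -> (forall t, 0 <= t <= pi *+ 2 -> `|f 2%N t| <= K) ->
 ~~ badc ((c * de)^+2*K) i -> (size (zc i))%:R <= scf (h (cpt i)) (h (cpt i.+1)).
move=> im hK nb; case E : (zc i) => [|x l].
 by rewrite scf01 ler0n.
have : x \in zc i by rewrite E mem_head.
rewrite mem_zc// => /andP[/andP[x1 x2] /eqP hx].
set a := cpt i in x1 nb *; set b := cpt i.+1 in x2 nb *.
have ba : b-a = de by rewrite /b cptS /a; ring.
have ab : a <= b by exact: cpt_le.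
have xab : a <= x <= b by rewrite !ltW.
have aab : a <= a <= b by rewrite lexx.
have bab : a <= b <= b by rewrite ab lexx.
have n1 t : a <= t <= b -> f 1%N t != 0.
 move=> tab; apply/eqP => ft; case/negP: nb.
 have h1 u : a <= u <= b -> `|f 1%N u| <= c*(b-a)*K by apply: (small_from_zero (ltW c0) (hd 1%N) tab ft) => v /(cell_sub im); exact: hK.
 have h2 u : a <= u <= b -> `|h u| <= (c * de)^+2*K.
  move=> uab; have := small_from_zero (ltW c0) (hd 0%N) xab hx h1 uab.
  by rewrite ba expr2 -!mulrA.
 by rewrite /badc !h2.
have sg t : a <= t <= b -> 0 < f 1%N a*f 1%N t.
 move=> /andP[t1 t2]; rewrite ltNge; apply/negP => h1.
 have [e /andP[e1 e2] he] := ivt_zero t1 (hd 1%N) h1.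
 by have := n1 e; rewrite he eqxx e1 (le_trans e2 t2) => /(_ isT).
have mon u v : a <= u -> u < v -> v <= b -> 0 < f 1%N a*(h v-h u).
 move=> au uv vb; have [e /andP[e1 e2] ->] := mvt (ltW uv) (fun t _ => hd 0%N t).
 rewrite -mulrA mulrCA pmulr_rgt0// mulrA mulr_gt0 ?subr_gt0// sg//.
 by rewrite (le_trans au e1) (le_trans e2 vb).
have m1 := mon a x (lexx _) x1 (ltW x2); have m2 := mon x b (ltW x1) x2 (lexx _).
rewrite hx in m1 m2.
have sc1 : scf (h a) (h b) = 1.
 exact: scf_opp m1 m2.
rewrite sc1; case: l E => [|y l] E => //.
have xy : x != y.
 have : uniq (zc i) by exact: filter_uniq.
 by rewrite E /= in_cons negb_or => /andP[/andP[]].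
have : y \in zc i by rewrite E !in_cons eqxx orbT.
rewrite mem_zc// => /andP[/andP[y1 y2] /eqP hy].
case: (ltgtP x y) xy => // xy _.
 by have := mon x y (ltW x1) xy (ltW y2); rewrite hx hy subrr mulr0 ltxx.
by have := mon y x (ltW y1) xy (ltW x2); rewrite hx hy subrr mulr0 ltxx.
Qed.

(** More than L zeros would force |h| <= (c de)^(L+1) K on the whole cell, end points included, by
    [zlist_small]. *)
Lemma zc_size K L i : (i < m)%N -> (forall t, 0 <= t <= pi *+ 2 -> `|f L.+1 t| <= K) ->
 (c * de)^+L.+1*K < `|h (cpt i)| -> (size (zc i) <= L)%N.
move=> im hK; apply: contraTT; rewrite -ltnNge -leNgt => Lz.
set a := cpt i; set b := cpt i.+1.
have ba : b-a = de by rewrite /b cptS /a; ring.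
have ab : a <= b by exact: cpt_le.
pose t := sort <=%O (zc i).
have st : size t = size (zc i) by rewrite size_sort.
have mt j : (j < size t)%N -> nth 0 t j \in zc i.
 by move=> jt; rewrite -(mem_sort <=%O) mem_nth.
have srt : sorted <%O t by rewrite sort_lt_sorted filter_uniq.
have zl : zlist h a b L (nth 0 t).
 split=> j jL.
 - have := mt j; rewrite st (leq_ltn_trans jL Lz) => /(_ isT).
  by rewrite mem_zc// => /andP[/andP[h1 h2] _]; rewrite !ltW.
 - apply: (sorted_ltn_nth lt_trans 0 srt); rewrite ?inE ?st//.
   exact: ltn_trans jL Lz.
  exact: leq_ltn_trans jL Lz.
 - have := mt j; rewrite st (leq_ltn_trans jL Lz) => /(_ isT).
  by rewrite mem_zc// => /andP[_ /eqP].
by rewrite -ba; apply: (zlist_small c0 hd zl (fun t ht => hK t (cell_sub im ht))); rewrite lexx.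
Qed.

Lemma zeros_ge_sc : \sum_(i < m) scf (h (cpt i)) (h (cpt i.+1)) <= (size s)%:R.
by rewrite -sum_zc natr_sum; apply: ler_sum => i _; exact: sc_le_zc. Qed.

Lemma zeros_le_sc K L kap : (forall t, 0 <= t <= pi *+ 2 -> `|f 2%N t| <= K) -> (c * de)^+2*K <= kap ->
 (forall i, (i < m)%N -> (size (zc i) <= L)%N) ->
 (size s)%:R <= \sum_(i < m) scf (h (cpt i)) (h (cpt i.+1))+L%:R*\sum_(i < m) (badc kap i)%:R.
move=> hK hk hL; rewrite -sum_zc natr_sum mulr_sumr -big_split/=; apply: ler_sum => i _.
case: (boolP (badc kap i)) => bi.
 by rewrite mulr1 scf01 (le_via L%:R) ?ler_nat ?hL// lerDr ler0n.
rewrite mulr0 addr0; apply: (zc_le_sc (ltn_ord i) hK); apply: contraNN bi => /andP[h1 h2].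
by rewrite /badc (le_trans h1 hk) (le_trans h2 hk).
Qed.

End cells.

Lemma nb_zeros_seq (h : R -> R) : finite_set [set x : R | 0 <= x <= pi *+ 2 /\ h x = 0] ->
 exists s : seq R, [/\ uniq s, forall x, x \in s <-> (0 <= x <= pi *+ 2 /\ h x = 0) &
  nb_zeros h = (size s)%:R].
set Z := [set x | _] => fZ; exists (finmap.enum_fset (fset_set Z)); split; first exact: finmap.fset_uniq.
 by move=> x; rewrite in_fset_set//; split; rewrite inE.
by rewrite /nb_zeros /counting -/Z asboolT.
Qed.

End zeros_deterministic.

(** * Normalised derivatives of the trigonometric vectors *)

Section trig_derivatives.
Variable R : realType.

(** The m-th derivative of [trig] in t divided by n^m: since k < n, its norm is bounded uniformly in
    m. *)
Definition trigd n (w : 'I_n -> R) (m : nat) (t : R) (i : 'I_(n+n)) : R :=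
 match fintype.split i with
 | inl k => w k*(k%:R/n%:R)^+m*cos (k%:R * t+m%:R*(pi/2))
 | inr k => w k*(k%:R/n%:R)^+m*sin (k%:R * t+m%:R*(pi/2))
 end.

Lemma trigd_lshift n (w : 'I_n -> R) m t k : trigd w m t (lshift n k) =
 w k*(k%:R/n%:R)^+m*cos (k%:R * t+m%:R*(pi/2)).
by rewrite /trigd (unsplitK (inl k)). Qed.

Lemma trigd_rshift n (w : 'I_n -> R) m t k : trigd w m t (rshift n k) =
 w k*(k%:R/n%:R)^+m*sin (k%:R * t+m%:R*(pi/2)).
by rewrite /trigd (unsplitK (inr k)). Qed.

Lemma trigd0 n (w : 'I_n -> R) t : trigd w 0 t = trig w t.
apply/funext => i; rewrite /trigd /trig; case: fintype.split => k;
by rewrite expr0 mulr1 mul0r addr0.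
Qed.

Lemma trigd_nsq_le n (w : 'I_n -> R) m t : \sum_i trigd w m t i^+2 <= \sum_k w k^+2.
rewrite sum_split2; apply: ler_sum => k _; rewrite trigd_lshift trigd_rshift.
have k1 : k%:R/n%:R <= 1 :> R.
 have n0 : (0 < n)%N by exact: leq_ltn_trans (ltn_ord k).
 by rewrite ler_pdivrMr ?ltr0n// mul1r ler_nat ltnW.
have k0 : 0 <= k%:R/n%:R :> R by [].
move: (k%:R/n%:R) k0 k1 => q q0 q1.
rewrite !(exprMn _ (w k*q^+m)) -mulrDr cos2Dsin2 mulr1 exprMn.
by rewrite ler_piMr ?sqr_ge0// -exprM exprn_ile1.
Qed.

Lemma trigd_abs_le n (w : 'I_n -> R) m t i : bdd w 1 -> `|trigd w m t i| <= 1.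
move=> w1; have H (k : 'I_n) (c : R) : `|c| <= 1 -> `|w k*(k%:R/n%:R)^+m*c| <= 1.
 have k1 : k%:R/n%:R <= 1 :> R.
  have n0 : (0 < n)%N by exact: leq_ltn_trans (ltn_ord k).
  by rewrite ler_pdivrMr ?ltr0n// mul1r ler_nat ltnW.
 move=> c1; rewrite !normrM; apply: mulr_ile1 => //.
 apply: mulr_ile1 => //; rewrite normrX exprn_ile1//.
 by rewrite ger0_norm// divr_ge0.
rewrite /trigd; case: fintype.split => k; apply: H; [exact: cos_max|].
by rewrite -(ler_pXn2r (n := 2))// expr1n sqr_normr// sin2cos2 gerBl sqr_ge0.
Qed.

Lemma dot_trigd_der n (w : 'I_n -> R) m x t : (0 < n)%N ->
 der (fun s => dot (trigd w m s) x) t (n%:R * dot (trigd w m.+1 t) x).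
move=> n0; have nn : n%:R != 0 :> R by rewrite pnatr_eq0 -lt0n.
have E j s : dot (trigd w j s) x = \sum_k
  (tnth x (lshift n k)*(w k*(k%:R/n%:R)^+j)*cos (k%:R*s+j%:R*(pi/2)) +
  tnth x (rshift n k)*(w k*(k%:R/n%:R)^+j)*sin (k%:R*s+j%:R*(pi/2))) by rewrite /dot sum_split2; apply: eq_bigr => k _; rewrite trigd_lshift trigd_rshift; ring.
have -> := funext (E m).
have dl (k : 'I_n) : der (fun s : R => k%:R*s+m%:R*(pi/2)) t k%:R.
 apply: der_eq; first by apply: der_add; [apply: der_scale; exact: der_id|exact: der_cst].
 by rewrite mulr1 addr0.
apply: der_eq.
 apply: der_sum => k; apply: der_add; apply: der_scale.
  by apply: der_cos; exact: dl.
 by apply: der_sin; exact: dl.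
rewrite E mulr_sumr; apply: eq_bigr => k _.
have -> : k%:R * t+m.+1%:R*(pi/2) = k%:R * t+m%:R*(pi/2)+pi/2 by rewrite -natr1; ring.
rewrite cosDpihalf sinDpihalf exprS; field.
exact: nn.
Qed.

End trig_derivatives.

(** * The number of roots of a trigonometric polynomial *)

Section trig_roots.
Import mathcomp.real_closed.complex.
Variable R : realType.
Local Notation C := (complex R).

Let e (t : R) : C := Complex (cos t) (sin t).

Let eD s t : e (s+t) = e s*e t.
rewrite /e cosD sinD; apply/eqP; rewrite eq_complex eqxx/=.
by apply/eqP; ring.
Qed.

Let eX t k : e t^+k = e (k%:R * t).
elim: k => [|k IH]; last by rewrite exprS IH -eD -natr1 mulrDl mul1r addrC.
by rewrite expr0 mul0r /e cos0 sin0.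
Qed.

Let e_neq0 t : e t != 0.
apply/eqP => e0; have : e t*e (- t) = 1 by rewrite -eD subrr /e cos0 sin0.
by rewrite e0 mul0r => /eqP; rewrite eq_sym oner_eq0.
Qed.

Let e_inj s t : 0 <= s < pi *+ 2 -> 0 <= t < pi *+ 2 -> e s = e t -> s = t.
wlog st : s t/s <= t.
 by move=> H hs ht E; have [st|/ltW st] := leP s t; [exact: H|exact/esym/H].
move=> /andP[s0 s2] /andP[t0 t2] [ec es].
apply/eqP; rewrite eq_le st/= leNgt; apply/negP => lt.
have c1 : cos (t-s) = 1 by rewrite cosB ec es -!expr2 cos2Dsin2.
have s0' : 0 < sin ((t-s)/2) by apply: sin_gt0_pi; apply/andP; split; move: t2; rewrite -mulr_natl; lra.
have : cos (t-s) = 1-2*sin ((t-s)/2)^+2.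
 rewrite [in LHS](_ : t-s = (t-s)/2+(t-s)/2); last by field.
 by rewrite cosD -!expr2 cos2sin2; ring.
by rewrite c1; have := exprn_gt0 2 s0'; lra.
Qed.

Variables (n : nat) (a b : 'I_n -> R).
Definition tpoly (t : R) : R := \sum_k (a k*cos (k%:R * t)+b k*sin (k%:R * t)).

Let A k : C := Complex (a k/2) (- (b k/2)).
Let B k : C := Complex (a k/2) (b k/2).
Let p : {poly C} := \sum_k (A k *: 'X^(n.-1+k)+B k *: 'X^(n.-1-k)).

Let p_eval t : p.[e t] = e (n.-1%:R * t)*Complex (tpoly t) 0.
rewrite /p horner_sum.
have -> : Complex (tpoly t) 0 = \sum_k (Complex (a k*cos (k%:R * t)+b k*sin (k%:R * t)) 0 : C).
 rewrite /tpoly; elim/big_rec2 : _ => // k y1 y2 _ <-.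
 by apply/eqP; rewrite eq_complex /= addr0 !eqxx.
rewrite mulr_sumr; apply: eq_bigr => k _.
rewrite hornerD !hornerZ !hornerXn !eX.
have kn : (k <= n.-1)%N by rewrite -ltnS (ltn_predK (ltn_ord k)).
rewrite natrD natrB// mulrDl mulrBl !eD [e (- _)]/e cosN sinN.
rewrite mulrCA [B k*_]mulrCA -mulrDr; congr (_*_).
rewrite /A /B /e; set c := cos _; set s := sin _.
by apply/eqP; rewrite eq_complex /=; apply/andP; split; apply/eqP; field.
Qed.

Let size_p : (0 < n)%N -> (size p < n.*2)%N.
move=> n0; apply: (@leq_ltn_trans (n.*2.-1)); last by rewrite ltn_predL double_gt0.
apply: leq_trans (size_sum _ _ _) _; apply/bigmax_leqP => k _.
have kn : (k <= n.-1)%N by rewrite -ltnS prednK// ltn_ord.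
apply: leq_trans (size_polyD _ _) _; rewrite geq_max; apply/andP; split.
 apply: leq_trans (size_scale_leq _ _) _; rewrite size_polyXn.
 by rewrite -ltnS prednK ?double_gt0// -addnn -addSn prednK// -addnS leq_add2l ltn_ord.
apply: leq_trans (size_scale_leq _ _) _; rewrite size_polyXn.
rewrite -ltnS prednK ?double_gt0// -addnn.
apply: (@leq_ltn_trans n); last by rewrite -{1}(addn0 n) ltn_add2l.
by rewrite -[X in (_ < X)%N](prednK n0) ltnS leq_subr.
Qed.

(** Times e^(i(n-1)t), the trigonometric polynomial is the value at e^(it) of a complex polynomial p
    of degree at most 2n-2, and e^(it) is injective on [0, 2 pi). With 2n roots, p vanishes
    identically. *)
Lemma tpoly_roots (s : seq R) : uniq s -> (forall t, t \in s -> 0 <= t < pi *+ 2) ->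
 (forall t, t \in s -> tpoly t = 0) -> (n.*2 <= size s)%N -> forall t, tpoly t = 0.
move=> us s2 s0 ss t.
have [n0|n0] := posnP n.
 by rewrite /tpoly; case: n n0 a b => // _ a' b'; rewrite big_ord0.
have p0 : p = 0.
 apply/eqP; apply: contraTT ss => pn; rewrite -ltnNge.
 apply: leq_trans (size_p n0); rewrite ltnS -(size_map e); apply: ltnW.
 apply: max_poly_roots => //.
  apply/allP => z /mapP[y ys ->]; apply/rootP; rewrite p_eval s0//.
  by rewrite (_ : Complex 0 0 = 0 :> C)// mulr0.
 rewrite map_inj_in_uniq// => x y xs ys; exact: e_inj (s2 x xs) (s2 y ys).
have := p_eval t; rewrite p0 horner0 => /esym/eqP; rewrite mulf_eq0 (negPf (e_neq0 _))/=.
by rewrite eq_complex => /andP[/eqP].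
Qed.

Lemma tpoly_zeros_le (s : seq R) t0 : tpoly t0 != 0 -> uniq s ->
 (forall t, t \in s -> 0 <= t <= pi *+ 2 /\ tpoly t = 0) -> (size s <= n.*2)%N.
move=> t0n us hs; rewrite leqNgt; apply/negP => lt.
(* The end point 2 pi is removed, since it gives the same root of p as 0. *)
move/eqP : t0n; apply; apply: (@tpoly_roots (rem (pi *+ 2) s)).
- exact: rem_uniq.
- move=> t; rewrite mem_rem_uniq// inE => /andP[tn ts].
 by have [/andP[-> t2] _] := hs t ts; rewrite lt_def eq_sym tn.
- by move=> t /mem_rem ts; case: (hs t ts).
- case: (boolP (pi *+ 2 \in s)) => [i|i]; first by rewrite size_rem// -ltnS (ltn_predK lt).
 by rewrite rem_id// ltnW.
Qed.

Lemma tpoly_zeros_finite t0 : tpoly t0 != 0 ->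
 finite_set [set x : R | 0 <= x <= pi *+ 2 /\ tpoly x = 0].
move=> t0n; apply: contrapT => inf.
have [F FZ nF] := infinite_set_fset n.*2.+1 inf.
have := @tpoly_zeros_le (finmap.enum_fset F) t0 t0n (finmap.fset_uniq F).
move=> /(_ _) H; have {}H := H (fun t tF => FZ t tF).
by move: (leq_trans nF H); rewrite ltnn.
Qed.

Lemma nb_zeros_tpoly : 0 <= nb_zeros tpoly <= n.*2%:R.
(* An infinite zero set counts as 0 by convention. *)
have [fZ|inf] := pselect (finite_set [set x : R | 0 <= x <= pi *+ 2 /\ tpoly x = 0]); last first.
 by rewrite /nb_zeros /counting asboolF//= lexx ler0n.
have [s [us sP ->]] := nb_zeros_seq fZ; rewrite ler0n ler_nat/=.
(* A polynomial vanishing identically would vanish at the [size s + 1] points i/(size s + 1) of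
   [0, 1], more than the complete list [s] of zeros can contain. *)
have [t0 ht0] : exists t0, tpoly t0 != 0.
 apply: contrapT => /forallNP h0.
 pose q := [seq i%:R/(size s).+1%:R : R | i <- iota 0 (size s).+1].
 have uq : uniq q.
  rewrite map_inj_uniq ?iota_uniq// => i j /(mulIf _) h.
  by apply/eqP; rewrite -(eqr_nat R); apply/eqP/h.
 have : (size q <= size s)%N.
  apply: uniq_leq_size => // x xq.
  have /mapP[j] := xq; rewrite mem_iota add0n => /andP[_ im] ->.
  apply/sP; split; last by apply/eqP/negPn/negP/h0.
  rewrite divr_ge0//= ler_pdivrMr//; apply: (le_via (1*(size s).+1%:R)).
   by rewrite mul1r ler_nat ltnW.
  by rewrite ler_pM2r// -mulr_natl; have := @pi_ge2 R; lra.
 by rewrite size_map size_iota ltnn.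
by apply: (tpoly_zeros_le ht0 us) => t /sP.
Qed.

End trig_roots.

(** * Sigmoid approximation of the sign *)

Section sigmoid.
Variable R : realType.
Implicit Types x y z : R.

(** This is tanh(z/2). It solves y' = (1 - y^2)/2, so its derivatives are polynomials in y and
    bounded. *)
Definition sigm z : R := 1-2*(1+expR z)^-1.
Definition dsigm z : R := (1-sigm z^+2)/2.
Definition ddsigm z : R := - (sigm z * dsigm z).
Definition dddsigm z : R := - (dsigm z^+2+sigm z * ddsigm z).

Let e1 z : 0 < 1+expR z. by []. Qed.

Lemma sigm_lt z : -1 < sigm z < 1.
have e0 := expR_gt0 z; have i0 : 0 < (1+expR z)^-1 by rewrite invr_gt0.
have i1 : (1+expR z)^-1 < 1 by rewrite invf_lt1; lra.
by rewrite /sigm; apply/andP; split; lra.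
Qed.

Lemma sigm_norm z : `|sigm z| <= 1.
by have /andP[h1 h2] := sigm_lt z; rewrite ler_norml !ltW. Qed.

Lemma der_sigm z : der sigm z (dsigm z).
apply: der_eq.
 apply: der_sub; first exact: der_cst.
 apply: der_scale; apply: der_inv; first by rewrite gt_eqF.
 by apply: der_add; [exact: der_cst|apply: der_expR; exact: der_id].
by rewrite /dsigm /sigm; field.
Qed.

Lemma der_dsigm z : der dsigm z (ddsigm z).
rewrite (_ : dsigm = fun t => 2^-1*(1-sigm t^+2)); last first.
 by apply/funext => t; rewrite /dsigm mulrC.
apply: der_eq.
 apply: der_scale; apply: der_sub; first exact: der_cst.
 by apply: der_exp; exact: der_sigm.
by rewrite /ddsigm; field.
Qed.

Lemma der_ddsigm z : der ddsigm z (dddsigm z).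
apply: der_eq.
 by apply: der_opp; apply: der_mul; [exact: der_sigm|exact: der_dsigm].
by rewrite /dddsigm; ring.
Qed.

Lemma dsigm_norm z : `|dsigm z| <= 2^-1.
have h : sigm z^+2 <= 1 by rewrite -(sqr_normr _) exprn_ile1// sigm_norm.
by rewrite ger0_norm /dsigm; have := sqr_ge0 (sigm z); lra.
Qed.

Lemma ddsigm_norm z : `|ddsigm z| <= 2^-1.
rewrite normrN normrM -[leRHS]mul1r; apply: ler_pM => //; [exact: sigm_norm|exact: dsigm_norm].
Qed.

Lemma dddsigm_norm z : `|dddsigm z| <= 1.
rewrite normrN; apply: ler_normD_via.
have h1 : `|dsigm z^+2| <= 2^-1.
 rewrite normrX expr2; have := dsigm_norm z; have := normr_ge0 (dsigm z); nra.
have h2 : `|sigm z * ddsigm z| <= 2^-1 by rewrite normrM -[leRHS]mul1r; apply: ler_pM => //; [exact: sigm_norm|exact: ddsigm_norm].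
by lra.
Qed.

Lemma der_meas (f df : R -> R) : (forall x, der f x (df x)) -> msr f.
by move=> h; apply: continuous_measurable_fun => x; exact: der_continuous (h x).
Qed.

Lemma msr_sigm : msr sigm. exact: der_meas der_sigm. Qed.
Lemma msr_dsigm : msr dsigm. exact: der_meas der_dsigm. Qed.

Lemma sigmN z : sigm (- z) = - sigm z.
have e0 := expR_gt0 z; have e0' := e1 z.
by rewrite /sigm expRN; field; rewrite !gt_eqF.
Qed.

Lemma sigm_sgr z : z != 0 -> `|sigm z-sgr z| <= 2 / `|z|.
wlog z0 : z/0 <= z.
 move=> H zn; have [z0|/ltW z0] := leP 0 z; first exact: H.
 have := H (- z); rewrite oppr_ge0 oppr_eq0 normrN sigmN sgrN// => /(_ z0 zn).
 by rewrite -opprD normrN.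
move=> zn; have zp : 0 < z by rewrite lt_def zn.
rewrite /sgr ltNge z0/= (gtr0_norm zp) /sigm.
have -> : 1-2*(1+expR z)^-1-1 = - (2*(1+expR z)^-1) by ring.
rewrite normrN ger0_norm => //.
rewrite ler_pM2l// lef_pV2 ?posrE//.
by have := expR_ge1Dx z; lra.
Qed.

Lemma sigm_cvg y : y != 0 -> sigm (k%:R*y) @[k --> \oo] --> sgr y.
move=> y0; apply/cvgrPdist_le => eps eps0.
have yp : 0 < `|y| by rewrite normr_gt0.
near=> k.
have k0 : 0 < k%:R :> R by near: k; exists 1%N => // k /=; rewrite ltr0n.
have ky : k%:R*y != 0 by rewrite mulf_neq0// gt_eqF.
rewrite distrC -[sgr y](sgr_pmul y k0); apply: le_trans (sigm_sgr ky) _.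
rewrite normrM gtr0_norm// ler_pdivrMr ?mulr_gt0//.
have : 2/(eps * `|y|) <= k%:R.
 near: k; exists (Num.truncn (2/(eps * `|y|))).+1 => // k /= hk.
 by apply: ltW; apply: lt_le_trans (truncnS_gt _) _; rewrite ler_nat.
rewrite ler_pdivrMr ?mulr_gt0// => h.
by rewrite mulrCA.
Unshelve. all: by end_near.
Qed.

End sigmoid.

(** * Block functions: sign changes, double changes, smoothing errors, bumps *)

Section block_instances.
Variables (R : realType) (n d : nat) (U : 'I_d -> 'I_n -> R).
Notation tp := (n.-tuple R).

Lemma gsm_sigm (l : 'I_d) (kap : R) : gsm U (fun x => sigm (kap * dot (U l) x)).
have dl (f df : R -> R) : (forall x, der f x (df x)) ->
  forall y : R, der (fun t => f (kap * t)) y (df (kap*y)*kap).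
 move=> h y; apply: der_eq.
  by apply: der_comp; [apply: der_scale; exact: der_id|exact: h].
 by rewrite mulr1.
have hL (a b : R) : `|a| <= 1 -> `|a*kap| <= `|kap| by move=> h; rewrite normrM ler_piMl.
apply: (@gsm_dot R n d U l (fun y => sigm (kap*y)) (fun y => dsigm (kap*y)*kap) (1 + `|kap| + kap^+2)).
- exact: (measurableT_comp (@msr_sigm R)).
- apply: measurable_funM; last exact: measurable_cst.
 exact: (measurableT_comp (@msr_dsigm R)).
- move=> x; have := sigm_norm (kap*x); have := normr_ge0 kap; have := sqr_ge0 kap; lra.
- move=> x; have := @hL (dsigm (kap*x)) 0; have := dsigm_norm (kap*x) => h1 h2.
 have := sqr_ge0 kap; have : `|dsigm (kap*x)*kap| <= `|kap| by apply: h2; lra.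
 by lra.
- apply: (@taylor2_norm _ _ _ (fun y => ddsigm (kap*y)*kap*kap)) => x.
 + exact: dl (@der_sigm R) x.
 + rewrite (_ : (fun y : R => dsigm (kap*y)*kap) = fun y => kap * dsigm (kap*y)); last first.
   by apply/funext => y; rewrite mulrC.
  by apply: der_eq; [apply: der_scale; exact: dl (@der_dsigm R) x|rewrite mulrC].
 + rewrite -mulrA normrM -expr2 (ger0_norm (sqr_ge0 _)).
  have h := ddsigm_norm (kap*x).
  have : `|ddsigm (kap*x)|*kap^+2 <= 1*kap^+2 by apply: ler_wpM2r; [exact: sqr_ge0|lra].
  by have := normr_ge0 kap; lra.
Qed.

Lemma ae_dot_neq0 (u : 'I_n -> R) : \sum_i u i^+2 != 0 ->
 {ae gauss n, forall x, dot u x != 0}.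
move=> un; pose Z := [set x : R | x = 0].
have mZ : measurable Z by exact: measurable_set1.
have ms : msr (fun x : R => Num.sqrt (\sum_i u i^+2)*x) by [].
have E := eqlaw_measure (msr_dot u) ms (@eqlaw_dot R n u) mZ.
exists (dot u @^-1` Z); split.
- by rewrite -[X in measurable X]setTI; exact: (msr_dot u).
- rewrite E (_ : _ @^-1` Z = [set 0]); first exact: gam_set1.
 apply/seteqP; split => x; rewrite /Z/=; last by move=> ->; rewrite mulr0.
 move=> /eqP; rewrite mulf_eq0 => /orP[|/eqP//].
 rewrite sqrtr_eq0 => h; exfalso; move/negP: un; apply.
 by rewrite eq_le h/=.
- by move=> x /= /negP; rewrite negbK => /eqP.
Qed.

Hypothesis Un0 : forall l, \sum_i U l i^+2 != 0.

Let S l k (x : tp) := sigm (k%:R * dot (U l) x).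
Let s l (x : tp) := sgr (dot (U l) x).

Lemma sgr_limit : {ae gauss n, forall x, forall l, S l k x @[k --> \oo] --> s l x}.
apply: near_forall_fin => l; apply: filterS (ae_dot_neq0 (Un0 l)) => x; exact: sigm_cvg.
Qed.

Let S1 l k x : `|S l k x| <= 1. exact: sigm_norm. Qed.
Let s1 l x : `|s l x| <= 1. by rewrite sgr_norm. Qed.
Let gS l k : gsm U (S l k). exact: gsm_sigm. Qed.
Let ms l : msr (s l).
exact: (measurableT_comp (@msr_sgr R)). Qed.

Let mul1 (a b : R) : `|a| <= 1 -> `|b| <= 1 -> `|a*b| <= 1.
by move=> h1 h2; rewrite normrM mulr_ile1. Qed.

Lemma blockfn_scf l l' : blockfn U (fun x => scf (dot (U l) x) (dot (U l') x)).
have b (a b : R) : `|a| <= 1 -> `|b| <= 1 -> `|2^-1 + - 2^-1*(a*b)| <= 1.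
 by move=> h1 h2; have := mul1 h1 h2; rewrite !ler_norml => /andP[? ?]; apply/andP; split; lra.
have E x : scf (dot (U l) x) (dot (U l') x) = 2^-1 + - 2^-1*(s l x*s l' x) by rewrite /scf -/(s l x) -/(s l' x); field.
rewrite (funext E); split.
- by [].
- by move=> x; exact: b.
exists (fun k x => 2^-1 + - 2^-1*(S l k x*S l' k x)); split.
- by move=> k; apply: gsm_add; [exact: gsm_cst|apply: gsm_scale; exact: gsm_mul].
- by move=> k x; exact: b.
- apply: filterS sgr_limit => x h; apply: cvgD; first exact: cvg_cst.
 by apply: cvgM; [exact: cvg_cst|apply: cvgM; exact: h].
Qed.

(** Indicator that y has the sign opposite to both x and z: the pair of sign changes that is lost
    when the middle point is dropped. *)
Definition scB (x y z : R) : R := (1+sgr x*sgr z-sgr x*sgr y-sgr y*sgr z)/4.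

Lemma blockfn_scB l l' l'' : blockfn U (fun x => scB (dot (U l) x) (dot (U l') x) (dot (U l'') x)).
have b (a b c : R) : `|a| <= 1 -> `|b| <= 1 -> `|c| <= 1 ->
  `|4^-1+4^-1*(a*c) + - 4^-1*(a*b) + - 4^-1*(b*c)| <= 1.
 move=> h1 h2 h3; have := mul1 h1 h2; have := mul1 h2 h3; have := mul1 h1 h3.
 by rewrite !ler_norml => /andP[? ?] /andP[? ?] /andP[? ?]; apply/andP; split; lra.
have E x : scB (dot (U l) x) (dot (U l') x) (dot (U l'') x) =
  4^-1+4^-1*(s l x*s l'' x) + - 4^-1*(s l x*s l' x) + - 4^-1*(s l' x*s l'' x) by rewrite /scB -/(s l x) -/(s l' x) -/(s l'' x); field.
rewrite (funext E); split.
- apply: measurable_funD; last by apply: measurable_funM.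
 by apply: measurable_funD.
- by move=> x; exact: b.
exists (fun k x => 4^-1+4^-1*(S l k x*S l'' k x) + - 4^-1*(S l k x*S l' k x) + - 4^-1*(S l' k x*S l'' k x)); split.
- move=> k; apply: gsm_add; last by apply: gsm_scale; exact: gsm_mul.
 apply: gsm_add; last by apply: gsm_scale; exact: gsm_mul.
 by apply: gsm_add; [exact: gsm_cst|apply: gsm_scale; exact: gsm_mul].
- by move=> k x; exact: b.
- apply: filterS sgr_limit => x h.
 apply: cvgD; last by apply: cvgM; [exact: cvg_cst|apply: cvgM; exact: h].
 apply: cvgD; last by apply: cvgM; [exact: cvg_cst|apply: cvgM; exact: h].
 apply: cvgD; first exact: cvg_cst.
 by apply: cvgM; [exact: cvg_cst|apply: cvgM; exact: h].
Qed.

Definition scT (kap x y : R) : R := (1-sigm (kap*x)*sigm (kap*y))/2.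

Lemma blockfn_diff kap l l' :
 blockfn U (fun x => scf (dot (U l) x) (dot (U l') x)-scT kap (dot (U l) x) (dot (U l') x)).
pose T l x := sigm (kap * dot (U l) x).
have T1 i x : `|T i x| <= 1 by exact: sigm_norm.
have gT i : gsm U (T i) by exact: gsm_sigm.
have b (a b c e : R) : `|a| <= 1 -> `|b| <= 1 -> `|c| <= 1 -> `|e| <= 1 ->
  `|2^-1*(a*b) + - 2^-1*(c*e)| <= 1.
 move=> h1 h2 h3 h4; have := mul1 h1 h2; have := mul1 h3 h4.
 by rewrite !ler_norml => /andP[? ?] /andP[? ?]; apply/andP; split; lra.
have E x : scf (dot (U l) x) (dot (U l') x)-scT kap (dot (U l) x) (dot (U l') x) =
  2^-1*(T l x*T l' x) + - 2^-1*(s l x*s l' x) by rewrite /scf /scT -/(s l x) -/(s l' x) -/(T l x) -/(T l' x); field.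
rewrite (funext E); split.
- apply: measurable_funD; apply: measurable_funM; try exact: measurable_cst.
  by apply: measurable_funM; exact: gsm_meas (gT _).
 by [].
- by move=> x; exact: b.
exists (fun k x => 2^-1*(T l x*T l' x) + - 2^-1*(S l k x*S l' k x)); split.
- by move=> k; apply: gsm_add; apply: gsm_scale; exact: gsm_mul.
- by move=> k x; exact: b.
- apply: filterS sgr_limit => x h; apply: cvgD; first exact: cvg_cst.
 by apply: cvgM; [exact: cvg_cst|apply: cvgM; exact: h].
Qed.

(** Smooth substitute for the indicator of |x| <= kap, on which it is at least e^(-1/2); its
    Gaussian expectations are explicit. *)
Definition bump (kap x : R) : R := expR (- (kap^-1^+2*x^+2/2)).

Lemma bump_bounds (kap x : R) : 0 <= bump kap x <= 1.
rewrite expR_ge0 -[leRHS]expR0 ler_expR oppr_le0.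
exact: mulr_ge0.
Qed.

Lemma bump_norm (kap x : R) : `|bump kap x| <= 1.
by have /andP[h1 h2] := bump_bounds kap x; rewrite ger0_norm. Qed.

Lemma msr_bump (kap : R) : msr (bump kap).
exact: msr_expR_sq. Qed.

Lemma gsm_bump (l : 'I_d) (kap : R) : gsm U (fun x => bump kap (dot (U l) x)).
set c := kap^-1^+2; have c0 : 0 <= c by exact: sqr_ge0.
have cb (x : R) : c*x^+2*bump kap x <= 2.
 have h := expR_ge1Dx (c*x^+2/2); rewrite /bump expRN ler_pdivrMr ?expR_gt0//.
 by have : 0 <= c*x^+2 by [nneg]; lra.
pose db x := - (c*x)*bump kap x.
pose ddb x := (c^+2*x^+2-c)*bump kap x.
have hb x : der (bump kap) x (db x).
 apply: der_eq.
  apply: der_expR; apply: der_opp.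
  rewrite (_ : (fun t : R => c * t^+2/2) = fun t => c/2 * t^+2); last first.
   by apply/funext => t; ring.
  by apply: der_scale; apply: der_exp; exact: der_id.
 by rewrite /db /bump -/c; field.
have hdb x : der db x (ddb x).
 apply: der_eq.
  by apply: der_mul; [apply: der_opp; apply: der_scale; exact: der_id|exact: hb].
 by rewrite /ddb /db; ring.
have ddb_le x : `|ddb x| <= 2*c+c.
 rewrite /ddb mulrBl; apply: ler_normB_via.
 have /andP[b0 b1] := bump_bounds kap x.
 have h1 : c^+2*x^+2*bump kap x = c*(c*x^+2*bump kap x) by ring.
 have h2 := ler_wpM2l c0 (cb x); have h3 := ler_wpM2l c0 b1.
 have h4 : 0 <= c*bump kap x by [].
 have h5 : 0 <= c*(c*x^+2*bump kap x) by [].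
 by rewrite h1 !ger0_norm; lra.
have db_le x : `|db x| <= 2+c.
 have /andP[b0 b1] := bump_bounds kap x.
 have h : c * `|x| <= c*x^+2+c.
  have : `|x| <= x^+2+1 by rewrite -(sqr_normr x); have := sqr_ge0 (`|x| - 1); have := normr_ge0 x; lra.
  by move=> /(ler_wpM2l c0); lra.
 have h3 := ler_wpM2l c0 b1.
 rewrite /db normrM normrN normrM (ger0_norm c0) (ger0_norm b0).
 by have := ler_wpM2r b0 h; have := cb x; lra.
apply: (@gsm_dot R n d U l (bump kap) db (3+3*c)).
- exact: msr_bump.
- exact: der_meas hdb.
- by move=> x; apply: le_trans (bump_norm _ _) _; lra.
- by move=> x; apply: le_trans (db_le x) _; lra.
- apply: taylor2_norm hb hdb _ => x; apply: le_trans (ddb_le x) _; lra.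
Qed.

Lemma blockfn_bump kap l l' : blockfn U (fun x => bump kap (dot (U l) x)*bump kap (dot (U l') x)).
have g : gsm U (fun x => bump kap (dot (U l) x)*bump kap (dot (U l') x)) by apply: gsm_mul; exact: gsm_bump.
split; first exact: gsm_meas g.
 by move=> x; apply: mul1; exact: bump_norm.
exists (fun _ x => bump kap (dot (U l) x)*bump kap (dot (U l') x)); split => //.
- by move=> k x; apply: mul1; exact: bump_norm.
- by apply: aeW => x; exact: cvg_cst.
Qed.

End block_instances.

Ltac measurable_leaf4 := first [ measurable_leaf3 | exact: msr_sigm | exact: msr_dsigm | exact: msr_bump ].
Ltac measurable_leaf ::= measurable_leaf4.

(** * Covariance of the process and probabilities at two or three points *)

Section trig_process_law.
Variables (R : realType) (n : nat).
Hypothesis n4 : (4 <= n)%N.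
Notation tp := ((n+n).-tuple R).
Notation G := (gauss (R := R) (n+n)).

Let n0 : (0 < n)%N. exact: leq_trans n4. Qed.
Let nR : 0 < n%:R :> R. by rewrite ltr0n. Qed.

Definition hx (t : R) (x : tp) : R := dot (trig (@wunit R n) t) x.

Lemma msr_hx t : msr (hx t). exact: msr_dot. Qed.

Notation rr := (covf (@wunit R n)).

Lemma rr0 : rr 0 = 1.
rewrite covf0 (eq_bigr (fun=> n%:R^-1)); last by move=> k _; exact: wunit_sq.
by rewrite sumr_const card_ord -[LHS]mulr_natl mulfV// gt_eqF.
Qed.

Lemma trig_unit t : \sum_i trig (@wunit R n) t i^+2 = 1.
by rewrite trig_nsq rr0. Qed.

(** Second spectral moment: minus the second derivative of [covf w] at 0. *)
Definition lam2 (w : 'I_n -> R) : R := \sum_k w k^+2*k%:R^+2.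

Lemma covf_lower (w : 'I_n -> R) t : covf w 0-lam2 w * t^+2/2 <= covf w t.
rewrite covf0 /lam2 !mulr_suml -sumrB; apply: ler_sum => k _.
rewrite (_ : _-_ = w k^+2*(1-(k%:R * t)^+2/2)); last by field.
by apply: ler_wpM2l; [exact: sqr_ge0|exact: cos_ge2].
Qed.

Lemma covf_upper (w : 'I_n -> R) t :
 covf w t <= covf w 0-lam2 w * t^+2/2+covf w 0*(n%:R * t)^+4/24.
rewrite covf0 /lam2 !mulr_suml -sumrB -big_split/=; apply: ler_sum => k _.
apply: le_trans (ler_wpM2l (sqr_ge0 _) (cos_le4 (k%:R * t))) _.
have h : (k%:R * t)^+4 <= (n%:R * t)^+4.
 rewrite !exprMn; apply: ler_wpM2r; first by rewrite (exprM t 2 2) sqr_ge0.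
 by apply: lerXn2r; rewrite ?nnegrE// ler_nat ltnW.
have := ler_wpM2l (sqr_ge0 (w k)) h; lra.
Qed.

Lemma covf_norm (w : 'I_n -> R) t : `|covf w t| <= covf w 0.
rewrite covf0; apply: le_trans (ler_norm_sum _ _ _) _; apply: ler_sum => k _.
by rewrite normrM ger0_norm ?sqr_ge0// ler_piMr ?sqr_ge0// cos_max.
Qed.

Lemma rr_norm t : -1 <= rr t <= 1.
by rewrite -ler_norml -rr0; exact: covf_norm. Qed.

(** Root mean square frequency of the process, of order n. *)
Definition kap0 : R := Num.sqrt (lam2 (@wunit R n)).

Lemma kap0_sq : kap0^+2 = lam2 (@wunit R n).
by rewrite sqr_sqrtr// /lam2. Qed.

Lemma sum_sq_ord m : 6*\sum_(k < m) k%:R^+2 = (m%:R-1) * m%:R*(2 * m%:R-1) :> R.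
elim: m => [|m IH]; first by rewrite big_ord0 mulr0 mulr0 mul0r.
by rewrite big_ord_recr/= mulrDr IH -natr1; ring.
Qed.

Lemma kap0_bounds : n%:R/3 <= kap0 <= n%:R.
have n4' : 4 <= n%:R :> R by rewrite (ler_nat R 4).
have E : kap0^+2 = (n%:R-1)*(2*n%:R-1)/6.
 rewrite kap0_sq /lam2 (eq_bigr (fun k : 'I_n => n%:R^-1*k%:R^+2)); last first.
  by move=> k _; rewrite wunit_sq.
 rewrite -mulr_sumr; apply: (mulfI (x := 6*n%:R)) => //.
 rewrite [LHS](_ : _ = 6*(\sum_(k < n) k%:R^+2)*(n%:R/n%:R)); last by ring.
 by rewrite sum_sq_ord divff ?gt_eqF//; field.
have k0 : 0 <= kap0 by [].
apply/andP; split; rewrite -(ler_pXn2r (n := 2)) ?divr_ge0// E; nra.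
Qed.

Lemma E_sgr2 t t' : Ex G (fun x => sgr (hx t x)*sgr (hx t' x)) = 1-2*acos (rr (t-t'))/pi.
by rewrite (@sign_corr R _ _ _ 1) ?trig_unit// trig_inner divr1.
Qed.

Let msg t : msr (fun x => sgr (hx t x)).
by []. Qed.

Lemma intg_sgr2 t t' : intg G (fun x => sgr (hx t x)*sgr (hx t' x)).
apply: (intg_bnd 1) => //.
by move=> x; rewrite normrM !sgr_norm mulr1.
Qed.

Lemma E_scf t t' : Ex G (fun x => scf (hx t x) (hx t' x)) = acos (rr (t-t'))/pi.
have I := intg_sgr2 t t'; have p0 := @pi_gt0 R.
transitivity (Ex G (fun x => 2^-1-2^-1*(sgr (hx t x)*sgr (hx t' x)))).
 by apply: Ex_eq => x; rewrite /scf; field.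
rewrite ExB ?Ex_cst ?ExZ ?E_sgr2//; [|exact: intg_cst|exact: intgZ].
by rewrite -mulrA; move: (_/pi) => q; field.
Qed.

Lemma E_scB t s : Ex G (fun x => scB (hx t x) (hx (t+s) x) (hx (t+2*s) x)) =
 (2*acos (rr s)-acos (rr (2*s)))/(2 * pi).
have p0 := @pi_gt0 R; have I := intg_sgr2; have Z c u v := @intgZ _ _ _ G c _ (I u v).
transitivity (Ex G (fun x => 4^-1+4^-1*(sgr (hx t x)*sgr (hx (t+2*s) x))
  - 4^-1*(sgr (hx t x)*sgr (hx (t+s) x))-4^-1*(sgr (hx (t+s) x)*sgr (hx (t+2*s) x)))).
 by apply: Ex_eq => x; rewrite /scB; field.
have I0 : intg G (fun=> 4^-1) by exact: intg_cst.
rewrite ExB//; last by apply: intgB => //; exact: intgD.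
rewrite ExB//; last exact: intgD.
rewrite ExD// Ex_cst !ExZ// !E_sgr2.
have -> : t-(t+2*s) = - (2*s) by ring.
have -> : t-(t+s) = - s by ring.
have -> : t+s-(t+2*s) = - s by ring.
by rewrite !covfN invfM; move: pi^-1 => q; field.
Qed.

(** The angle acos(rr s) is kap0 s up to O((ns)^3), so the linear terms cancel in 2 acos(rr s) -
    acos(rr(2s)). *)
Lemma E_scB_le t s : 0 < s -> n%:R*s <= 1/2 ->
 Ex G (fun x => scB (hx t x) (hx (t+s) x) (hx (t+2*s) x)) <= (n%:R*s)^+3.
move=> s0 hs; rewrite E_scB; set X := n%:R*s in hs *.
have /andP[k1 k2] := kap0_bounds.
have X0 : 0 < X by [].
pose tau := kap0*s.
have t1 : X/3 <= tau by rewrite /X /tau mulrAC ler_pM2r.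
have t2 : tau <= X by rewrite /X /tau ler_pM2r.
have tau0 : 0 < tau by lra.
have low u : 1-(kap0*u)^+2/2 <= rr u.
 by have := covf_lower (@wunit R n) u; rewrite rr0 -kap0_sq -exprMn.
have up u : rr u <= 1-(kap0*u)^+2/2+(n%:R*u)^+4/24.
 by have := covf_upper (@wunit R n) u; rewrite rr0 -kap0_sq mul1r -exprMn.
have h1 : acos (rr s) <= tau+tau^+3 by apply: acos_upper (rr_norm s) (low s); apply/andP; split; rewrite -/tau; lra.
have h2 : 2 * tau-2*((2*X)^+4/24)/(2 * tau) <= acos (rr (2*s)).
 apply: acos_lower; [by rewrite mulr_gt0|by apply: divr_ge0 => //; apply: exprn_ge0; lra|exact: rr_norm|].
 have := up (2*s); rewrite (_ : kap0*(2*s) = 2 * tau); last by rewrite /tau; ring.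
 by rewrite (_ : n%:R*(2*s) = 2*X)//; rewrite /X; ring.
have h3 : 2*((2*X)^+4/24)/(2 * tau) <= 2*X^+3.
 have tt : 0 < 2 * tau by [].
 rewrite ler_pdivrMr//.
 have : X^+3*(X/3) <= X^+3 * tau by apply: ler_wpM2l.
 by rewrite (_ : (2*X)^+4 = 16*(X^+3*X)); [lra|ring].
have h4 : tau^+3 <= X^+3 by apply: lerXn2r.
have p2 := @pi_ge2 R; have X3 : 0 <= X^+3 by apply: exprn_ge0; exact: ltW.
have pp : 0 < 2 * pi :> R by [].
rewrite ler_pdivrMr//.
have : X^+3*4 <= X^+3*(2 * pi) by apply: ler_wpM2l; lra.
by lra.
Qed.

Lemma E_bump t (kap : R) : 0 < kap -> Ex G (fun x => bump kap (hx t x)) <= kap.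
move=> k0; set c := kap^-1^+2.
have c0 : 0 < c by [].
have mb := @msr_bump R kap.
have If : intg (gam (R := R)) (bump kap) by apply: (intg_bnd 1) => // x; exact: bump_norm.
have := @Ex_dot_gam R _ (trig (@wunit R n) t) (bump kap) mb.
rewrite trig_unit sqrtr1 (_ : (fun x => bump kap (1*x)) = bump kap); last first.
 by apply/funext => x; rewrite mul1r.
move=> /(_ If)[_ ->].
have := @Ex_gam_exp R c; rewrite -[Ex gam (fun x => expR _)]/(Ex gam (bump kap)) => -> //.
rewrite -[leRHS]invrK lef_pV2 ?posrE ?sqrtr_gt0 ?invr_gt0//.
have -> : kap^-1 = Num.sqrt c by rewrite /c sqrtr_sqr gtr0_norm// invr_gt0.
by apply: ler_wsqrtr; lra.
Qed.

(** The values at t and t+de have equal variances, so their sum and difference are independent and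
    the product of bumps splits along them. The sum has variance at least 2 and the difference at
    least (n de)^2/36; each factor of the expectation is of order kap over the standard
    deviation. *)
Lemma E_bump2 t de (kap : R) : 0 < kap -> 0 < de -> n%:R * de <= 1 ->
 Ex G (fun x => bump kap (hx t x)*bump kap (hx (t+de) x)) <= 9*kap^+2/(n%:R * de).
move=> k0 d0 hd; set X := n%:R * de in hd *; set rho := rr de.
have X0 : 0 < X by [].
pose u := trig (@wunit R n) t; pose v := trig (@wunit R n) (t+de).
have u2 : \sum_i u i^+2 = 1 by exact: trig_unit.
have v2 : \sum_i v i^+2 = 1 by exact: trig_unit.
have uv : \sum_i u i*v i = rho by rewrite trig_inner -covfN; congr (rr _); ring.
pose S i := u i+v i; pose D i := u i-v i.
have S2 : \sum_i S i^+2 = 2*(1+rho).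
 rewrite (eq_bigr (fun i => u i^+2+2*(u i*v i)+v i^+2)); last by move=> i _; rewrite /S; ring.
 by rewrite !big_split/= -mulr_sumr u2 v2 uv; ring.
have D2 : \sum_i D i^+2 = 2*(1-rho).
 rewrite (eq_bigr (fun i => u i^+2 + - 2*(u i*v i)+v i^+2)); last by move=> i _; rewrite /D; ring.
 by rewrite !big_split/= -mulr_sumr u2 v2 uv; ring.
have SD : \sum_i S i*D i = 0.
 rewrite (eq_bigr (fun i => u i^+2-v i^+2)); last by move=> i _; rewrite /S /D; ring.
 by rewrite sumrB u2 v2 subrr.
have /andP[k1 k2] := kap0_bounds.
have r1 : X^+2/72 <= 1-rho.
 have := covf_upper (@wunit R n) de; rewrite rr0 -kap0_sq mul1r -/X -/rho.
 have h1 : (X/3)^+2 <= kap0^+2 * de^+2.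
  have h0 : X/3 <= kap0 * de by rewrite /X mulrAC ler_pM2r.
  by rewrite -exprMn; apply: lerXn2r.
 have h2 : X^+4 <= X^+2 by rewrite (exprD X 2 2) ler_piMr ?sqr_ge0// exprn_ile1// ltW.
 have E9 : (X/3)^+2 = X^+2/9 by field.
 rewrite E9 in h1.
 by lra.
have r2 : 0 <= rho.
 have := covf_lower (@wunit R n) de; rewrite rr0 -kap0_sq -/rho -exprMn.
 have h1 : (kap0 * de)^+2 <= 1.
  apply: exprn_ile1 => //.
  by apply: le_trans hd; rewrite /X ler_pM2r.
 by lra.
have [[[a b] g] [[/= a0 aE abE g0 bgE] H]] := gauss_pair S D.
rewrite S2 in aE; rewrite SD in abE; rewrite D2 in bgE.
have b0 : b = 0.
 move/eqP: abE; rewrite mulf_eq0 => /orP[/eqP a00|/eqP//].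
 by move: aE; rewrite a00 expr0n/=; lra.
rewrite b0 expr0n/= add0r in bgE.
set c := kap^-1^+2.
have c0 : 0 < c by [].
pose f (p : R*R) := expR (- (c/2 * p.1^+2/2))*expR (- (c/2 * p.2^+2/2)).
have f1 p : `|f p| <= 1.
 have h (y : R) : 0 <= expR (- (c/2*y^+2/2)) <= 1.
  rewrite expR_ge0 -[leRHS]expR0 ler_expR oppr_le0.
  exact: mulr_ge0.
 have /andP[h1 h2] := h p.1; have /andP[h3 h4] := h p.2.
 by rewrite ger0_norm /f; [exact: mulr_ile1|exact: mulr_ge0].
have mf : msr f by apply: measurable_funM; apply: (measurableT_comp (msr_expR_sq (c/2))).
have -> : Ex G (fun x => bump kap (hx t x)*bump kap (hx (t+de) x)) =
  Ex G (fun x => f (dot S x, dot D x)).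
 apply: Ex_eq => x; rewrite /f /bump -!expRD; congr expR.
 have dS : dot S x = hx t x+hx (t+de) x by rewrite /hx /dot -big_split/=; apply: eq_bigr => i _; rewrite /S mulrDl.
 have dD : dot D x = hx t x-hx (t+de) x by rewrite /hx /dot -sumrB; apply: eq_bigr => i _; rewrite /D mulrBl.
 by rewrite /= dS dD -/c; field.
rewrite (H f 1 mf f1)/= b0.
have ex (r : R) : Ex gam (fun y : R => expR (- (c/2*(r*y)^+2/2))) =
  (Num.sqrt (1+c/2*r^+2))^-1.
 rewrite -(@Ex_gam_exp R (c/2*r^+2)); last by have : 0 <= c/2*r^+2 by [nneg]; lra.
 by apply: Ex_eq => y; congr expR; rewrite exprMn; ring.
have If (r : R) : intg gam (fun y : R => expR (- (c/2*(r*y)^+2/2))).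
 apply: (intg_bnd 1).
  exact: (measurableT_comp (msr_expR_sq (c/2))).
 move=> y; rewrite ger0_norm ?expR_ge0// -[leRHS]expR0 ler_expR oppr_le0.
 by [].
rewrite (_ : Ex gam _ = Ex gam (fun x : R => (Num.sqrt (1+c/2 * g^+2))^-1*expR (- (c/2*(a*x)^+2/2)))); last first.
 apply: Ex_eq => x; rewrite -ex [RHS]mulrC -(ExZ _ (If g)); apply: Ex_eq => y.
 by rewrite /f/= mul0r add0r.
rewrite ExZ// ex aE bgE -invfM -[leRHS]invrK lef_pV2 ?posrE.
- apply: (le_via (Num.sqrt c*X/9*Num.sqrt c)).
  rewrite invf_div invfM (_ : _*X/9*_ = Num.sqrt c^+2*X/9); last by ring.
  have -> : Num.sqrt c^+2 = (kap^+2)^-1 by rewrite (sqr_sqrtr (ltW c0)) /c exprVn.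
  by apply: eq_ler; ring.
 apply: ler_pM => //.
  have -> : Num.sqrt c*X/9 = Num.sqrt (c*(X/9)^+2).
   rewrite (sqrtrM _ (ltW c0)).
   have X9 : 0 <= X/9 by [].
   by rewrite (sqrtr_sqr (X/9)) (ger0_norm X9); ring.
  apply: ler_wsqrtr; have := ler_wpM2l (ltW c0) r1.
  rewrite expr_div_n (_ : 9^+2 = 81 :> R); last by ring.
  by have : 0 <= c*X^+2 by [nneg]; lra.
 apply: ler_wsqrtr; have : 0 <= c*rho by rewrite mulr_ge0// ltW.
 by lra.
- rewrite mulr_gt0// sqrtr_gt0; last by have : 0 <= c*rho by [rewrite mulr_ge0// ltW]; lra.
 by have := ler_wpM2l (ltW c0) r1; have : 0 <= c*X^+2 by [nneg]; lra.
- by [].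
Qed.

End trig_process_law.

Ltac measurable_leaf5 := first [ measurable_leaf4 | exact: msr_hx ].
Ltac measurable_leaf ::= measurable_leaf5.

(** * Grid sums and variances *)

Section grid_sums.
Variable R : realType.

(** Cells are sorted by residue q modulo Q; consecutive cells of a class are 2 pi/n apart on the
    grid of n Q points. *)
Lemma sum_grid (n Q : nat) (F : nat -> R) :
 \sum_(i < n*Q) F i = \sum_(q < Q) \sum_(j < n) F (j*Q+q)%N.
elim: n F => [|n IH] F.
 by rewrite mul0n big_ord0 big1// => q _; rewrite big_ord0.
rewrite mulSn big_split_ord/= (IH (fun i => F (Q + i)%N)) -big_split/=.
apply: eq_bigr => q _; rewrite big_ord_recl/=; congr (_+_).
by apply: eq_bigr => j _; rewrite /bump/= mulSn addnA.
Qed.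

Lemma sum_double (m : nat) (F : nat -> R) :
 \sum_(i < m.*2) F i = \sum_(i < m) (F i.*2+F i.*2.+1).
elim: m => [|m IH]; first by rewrite !big_ord0.
by rewrite doubleS !big_ord_recr/= IH addrA.
Qed.

End grid_sums.

Section variance.
Context d (T : measurableType d) (R : realType) (P : probability T R).

Implicit Types f g : T -> R.

Definition Vr f : R := Ex P (fun x => (f x-Ex P f)^+2).

Lemma Vr_bound f (M : R) : msr f -> bdd f M ->
 intg P f /\ intg P (fun x => (f x-Ex P f)^+2).
move=> mf fM; have fE : `|Ex P f| <= M by exact: Ex_bound.
split; first exact: intg_bounded mf fM.
apply: (intg_bnd ((M+M)^+2)).
 by [].
move=> x; rewrite normrX lerXn2r ?nnegrE//; first by apply: addr_ge0; exact: le_trans fE.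
by apply: ler_normB_via; exact: lerD.
Qed.

Lemma VrE f (M : R) : msr f -> bdd f M ->
 Vr f = Ex P (fun x => f x^+2)-Ex P f^+2.
move=> mf fM; have If : intg P f by exact: intg_bounded mf fM.
have If2 : intg P (fun x => f x^+2).
 apply: (intg_bnd (M^+2)) => //.
 by move=> x; rewrite normrX lerXn2r ?nnegrE// (le_trans _ (fM x)).
rewrite /Vr; set e := Ex P f.
transitivity (Ex P (fun x => f x^+2-(2*e*f x-e^+2))).
 by apply: Ex_eq => x; ring.
rewrite ExB//; last by apply: intgB; [exact: intgZ|exact: intg_cst].
rewrite ExB; [|exact: intgZ|exact: intg_cst].
by rewrite ExZ// Ex_cst -/e; ring.
Qed.

Lemma Vr_ge0 f : 0 <= Vr f.
by []. Qed.

Lemma Vr_le_sq f (M : R) : msr f -> bdd f M ->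
 Vr f <= Ex P (fun x => f x^+2).
by move=> mf fM; rewrite (VrE mf fM) gerBl sqr_ge0. Qed.

(** Young's inequality with a free parameter, later taken as 1, as 2 to close a geometric recursion,
    or small for a perturbation. *)
Lemma VrD_le f g (M a : R) : 0 < a -> msr f -> msr g ->
 bdd f M -> bdd g M ->
 Vr (fun x => f x+g x) <= (1+a)*Vr f+(1+a^-1)*Vr g.
move=> a0 mf mg fM gM.
have [If Vf] := Vr_bound mf fM; have [Ig Vg] := Vr_bound mg gM.
have mfg : msr (fun x => f x+g x) by [].
have fgM x : `|f x+g x| <= M+M by apply: ler_normD_via; exact: lerD.
have [_ Vfg] := Vr_bound mfg fgM.
rewrite /Vr -!ExZ// -ExD; [|exact: intgZ|exact: intgZ].
apply: Ex_le => //; first by apply: intgD; exact: intgZ.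
move=> x; rewrite ExD//; set u := f x-_; set v := g x-_.
have -> : f x+g x-(Ex P f+Ex P g) = u+v by rewrite /u /v; ring.
have : 0 <= a^-1*(a*u-v)^+2 by [].
have -> : a^-1*(a*u-v)^+2 = a*u^+2-2*(u*v)+a^-1*v^+2 by field.
by move=> h; rewrite sqrrD -mulr_natl; lra.
Qed.

Lemma Vr_eq f g : f =1 g -> Vr f = Vr g.
by move=> h; rewrite (funext h). Qed.

Lemma Vr_cst c : Vr (fun=> c) = 0.
by rewrite /Vr !Ex_cst subrr expr0n. Qed.

Lemma VrZ f (c M : R) : msr f -> bdd f M ->
 Vr (fun x => c*f x) = c^+2*Vr f.
move=> mf fM; have [If Vf] := Vr_bound mf fM.
by rewrite /Vr -ExZ//; apply: Ex_eq => x; rewrite ExZ//; ring.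
Qed.

End variance.

Lemma cptS_pi (R : realType) (m i : nat) : cpt R m i.+1 = cpt R m i+2*(pi/m%:R).
by rewrite /cpt -natr1 -mulr_natr; ring. Qed.

Lemma cpt_double (R : realType) (m i : nat) : (0 < m)%N ->
 cpt R m.*2 i.*2 = cpt R m i /\ cpt R m.*2 i.*2.+1 = cpt R m i+pi/m%:R.
move=> m0; have M0 : m%:R != 0 :> R by rewrite pnatr_eq0 -lt0n.
have D k : k.*2%:R = 2*k%:R :> R by rewrite -mul2n natrM.
rewrite /cpt -natr1 !D -(mulr_natr pi); move: M0; move: (m%:R : R) (i%:R : R) => M I M0.
by rewrite invfM; split; field.
Qed.

(** * Counts at one mesh: blocks, doubling and fluctuations *)

Section levels.
Variables (R : realType) (n : nat).
Hypothesis n4 : (4 <= n)%N.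
Notation tp := ((n+n).-tuple R).
Notation G := (gauss (R := R) (n+n)).
Notation hx := (@hx R n).

Let n0 : (0 < n)%N. exact: leq_trans n4. Qed.
Let nR : 0 < n%:R :> R. by rewrite ltr0n. Qed.

Section one_level.
Variables (Q' : nat) (Phi : R -> R -> R -> R) (v : R).
Let Q := Q'.+1.
Hypothesis Q4 : (4 <= Q)%N.
Hypothesis bPhi : forall (N : nat) (U : 'I_3 -> 'I_N -> R), (forall l, \sum_i U l i^+2 != 0) ->
 blockfn U (fun x => Phi (dot (U ord0) x) (dot (U (@Ordinal 3 1 isT)) x) (dot (U (@Ordinal 3 2 isT)) x)).

(** The block of cell i consists of its left end, its midpoint and its right end, so the half-step
    is pi/(nQ) with Q = Q'+1. *)
Definition cell_fun (i : nat) (x : tp) : R :=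
 Phi (hx (cpt R (n*Q) i) x) (hx (cpt R (n*Q) i+pi/(n*Q)%:R) x)
   (hx (cpt R (n*Q) i+2*(pi/(n*Q)%:R)) x).

Definition csum x : R := \sum_(i < n*Q) cell_fun i x.

Hypothesis Phiv : forall i, Ex G (fun x => cell_fun i x^+2) <= v.

Let s : R := pi/(n*Q)%:R.
Let tq (q : 'I_Q) : R := pi *+ 2*(q%:R/(n*Q)%:R).
Let QR : 0 < Q%:R :> R. by []. Qed.
Let nQR : 0 < (n*Q)%:R :> R. by rewrite ltr0n muln_gt0 n0. Qed.

Let s0 : 0 < s. by []. Qed.

(** n s = pi/Q, and pi < 4 <= Q. *)
Let ns1 : n%:R*s <= 1.
rewrite /s natrM invfM (_ : _*_ = pi/Q%:R*(n%:R/n%:R)); last by ring.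
rewrite divff ?gt_eqF// mulr1 ler_pdivrMr// mul1r; apply: (le_via 4).
 by have := @pihalf_lt2 R; lra.
by rewrite (ler_nat R 4).
Qed.

Let UU (q : 'I_Q) := @blockU R n s (tq q).
Let l0 : 'I_3 := ord0.
Let l1 : 'I_3 := @Ordinal 3 1 isT.
Let l2 : 'I_3 := @Ordinal 3 2 isT.

Let f (q : 'I_Q) (j : 'I_n) (x : tp) : R :=
 Phi (dot (UU q j l0) x) (dot (UU q j l1) x) (dot (UU q j l2) x).

Let fE q j x : f q j x = cell_fun (j*Q+q)%N x.
have E : mesh (tq q) j = cpt R (n*Q) (j*Q+q) by rewrite /mesh /tq /cpt natrD !natrM; field; rewrite !gt_eqF.
rewrite /f /cell_fun /UU /blockU E -/s.
rewrite -[nat_of_ord l0]/0%N -[nat_of_ord l1]/1%N -[nat_of_ord l2]/2%N.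
by rewrite mul0r mul1r addr0.
Qed.

Let bf q j : blockfn (UU q j) (f q j).
by apply: bPhi => l; rewrite /UU /blockU trig_unit// oner_neq0. Qed.

Let fr q (a : 'I_n -> 'I_3 -> R) :
 \sum_i (\sum_j \sum_l a j l*UU q j l i)^+2 <=
 2160*\sum_j \sum_i (\sum_l a j l*UU q j l i)^+2.
exact: (@trig_frame R n s (tq q) (n%:R*s) n4 s0 erefl ns1 a). Qed.

Let fv q j : Ex G (fun x => f q j x^+2) <= v.
by rewrite (@Ex_eq _ _ _ _ _ (fun x => cell_fun (j*Q+q)%N x^+2)) => [|x]; [exact: Phiv|rewrite fE]. Qed.

Lemma cell_meas i : (i < n*Q)%N -> msr (cell_fun i) /\ forall x, `|cell_fun i x| <= 1.
move=> iQ.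
have jn : (i %/ Q < n)%N by rewrite ltn_divLR.
have qQ : (i %% Q < Q)%N by rewrite ltn_mod.
have [h1 h2 _] := bf (Ordinal qQ) (Ordinal jn).
have E : cell_fun i = f (Ordinal qQ) (Ordinal jn) by apply/funext => x; rewrite fE/= -divn_eq.
by rewrite E.
Qed.

Let If q j : intg G (f q j).
by have [h1 h2 _] := bf q j; exact: (intg_bounded _ h1 h2). Qed.

Let csumE x : csum x = \sum_q \sum_j f q j x.
rewrite /csum (sum_grid n Q (fun i => cell_fun i x)); apply: eq_bigr => q _.
exact: eq_bigr => j _.
Qed.

Let Ecsum : Ex G csum = \sum_q \sum_j Ex G (f q j).
rewrite (@Ex_eq _ _ _ _ _ (fun x => \sum_q \sum_j f q j x)) => [|x] => //.
rewrite Ex_sum => [|q]; last by apply: intg_sum => j _; exact: If.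
by apply: eq_bigr => q _; rewrite Ex_sum.
Qed.

Let cntE x : csum x-Ex G csum = cnt f x.
rewrite csumE Ecsum /cnt -sumrB; apply: eq_bigr => q _.
by rewrite -sumrB.
Qed.

Lemma csum_meas : msr csum.
by apply: measurable_sum => i; case: (cell_meas (ltn_ord i)). Qed.

Lemma csum_bound x : `|csum x| <= (n*Q)%:R.
apply: le_trans (ler_norm_sum _ _ _) _.
rewrite -[X in _ <= X%:R]card_ord -sumr_const; apply: ler_sum => i _.
by case: (cell_meas (ltn_ord i)).
Qed.

Lemma csum_mgf (lam : R) : 2160*(Q%:R * `|lam|) <= 2^-1 ->
 Ex G (fun x => expR (lam*(csum x-Ex G csum))) <= expR (n%:R*2160*Q%:R^+2*v * lam^+2).
move=> hl; rewrite (@Ex_eq _ _ _ _ _ (fun x => expR (lam*cnt f x))) => [|x]; last by rewrite cntE.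
exact: (mgf_count (ltr0n _ 2160) fr bf fv hl).
Qed.

Lemma csum_var : Vr G csum <= 4*(n%:R*2160*Q%:R^+2*v).
rewrite /Vr (@Ex_eq _ _ _ _ _ (fun x => cnt f x^+2)) => [|x]; last by rewrite cntE.
exact: (var_count (ltr0n _ 2160) fr bf fv).
Qed.

Lemma csum_mean (e : R) : (forall i, Ex G (cell_fun i) <= e) -> Ex G csum <= (n*Q)%:R*e.
move=> he; rewrite Ecsum natrM mulrAC mulrC -[X in X%:R*_](card_ord Q) mulr_natl -sumr_const.
apply: ler_sum => q _; rewrite -[X in X%:R*_](card_ord n) mulr_natl -sumr_const.
apply: ler_sum => j _.
by rewrite (@Ex_eq _ _ _ _ _ (cell_fun (j*Q+q)%N)) => [|x].
Qed.

End one_level.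

Definition NN (m : nat) (x : tp) : R := \sum_(i < m) scf (hx (cpt R m i) x) (hx (cpt R m i.+1) x).

Definition BB (Q' : nat) := csum Q' (@scB R).

(** Halving the cells changes the count only where both halves of a cell change sign, and then by
    2. *)
Lemma NN_double Q' x : NN (n*Q'.+1).*2 x = NN (n*Q'.+1) x+2*BB Q' x.
rewrite /NN (sum_double _ (fun i => scf (hx (cpt R _ i) x) (hx (cpt R _ i.+1) x))) /BB /csum mulr_sumr -big_split/=.
apply: eq_bigr => i _; set m := (n*Q'.+1)%N.
have mN : (0 < m)%N by rewrite muln_gt0 n0.
have [E0 E1] := cpt_double R i mN; have [E2 _] := cpt_double R i.+1 mN.
rewrite doubleS in E2; rewrite E0 E1 E2 (cptS_pi R m i) /cell_fun -/m /scf /scB; set a := sgr _; set b := sgr _; set c := sgr _.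
by field.
Qed.

Lemma NN_csum Q' x : NN (n*Q'.+1) x = csum Q' (fun a _ c => scf a c) x.
apply: eq_bigr => i _; rewrite /cell_fun; congr (scf _ (hx _ _)).
by rewrite cptS_pi.
Qed.

Let Q8_4 Q' : (8 <= Q'.+1)%N -> (4 <= Q'.+1)%N. exact: leq_trans. Qed.

Lemma pi_lt4 : pi < 4 :> R. by have := @pihalf_lt2 R; lra. Qed.

Lemma nstep_le Q' : (8 <= Q'.+1)%N -> n%:R*(pi/(n*Q'.+1)%:R) <= 1/2 :> R.
move=> Q8; rewrite natrM invfM (_ : _*_ = pi/Q'.+1%:R*(n%:R/n%:R) :> R); last by ring.
rewrite divff ?gt_eqF// mulr1 ler_pdivrMr//.
have : 8 <= Q'.+1%:R :> R by rewrite (ler_nat R 8).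
by have := pi_lt4; lra.
Qed.

Lemma scf_01 (a b : R) : 0 <= scf a b <= 1.
by rewrite /scf /sgr; case: ifP => _; case: ifP => _; apply/andP; split; lra. Qed.

Let bB N (U : 'I_3 -> 'I_N -> R) (hU : forall l, \sum_i U l i^+2 != 0) :=
 @blockfn_scB R N 3 U hU ord0 (@Ordinal 3 1 isT) (@Ordinal 3 2 isT).
Let bS N (U : 'I_3 -> 'I_N -> R) (hU : forall l, \sum_i U l i^+2 != 0) :=
 @blockfn_scf R N 3 U hU ord0 (@Ordinal 3 2 isT).

Lemma B_le Q' i : (8 <= Q'.+1)%N -> Ex G (cell_fun Q' (@scB R) i) <= 64/Q'.+1%:R^+3.
move=> Q8; set s := pi/(n*Q'.+1)%:R : R.
have s0 : 0 < s by rewrite divr_gt0 ?pi_gt0// ltr0n muln_gt0 n0.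
apply: le_trans (E_scB_le n4 _ s0 (nstep_le Q8)) _.
have QR : 0 < Q'.+1%:R :> R by [].
have -> : n%:R*s = pi/Q'.+1%:R by rewrite /s natrM; field; rewrite !gt_eqF.
rewrite expr_div_n ler_pM2r ?exprn_gt0//.
rewrite (_ : 64 = 4^+3 :> R); last by ring.
by apply: lerXn2r; rewrite ?pi_ge0//; exact/ltW/pi_lt4.
Qed.

Lemma B_sq_le Q' i : (8 <= Q'.+1)%N -> Ex G (fun x => cell_fun Q' (@scB R) i x^+2) <= 64/Q'.+1%:R^+3.
move=> Q8; apply: le_trans (B_le i Q8); apply/eq_ler/Ex_eq => x.
by rewrite /cell_fun /scB /sgr; case: ifP => _; case: ifP => _; case: ifP => _; field.
Qed.

Lemma BB_meas Q' : msr (BB Q').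
exact: (csum_meas Q' bB). Qed.

Lemma BB_bound Q' x : `|BB Q' x| <= (n*Q'.+1)%:R.
exact: (csum_bound Q' bB x). Qed.

(** The second moment 64/Q^3 of one term outweighs the factor Q^2 lost between the classes, which
    leaves a variance proxy of order n/Q. *)
Lemma BB_mgf Q' (lam : R) : (8 <= Q'.+1)%N -> 2160*(Q'.+1%:R * `|lam|) <= 2^-1 ->
 Ex G (fun x => expR (lam*(BB Q' x-Ex G (BB Q')))) <= expR (2160*64*n%:R/Q'.+1%:R * lam^+2).
move=> Q8 hl; apply: le_trans (csum_mgf (Q8_4 Q8) bB (fun i => B_sq_le i Q8) hl) _.
rewrite ler_expR; apply: eq_ler; field.
by [].
Qed.

Lemma BB_var Q' : (8 <= Q'.+1)%N -> Vr G (BB Q') <= 8640*64*n%:R/Q'.+1%:R.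
move=> Q8; apply: le_trans (csum_var (Q8_4 Q8) bB (fun i => B_sq_le i Q8)) _.
apply: eq_ler; field.
by [].
Qed.

Lemma scf_sq_le Q' i : Ex G (fun x => cell_fun Q' (fun a _ c => scf a c) i x^+2) <= 1.
apply: le_trans (ler_norm _) _; apply: Ex_bound.
 apply: measurable_funX; rewrite /cell_fun /scf.
 apply: measurable_funM; last exact: measurable_cst.
 apply: measurable_funB; first exact: measurable_cst.
 by [].
move=> x; have /andP[h1 h2] := scf_01 (hx (cpt R (n*Q'.+1) i) x) (hx (cpt R (n*Q'.+1) i+2*(pi/(n*Q'.+1)%:R)) x).
by rewrite /cell_fun normrX exprn_ile1// ger0_norm.
Qed.

Lemma NN_mgf Q' (lam : R) : (4 <= Q'.+1)%N -> 2160*(Q'.+1%:R * `|lam|) <= 2^-1 ->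
 Ex G (fun x => expR (lam*(NN (n*Q'.+1) x-Ex G (NN (n*Q'.+1))))) <=
 expR (n%:R*2160*Q'.+1%:R^+2 * lam^+2).
move=> Q4 hl; have -> : NN (n*Q'.+1) = csum Q' (fun a _ c => scf a c).
 by apply/funext => x; exact: NN_csum.
by apply: le_trans (csum_mgf Q4 bS (@scf_sq_le Q') hl) _; rewrite mulr1.
Qed.

Lemma NN_meas m : msr (NN m).
apply: measurable_sum => i; rewrite /scf; apply: measurable_funM; last exact: measurable_cst.
apply: measurable_funB; first exact: measurable_cst.
by [].
Qed.

Lemma NN_ge0 m x : 0 <= NN m x.
by apply: sumr_ge0 => i _; case/andP: (scf_01 (hx (cpt R m i) x) (hx (cpt R m i.+1) x)). Qed.

Lemma NN_bound m x : `|NN m x| <= m%:R.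
rewrite ger0_norm ?NN_ge0//; rewrite -[X in _ <= X%:R]card_ord -sumr_const; apply: ler_sum => i _.
by case/andP: (scf_01 (hx (cpt R m i) x) (hx (cpt R m i.+1) x)).
Qed.

Definition cbad (kap : R) (m i : nat) (x : tp) : bool :=
 (`|hx (cpt R m i) x| <= kap) && (`|hx (cpt R m i.+1) x| <= kap).

Definition bumps Q' kap := csum Q' (fun a _ c => bump kap a*bump kap c).

Let bb kap N (U : 'I_3 -> 'I_N -> R) (hU : forall l, \sum_i U l i^+2 != 0) :=
 @blockfn_bump R N 3 U kap ord0 (@Ordinal 3 2 isT).

(** On a bad cell each of the two bumps is at least e^(-1/2), hence the factor e. *)
Lemma bad_le_bumps Q' kap x : 0 < kap ->
 \sum_(i < n*Q'.+1) (cbad kap (n*Q'.+1) i x)%:R <= expR 1*bumps Q' kap x.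
move=> k0; rewrite /bumps /csum mulr_sumr; apply: ler_sum => i _.
rewrite /cell_fun -cptS_pi /cbad; case: (boolP (_ && _)) => [/andP[h1 h2]|_]; last first.
 by rewrite mulr_ge0 ?expR_ge0// mulr_ge0.
have hk (y : R) : `|y| <= kap -> kap^-1^+2*y^+2/2 <= 1/2.
 move=> hy; rewrite ler_pM2r ?invr_gt0// exprVn ler_pdivrMl ?exprn_gt0// mulr1.
 by rewrite -(sqr_normr y); apply: lerXn2r.
rewrite /bump -!expRD -[leLHS]expR0 ler_expR.
by have := hk _ h1; have := hk _ h2; lra.
Qed.

Lemma bumps_E Q' kap i : (8 <= Q'.+1)%N -> 0 < kap ->
 Ex G (cell_fun Q' (fun a _ c => bump kap a*bump kap c) i) <= 3*kap^+2*Q'.+1%:R.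
move=> Q8 k0.
have QR : 0 < Q'.+1%:R :> R by [].
have nQ : 0 < (n*Q'.+1)%:R :> R by rewrite ltr0n muln_gt0 n0.
pose de : R := 2*(pi/(n*Q'.+1)%:R).
have d0 : 0 < de by [].
have nd : n%:R * de <= 1 by rewrite /de mulrCA -ler_pdivlMl//; apply: le_trans (nstep_le Q8) _; rewrite mulr1 mul1r.
apply: le_trans (E_bump2 n4 _ k0 d0 nd) _.
have -> : n%:R * de = 2 * pi/Q'.+1%:R by rewrite /de natrM; field; rewrite !gt_eqF.
rewrite invf_div (_ : 9*kap^+2*_ = 9*kap^+2*Q'.+1%:R/(2 * pi)); last by ring.
have p2 := @pi_ge2 R; have pp : 0 < 2 * pi :> R by lra.
rewrite ler_pdivrMr//; have X0 : 0 <= 3*kap^+2*Q'.+1%:R by nneg.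
have : 3*kap^+2*Q'.+1%:R*3 <= 3*kap^+2*Q'.+1%:R*(2 * pi) by apply: ler_wpM2l; lra.
by lra.
Qed.

Lemma bumps_sq Q' kap i : (8 <= Q'.+1)%N -> 0 < kap ->
 Ex G (fun x => cell_fun Q' (fun a _ c => bump kap a*bump kap c) i x^+2) <= 3*kap^+2*Q'.+1%:R.
move=> Q8 k0; apply: le_trans (bumps_E i Q8 k0).
have mC : msr (cell_fun Q' (fun a _ c => bump kap a*bump kap c) i) by [].
have C01 x : 0 <= cell_fun Q' (fun a _ c => bump kap a*bump kap c) i x <= 1.
 have /andP[h1 h2] := bump_bounds kap (hx (cpt R (n*Q'.+1) i) x).
 have /andP[h3 h4] := bump_bounds kap (hx (cpt R (n*Q'.+1) i+2*(pi/(n*Q'.+1)%:R)) x).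
 by rewrite /cell_fun mulr_ge0// mulr_ile1.
apply: Ex_le.
- apply: (intg_bnd 1) => //.
 by move=> x; have /andP[h1 h2] := C01 x; rewrite normrX exprn_ile1// ger0_norm.
- by apply: (intg_bnd 1) => // x; have /andP[h1 h2] := C01 x; rewrite ger0_norm.
- by move=> x; have /andP[h1 h2] := C01 x; rewrite expr2 ler_piMl.
Qed.

Lemma bumps_mean Q' kap : (8 <= Q'.+1)%N -> 0 < kap ->
 Ex G (bumps Q' kap) <= 3*n%:R*kap^+2*Q'.+1%:R^+2.
move=> Q8 k0; apply: le_trans (csum_mean (bb kap) (fun i => bumps_E i Q8 k0)) _.
by rewrite natrM; apply: eq_ler; ring.
Qed.

Lemma bumps_mgf Q' kap (lam : R) : (8 <= Q'.+1)%N -> 0 < kap -> 2160*(Q'.+1%:R * `|lam|) <= 2^-1 ->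
 Ex G (fun x => expR (lam*(bumps Q' kap x-Ex G (bumps Q' kap)))) <=
 expR (6480*n%:R*Q'.+1%:R^+3*kap^+2 * lam^+2).
move=> Q8 k0 hl; apply: le_trans (csum_mgf (Q8_4 Q8) (bb kap) (fun i => bumps_sq i Q8 k0) hl) _.
by rewrite ler_expR; apply: eq_ler; ring.
Qed.

Lemma bumps_var Q' kap : (8 <= Q'.+1)%N -> 0 < kap ->
 Vr G (bumps Q' kap) <= 4*(n%:R*2160*Q'.+1%:R^+2*(3*kap^+2*Q'.+1%:R)).
by move=> Q8 k0; exact: (csum_var (Q8_4 Q8) (bb kap) (fun i => bumps_sq i Q8 k0)). Qed.

Lemma bumps_meas Q' kap : msr (bumps Q' kap).
exact: (csum_meas Q' (bb kap)). Qed.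

Lemma bumps_bound Q' kap x : `|bumps Q' kap x| <= (n*Q'.+1)%:R.
exact: (csum_bound Q' (bb kap) x). Qed.

Lemma diff_var Q' kap (v : R) : (4 <= Q'.+1)%N ->
 (forall i, Ex G (fun x => cell_fun Q' (fun a _ c => scf a c-scT kap a c) i x^+2) <= v) ->
 Vr G (csum Q' (fun a _ c => scf a c-scT kap a c)) <= 8640*n%:R*Q'.+1%:R^+2*v.
move=> Q4 hv.
have bD N (U : 'I_3 -> 'I_N -> R) (hU : forall l, \sum_i U l i^+2 != 0) :=
 @blockfn_diff R N 3 U hU kap ord0 (@Ordinal 3 2 isT).
apply: le_trans (csum_var Q4 bD hv) _.
by apply: eq_ler; ring.
Qed.

End levels.

Ltac measurable_leaf6 := first [ measurable_leaf5 | exact: BB_meas | exact: NN_meas | exact: bumps_meas ].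
Ltac measurable_leaf ::= measurable_leaf6.

(** * Exceptional events and approximation of the number of zeros *)

Section even_moments.
Variable R : realType.

Definition evp (q : nat) (y : R) : R := (y^+2)^+q.

Lemma evp_ge0 q y : 0 <= evp q y.
by []. Qed.

Lemma evp_lt1 q y : evp q.+1 y < 1 -> `|y| < 1.
apply: contraTT; rewrite -!leNgt => y1; rewrite /evp -(sqr_normr y).
by rewrite exprn_ege1// exprn_ege1.
Qed.

Lemma evp_meas q : msr (evp q).
by []. Qed.

Lemma evpZ q (c y : R) : evp q (c*y) = c^+(q.*2)*evp q y.
rewrite /evp (_ : (c*y)^+2 = c^+2*y^+2); last by ring.
by rewrite [LHS]exprMn -[in LHS]exprM mul2n.
Qed.

Lemma Ex_dot_evp q : exists2 C : R, 0 <= C & forall N (u : 'I_N -> R), \sum_i u i^+2 <= 1 ->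
 IG N (fun x => evp q (dot u x)) /\ EG N (fun x => evp q (dot u x)) <= C.
exists (Ex gam (fun x : R => (1+x^+2)^+q)).
 by [].
move=> N u u1; set s := Num.sqrt (\sum_i u i^+2).
have s01 : s^+2 <= 1 by rewrite sqr_sqrtr// sumr_ge0// => i _.
have le x : evp q (s*x) <= (1+x^+2)^+q.
 rewrite /evp (_ : (s*x)^+2 = s^+2*x^+2); last by ring.
 apply: lerXn2r.
 - by [].
 - by [].
 - by apply: (le_via (x^+2)); [apply: ler_piMl => //; exact: sqr_ge0|rewrite lerDr].
have mf : msr (fun x : R => evp q (s*x)) by [].
have If : intg gam (fun x : R => evp q (s*x)) by apply: (@intg_gam_le R _ 1 q) => // x; rewrite mul1r ger0_norm ?evp_ge0.
have [h1 ->] := Ex_dot_gam (evp_meas q) If; split=> //.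
by apply: Ex_le => //; exact: intg_gam_poly.
Qed.

Lemma sup_grid (g dg : R -> R) (c B K : R) M : (0 < M)%N -> 0 <= c ->
 (forall t, der g t (c * dg t)) -> bdd dg B ->
 (forall j, (j <= M)%N -> `|g (cpt R M j)| <= K) ->
 forall t, 0 <= t <= pi *+ 2 -> `|g t| <= K+c*(pi *+ 2/M%:R)*B.
move=> M0 c0 hd hB hK t /andP[t0 t2].
have MR : 0 < M%:R :> R by rewrite ltr0n.
have p2 : 0 < pi *+ 2 :> R by [].
pose y : R := t * M%:R/(pi *+ 2).
have y0 : 0 <= y by [].
pose j := Num.truncn y.
have j1 : j%:R <= y by rewrite truncn_le.
have j2 : y < j.+1%:R by exact: truncnS_gt.
have jM : (j <= M)%N.
 rewrite -(ler_nat R) (le_trans j1)// ler_pdivrMr//; rewrite [leLHS]mulrC.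
 exact: ler_wpM2l.
have de0 : 0 < pi *+ 2/M%:R :> R by [].
have yt : t = y*(pi *+ 2/M%:R).
 rewrite /y; move: (pi *+ 2 : R) (M%:R : R) p2 MR => P M' P0 M0'.
 by field; rewrite !gt_eqF.
have td : `|t-cpt R M j| <= pi *+ 2/M%:R.
 rewrite /cpt {1}yt -mulrBl ger0_norm; last by rewrite mulr_ge0 ?subr_ge0// ltW.
 rewrite -[leRHS]mul1r; apply: ler_wpM2r => //.
 by rewrite -natr1 in j2; lra.
have B0 : 0 <= B by apply: le_trans (hB 0).
have hL u : `|c * dg u| <= c*B by rewrite normrM (ger0_norm c0); apply: ler_wpM2l.
have := taylor1_norm hd hL (cpt R M j) t => h.
have -> : g t = g (cpt R M j)+(g t-g (cpt R M j)) by ring.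
apply: ler_normD_via; apply: lerD; first exact: hK.
apply: le_trans h _; rewrite (_ : c*(pi *+ 2/M%:R)*B = c*B*(pi *+ 2/M%:R)); last by ring.
exact: ler_wpM2l.
Qed.

End even_moments.

Section zero_number.
Variables (R : realType) (n : nat).
Hypothesis n4 : (4 <= n)%N.
Notation tp := ((n+n).-tuple R).
Notation G := (gauss (R := R) (n+n)).
Notation hx := (@hx R n).

Let n0 : (0 < n)%N. exact: leq_trans n4. Qed.
Let nR : 0 < n%:R :> R. by rewrite ltr0n. Qed.

Definition ft (m : nat) (t : R) (x : tp) : R := dot (trigd (@wunit R n) m t) x.

Lemma ft0 t x : ft 0 t x = hx t x. by rewrite /ft trigd0. Qed.

Lemma ft_der m x t : der (ft m ^~ x) t (n%:R*ft m.+1 t x).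
exact: dot_trigd_der. Qed.

Lemma wunit_le1 k : `|@wunit R n k| <= 1.
rewrite /wunit ger0_norm ?sqrtr_ge0// invf_le1 ?sqrtr_gt0//.
by rewrite -{1}(sqrtr1 R) ler_wsqrtr// ler1n.
Qed.

Lemma ft_abs_le m t x (B : R) : (forall i, `|tnth x i| <= B) -> `|ft m t x| <= (n+n)%:R*B.
move=> hB; apply: le_trans (ler_norm_sum _ _ _) _.
rewrite mulr_natl -[X in _ <= _ *+ X](card_ord (n+n)) -sumr_const; apply: ler_sum => i _.
rewrite normrM -[leRHS]mul1r; apply: ler_pM => //.
by apply: trigd_abs_le => k; exact: wunit_le1.
Qed.

Lemma trigd_nsq1 m t : \sum_i trigd (@wunit R n) m t i^+2 <= 1.
apply: le_trans (trigd_nsq_le _ _ _) _.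
under eq_bigr do rewrite wunit_sq//.
by rewrite sumr_const card_ord -(mulr_natr n%:R^-1) mulVf.
Qed.

Definition ZZ (x : tp) : R := nb_zeros (fun t => hx t x).

Let aa (x : tp) (k : 'I_n) : R := (Num.sqrt n%:R)^-1 * tnth x (lshift n k).
Let bb (x : tp) (k : 'I_n) : R := (Num.sqrt n%:R)^-1 * tnth x (rshift n k).

Lemma hx_split t x : hx t x = \sum_k (Num.sqrt n%:R)^-1 *
 (tnth x (lshift n k)*cos (k%:R * t)+tnth x (rshift n k)*sin (k%:R * t)).
rewrite -[hx t x]/(dot _ x) /dot sum_split2; apply: eq_bigr => k _.
by rewrite trig_lshift trig_rshift /wunit; ring.
Qed.

Let hx_tpoly x t : hx t x = tpoly (aa x) (bb x) t.
by rewrite hx_split; apply: eq_bigr => k _; rewrite /aa /bb; ring. Qed.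

Let ZZE x : ZZ x = nb_zeros (tpoly (aa x) (bb x)).
by rewrite /ZZ (funext (hx_tpoly x)). Qed.

Lemma ZZ_bounds x : 0 <= ZZ x <= n.*2%:R.
by rewrite ZZE; exact: nb_zeros_tpoly. Qed.

Lemma ZZ_norm x : `|ZZ x| <= n.*2%:R.
by have /andP[h1 h2] := ZZ_bounds x; rewrite ger0_norm. Qed.

Lemma ZZ_meas : msr ZZ.
apply: (@measurable_nb_zeros _ _ R (fun t x => hx t x)) => [t|x] => //.
move=> t; apply: (@der_continuous _ _ _ (n%:R*ft 1 t x)).
by have := ft_der 0 x t; rewrite (_ : ft 0 ^~ x = (fun t => hx t x))//; apply/funext => s; rewrite ft0.
Qed.

Section approx.
Variables (Q' r : nat).
Let Q := Q'.+1.
Hypothesis Q8 : (8 <= Q)%N.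

(** Kq = Q^(1/4) bounds the normalised derivatives: it grows, so that exceeding it is unlikely, but
    slowly enough for the mean number of bad cells to be of order n Q^(-3/2). With derivatives at
    most 2 Kq, a cell can hold more than r+2 zeros only if its values are at most [rhoq], and [kapq]
    is the threshold of [badc]. *)
Definition Kq : R := Num.sqrt (Num.sqrt Q%:R).
Definition rhoq : R := (pi *+ 2/Q%:R)^+r.+3*(2*Kq).
Definition kapq : R := (pi *+ 2/Q%:R)^+2*(2*Kq).
(** With coefficients at most nQ a derivative is at most 2n (nQ), so moving by one step of this mesh
    changes a normalised derivative by at most pi/4, below 1 <= Kq. *)
Definition Mq : nat := (16*(n*n*n)*Q)%N.

(** At least 1 outside the good event, so that its mean bounds a probability. The terms detect a
    large second derivative, a large derivative of order r+3, a large coefficient, and a grid value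
    below [rhoq]; even powers and bumps keep the mean computable. *)
Definition off (x : tp) : R :=
 \sum_(j < Mq.+1) evp r.+1.*2 (Kq^-1*ft 2 (cpt R Mq j) x) +
 \sum_(j < Mq.+1) evp r.+1.*2 (Kq^-1*ft r.+3 (cpt R Mq j) x) +
 \sum_i evp r.+1.*2 ((n*Q)%:R^-1 * tnth x i) +
 \sum_(i < (n*Q).+1) expR 1*bump rhoq (hx (cpt R (n*Q) i) x).

Let QR : 0 < Q%:R :> R. by []. Qed.
Let K1 : 1 <= Kq.
have h (y : R) : 1 <= y -> 1 <= Num.sqrt y by move=> y1; rewrite -{1}(sqrtr1 R) ler_wsqrtr.
by rewrite /Kq; apply: (h); apply: h; rewrite ler1n.
Qed.
Let K0 : 0 < Kq. exact: lt_le_trans K1. Qed.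
Let m0 : (0 < n*Q)%N. by rewrite muln_gt0 n0. Qed.
Let mR0 : 0 < (n*Q)%:R :> R. by rewrite ltr0n. Qed.
Let M0 : (0 < Mq)%N. by rewrite /Mq !muln_gt0 n0. Qed.
Let p2 : 0 < pi *+ 2 :> R. by []. Qed.
Let rho0 : 0 < rhoq. by rewrite /rhoq mulr_gt0 ?exprn_gt0 ?divr_gt0// mulr_gt0. Qed.

Lemma kapq_gt0 : 0 < kapq. by []. Qed.

Let t1 x j := evp_ge0 r.+1.*2 (Kq^-1*ft 2 (cpt R Mq j) x).
Let t2 x j := evp_ge0 r.+1.*2 (Kq^-1*ft r.+3 (cpt R Mq j) x).
Let t3 (x : tp) i := evp_ge0 r.+1.*2 ((n*Q)%:R^-1 * tnth x i).
Let t4 x i : 0 <= expR 1*bump rhoq (hx (cpt R (n*Q) i) x).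
by []. Qed.

Lemma off_ge0 x : 0 <= off x.
by rewrite /off !addr_ge0// sumr_ge0. Qed.

Lemma bump_lt1 (k y : R) : 0 < k -> expR 1*bump k y < 1 -> k < `|y|.
move=> k0; apply: contraTT; rewrite -!leNgt => yk; rewrite /bump -expRD -[leLHS]expR0 ler_expR.
have : k^-1^+2*y^+2 <= 1.
 rewrite exprVn ler_pdivrMl ?exprn_gt0// mulr1 -(sqr_normr y).
 exact: lerXn2r.
by lra.
Qed.

Let sum_lt1 (I : finType) (F : I -> R) i : (forall j, 0 <= F j) -> \sum_j F j < 1 -> F i < 1.
move=> F0; rewrite (bigD1 i)//= => h; apply: le_lt_trans h.
by rewrite lerDl sumr_ge0.
Qed.

Lemma off_lt1 x : off x < 1 ->
 [/\ forall j, (j <= Mq)%N -> `|ft 2 (cpt R Mq j) x| <= Kq,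
   forall j, (j <= Mq)%N -> `|ft r.+3 (cpt R Mq j) x| <= Kq,
   forall i, `|tnth x i| <= (n*Q)%:R &
   forall i, (i <= n*Q)%N -> rhoq < `|hx (cpt R (n*Q) i) x|].
rewrite /off; set S1 := \sum_(j < _) _; set S2 := \sum_(j < _) _; set S3 := \sum_i _; set S4 := \sum_(j < _) _.
have P1 : 0 <= S1 by exact: sumr_ge0.
have P2 : 0 <= S2 by exact: sumr_ge0.
have P3 : 0 <= S3 by exact: sumr_ge0.
have P4 : 0 <= S4 by [].
move=> h.
have H1 : S1 < 1 by move: S1 S2 S3 S4 P1 P2 P3 P4 h => a b c d; lra.
have H2 : S2 < 1 by move: S1 S2 S3 S4 P1 P2 P3 P4 h {H1} => a b c d; lra.
have H3 : S3 < 1 by move: S1 S2 S3 S4 P1 P2 P3 P4 h {H1 H2} => a b c d; lra.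
have H4 : S4 < 1 by move: S1 S2 S3 S4 P1 P2 P3 P4 h {H1 H2 H3} => a b c d; lra.
have sc (k y : R) : 0 < k -> `|k^-1*y| < 1 -> `|y| <= k.
 by move=> k0; rewrite normrM (@gtr0_norm _ k^-1) ?invr_gt0// ltr_pdivrMl// mulr1 => /ltW.
split.
- move=> j jM; have jM' : (j < Mq.+1)%N by [].
 by have := sum_lt1 (Ordinal jM') (t1 x) H1 => /evp_lt1; exact: sc.
- move=> j jM; have jM' : (j < Mq.+1)%N by [].
 by have := sum_lt1 (Ordinal jM') (t2 x) H2 => /evp_lt1; exact: sc.
- by move=> i; have := sum_lt1 i (t3 x) H3 => /evp_lt1; exact: sc.
- move=> i im; have im' : (i < (n*Q).+1)%N by [].
 by have := sum_lt1 (Ordinal im') (t4 x) H4 => /bump_lt1; apply.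
Qed.

Let sup_ft m x : (forall j, (j <= Mq)%N -> `|ft m (cpt R Mq j) x| <= Kq) ->
 (forall i, `|tnth x i| <= (n*Q)%:R) -> forall t, 0 <= t <= pi *+ 2 -> `|ft m t x| <= 2*Kq.
move=> h1 h2 t ht.
have hB u : `|ft m.+1 u x| <= (n+n)%:R*(n*Q)%:R by exact: ft_abs_le.
apply: le_trans (sup_grid M0 (ltW nR) (ft_der m x) hB h1 ht) _.
rewrite (_ : 2*Kq = Kq+Kq); last by ring.
rewrite lerD2l; apply: le_trans K1.
rewrite /Mq !natrM natrD -(mulr_natr pi).
have -> : n%:R*(pi*2/(16*(n%:R*n%:R*n%:R)*Q%:R))*((n%:R+n%:R)*(n%:R*Q%:R)) = pi/4 :> R.
 by move: (pi : R) (n%:R : R) (Q%:R : R) nR QR => p a b a0 b0; field; rewrite !gt_eqF.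
by have := @pihalf_lt2 R; lra.
Qed.

Let cde : n%:R*(pi *+ 2/(n*Q)%:R) = pi *+ 2/Q%:R :> R.
by rewrite natrM; move: (pi *+ 2 : R) (n%:R : R) (Q%:R : R) nR QR => p a b a0 b0; field; rewrite !gt_eqF. Qed.

(** On the good event a bad cell holds at most r+2 zeros, and every other cell has exactly as many
    zeros as sign changes. *)
Lemma zeros_approx x : off x < 1 ->
 `|ZZ x-NN (n*Q) x| <= r.+2%:R*(expR 1*@bumps R n Q' kapq x).
move=> /off_lt1[h1 h2 h3 h4].
have s2 := sup_ft h1 h3; have sL := sup_ft h2 h3.
pose f i t := ft i t x.
have hd i t : der (f i) t (n%:R*f i.+1 t) by exact: ft_der.
have nz i : (i <= n*Q)%N -> f 0%N (cpt R (n*Q) i) != 0.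
 by move=> im; rewrite /f ft0 -normr_gt0 (lt_trans rho0)// h4.
have fin : finite_set [set t : R | 0 <= t <= pi *+ 2 /\ hx t x = 0].
 rewrite (_ : [set t : R | _] = [set t : R | 0 <= t <= pi *+ 2 /\ tpoly (aa x) (bb x) t = 0]); last first.
  by apply/seteqP; split=> t /=; rewrite hx_tpoly.
 apply: (@tpoly_zeros_finite _ _ _ _ (cpt R (n*Q) 0)).
 by rewrite -hx_tpoly -ft0; exact: nz.
have [s [us sP Zs]] := nb_zeros_seq fin.
have sP' t : t \in s <-> 0 <= t <= pi *+ 2 /\ f 0%N t = 0 by rewrite /f ft0.
have NE : \sum_(i < n*Q) scf (f 0%N (cpt R (n*Q) i)) (f 0%N (cpt R (n*Q) i.+1)) = NN (n*Q) x by apply: eq_bigr => i _; rewrite /f !ft0.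
have lo := zeros_ge_sc hd m0 nz sP'.
have up := @zeros_le_sc R f n%:R (n*Q) s nR hd m0 nz us sP' (2*Kq) r.+2 kapq s2.
rewrite cde in up.
have sz i : (i < n*Q)%N -> (size (zc (n*Q) s i) <= r.+2)%N.
 move=> im; apply: (zc_size nR hd m0 us sP' im sL).
 by rewrite cde /f ft0; apply: h4; exact: ltnW.
move: (up (lexx _) sz) lo; rewrite NE /ZZ Zs => u1 l1.
rewrite ger0_norm ?subr_ge0// lerBlDl; apply: le_trans u1 _; rewrite lerD2l.
apply: ler_wpM2l => //; apply: le_trans (bad_le_bumps Q' x kapq_gt0).
by apply: ler_sum => i _; rewrite /badc /f !ft0.
Qed.

(** Outside the good event the trivial bounds on both counts are paid for by off >= 1. *)
Lemma zeros_approx_all x : `|ZZ x-NN (n*Q) x| <=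
 r.+2%:R*(expR 1*@bumps R n Q' kapq x)+(n*Q+n.*2)%:R * off x.
have b0 : 0 <= @bumps R n Q' kapq x by [].
have [h|h] := ltP (off x) 1.
 apply: le_trans (zeros_approx h) _; rewrite lerDl mulr_ge0// off_ge0//.
apply: ler_normB_via; apply: (le_via ((n*Q+n.*2)%:R * off x)); last first.
 by rewrite lerDr mulr_ge0// mulr_ge0.
apply: (le_via (n*Q+n.*2)%:R); last by rewrite ler_peMr.
by rewrite natrD addrC; apply: lerD; [exact: NN_bound|exact: ZZ_norm].
Qed.

End approx.

End zero_number.

Ltac measurable_leaf7 := first [ measurable_leaf6 | exact: evp_meas | exact: ZZ_meas ].
Ltac measurable_leaf ::= measurable_leaf7.

(** * Mean and mean square of the discretisation error *)

Section zero_expectations.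
Variable R : realType.

Lemma sqrt_ge1 (y : R) : 1 <= y -> 1 <= Num.sqrt y <= y.
move=> y1; apply/andP; split; first by rewrite -{1}(sqrtr1 R) ler_wsqrtr.
by rewrite -{2}(sqr_sqrtr (le_trans ler01 y1)) expr2 ler_peMl ?sqrtr_ge0// -{1}(sqrtr1 R) ler_wsqrtr.
Qed.

Lemma Kq_pow4 Q' : Kq R Q'^+4 = Q'.+1%:R.
by rewrite /Kq (exprM _ 2 2) !sqr_sqrtr. Qed.

Lemma Kq_bounds Q' : 1 <= Kq R Q' <= Q'.+1%:R.
have Q1 : 1 <= Q'.+1%:R :> R by rewrite ler1n.
have /andP[h1 h2] := sqrt_ge1 Q1; have /andP[h3 h4] := sqrt_ge1 h1.
by rewrite /Kq h3 (le_trans h4).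
Qed.

Lemma twopi_le8 : pi *+ 2 <= 8 :> R.
by rewrite mulr2n; have := @pi_lt4 R; lra. Qed.

Lemma twopi_pow_le k : (pi *+ 2)^+k <= 8^+k :> R.
have p0 : 0 <= pi *+ 2 :> R by [].
apply: lerXn2r; [by rewrite nnegrE|by rewrite nnegrE|exact: twopi_le8].
Qed.

Lemma kapq_sq Q' : kapq R Q'^+2 <= 2^+14*Num.sqrt Q'.+1%:R/Q'.+1%:R^+4.
have QR : 0 < Q'.+1%:R :> R by [].
rewrite /kapq exprMn -exprM expr_div_n exprMn.
have -> : Kq R Q'^+2 = Num.sqrt Q'.+1%:R by rewrite /Kq sqr_sqrtr// sqrtr_ge0.
rewrite (_ : 2^+14*Num.sqrt Q'.+1%:R/Q'.+1%:R^+4 = 8^+4/Q'.+1%:R^+4*(2^+2*Num.sqrt Q'.+1%:R)); last by ring.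
apply: ler_wpM2r => //.
apply: ler_wpM2r => //.
exact: twopi_pow_le.
Qed.

Lemma dot_delta N (i : 'I_N) (x : N.-tuple R) : dot (fun j => (j == i)%:R) x = tnth x i.
rewrite /dot (bigD1 i)//= eqxx mul1r big1 ?addr0// => j ji.
by rewrite (negbTE ji) mul0r.
Qed.

Lemma delta_nsq N (i : 'I_N) : \sum_(j < N) ((j == i)%:R : R)^+2 = 1.
rewrite (bigD1 i)//= eqxx expr1n big1 ?addr0// => j ji.
by rewrite (negbTE ji) expr0n.
Qed.

Lemma evp_scaled q : exists2 C : R, 0 <= C & forall N (u : 'I_N -> R) (c : R), \sum_i u i^+2 <= 1 ->
 IG N (fun x => evp q (c * dot u x)) /\
 EG N (fun x => evp q (c * dot u x)) <= c^+(q.*2)*C.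
have [C C0 hC] := Ex_dot_evp R q; exists C => // N u c hu; have [h1 h2] := hC _ u hu.
rewrite (_ : (fun x => _) = (fun x => c^+(q.*2)*evp q (dot u x))); last first.
 by apply/funext => x; rewrite evpZ.
split; first exact: intgZ.
by rewrite ExZ//; apply: ler_wpM2l => //; rewrite -mul2n exprM exprn_ge0// sqr_ge0.
Qed.

Lemma rhoq_le Q' r : rhoq R Q' r <= 2*8^+r.+3/Q'.+1%:R^+r.+2.
have QR : 0 < Q'.+1%:R :> R by [].
rewrite /rhoq expr_div_n (exprS (Q'.+1%:R) r.+2) invfM.
have /andP[k1 k2] := Kq_bounds Q'.
have -> : 2*8^+r.+3/Q'.+1%:R^+r.+2 = 8^+r.+3*(Q'.+1%:R^-1/Q'.+1%:R^+r.+2)*(2*Q'.+1%:R) :> R.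
 move: (8^+r.+3 : R) (exprn_gt0 r.+2 QR); move: (Q'.+1%:R^+r.+2 : R) (Q'.+1%:R : R) QR => b c c0 a b0.
 by field; rewrite !gt_eqF.
apply: ler_pM.
- by apply: mulr_ge0; first by rewrite exprn_ge0// mulr2n addr_ge0// pi_ge0.
- by [].
- apply: ler_wpM2r => //.
 exact: twopi_pow_le.
- exact: ler_wpM2l.
Qed.

Lemma intg_bump_hx n t (k : R) : IG (n+n) (fun x => bump k (@hx R n t x)).
by apply: (intg_bnd 1); last by move=> x; exact: bump_norm.
Qed.

Lemma shift_pow1 (a c q : R) r : q != 0 -> 17*c*a/q^+r = 17*a*q*(c/q^+r.+1).
move=> q0; have b0 : q^+r != 0 by rewrite expf_neq0.
by rewrite exprS; move: (q^+r) b0 => b b0; field; rewrite q0 b0.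
Qed.

Lemma shift_pow2 (e d a q : R) r : q != 0 ->
 4*(e * d)*a/q^+r = 2*a*q^+2*(e*(2 * d/q^+r.+2)).
move=> q0; have b0 : q^+r != 0 by rewrite expf_neq0.
rewrite (_ : q^+r.+2 = q^+r*q^+2); last by rewrite -exprD addn2.
by move: (q^+r) b0 => b b0; field; rewrite q0 b0.
Qed.

(** The powers are matched: the power 4(r+1) of a derivative divided by Q^(1/4) has mean
    O(Q^-(r+1)), over about 16 n^3 Q points, and the bumps of width [rhoq] have mean O(Q^-(r+2)),
    over about n Q points. Thus any power of Q can be gained, at the fixed price n^3. *)
Lemma off_mean r : exists2 C : R, 0 <= C & forall n Q', (4 <= n)%N ->
 IG (n+n) (@off R n Q' r) /\
 EG (n+n) (@off R n Q' r) <= C*n%:R^+3/Q'.+1%:R^+r.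
have [c c0 hc] := evp_scaled r.+1.*2.
exists (36*c+4*(expR 1*8^+r.+3)).
 by rewrite addr_ge0// mulr_ge0 mulr_ge0 exprn_ge0.
move=> n Q' n4; have n0 : (0 < n)%N by exact: leq_trans n4.
have n1 : 1 <= n%:R :> R by rewrite ler1n.
pose Q : R := Q'.+1%:R; have Q1 : 1 <= Q by rewrite ler1n.
have QR : 0 < Q by [].
have /andP[k1 _] := Kq_bounds Q'; have K0 : 0 < Kq R Q' by exact: lt_le_trans k1.
pose P f (a : R) := IG (n+n) f /\ EG (n+n) f <= a.
have PS (I : finType) f (a b : R) : (forall i : I, P (f i) a) -> #|I|%:R*a <= b -> P (fun x => \sum_i f i x) b.
 move=> h ab; split; first by apply: intg_sum => i _; case: (h i).
 rewrite Ex_sum => [|i]; last by case: (h i).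
 by apply: le_trans ab; rewrite mulr_natl -sumr_const; apply: ler_sum => i _; case: (h i).
have PD f g (a b : R) : P f a -> P g b -> P (fun x => f x+g x) (a+b).
 by move=> [i1 h1] [i2 h2]; split; [exact: intgD|rewrite ExD//; exact: lerD].
have ef m t : P (fun x => evp r.+1.*2 ((Kq R Q')^-1*@ft R n m t x)) (c/Q^+r.+1).
 have [h1 h2] := hc _ (trigd (@wunit R n) m t) (Kq R Q')^-1 (trigd_nsq1 n4 m t).
 split=> //; apply: le_trans h2 _; rewrite mulrC; apply: ler_wpM2l => //.
 rewrite exprVn lef_pV2 ?posrE ?exprn_gt0// /Q -Kq_pow4 -exprM.
 by rewrite (_ : r.+1.*2.*2 = (4*r.+1)%N)// -!mul2n mulnA.
have ex i : P (fun x => evp r.+1.*2 ((n*Q'.+1)%:R^-1 * tnth x i)) (c/Q^+r).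
 have d1 : \sum_(j < n+n) ((j == i)%:R : R)^+2 <= 1 by rewrite delta_nsq.
 have [] := hc _ _ ((n*Q'.+1)%:R^-1) d1.
 under eq_fun do rewrite dot_delta.
 move=> h1 h2; split=> //; apply: le_trans h2 _; rewrite mulrC; apply: ler_wpM2l => //.
 rewrite exprVn lef_pV2 ?posrE ?exprn_gt0// ?ltr0n ?muln_gt0 ?n0//.
 apply: (le_via (Q^+r.+1.*2.*2)).
  by apply: ler_weXn2l => //; rewrite -!muln2; lia.
 by apply: lerXn2r; rewrite ?nnegrE// natrM -/Q ler_peMl.
have eb i : P (fun x => expR 1*bump (rhoq R Q' r) (@hx R n (cpt R (n*Q'.+1) i) x))
  (expR 1*(2*8^+r.+3/Q^+r.+2)).
 split; first by apply: intgZ; exact: intg_bump_hx.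
 rewrite ExZ; last exact: intg_bump_hx.
 apply: ler_wpM2l => //.
 by apply: le_trans (rhoq_le _ _); apply: E_bump.
have n3 : n%:R <= n%:R^+3 :> R by rewrite -[leLHS]expr1; exact: ler_weXn2l.
have E1 m := PS _ _ _ (17*c*n%:R^+3/Q^+r) (fun j : 'I_(Mq n Q').+1 => ef m (cpt R (Mq n Q') j)).
have E3 := PS _ _ _ (2*c*n%:R^+3/Q^+r) ex.
have E4 := PS _ _ _ (4*(expR 1*8^+r.+3)*n%:R^+3/Q^+r) (fun i : 'I_(n*Q'.+1).+1 => eb i).
rewrite !card_ord in E1 E3 E4.
suff : P (@off R n Q' r) (17*c*n%:R^+3/Q^+r+17*c*n%:R^+3/Q^+r+2*c*n%:R^+3/Q^+r +
  4*(expR 1*8^+r.+3)*n%:R^+3/Q^+r).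
 by move=> [h1 h2]; split=> //; apply: le_trans h2 _; rewrite -/Q; move: (Q^+r)^-1 (8^+r.+3 : R) => b d; lra.
have h17 : (Mq n Q').+1%:R*(c/Q^+r.+1) <= 17*c*n%:R^+3/Q^+r.
 have -> : 17*c*n%:R^+3/Q^+r = 17*n%:R^+3*Q*(c/Q^+r.+1) :> R by exact: shift_pow1.
 apply: ler_wpM2r => //.
 rewrite /Mq -natr1 !natrM -/Q.
 have : 1 <= n%:R^+3*Q by rewrite mulr_ege1// exprn_ege1.
 by rewrite (_ : n%:R*n%:R*n%:R = n%:R^+3 :> R); [lra|ring].
rewrite /off; refine (PD _ _ _ _ (PD _ _ _ _ (PD _ _ _ _ (E1 2%N h17) (E1 r.+3 h17)) (E3 _)) (E4 _)).
 rewrite (_ : 2*c*n%:R^+3/Q^+r = 2*n%:R^+3*(c/Q^+r)); last by ring.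
 by apply: ler_wpM2r => //; rewrite natrD; lra.
have -> : 4*(expR 1*8^+r.+3)*n%:R^+3/Q^+r =
  2*n%:R^+3*Q^+2*(expR 1*(2*8^+r.+3/Q^+r.+2)) by exact: shift_pow2.
have p8 : 0 <= 8^+r.+3 :> R by exact: exprn_ge0.
apply: ler_wpM2r.
 apply: mulr_ge0; first exact: expR_ge0.
 by apply: divr_ge0; [apply: mulr_ge0|apply: exprn_ge0; exact: ltW].
have h1 : n%:R*Q <= n%:R^+3*Q^+2.
 by apply: ler_pM => //; rewrite -[leLHS]expr1; exact: ler_weXn2l.
have h2 : 1 <= n%:R*Q by exact: mulr_ege1.
by rewrite -natr1 natrM -/Q; lra.
Qed.

Lemma bumps_kapq_mean n Q' : (4 <= n)%N -> (8 <= Q'.+1)%N ->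
 EG (n+n) (@bumps R n Q' (kapq R Q')) <= (3*2^+14)*n%:R*Num.sqrt Q'.+1%:R/Q'.+1%:R^+2.
move=> n4 Q8; apply: le_trans (bumps_mean n4 Q8 (kapq_gt0 R Q')) _.
have QR : 0 < Q'.+1%:R :> R by [].
have -> : (3*2^+14)*n%:R*Num.sqrt Q'.+1%:R/Q'.+1%:R^+2 =
 3*n%:R*(2^+14*Num.sqrt Q'.+1%:R/Q'.+1%:R^+4)*Q'.+1%:R^+2 :> R.
 by move: (n%:R : R) (Num.sqrt (Q'.+1%:R : R)) (Q'.+1%:R : R) QR => a s q q0; field; rewrite gt_eqF.
apply: ler_wpM2r => //.
by apply: ler_wpM2l; [exact: mulr_ge0|exact: kapq_sq].
Qed.

Lemma intg_bumps n Q' (k : R) : (4 <= n)%N -> IG (n+n) (@bumps R n Q' k).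
by move=> n4; exact: (intg_bounded _ (bumps_meas n4 Q' k) (fun x => bumps_bound n4 Q' k x)). Qed.

Lemma intg_NN n m : IG (n+n) (@NN R n m).
exact: (intg_bounded _ (NN_meas m) (fun x => NN_bound m x)). Qed.

Lemma intg_ZZ n : (4 <= n)%N -> IG (n+n) (@ZZ R n).
by move=> n4; exact: (intg_bounded _ (ZZ_meas n4) (fun x => ZZ_norm x)). Qed.

Lemma ZZ_mean_diff r : exists2 C : R, 0 <= C & forall n Q', (4 <= n)%N -> (8 <= Q'.+1)%N ->
 `|EG (n+n) (@ZZ R n)-EG (n+n) (@NN R n (n*Q'.+1))| <=
 C*(n%:R*Num.sqrt Q'.+1%:R/Q'.+1%:R^+2+n%:R^+4*Q'.+1%:R/Q'.+1%:R^+r).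
have [C C0 hC] := off_mean r.
have L0 : 0 <= r.+2%:R*(expR 1*(3*2^+14)) :> R by [].
exists (r.+2%:R*(expR 1*(3*2^+14))+2*C) => //.
move=> n Q' n4 Q8; have [Io Eo] := hC n Q' n4.
have Ib := intg_bumps Q' (kapq R Q') n4.
rewrite -ExB; [|exact: intg_ZZ|exact: intg_NN].
have mD : msr (fun x => @ZZ R n x-@NN R n (n*Q'.+1) x) by exact: measurable_funB.
have I1 : IG (n+n) (fun x => r.+2%:R*(expR 1*@bumps R n Q' (kapq R Q') x)) by apply: intgZ; exact: intgZ.
have I2 : IG (n+n) (fun x => (n*Q'.+1+n.*2)%:R*@off R n Q' r x) by exact: intgZ.
apply: le_trans (Ex_abs_le mD (intgD I1 I2) (@zeros_approx_all R n n4 Q' r)) _.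
rewrite ExD// !ExZ//; last exact: intgZ.
have QR : 0 < Q'.+1%:R :> R by [].
set a := n%:R*_/_; set b := n%:R^+4*_/_.
have a0 : 0 <= a by [].
have b0 : 0 <= b by [].
have h1 : r.+2%:R*(expR 1*EG (n+n) (@bumps R n Q' (kapq R Q'))) <= r.+2%:R*(expR 1*(3*2^+14))*a.
 rewrite -!mulrA; apply: ler_wpM2l => //; apply: ler_wpM2l => //.
 by apply: le_trans (bumps_kapq_mean n4 Q8) _; rewrite /a !mulrA.
have h2 : (n*Q'.+1+n.*2)%:R*EG (n+n) (@off R n Q' r) <= 2*C*b.
 have -> : 2*C*b = 2*n%:R*Q'.+1%:R*(C*n%:R^+3/Q'.+1%:R^+r) by rewrite /b; ring.
 apply: ler_pM => //; first by apply: Ex_ge0 => x; exact: off_ge0.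
 rewrite natrD natrM -mul2n natrM.
 have : n%:R*2 <= n%:R*Q'.+1%:R :> R by apply: ler_wpM2l => //; rewrite (ler_nat R 2); exact: leq_trans Q8.
 by lra.
move: h1 h2 L0; move: (r.+2%:R*(expR 1*(3*2^+14))) => L h1 h2 L0.
have : 0 <= 2*C*a by [].
have : 0 <= L*b by [].
by lra.
Qed.

(** In this inequality and the next two, s stands for sqrt Q; they collect the powers of s for
    [ZZ_L2_diff]. *)
Lemma var_shift (N a b s K : R) : 0 < s -> 0 <= N -> 0 <= a -> K <= b*s/(s^+2)^+4 ->
 4*(N*a*(s^+2)^+2*(3*K*s^+2)) <= 4*a*(3*b)*N/s.
move=> s0 N0 a0 hK.
have -> : 4*(N*a*(s^+2)^+2*(3*K*s^+2)) = 12*N*a*s^+6*K by ring.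
have -> : 4*a*(3*b)*N/s = 12*N*a*s^+6*(b*s/(s^+2)^+4) by field.
exact: ler_wpM2l.
Qed.

Lemma sq_shift (B s : R) : 1 <= s -> (B*s/(s^+2)^+2)^+2 <= B^+2/s.
move=> s1; have s0 : 0 < s by exact: lt_le_trans s1.
have -> : (B*s/(s^+2)^+2)^+2 = B^+2/s*(s^-1)^+5 by field.
apply: ler_piMr => //.
by rewrite exprn_ile1 ?(ltW s0)// invf_le1.
Qed.

Lemma cube_shift (N C s : R) : 1 <= s -> 0 <= N -> 0 <= C ->
 (3*N*s^+2)^+2*(C*N^+3/(s^+2)^+3) <= 9*C*N^+5/s.
move=> s1 N0 C0; have s0 : 0 < s by exact: lt_le_trans s1.
have -> : (3*N*s^+2)^+2*(C*N^+3/(s^+2)^+3) = 9*C*N^+5/s*s^-1 by field.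
by apply: ler_piMr; [nneg|rewrite invf_le1].
Qed.

(** The constant D depends on n: the lemma serves to let Q tend to infinity at fixed n and so to
    identify the limit of the telescoping sum. *)
Lemma ZZ_L2_diff n : (4 <= n)%N -> exists2 D : R, 0 <= D & forall Q', (8 <= Q'.+1)%N ->
 EG (n+n) (fun x => (@ZZ R n x-@NN R n (n*Q'.+1) x)^+2) <= D/Num.sqrt Q'.+1%:R.
move=> n4; have [C C0 hC] := off_mean 3.
pose N : R := n%:R.
have N0 : 0 <= N by [].
pose c1 : R := (5*expR 1)^+2.
pose c2 : R := 4*2160*(3*2^+14)*N+((3*2^+14)*N)^+2.
pose c3 : R := 9*C*N^+5.
have c10 : 0 <= c1 by [].
have c20 : 0 <= c2 by [].
have c30 : 0 <= c3 by [].
exists (c1*c2+c3) => //.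
move=> Q' Q8; have [Io Eo] := hC n Q' n4.
have Q1 : 1 <= Q'.+1%:R :> R by rewrite ler1n.
have QR : 0 < Q'.+1%:R :> R by [].
pose s : R := Num.sqrt Q'.+1%:R.
have s1 : 1 <= s by have /andP[] := sqrt_ge1 Q1.
have s0 : 0 < s by [].
have sQ : Q'.+1%:R = s^+2 by rewrite sqr_sqrtr// ltW.
pose k := kapq R Q'; have k0 : 0 < k by exact: kapq_gt0.
have mb := bumps_meas n4 Q' k; have bb := fun x => bumps_bound n4 Q' k x.
have b2 : EG (n+n) (fun x => @bumps R n Q' k x^+2) <= c2/s.
 have := VrE (gauss (n+n)) mb bb.
 have : Vr (gauss (n+n)) (@bumps R n Q' k) <= 4*2160*(3*2^+14)*N/s.
  apply: le_trans (bumps_var n4 Q8 k0) _.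
  have hk : k^+2 <= 2^+14*s/(s^+2)^+4 by rewrite -sQ; exact: kapq_sq.
  by rewrite sQ; exact: (var_shift s0 N0 (ler0n _ 2160) hk).
 have : EG (n+n) (@bumps R n Q' k)^+2 <= ((3*2^+14)*N)^+2/s.
  apply: (le_via (((3*2^+14)*N*s/Q'.+1%:R^+2)^+2)).
   apply: lerXn2r; rewrite ?nnegrE.
   - by [].
   - by [].
   - exact: bumps_kapq_mean.
  by rewrite sQ; exact: sq_shift.
 by rewrite /c2 mulrDl; lra.
have Ib2 : IG (n+n) (fun x => @bumps R n Q' k x^+2).
 apply: (intg_bnd ((n*Q'.+1)%:R^+2)) => //.
 by move=> x; rewrite normrX lerXn2r.
have m0 : 0 <= (n*Q'.+1+n.*2)%:R :> R by [].
have pw x : `|(@ZZ R n x-@NN R n (n*Q'.+1) x)^+2| <=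
  c1*@bumps R n Q' k x^+2+(n*Q'.+1+n.*2)%:R^+2*@off R n Q' 3 x.
 have o0 := @off_ge0 R n Q' 3 x.
 rewrite normrX; have [h|h] := ltP (@off R n Q' 3 x) 1.
  apply: (le_via (c1*@bumps R n Q' k x^+2)); last by rewrite lerDl mulr_ge0// exprn_ge0.
  rewrite /c1 -exprMn -mulrA; apply: lerXn2r; rewrite ?nnegrE//.
   exact: le_trans (zeros_approx n4 h).
 apply: (le_via ((n*Q'.+1+n.*2)%:R^+2*@off R n Q' 3 x)); last first.
  by rewrite lerDr mulr_ge0// sqr_ge0.
 apply: (le_via ((n*Q'.+1+n.*2)%:R^+2)); last by rewrite ler_peMr// exprn_ge0.
 apply: lerXn2r; rewrite ?nnegrE//; apply: ler_normB_via.
 by rewrite natrD addrC; apply: lerD; [exact: NN_bound|exact: ZZ_norm].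
apply: le_trans (ler_norm _) _.
have mD : msr (fun x => (@ZZ R n x-@NN R n (n*Q'.+1) x)^+2) by apply: measurable_funX; apply: measurable_funB.
have I1 : IG (n+n) (fun x => c1*@bumps R n Q' k x^+2) by exact: intgZ.
have I2 : IG (n+n) (fun x => (n*Q'.+1+n.*2)%:R^+2*@off R n Q' 3 x) by exact: intgZ.
apply: le_trans (Ex_abs_le mD (intgD I1 I2) pw) _.
rewrite ExD// !ExZ// mulrDl; apply: lerD.
 by rewrite -mulrA; apply: ler_wpM2l.
apply: (le_via ((3*N*Q'.+1%:R)^+2*(C*N^+3/Q'.+1%:R^+3))).
 apply: ler_pM; [exact: sqr_ge0|by apply: Ex_ge0 => x; exact: off_ge0| |exact: Eo].
 apply: lerXn2r; rewrite ?mulr_ge0//; rewrite natrD natrM -mul2n natrM -/N.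
 have : N*1 <= N*Q'.+1%:R :> R by apply: ler_wpM2l.
 by lra.
by rewrite -/s sQ; exact: cube_shift.
Qed.

End zero_expectations.

(** * Dyadic levels and convexity *)

Section dyadic_levels.
Variable R : realType.

(** The predecessor of the level Q = 8 2^j, since the mesh parameter is always written Q'+1. *)
Definition Qd (j : nat) : nat := (8*2 ^ j).-1.

Lemma QdE j : (Qd j).+1 = (8*2 ^ j)%N.
by rewrite /Qd prednK// muln_gt0 expn_gt0. Qed.

Lemma Qd8 j : (8 <= (Qd j).+1)%N.
by rewrite QdE leq_pmulr// expn_gt0. Qed.

Lemma QdR j : (Qd j).+1%:R = 8*2^+j :> R.
by rewrite QdE natrM natrX. Qed.

(** Lets level j have a weight of order j^(-2) in the exponential moment: the square of (j+1)(j+2)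
    is absorbed by the factor 2^(-j). The ratio of the two powers is largest at j = 4, where it is
    81. *)
Lemma pow4_le_exp2 j : (j.+2 ^ 4 <= 82*2 ^ j)%N.
case: j => [//|[//|[//|[//|j]]]].
elim: j => [//|j IH].
have h : (j.+4.+3 ^ 4 <= 2*j.+4.+2 ^ 4)%N by rewrite !expnS !expn0; nia.
rewrite [in leqRHS]expnS; apply: leq_trans h _.
by rewrite mulnCA leq_mul2l.
Qed.

(** The missing mass 1 - sum_i w_i is placed at 0, where the exponential is 1. *)
Lemma jensen_exp (I : finType) (w a : I -> R) : (forall i, 0 <= w i) -> \sum_i w i <= 1 ->
 expR (\sum_i w i*a i) <= \sum_i w i*expR (a i)+(1-\sum_i w i).
move=> w0 w1; set s := \sum_i w i*a i.
have tl (y : R) : expR s*(1+(y-s)) <= expR y.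
 have -> : expR y = expR s*expR (y-s) by rewrite -expRD; congr expR; ring.
 by apply: ler_wpM2l; [exact: expR_ge0|exact: expR_ge1Dx].
have h1 : \sum_i w i*(expR s*(1+(a i-s))) <= \sum_i w i*expR (a i) by apply: ler_sum => i _; apply: ler_wpM2l.
have E1 : \sum_i w i*(expR s*(1+(a i-s))) = expR s*((1-s)*\sum_i w i+s).
 transitivity (\sum_i (expR s*(1-s)*w i+expR s*(w i*a i))).
  by apply: eq_bigr => i _; ring.
 by rewrite big_split/= -!mulr_sumr -/s; ring.
have h2 : expR s*(1-s) <= 1.
 by have := tl 0; rewrite expR0 sub0r.
have h3 : (1-\sum_i w i)*(expR s*(1-s)) <= (1-\sum_i w i)*1 by apply: ler_wpM2l => //; rewrite subr_ge0.
by rewrite E1 in h1; lra.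
Qed.

Lemma expR_ge_pow (x : R) q : 0 <= x -> (x/q.+1%:R)^+q.+1 <= expR x.
move=> x0; have q0 : 0 < q.+1%:R :> R by [].
have -> : expR x = expR (x/q.+1%:R)^+q.+1 by rewrite -expRM_natl -mulr_natl mulrC divfK ?gt_eqF.
apply: lerXn2r; rewrite ?divr_ge0//.
by apply: le_trans (expR_ge1Dx _); rewrite lerDr.
Qed.

Lemma expRN_le_pow (a : R) q : 0 < a -> exists2 C : R, 0 <= C & forall u, 1 <= u ->
 expR (- (a*u)) <= C/u^+q.
move=> a0; exists ((q.+1%:R/a)^+q.+1) => //.
move=> u u1; have u0 : 0 < u by exact: lt_le_trans u1.
have au : 0 < a*u by [].
have h := @expR_ge_pow (a*u) q (ltW au).
have p0 : 0 < (a*u/q.+1%:R)^+q.+1 by [].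
rewrite expRN; apply: (le_via ((a*u/q.+1%:R)^+q.+1)^-1).
 by rewrite lef_pV2.
rewrite -exprVn (_ : (a*u/q.+1%:R)^-1 = q.+1%:R/a*u^-1); last first.
 by field; rewrite !gt_eqF.
rewrite exprMn; apply: ler_wpM2l => //.
rewrite exprVn lef_pV2 ?exprn_gt0//; apply: ler_weXn2l => //.
Qed.

End dyadic_levels.

(** * Summation over levels: exponential moment and variance *)

Section level_sums.
Variables (R : realType) (n : nat).
Hypothesis n4 : (4 <= n)%N.
Notation tp := ((n+n).-tuple R).
Notation G := (gauss (R := R) (n+n)).
Notation N j := (@NN R n (n*(Qd j).+1)).
Notation B j := (@BB R n (Qd j)).

Let nR : 0 < n%:R :> R. by rewrite ltr0n (leq_trans _ n4). Qed.

Lemma N_step j x : N j.+1 x = N j x+2*B j x.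
have n0 : (0 < n)%N by exact: leq_trans n4.
by rewrite -(NN_double n4) !QdE expnS -!muln2; congr (NN _ _); lia.
Qed.

Lemma N_sum k x : N k x = N 0 x+\sum_(j < k) 2*B j x.
elim: k => [|k IH]; first by rewrite big_ord0 addr0.
by rewrite N_step IH big_ord_recr/= addrA.
Qed.

Lemma intg_BB j : intg G (B j).
exact: (intg_bounded _ (BB_meas n4 _) (fun x => BB_bound n4 _ x)). Qed.

Lemma EN_sum k : Ex G (N k) = Ex G (N 0)+\sum_(j < k) 2*Ex G (B j).
rewrite (Ex_eq _ (N_sum k)) ExD; [|exact: intg_NN|]; last first.
 by apply: intg_sum => j _; apply: intgZ; exact: intg_BB.
have Ib j : intg G (fun x => 2*B j x) by apply: intgZ; exact: intg_BB.
congr (_+_); rewrite Ex_sum//.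
by apply: eq_bigr => j _; rewrite ExZ//; exact: intg_BB.
Qed.

(** 1/sqrt n is the inverse scale of the fluctuations; the power of 2 is small enough for the
    conditions and exponents of all levels together. *)
Definition lam0 : R := (2^+17)^-1/Num.sqrt n%:R.

Lemma lam0_sq : lam0^+2 = (2^+34)^-1/n%:R.
rewrite /lam0 exprMn !exprVn sqr_sqrtr => //.
by rewrite -exprM.
Qed.

(** Applied with P = 2^j, m = n and s proportional to the inverse weight: P s is at most of order
    P^(3/2), hence of order sqrt n, as long as (8P)^3 <= n. This is how the levels come to be
    restricted to Q^3 <= n. *)
Lemma level_cond (P s m l : R) : 0 < P -> 0 <= s -> s^+2 <= 82*P -> 512*P^+3 <= m ->
 0 <= l -> l^+2 * m*2^+34 = 1 -> 2160*(8*P*(l*(4*s))) <= 2^-1.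
move=> P0 s0 sP Pm l0 lm; set X := leLHS.
have X0 : 0 <= X by [].
have m0 : 0 < m by exact: lt_le_trans Pm.
rewrite leNgt; apply/negP => hX.
have X2 : 2^-1^+2 <= X^+2 by apply: lerXn2r; rewrite ?nnegrE// ltW.
have E1 : X^+2 * m*2^+34 = (2160*32)^+2*(P^+2*s^+2)*(l^+2 * m*2^+34) by rewrite /X; ring.
rewrite lm mulr1 in E1.
have h1 : P^+2*s^+2 <= P^+2*(82*P) by apply: ler_wpM2l.
have h2 : P^+2*(82*P) = 82*P^+3 by ring.
have h3 : 2^-1^+2 * m <= X^+2 * m by apply: ler_wpM2r.
by move: E1 h1 h2 h3 Pm m0; move: (P^+3) (P^+2*s^+2) (P^+2*(82*P)) (X^+2 * m) => a b c d; lra.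
Qed.

(** N_k is N_0 plus the corrections 2 B_j, and the exponential of the sum is bounded by convexity
    with weights 1/2 and 1/(2(j+1)(j+2)), whose sum telescopes below 1. Dividing by the weight
    enlarges the parameter of level j by a factor of order j^2, which its variance proxy n/2^j
    absorbs. *)
Lemma N_exp_moment k (sg : R) : sg^+2 = 1 -> (512*8 ^ k <= n)%N ->
 Ex G (fun x => expR (sg * lam0*(N k x-Ex G (N k)))) <= expR 1.
move=> sg1 kn.
pose w (i : 'I_k.+1) : R := if unlift ord0 i is Some j then (2*(j.+1%:R*j.+2%:R))^-1 else 2^-1.
pose a (i : 'I_k.+1) (x : tp) : R := if unlift ord0 i is Some j
 then sg * lam0*(4*(j.+1%:R*j.+2%:R))*(B j x-Ex G (B j))
 else sg * lam0*2*(N 0 x-Ex G (N 0)).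
have w0 i : 0 <= w i by rewrite /w; case: unlift => [j|]; rewrite invr_ge0// mulr_ge0.
have w1 : \sum_i w i <= 1.
 rewrite big_ord_recl /w unlift_none.
 under eq_bigr do rewrite liftK.
 have -> : \sum_(i < k) (2*(i.+1%:R * i.+2%:R))^-1 = 2^-1-(2*k.+1%:R)^-1 :> R.
  elim: k {kn w a w0} => [|k IH]; first by rewrite big_ord0 mulr1 subrr.
  rewrite big_ord_recr/= IH -(natr1 k.+1); have : k.+1%:R != 0 :> R by [].
  have : k.+1%:R+1 != 0 :> R by rewrite natr1.
  by move: (k.+1%:R : R) => y y1 y0; field; rewrite y1 y0.
 have : 0 <= (2*k.+1%:R)^-1 :> R by [].
 by move: (2*k.+1%:R)^-1 => y y0; lra.
have sE x : sg * lam0*(N k x-Ex G (N k)) = \sum_i w i*a i x.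
 rewrite big_ord_recl /w /a unlift_none N_sum EN_sum.
 under [in RHS]eq_bigr do rewrite liftK.
 have -> : \sum_(i < k) (2*(i.+1%:R * i.+2%:R))^-1*(sg * lam0*(4*(i.+1%:R * i.+2%:R))*(B i x-Ex G (B i)))
  = sg * lam0*(\sum_(j < k) 2*B j x-\sum_(j < k) 2*Ex G (B j)).
  rewrite -sumrB mulr_sumr; apply: eq_bigr => i _.
  have : i.+1%:R != 0 :> R by []; have : i.+2%:R != 0 :> R by [].
  by move: (i.+1%:R : R) (i.+2%:R : R) => y z z0 y0; field; rewrite y0 z0.
 by field.
have ma i : msr (a i) /\ exists M, forall x, `|a i x| <= M.
 rewrite /a; case: unliftP => [j|] _.
  split; first by apply: measurable_funM; [exact: measurable_cst|apply: measurable_funB; [exact: BB_meas|exact: measurable_cst]].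
  exists (`|sg * lam0*(4*(j.+1%:R*j.+2%:R))|*((n*(Qd j).+1)%:R + `|Ex G (B j)|)) => x.
  rewrite normrM; apply: ler_wpM2l => //; apply: ler_normB_via.
  by rewrite lerD2r; exact: BB_bound.
 split; first by apply: measurable_funM; [exact: measurable_cst|apply: measurable_funB; [exact: NN_meas|exact: measurable_cst]].
 exists (`|sg * lam0*2|*((n*(Qd 0).+1)%:R + `|Ex G (N 0)|)) => x.
 rewrite normrM; apply: ler_wpM2l => //; apply: ler_normB_via.
 by rewrite lerD2r; exact: NN_bound.
have Ia i : intg G (fun x => w i*expR (a i x)).
 apply: intgZ; have [m1 [M hM]] := ma i.
 apply: (intg_bnd (expR M)); first exact: (measurableT_comp (@measurable_expR R)).
 by move=> x; rewrite ger0_norm ?expR_ge0// ler_expR (le_trans (ler_norm _)).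
have l0 : 0 <= lam0 by rewrite /lam0; nneg.
have lm : lam0^+2*n%:R*2^+34 = 1 by rewrite lam0_sq; field; rewrite gt_eqF.
have lmn : lam0^+2*n%:R = (2^+34)^-1 by rewrite lam0_sq mulfVK// gt_eqF.
have asg : `|sg| = 1.
 by apply/eqP; rewrite -(@eqrXn2 _ 2)// expr1n sqr_normr// sg1.
have kR : 512*8^+k <= n%:R :> R by rewrite -natrX -natrM ler_nat.
have Ea i : Ex G (fun x => expR (a i x)) <= expR 1.
 rewrite /a; case: unliftP => [j|] _.
  have P0 : 0 < 2^+j :> R by exact: exprn_gt0.
  have s0 : 0 <= j.+1%:R*j.+2%:R :> R by rewrite mulr_ge0.
  have s2 : (j.+1%:R*j.+2%:R)^+2 <= 82*2^+j :> R.
   rewrite -natrX -!natrM -natrX ler_nat; apply: leq_trans (pow4_le_exp2 j).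
   by rewrite (expnM _ 2 2) leq_exp2r// (expnS _ 1) expn1 leq_mul2r leqnSn orbT.
  have Pn : 512*(2^+j)^+3 <= n%:R :> R.
   apply: le_trans kR; apply: ler_wpM2l; first exact: ler0n.
   rewrite -exprM mulnC exprM (_ : 2^+3 = 8 :> R); last by ring.
   by apply: ler_weXn2l; [lra|exact: ltnW (ltn_ord j)].
  have nl : `|sg * lam0*(4*(j.+1%:R*j.+2%:R))| = lam0*(4*(j.+1%:R*j.+2%:R)).
   by rewrite -mulrA normrM asg mul1r ger0_norm// mulr_ge0// mulr_ge0.
  apply: le_trans (BB_mgf n4 (Qd8 j) _) _.
   by rewrite nl QdR; exact: (level_cond P0 s0 s2 Pn l0 lm).
  rewrite ler_expR QdR.
  have -> : 2160*64*n%:R/(8*2^+j)*(sg * lam0*(4*(j.+1%:R*j.+2%:R)))^+2 =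
   2160*128*((j.+1%:R*j.+2%:R)^+2/2^+j)*(sg^+2*(lam0^+2*n%:R)).
   by move: P0 (j.+1%:R*j.+2%:R : R); move: (2^+j : R) => P P0 s; field; rewrite gt_eqF.
  rewrite sg1 mul1r lmn.
  have h1 : (j.+1%:R*j.+2%:R)^+2/2^+j <= 82 :> R by rewrite ler_pdivrMr.
  by move: h1; move: (_/2^+j : R) => y; lra.
 have nl : `|sg * lam0*2| = lam0*(4*2^-1).
  by rewrite -mulrA normrM asg mul1r ger0_norm ?mulr_ge0//; congr (_*_); field.
 apply: le_trans (NN_mgf n4 (leq_trans _ (Qd8 0)) _) _ => //.
  have half0 : 0 <= 2^-1 :> R by lra.
  have half2 : 2^-1^+2 <= 82*2^+0 :> R by rewrite expr0; lra.
  have n512 : 512*(2^+0)^+3 <= n%:R :> R.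
   rewrite expr0 expr1n mulr1; apply: le_trans kR; rewrite -[leLHS]mulr1; apply: ler_wpM2l; first exact: ler0n.
   by rewrite exprn_ege1//; lra.
  by rewrite nl QdR; exact: (level_cond ltr01 half0 half2 n512 l0 lm).
 rewrite ler_expR QdR expr0 mulr1.
 have -> : n%:R*2160*8^+2*(sg * lam0*2)^+2 = 2160*256*(sg^+2*(lam0^+2*n%:R)) by ring.
 by rewrite sg1 mul1r lmn; lra.
rewrite (Ex_eq _ (fun x => congr1 expR (sE x))).
have Is : intg G (fun x => \sum_i w i*expR (a i x)) by apply: intg_sum.
have I2 := intgD Is (intg_cst G (1-\sum_i w i)).
have ms : msr (fun x => expR (\sum_i w i*a i x)).
 apply: (measurableT_comp (@measurable_expR R)); apply: measurable_sum => i.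
 by apply: measurable_funM; [exact: measurable_cst|case: (ma i)].
apply: (le_via (Ex G (fun x => \sum_i w i*expR (a i x)+(1-\sum_i w i)))).
 apply: le_trans (ler_norm _) _; apply: Ex_abs_le => // x.
 by rewrite ger0_norm ?expR_ge0//; exact: jensen_exp.
rewrite ExD//; last exact: intg_cst.
rewrite Ex_sum// Ex_cst.
have h1 : \sum_i Ex G (fun x => w i*expR (a i x)) <= \sum_i w i*expR 1.
 apply: ler_sum => i _; have [m1 [M hM]] := ma i.
 rewrite ExZ; first by apply: ler_wpM2l.
 apply: (intg_bnd (expR M)); first exact: (measurableT_comp (@measurable_expR R)).
 by move=> x; rewrite ger0_norm ?expR_ge0// ler_expR (le_trans (ler_norm _)).
rewrite -mulr_suml in h1.
have e1 : 1 <= expR 1 :> R by rewrite -[leLHS]expR0 ler_expR.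
have : (1-\sum_i w i)*1 <= (1-\sum_i w i)*expR 1 by apply: ler_wpM2l => //; rewrite subr_ge0.
by move: h1; move: (\sum_i w i) (\sum_i Ex G (fun x => w i*expR (a i x))) => s u; lra.
Qed.

Lemma B_var j : Vr G (fun x => 2*B j x) <= 2160*128*n%:R/2^+j.
rewrite (VrZ _ _ (BB_meas n4 _) (fun x => BB_bound n4 _ x)).
have := BB_var R n4 (Qd8 j); rewrite QdR.
have P0 : 0 < 2^+j :> R by [].
rewrite (_ : 8640*64*n%:R/(8*2^+j) = 2160*32*n%:R/2^+j); last first.
 by move: (2^+j : R) P0 => P P0; field; rewrite gt_eqF.
by move: (Vr _ _) => v; move: (n%:R/2^+j : R) => u; lra.
Qed.

(** The coarsest level is split off with the weights 1+2 and 1+1/2. With V the bound of [B_var] at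
    level j, the recursion closes since 3 V + (3/2)(12 V/2) = 12 V. *)
Lemma levels_var j m : Vr G (fun x => \sum_(i < m) 2*B (j + i) x) <= 12*(2160*128)*n%:R/2^+j.
pose A : R := 2160*128*n%:R.
have A0 : 0 <= A by [].
have mB i : msr (fun x => 2*B i x) by [].
have bB i x : `|2*B i x| <= 2*(n*(Qd i).+1)%:R by rewrite normrM (ger0_norm (ler0n _ 2)) ler_pM2l//; exact: BB_bound.
suff : Vr G (fun x => \sum_(i < m) 2*B (j + i) x) <= 12*A/2^+j by rewrite /A !mulrA.
elim: m j => [|m IH] j.
 have -> : (fun x : tp => \sum_(i < 0) 2*B (j + i) x) = fun=> 0 by apply/funext => x; rewrite big_ord0.
 by rewrite Vr_cst.
have mS j' : msr (fun x => \sum_(i < m) 2*B (j' + i) x) by [].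
pose M1 : R := 2*(n*(Qd j).+1)%:R; pose M2 : R := \sum_(i < m) 2*(n*(Qd (j.+1 + i)).+1)%:R.
have M10 : 0 <= M1 by [].
have M20 : 0 <= M2 by [].
have E x : \sum_(i < m.+1) 2*B (j + i) x = 2*B j x+\sum_(i < m) 2*B (j.+1 + i) x by rewrite big_ord_recl/= addn0; congr (_+_); apply: eq_bigr => i _; rewrite addSnnS.
rewrite (Vr_eq _ E).
have b1 x : `|2*B j x| <= M1+M2 by apply: le_trans (bB j x) _; rewrite lerDl.
have b2 x : `|\sum_(i < m) 2*B (j.+1 + i) x| <= M1+M2.
 apply: (le_via M2); last by rewrite lerDr.
 by apply: le_trans (ler_norm_sum _ _ _) _; apply: ler_sum => i _.
apply: le_trans (VrD_le G (ltr0n _ 2) (mB j) (mS j.+1) b1 b2) _.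
have h1 := B_var j; rewrite -/A in h1; have h2 := IH j.+1.
have e2 : 12*A/2^+j.+1 = 6*(A/2^+j).
 have P0 : 0 < 2^+j :> R by [].
 by rewrite exprS; move: (2^+j : R) P0 => P P0; field.
rewrite e2 in h2; rewrite -mulrA.
by move: h1 h2; move: (Vr _ _) (Vr _ _) (A/2^+j) => u v a; lra.
Qed.

(** At fixed n the count at level j+k tends to the number of zeros in mean square as k grows, so the
    bound on the telescoping sum passes to the limit. *)
Lemma ZZ_level_var j : Vr G (fun x => @ZZ R n x-N j x) <= 2160*4096*n%:R/2^+j.
have [D D0 hD] := ZZ_L2_diff R n4.
pose V : R := 2160*128*12*n%:R/2^+j.
suff h e : 0 < e -> Vr G (fun x => @ZZ R n x-N j x) <= 2*V+e.
 apply: (le_via (2*V)).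
  by apply/ler_addgt0Pr => e; exact: h.
 rewrite /V -!mulrA; have : 0 <= n%:R/2^+j :> R by rewrite mulr_ge0// invr_ge0 exprn_ge0.
 by move: (n%:R/2^+j) => u; lra.
move=> e0.
have [k hk] : exists k, 2*(D/Num.sqrt (Qd (j+k)).+1%:R) <= e.
 have [k0 hk0] := small_step (2*D) e0; exists k0; apply: le_trans hk0.
 rewrite mulrA; apply: ler_wpM2l => //.
 rewrite lef_pV2 ?sqrtr_gt0//; apply: ler_wsqrtr; rewrite ler_nat QdE.
 apply: (@leq_trans (2 ^ k0)); first exact: ltn_expl.
 by rewrite expnD mulnA leq_pmull// muln_gt0 expn_gt0.
pose S x := \sum_(i < k) 2*B (j + i) x.
have NE x : N (j+k) x = N j x+S x.
 rewrite /S; elim: k {hk S} => [|k IH]; first by rewrite addn0 big_ord0 addr0.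
 by rewrite addnS N_step IH big_ord_recr/= addrA.
have E x : @ZZ R n x-N j x = S x+(@ZZ R n x-N (j+k) x) by rewrite NE; ring.
rewrite (Vr_eq _ E).
have mZN : msr (fun x => @ZZ R n x-N (j+k) x) by exact: measurable_funB.
have mS : msr S by [].
pose M : R := n.*2%:R+(n*(Qd (j+k)).+1)%:R+(n*(Qd j).+1)%:R.
have b2 x : `|@ZZ R n x-N (j+k) x| <= M.
 apply: ler_normB_via; rewrite /M.
 have := @ZZ_norm R n x; have := @NN_bound R n (n*(Qd (j+k)).+1) x.
 by have : 0 <= (n*(Qd j).+1)%:R :> R by []; lra.
have b1 x : `|S x| <= M.
 have -> : S x = N (j+k) x-N j x by rewrite NE; ring.
 apply: ler_normB_via; rewrite /M.
 have := @NN_bound R n (n*(Qd j).+1) x; have := @NN_bound R n (n*(Qd (j+k)).+1) x.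
 by have : 0 <= n.*2%:R :> R by []; lra.
have v1 := levels_var j k.
have v2 : Vr G (fun x => @ZZ R n x-N (j+k) x) <= D/Num.sqrt (Qd (j+k)).+1%:R by apply: le_trans (Vr_le_sq _ mZN b2) _; exact: hD (Qd8 _).
apply: le_trans (VrD_le G ltr01 mS mZN b1 b2) _.
rewrite invr1 (_ : 2*V = (1+1)*(12*(2160*128)*n%:R/2^+j)); last by rewrite /V; ring.
apply: lerD; first by apply: ler_wpM2l v1.
by apply: le_trans hk; apply: ler_wpM2l v2.
Qed.

End level_sums.

(** * Tail bounds for the number of zeros *)

Section moments.
Variable R : realType.

(** With Q = 8 2^k this reads Q^3 <= n < 8 Q^3. *)
Lemma ex_level n : (512 <= n)%N -> exists k, (512*8 ^ k <= n < 512*8 ^ k.+1)%N.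
move=> n512; have q0 : (0 < n %/ 512)%N by rewrite divn_gt0.
have /andP[h1 h2] := trunc_log_bounds (isT : 1 < 8)%N q0.
exists (trunc_log 8 (n %/ 512)); apply/andP; split.
 by rewrite mulnC -leq_divRL.
by rewrite mulnC -ltn_divLR.
Qed.

Lemma measurable_ge_set d (T : measurableType d) (f : T -> R) a : msr f ->
 measurable [set x | a <= f x].
move=> mf; have := @measurable_fun_ler _ _ _ setT (cst a) f (measurable_cst _) mf.
by move=> /(_ measurableT [set true] I); rewrite setTI; congr measurable;
 apply/seteqP; split => x.
Qed.

(** With s = sqrt n and Q = 8k: the bias n Q^(-3/2) is at most 3 sqrt n when Q^3 <= n <= 8 Q^3. *)
Lemma level_sizes (s k : R) : 0 < s -> 1 <= k -> 512*k^+3 <= s^+2 -> s^+2 <= 4096*k^+3 ->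
 s^+2*Num.sqrt (8*k)/(8*k)^+2 <= 3*s.
move=> s0 k1 h1 h2; have k0 : 0 < k by exact: lt_le_trans k1.
have Q0 : 0 < (8*k)^+2 by [].
rewrite ler_pdivrMr// (_ : s^+2*_ = s*(s*Num.sqrt (8*k))); last by ring.
rewrite (_ : 3*s*_ = s*(3*(8*k)^+2)); last by ring.
apply: ler_wpM2l => //.
rewrite -(@ler_pXn2r _ 2)// ?nnegrE.
rewrite exprMn sqr_sqrtr => //.
have : s^+2*(8*k) <= 4096*k^+3*(8*k) by apply: ler_wpM2r.
move=> h; apply: le_trans h _.
rewrite (_ : 4096*k^+3*(8*k) = 4096*8*k^+4); last by ring.
rewrite (_ : (3*(8*k)^+2)^+2 = 9*4096*k^+4); last by ring.
have : 0 <= k^+4 by [].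
by lra.
Qed.

(** When z deviates by s u, either e >= 1 or one of f - Ef, its opposite and L (b - Eb) reaches s
    u/4, because the two biases together take at most another quarter. Each of the last three cases
    is charged to an exponential that is then at least 1. *)
Lemma indicator_split (z f b e Ef Eb s u lam c L D K : R) :
 0 < s -> 0 < L -> 0 <= e -> lam*s = c -> 0 < lam -> 4*D <= u -> 0 < D ->
 (e < 1 -> `|z-f| <= L*b) -> L*Eb + `|K| <= D*s ->
 s*u <= `|z-(Ef+K)| ->
 1 <= e+expR (lam*(f-Ef))*expR (- (c/4*u)) +
    expR (- lam*(f-Ef))*expR (- (c/4*u)) +
    expR (lam*(b-Eb))*expR (- (c/(4*L)*u)).
move=> s0 L0 e0 <- l0 Du D0 zf hE hz.
have p1 := expR_ge0 (lam*(f-Ef)); have p2 := expR_ge0 (- lam*(f-Ef)).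
have p3 := expR_ge0 (lam*(b-Eb)); have p4 := expR_ge0 (- (lam*s/4*u)).
have p5 := expR_ge0 (- (lam*s/(4*L)*u)).
have t1 := mulr_ge0 p1 p4; have t2 := mulr_ge0 p2 p4; have t3 := mulr_ge0 p3 p5.
have [e1|e1] := ltP e 1; last by lra.
have {}zf := zf e1.
have big (y w : R) : 0 <= y-w -> 1 <= expR y*expR (- w).
 by move=> h; rewrite -expRD -[leLHS]expR0 ler_expR.
have [h1|h1] := leP (s*u/4) (f-Ef).
 have := big (lam*(f-Ef)) (lam*s/4*u).
 rewrite (_ : lam*(f-Ef)-lam*s/4*u = lam*(f-Ef-s*u/4)); last by ring.
 by rewrite mulr_ge0 ?subr_ge0 ?(ltW l0)// => /(_ isT); lra.
have [h2|h2] := leP (s*u/4) (- (f-Ef)).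
 have := big (- lam*(f-Ef)) (lam*s/4*u).
 rewrite (_ : - lam*(f-Ef)-lam*s/4*u = lam*(- (f-Ef)-s*u/4)); last by ring.
 by rewrite mulr_ge0 ?subr_ge0 ?(ltW l0)// => /(_ isT); lra.
have [h3|h3] := leP (s*u/4) (L*(b-Eb)).
 have := big (lam*(b-Eb)) (lam*s/(4*L)*u).
 rewrite (_ : lam*(b-Eb)-lam*s/(4*L)*u = lam*((b-Eb)-s*u/(4*L))); last by ring.
 rewrite mulr_ge0 ?(ltW l0)//; last first.
  rewrite subr_ge0 ler_pdivrMr; move: h3; rewrite ler_pdivrMr// => h3.
  by rewrite (_ : (b-Eb)*(4*L) = L*(b-Eb)*4)//; ring.
 by move=> /(_ isT); lra.
have : `|z-(Ef+K)| <= `|z-f| + (`|f-Ef| + `|K|).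
 rewrite (_ : z-(Ef+K) = (z-f)+((f-Ef)-K)); last by ring.
 by apply: ler_normD_via; rewrite lerD2l; exact: ler_normB.
have fE : `|f-Ef| < s*u/4 by rewrite ltr_norml; apply/andP; split; lra.
have Ds : 4*(D*s) <= s*u by rewrite (_ : 4*(D*s) = s*(4*D)); [apply: ler_wpM2l => //; exact: ltW|ring].
have : L*b = L*(b-Eb)+L*Eb by ring.
have su0 : 0 < s*u by apply: mulr_gt0; lra.
move=> h4 h5; suff : s*u < s*u by rewrite ltxx.
by move: h3 hE hz zf fE Ds h4 h5 su0; clear; move: (L*(b-Eb)) (L*Eb) (L*b) (s*u) (D*s) (`|z-f|) (`|K|) (`|f-Ef|) (`|z-(Ef+K)|) => *; lra.
Qed.

End moments.

Section zero_tails.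
Variable R : realType.

Lemma bumps_exp_moment n k : (4 <= n)%N -> (512*8 ^ k <= n)%N ->
 EG (n+n) (fun x => expR (lam0 R n*(@bumps R n (Qd k) (kapq R (Qd k)) x -
  EG (n+n) (@bumps R n (Qd k) (kapq R (Qd k)))))) <= expR 1.
move=> n4 kn; have nR : 0 < n%:R :> R by rewrite ltr0n (leq_trans _ n4).
have P0 : 0 < 2^+k :> R by exact: exprn_gt0.
have P1 : 1 <= 2^+k :> R by apply: exprn_ege1; lra.
have l0 : 0 <= lam0 R n by rewrite /lam0; nneg.
have lmn : lam0 R n^+2*n%:R = (2^+34)^-1 by rewrite lam0_sq ?mulfVK// gt_eqF.
have kR : 512*(2^+k)^+3 <= n%:R :> R.
 by rewrite -exprM mulnC exprM (_ : 2^+3 = 8%:R :> R) -?natrX -?natrM ?ler_nat//; ring.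
have k0 := kapq_gt0 R (Qd k).
apply: le_trans (bumps_mgf n4 (Qd8 k) k0 _) _.
 rewrite (ger0_norm l0) QdR.
 have h := @level_cond R (2^+k) 4^-1 n%:R (lam0 R n) P0.
 rewrite (_ : lam0 R n = lam0 R n*(4*4^-1)); last by field.
 by apply: h => //; lra.
rewrite ler_expR.
have Q0 : 0 < (Qd k).+1%:R :> R by [].
have Q1 : 1 <= (Qd k).+1%:R :> R by rewrite ler1n.
have /andP[s1 s2] := sqrt_ge1 Q1.
apply: (le_via (6480*n%:R*(Qd k).+1%:R^+3*(2^+14*Num.sqrt (Qd k).+1%:R/(Qd k).+1%:R^+4) * lam0 R n^+2)).
 apply: ler_wpM2r; first exact: sqr_ge0.
 by apply: ler_wpM2l; [nneg|exact: kapq_sq].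
have -> : 6480*n%:R*(Qd k).+1%:R^+3*(2^+14*Num.sqrt (Qd k).+1%:R/(Qd k).+1%:R^+4) * lam0 R n^+2 =
 6480*2^+14*(lam0 R n^+2*n%:R)*(Num.sqrt (Qd k).+1%:R/(Qd k).+1%:R).
 by move: Q0; move: (Num.sqrt (Qd k).+1%:R : R) ((Qd k).+1%:R : R) => a b b0; field; rewrite gt_eqF.
rewrite lmn; have : Num.sqrt (Qd k).+1%:R/(Qd k).+1%:R <= 1 :> R by rewrite ler_pdivrMr// mul1r.
have : 0 <= Num.sqrt (Qd k).+1%:R/(Qd k).+1%:R :> R by rewrite divr_ge0// sqrtr_ge0.
by move: (_/_ : R) => y; lra.
Qed.

(** For u <= 4D the bound is trivial, and for u > 3 sqrt n the event is empty since there are at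
    most 2n zeros. In between the level Q of order n^(1/3) is used: the exponential terms decay
    faster than any power of u, and the exceptional term of order n^3/Q^r is small enough because u
    <= 72 Q^3 there. *)
Lemma zero_tail q : exists2 C : R, 0 <= C & forall n, (512 <= n)%N -> forall u, 1 <= u ->
 fine (gauss (n+n) [set x | Num.sqrt n%:R*u <= `|@ZZ R n x-EG (n+n) (@ZZ R n)|]) <=
 C/u^+q.
(* Since n <= 8 Q^3, the product of u^q and n^3 needs r >= 3q+9, and the bias n^4 Q/Q^r needs r >=
   13. *)
pose r := (3*q+13)%N.
have [Co Co0 hCo] := off_mean R r; have [Cm Cm0 hCm] := ZZ_mean_diff R r.
pose L : R := r.+2%:R*expR 1.
have L0 : 0 < L by rewrite /L mulr_gt0// expR_gt0.
pose c : R := (2^+17)^-1; have c0 : 0 < c by rewrite /c invr_gt0 exprn_gt0.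
have [C1 C10 hC1] := @expRN_le_pow R (c/4) q (divr_gt0 c0 (ltr0n _ 4)).
have cL0 : 0 < c/(4*L) by rewrite divr_gt0// mulr_gt0.
have [C2 C20 hC2] := @expRN_le_pow R (c/(4*L)) q cL0.
pose D : R := L*(9*2^+14)+Cm*(3+4096)+1.
have D0 : 0 < D.
 rewrite /D; apply: ltr_wpDl; last exact: ltr01.
 by move: (ltW L0); clear -Cm0; move: L => l l0; nneg.
pose C3 : R := Co*512*72^+q.
have C30 : 0 <= C3 by rewrite /C3; nneg.
have e10 := expR_ge0 (1 : R).
exists ((4*D)^+q+(C3+expR 1*C1+expR 1*C1+expR 1*C2)).
 by rewrite !addr_ge0// ?mulr_ge0// exprn_ge0// mulr_ge0// ltW.
move=> n n512 u u1; have n4 : (4 <= n)%N by exact: leq_trans n512.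
set G := gauss (n+n); set EZ := Ex G _; set s := Num.sqrt n%:R.
have nR : 0 < n%:R :> R by rewrite ltr0n (leq_trans _ n4).
have s0 : 0 < s by rewrite sqrtr_gt0.
have s2 : s^+2 = n%:R by rewrite sqr_sqrtr// ltW.
have u0 : 0 < u by exact: lt_le_trans u1.
have uq : 0 < u^+q by exact: exprn_gt0.
have mDf : msr (fun x => `|@ZZ R n x-EZ|).
 apply: (measurableT_comp (@normr_measurable R setT)); apply: measurable_funB; [exact: ZZ_meas|exact: measurable_cst].
have mA := measurable_ge_set (s*u) mDf.
set A := [set x | _] in mA *.
rewrite -Ex_indic//.
have i1 x : `|\1_A x : R| <= 1 by rewrite indicE; case: (_ \in _); rewrite ?normr1 ?normr0.
have mI : msr (\1_A : _ -> R) by exact: measurable_indic.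
have R0 : 0 <= C3+expR 1*C1+expR 1*C1+expR 1*C2 by rewrite !addr_ge0// mulr_ge0.
have [uD|uD] := leP u (4*D).
 apply: (le_via 1).
  by apply: le_trans (ler_norm _) _; exact: Ex_bound.
 rewrite ler_pdivlMr// mul1r; apply: (le_via ((4*D)^+q)); last by rewrite lerDl.
 by apply: lerXn2r => //; rewrite nnegrE ltW// (lt_le_trans u0).
apply: (le_via ((C3+expR 1*C1+expR 1*C1+expR 1*C2)/u^+q)); last first.
 by rewrite ler_pM2r ?invr_gt0// lerDr exprn_ge0// mulr_ge0// ltW.
have [us|us] := ltP (3*s) u.
 rewrite (_ : \1_A = fun=> 0) ?Ex_cst; first by rewrite divr_ge0// ltW.
 apply/funext => x; rewrite indicE; case: (boolP (x \in A)) => //; rewrite inE /A/= => h.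
 have /andP[z0 z1] := ZZ_bounds x.
 have /andP[y0 y1] : 0 <= EZ <= n.*2%:R by apply: Ex_between; [exact: ZZ_meas|exact: ZZ_bounds].
 have : `|@ZZ R n x-EZ| <= n.*2%:R by rewrite ler_norml; move: z0 z1 y0 y1; clear; move: (@ZZ R n x) (EZ) (n.*2%:R : R) => *; apply/andP; split; lra.
 move=> h2; have := le_trans h h2; rewrite -mul2n natrM -s2 => h3.
 have : s*(3*s) < s*u by rewrite ltr_pM2l.
 rewrite (_ : s*(3*s) = 3*s^+2); last by ring.
 move=> h4; suff : s*u < s*u by rewrite ltxx.
 by move: h3 h4; have := exprn_gt0 2 s0; clear; move: (s^+2) (s*u) => a b a0 h3 h4; lra.
have [k /andP[kn nk]] := ex_level n512.
pose Q : R := (Qd k).+1%:R; pose P : R := 2^+k.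
have QP : Q = 8*P by exact: QdR.
have P1 : 1 <= P by apply: exprn_ege1; rewrite (ler_nat R 1 2).
have P0 : 0 < P by exact: lt_le_trans P1.
have Q0 : 0 < Q by rewrite QP mulr_gt0.
have Q1 : 1 <= Q by rewrite QP; move: P1; clear; move: (P) => p; lra.
have k8 : (8 ^ k)%:R = P^+3 :> R.
 by rewrite natrX /P -exprM mulnC exprM; congr (_^+k); ring.
have kR : 512*P^+3 <= s^+2 by rewrite s2 -k8 -natrM ler_nat.
have Rk : s^+2 <= 4096*P^+3.
 have : (n <= 512*8 ^ k.+1)%N by exact: ltnW.
 by rewrite -(ler_nat R) natrM expnS natrM k8 s2; clear; move: (P^+3) (n%:R : R) => a c; lra.
pose b := @bumps R n (Qd k) (kapq R (Qd k)).
pose f := @NN R n (n*(Qd k).+1); pose e := @off R n (Qd k) r.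
have F1 : n%:R*Num.sqrt Q/Q^+2 <= 3*s.
 by rewrite -s2 QP; exact: level_sizes.
have Eb : Ex G b <= 9*2^+14*s.
 apply: le_trans (bumps_kapq_mean R n4 (Qd8 k)) _; rewrite -/Q.
 rewrite (_ : 3*2^+14*n%:R*Num.sqrt Q/Q^+2 = 3*2^+14*(n%:R*Num.sqrt Q/Q^+2)); last by ring.
 by move: F1; clear; move: (n%:R*Num.sqrt Q/Q^+2) (s) => y z; lra.
have n3 : n%:R <= 8*Q^+3.
 by rewrite -s2 QP (_ : 8*(8*P)^+3 = 4096*P^+3)//; ring.
have QX m : 0 < Q^+m by exact: exprn_gt0.
have F2 : n%:R^+4*Q/Q^+r <= 4096.
 rewrite ler_pdivrMr//; apply: (le_via ((8*Q^+3)^+4*Q)).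
  by apply: ler_wpM2r; [exact: ltW|apply: lerXn2r; rewrite ?nnegrE ?mulr_ge0 ?(ltW (QX _))//].
 rewrite (_ : (8*Q^+3)^+4*Q = 4096*Q^+13); last by ring.
 by apply: ler_wpM2l; [exact: ler0n|apply: ler_weXn2l; rewrite ?leq_addl].
have s1 : 1 <= s.
 rewrite -(@ler_pXn2r _ 2) ?nnegrE ?(ltW s0)// expr1n; apply: le_trans kR.
 have : 1 <= P^+3 by exact: exprn_ege1.
 by clear; move: (P^+3) => p; lra.
have EK : `|EZ-Ex G f| <= Cm*(3+4096)*s.
 apply: le_trans (hCm n (Qd k) n4 (Qd8 k)) _; rewrite -/Q -(mulrA Cm); apply: ler_wpM2l; first exact: Cm0.
 move: F1 F2 s1; clear; move: (s) => s';
 by move: (n%:R*Num.sqrt Q/Q^+2) (n%:R^+4*Q/Q^+r) => y z; lra.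
have hE : L*Ex G b + `|EZ-Ex G f| <= D*s.
 have : L*Ex G b <= L*(9*2^+14*s) by apply: ler_wpM2l; [exact: ltW|].
 rewrite (_ : D*s = L*(9*2^+14*s)+Cm*(3+4096)*s+s); last by rewrite /D; ring.
 move: EK s0; clear; move: (L*(9*2^+14*s)) (L*Ex G b) (Cm*(3+4096)*s) (`|EZ-_|) (s) => *; lra.
have lc : lam0 R n*s = c by rewrite /lam0 -/s mulfVK// gt_eqF.
have l0 : 0 < lam0 R n by rewrite /lam0 -/s divr_gt0.
have [Ie Ee] := hCo n (Qd k) n4; rewrite -/Q -/e -/G in Ie Ee.
pose T1 x := expR (lam0 R n*(f x-Ex G f)).
pose T2 x := expR (- lam0 R n*(f x-Ex G f)).
pose T3 x := expR (lam0 R n*(b x-Ex G b)).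
have Iexp (g : (n+n).-tuple R -> R) (a m M : R) : msr g -> bdd g M ->
  intg G (fun x => expR (a*(g x-m))).
 move=> mg gM; apply: (intg_bnd (expR (`|a|*(M + `|m|)))).
  apply: (measurableT_comp (@measurable_expR R)); apply: measurable_funM; first exact: measurable_cst.
  by apply: measurable_funB => //; exact: measurable_cst.
 move=> x; rewrite ger0_norm ?expR_ge0// ler_expR; apply: le_trans (ler_norm _) _.
 by rewrite normrM; apply: ler_wpM2l => //; apply: ler_normB_via; rewrite lerD2r.
have I1 : intg G T1 by exact: (Iexp _ _ _ _ (NN_meas _) (fun x => NN_bound _ x)).
have I2 : intg G T2 by exact: (Iexp _ _ _ _ (NN_meas _) (fun x => NN_bound _ x)).
have I3 : intg G T3 by exact: (Iexp _ _ _ _ (bumps_meas n4 _ _) (fun x => bumps_bound n4 _ _ x)).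
have E1 : Ex G T1 <= expR 1.
 rewrite (@Ex_eq _ _ _ _ _ (fun x => expR (1 * lam0 R n*(f x-Ex G f)))) => [|x]; last by rewrite mul1r.
 by apply: N_exp_moment; rewrite ?expr1n.
have E2 : Ex G T2 <= expR 1.
 rewrite (@Ex_eq _ _ _ _ _ (fun x => expR (-1 * lam0 R n*(f x-Ex G f)))) => [|x]; last by rewrite mulN1r.
 by apply: N_exp_moment; rewrite ?sqrrN ?expr1n.
have E3 : Ex G T3 <= expR 1 by exact: bumps_exp_moment.
pose p4 := expR (- (c/4*u)); pose p5 := expR (- (c/(4*L)*u)).
have pw x : `|\1_A x| <= e x+p4*T1 x+p4*T2 x+p5*T3 x.
 rewrite indicE; case: (boolP (x \in A)) => [|_]; last first.
  have o0 := @off_ge0 R n (Qd k) r x; have m0 (y z : R) : 0 <= expR y*expR z by rewrite mulr_ge0 ?expR_ge0.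
  by rewrite normr0; apply: addr_ge0; [apply: addr_ge0; [apply: addr_ge0|]|]; [exact: o0|exact: m0..].
 rewrite inE /A/= normr1 => hx.
 have := @indicator_split R (@ZZ R n x) (f x) (b x) (e x) (Ex G f) (Ex G b) s u (lam0 R n) c L D (EZ-Ex G f).
 rewrite (mulrC (expR _) p4) (mulrC (expR _) p4) (mulrC (expR _) p5); apply => //.
 - exact: off_ge0.
 - exact: ltW.
 - by move=> e1; rewrite /L -mulrA; exact: zeros_approx.
 - by rewrite (addrC (Ex G f)) subrK.
apply: le_trans (ler_norm _) _.
have J1 := intgD Ie (intgZ p4 I1); have J2 := intgD J1 (intgZ p4 I2); have J3 := intgD J2 (intgZ p5 I3).
apply: le_trans (Ex_abs_le mI J3 pw) _.
rewrite (ExD J2); last exact: intgZ.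
rewrite (ExD J1); last exact: intgZ.
rewrite (ExD Ie); last exact: intgZ.
rewrite (ExZ p4 I1) (ExZ p4 I2) (ExZ p5 I3).
have B1 : p4 <= C1/u^+q by exact: hC1.
have B2 : p5 <= C2/u^+q by exact: hC2.
have B3 : Ex G e <= C3/u^+q.
 apply: le_trans Ee _; rewrite ler_pdivlMr// mulrAC ler_pdivrMr//.
 have u2 : u^+q <= (72*Q^+3)^+q.
  apply: lerXn2r; rewrite ?nnegrE ?(ltW u0)//.
  apply: (le_via (u^+2)); first by rewrite expr2 ler_peMl// ltW.
  apply: (le_via ((3*s)^+2)); first by apply: lerXn2r; rewrite ?nnegrE ?(ltW u0)// mulr_ge0// ltW.
  by rewrite exprMn s2; move: n3; clear; move: (Q^+3) (n%:R : R) => *; lra.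
 have nn3 : n%:R^+3 <= 512*Q^+9.
  apply: (le_via ((8*Q^+3)^+3)); first by apply: lerXn2r; rewrite ?nnegrE//.
  by apply: eq_ler; ring.
 apply: (le_via (Co*(512*Q^+9)*(72*Q^+3)^+q)).
  by apply: ler_pM; [nneg|nneg|apply: ler_wpM2l|].
 rewrite exprMn -exprM (_ : Co*(512*Q^+9)*_ = C3*(Q^+9*Q^+(3*q))); last by rewrite /C3; ring.
 apply: ler_wpM2l; first exact: C30.
 by rewrite -exprD; apply: ler_weXn2l; [exact: Q1|rewrite /r; clear; lia].
have hp (p t C : R) : 0 <= p -> 0 <= t -> p <= C/u^+q -> t <= expR 1 -> p * t <= expR 1*C/u^+q.
 by move=> p0 t0 hp ht; rewrite (_ : expR 1*C/_ = C/u^+q*expR 1); [apply: ler_pM|ring].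
have H1 := hp _ _ C1 (expR_ge0 _) (Ex_ge0 _ (fun x => expR_ge0 _)) B1 E1.
have H2 := hp _ _ C1 (expR_ge0 _) (Ex_ge0 _ (fun x => expR_ge0 _)) B1 E2.
have H3 := hp _ _ C2 (expR_ge0 _) (Ex_ge0 _ (fun x => expR_ge0 _)) B2 E3.
by rewrite !mulrDl; exact: lerD (lerD (lerD B3 H1) H2) H3.
Qed.

End zero_tails.

(** * Rescaled Gaussian coordinates and their likelihood ratio *)

Section lebesgue_scaling.
Variable R : realType.
Notation gR := (measurableTypeR R).
Notation mu := (@lebesgue_measure R).
Local Open Scope ereal_scope.

Lemma ge0_integral_scale (c : R) (f : gR -> \bar R) : (0 < c)%R -> msr f ->
 (forall x, 0 <= f x) -> c%:E*\int[mu]_x f (c*x)%R = \int[mu]_x f x.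
move=> c0 mf f0.
have mc : msr (fun x : gR => (c*x)%R : gR) by exact: measurable_funM.
have [nu nuE] : exists nu : {measure set gR -> \bar R},
  forall A, nu A = mu ((fun x : gR => (c*x)%R : gR) @^-1` A).
 by unshelve eexists (pushforward mu (fun x : gR => (c*x)%R : gR)); [exact: mc|].
have sc A : measurable A -> mscale (NngNum (ltW c0)) nu A = mu A.
 move=> mA; apply/esym; apply: lebesgue_measure_unique mA => X [[a b]] _ <-.
 change (mu `](a, b).1, (a, b).2] = c%:E*nu `](a, b).1, (a, b).2]%classic); rewrite nuE.
 rewrite /= (_ : (fun x => c*x)%R @^-1` _ = `](a/c)%R, (b/c)%R]%classic); last first.
  by apply/seteqP; split => x /=; rewrite !in_itv/= ltr_pdivrMr// ler_pdivlMr// mulrC.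
 rewrite /= !lebesgue_measure_itv/= !lte_fin ltr_pM2r ?invr_gt0//.
 case: ifP => // _; last by rewrite mule0.
 by rewrite -!EFinB -EFinM; congr EFin; field; rewrite gt_eqF.
have H := @ge0_integral_pushforward _ _ _ _ R _ mc mu setT f.
transitivity (c%:E*\int[pushforward mu (fun x : gR => (c*x)%R : gR)]_y f y).
 by rewrite H.
transitivity (c%:E*\int[nu]_y f y).
 by congr (_*_); apply: eq_measure_integral => A mA _; rewrite /= nuE.
transitivity (\int[mscale (NngNum (ltW c0)) nu]_y f y).
 by rewrite ge0_integral_mscale.
by apply: eq_measure_integral => A mA _; exact: sc.
Qed.

End lebesgue_scaling.

Section likelihood_ratio.
Variable R : realType.

(** Density of the Gaussian of variance 1/(1+t) with respect to the standard one. *)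
Definition lr (t x : R) : R := Num.sqrt (1+t)*expR (- (t*x^+2/2)).

Lemma lr_ge0 t x : 0 <= lr t x.
by rewrite /lr mulr_ge0 ?sqrtr_ge0 ?expR_ge0. Qed.

Lemma lr_le t x : 0 <= t -> lr t x <= Num.sqrt (1+t).
move=> t0; rewrite /lr ler_piMr ?sqrtr_ge0// -[leRHS]expR0 ler_expR oppr_le0.
by rewrite divr_ge0// mulr_ge0// sqr_ge0.
Qed.

Lemma msr_lr t : msr (lr t).
by apply: measurable_funM; [exact: measurable_cst|exact: msr_expR_sq]. Qed.

Lemma gam_scale_ge0 t (f : R -> \bar R) : 0 <= t -> msr f ->
 (forall x, 0 <= f x)%E ->
 (\int[gam]_x f ((Num.sqrt (1+t))^-1*x)%R = \int[gam]_x (f x*(lr t x)%:E))%E.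
move=> t0 mf f0; set s := (Num.sqrt (1+t))^-1.
have q0 : 0 < Num.sqrt (1+t) by rewrite sqrtr_gt0; lra.
have s0 : 0 < s by rewrite invr_gt0.
have s2 : s^+2 = (1+t)^-1 by rewrite exprVn sqr_sqrtr//; lra.
have mfs : msr (fun x : R => f (s*x)) by apply: (measurableT_comp mf); mR.
have ml : msr (fun x => (lr t x)%:E) by apply/measurable_EFinP; exact: msr_lr.
rewrite !ge0_integral_gam//; last 2 first.
- by apply: emeasurable_funM.
- by move=> x; rewrite mule_ge0// lee_fin lr_ge0.
have mn : msr (fun x : R => (npdf x)%:E).
 apply/measurable_EFinP; rewrite /npdf; exact: measurable_normal_pdf.
have n0 (x : R) : (0 <= (npdf x)%:E :> \bar R)%E by rewrite lee_fin normal_pdf_ge0.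
rewrite -(@ge0_integral_scale R s (fun x => f x*(lr t x)%:E*(npdf x)%:E)%E s0); last 2 first.
- by apply: emeasurable_funM => //; exact: emeasurable_funM.
- by move=> x; rewrite !mule_ge0// lee_fin lr_ge0.
rewrite -ge0_integralZl//; last 3 first.
- apply: (@measurableT_comp _ _ _ _ _ _ (fun x => f x*(lr t x)%:E*(npdf x)%:E)%E); last by mR.
 by apply: emeasurable_funM => //; exact: emeasurable_funM.
- by move=> x _; rewrite !mule_ge0// lee_fin lr_ge0.
- by rewrite lee_fin ltW.
apply: eq_integral => x _; rewrite muleA muleA (muleC s%:E) -!muleA; congr (_*_)%E.
rewrite -!EFinM; congr EFin; rewrite /lr !npdfE mulrA (mulrA s) mulVf ?gt_eqF// mul1r mulrCA -expRD.
congr (_*expR _); rewrite exprMn s2; field.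
by rewrite gt_eqF//; lra.
Qed.

Lemma gam_scale t (f : R -> R) (M : R) : 0 <= t -> msr f ->
 bdd f M ->
 Ex gam (fun x => f ((Num.sqrt (1+t))^-1*x)) = Ex gam (fun x => f x * lr t x).
move=> t0 mf fM; set s := (Num.sqrt (1+t))^-1.
have t1 : 0 < 1+t by lra.
have mg : msr (fun x : R => f x+M) by apply: measurable_funD => //; exact: measurable_cst.
have g0 x : 0 <= f x+M by have := fM x; rewrite ler_norml => /andP[]; lra.
have Il : intg gam (lr t) by apply: intgZ; exact: intg_gam_exp.
have lrM (g : R -> R) (B : R) : msr g -> bdd g B -> intg gam (fun x => g x * lr t x).
 move=> mg' gB; apply: (intg_bnd (B*Num.sqrt (1+t))).
  by apply: measurable_funM; [exact: mg'|exact: msr_lr].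
 move=> x; rewrite normrM; apply: ler_pM; [exact: normr_ge0|exact: normr_ge0|exact: gB|].
 by rewrite ger0_norm ?lr_ge0// lr_le.
have key : Ex gam (fun x => f (s*x)+M) = Ex gam (fun x => (f x+M) * lr t x).
 rewrite /Ex /Rintegral; congr fine.
 rewrite (gam_scale_ge0 (f := fun x => (f x+M)%:E) t0)//.
 by apply/measurable_EFinP.
have Ifs : intg gam (fun x => f (s*x)).
 by apply: (intg_bnd M) => //; apply: (measurableT_comp mf); mR.
rewrite ExD ?Ex_cst// in key; last exact: intg_cst.
have El : Ex gam (lr t) = 1.
 rewrite /lr ExZ; last exact: intg_gam_exp.
 by rewrite Ex_gam_exp// divff// gt_eqF// sqrtr_gt0.
have : Ex gam (fun x => (f x+M) * lr t x) = Ex gam (fun x => f x * lr t x)+M.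
 rewrite (@Ex_eq _ _ _ _ _ (fun x => f x * lr t x+M * lr t x)) => [|x]; last by ring.
 have J1 := lrM _ _ mf fM; have J2 := intgZ M Il.
 by rewrite ExD// ExZ// El mulr1.
by move: key; move: (Ex _ _) (Ex _ _) (Ex _ _) => a b c; lra.
Qed.

(** The exact value is (1+t)/sqrt(1+2t). Its excess over 1 is quadratic in t, so t = n^(-1/2) can be
    applied to a number of coordinates of order n. *)
Lemma Ex_lr_sq t : 0 <= t -> Ex gam (fun x => lr t x^+2) <= expR (t^+2/2).
move=> t0.
have E x : lr t x^+2 = (1+t)*expR (- ((2 * t)*x^+2/2)).
 rewrite /lr exprMn sqr_sqrtr; last by lra.
 by rewrite -expRM_natl; congr (_*expR _); field.
have h2 : 0 < 1+2 * t by lra.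
rewrite (Ex_eq _ E) ExZ; last exact: intg_gam_exp.
rewrite Ex_gam_exp//; apply: (le_via (1+t^+2/2)); last exact: expR_ge1Dx.
have q0 : 0 < Num.sqrt (1+2 * t) by rewrite sqrtr_gt0.
rewrite ler_pdivrMr// -(@ler_pXn2r _ 2)// ?nnegrE//.
rewrite exprMn sqr_sqrtr; last by lra.
rewrite -subr_ge0 (_ : _-_ = 2 * t^+3+t^+4*(1+2 * t)/4); last by field.
by nneg.
Qed.

Definition scl N (t : R) (b : 'I_N -> bool) (x : N.-tuple R) : N.-tuple R :=
 [tuple (if b i then (Num.sqrt (1+t))^-1 else 1) * tnth x i | i < N].

Definition lrN N (t : R) (b : 'I_N -> bool) (x : N.-tuple R) : R :=
 \prod_i (if b i then lr t (tnth x i) else 1).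

Lemma msr_coordscl N t b : msr (@scl N t b).
apply/measurable_fun_tnthP => i.
rewrite (_ : _ \o _ = fun p => (if b i then (Num.sqrt (1+t))^-1 else 1) * tnth p i); last first.
 by apply/funext => p /=; rewrite tnth_mktuple.
by apply: measurable_funM; [exact: measurable_cst|exact: measurable_tnth].
Qed.

Lemma msr_lrN N t b : msr (@lrN N t b).
apply: measurable_prod => i _; case: (b i); last exact: measurable_cst.
by apply: (measurableT_comp (msr_lr t)); exact: measurable_tnth.
Qed.

Lemma lrN_bounds N t b x : 0 <= t -> 0 <= @lrN N t b x <= Num.sqrt (1+t)^+N.
move=> t0; have s1 : 1 <= Num.sqrt (1+t) by rewrite -{1}(sqrtr1 R) ler_wsqrtr//; lra.
rewrite /lrN prodr_ge0 => [|i _]; last by case: (b i) => //; exact: lr_ge0.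
rewrite -[X in _ <= _^+X](card_ord N) -prodr_const; apply: ler_prod => i _.
by case: (b i); rewrite ?lr_ge0 ?lr_le// ler01.
Qed.

Lemma scl_cons N t (b : 'I_N.+1 -> bool) u x : scl t b (consT (u, x)) =
 consT ((if b ord0 then (Num.sqrt (1+t))^-1 else 1)*u, scl t (fun i => b (lift ord0 i)) x).
apply: eq_from_tnth => i; rewrite tnth_mktuple.
by case: (unliftP ord0 i) => [j ->|->]; rewrite ?tnth_consS ?tnth_cons0 ?tnth_mktuple.
Qed.

Lemma lrN_cons N t (b : 'I_N.+1 -> bool) u x : lrN t b (consT (u, x)) =
 (if b ord0 then lr t u else 1) * lrN t (fun i => b (lift ord0 i)) x.
rewrite /lrN big_ord_recl tnth_cons0; congr (_*_); apply: eq_bigr => i _.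
by rewrite tnth_consS.
Qed.

Lemma gauss_scale N t (b : 'I_N -> bool) (f : N.-tuple R -> R) (M : R) : 0 <= t ->
 msr f -> bdd f M ->
 EG N (fun x => f (scl t b x)) = EG N (fun x => f x * lrN t b x).
move=> t0; elim: N b f => [|N IH] b f mf fM.
 rewrite !Ex_gauss0.
 - by rewrite /lrN big_ord0 mulr1; congr f; apply: eq_from_tnth => -[].
 - by apply: measurable_funM => //; exact: msr_lrN.
 - exact: (measurableT_comp mf (msr_coordscl _ _)).
have s0 : 0 <= Num.sqrt (1+t) by exact: sqrtr_ge0.
have bl N' (b' : 'I_N' -> bool) (g : N'.-tuple R -> R) B : bdd g B ->
  forall x, `|g x * lrN t b' x| <= B*Num.sqrt (1+t)^+N'.
 move=> gB x; rewrite normrM; apply: ler_pM => //.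
 by have /andP[h1 h2] := lrN_bounds b' x t0; rewrite ger0_norm.
rewrite (@Ex_gaussS _ _ _ M)//; last exact: (measurableT_comp mf (msr_coordscl _ _)).
rewrite (@Ex_gaussS _ _ _ (M*Num.sqrt (1+t)^+N.+1)); last 2 first.
- by apply: measurable_funM => //; exact: msr_lrN.
- exact: bl fM.
pose b' i := b (lift ord0 i).
have mfc u : msr (fun x => f (consT (u, x))).
 by apply: (measurableT_comp mf); apply: measurable_consT_comp; [exact: measurable_cst|exact: measurable_id].
pose F u := EG N (fun x => f (consT (u, x)) * lrN t b' x).
have mF : msr F.
 apply: (@msr_Ex_snd _ _ _ _ _ gam (gauss N) (fun p => f (consT p) * lrN t b' p.2) (M*Num.sqrt (1+t)^+N)).
  apply: measurable_funM; first exact: (measurableT_comp mf (@measurable_consT R N)).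
  exact: (measurableT_comp (msr_lrN _ _) measurable_snd).
 by move=> p; exact: (bl N b' (fun x => f (consT (p.1, x)))).
have FM u : `|F u| <= M*Num.sqrt (1+t)^+N.
 apply: Ex_bound; last exact: (bl N b' (fun x => f (consT (u, x)))).
 by apply: measurable_funM => //; exact: msr_lrN.
transitivity (Ex gam (fun u => F ((if b ord0 then (Num.sqrt (1+t))^-1 else 1)*u))).
 apply: Ex_eq => u; rewrite /F -IH//; apply: Ex_eq => x; by rewrite scl_cons.
transitivity (Ex gam (fun u => F u*(if b ord0 then lr t u else 1))).
 case: (b ord0); first exact: gam_scale FM.
 by apply: Ex_eq => u; rewrite mul1r mulr1.
apply: Ex_eq => u; rewrite mulrC /F -ExZ; last first.
 apply: (intg_bounded _ _ (bl N b' (fun x => f (consT (u, x))) M _)) => //.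
 by apply: measurable_funM => //; exact: msr_lrN.
by apply: Ex_eq => x; rewrite lrN_cons; ring.
Qed.

Lemma Ex_lrN_sq N t (b : 'I_N -> bool) : 0 <= t ->
 EG N (fun x => lrN t b x^+2) <= expR (\sum_i (b i)%:R*(t^+2/2)).
move=> t0; elim: N b => [|N IH] b.
 rewrite Ex_gauss0; last by apply: measurable_funX; exact: msr_lrN.
 by rewrite /lrN !big_ord0 expr1n expR0.
have s0 : 0 <= Num.sqrt (1+t) by exact: sqrtr_ge0.
have bl N' (b' : 'I_N' -> bool) x : `|lrN t b' x^+2| <= (Num.sqrt (1+t)^+N')^+2.
 rewrite normrX; have /andP[h1 h2] := lrN_bounds b' x t0.
 by rewrite ger0_norm// lerXn2r ?nnegrE// exprn_ge0.
rewrite (Ex_gaussS (M := (Num.sqrt (1+t)^+N.+1)^+2))//; last first.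
 by apply: measurable_funX; exact: msr_lrN.
pose b' i := b (lift ord0 i).
have I2 : IG N (fun x => lrN t b' x^+2).
 by apply: (intg_bounded _ _ (bl N b')); apply: measurable_funX; exact: msr_lrN.
rewrite (@Ex_eq _ _ _ _ _ (fun u => EG N (fun x => lrN t b' x^+2)*(if b ord0 then lr t u else 1)^+2)) => [|u]; last first.
 by rewrite mulrC -ExZ//; apply: Ex_eq => x; rewrite lrN_cons exprMn.
rewrite ExZ; last first.
 apply: (intg_bnd (Num.sqrt (1+t)^+2)).
  by apply: measurable_funX; case: (b ord0); [exact: msr_lr|exact: measurable_cst].
 have s1 : 1 <= Num.sqrt (1+t) by rewrite -{1}(sqrtr1 R) ler_wsqrtr//; lra.
 move=> u; rewrite normrX lerXn2r ?nnegrE//.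
 by case: (b ord0); rewrite ?normr1// ger0_norm ?lr_ge0// lr_le.
rewrite big_ord_recl expRD mulrC; apply: ler_pM.
- by apply: Ex_ge0 => u; exact: sqr_ge0.
- by apply: Ex_ge0 => u; exact: sqr_ge0.
- case: (b ord0); first by rewrite mul1r; exact: Ex_lr_sq.
 by rewrite mul0r expR0 expr1n Ex_cst.
- exact: IH.
Qed.

(* The Hammersley-Chapman-Robbins inequality. *)
Lemma variance_lower N t (b : 'I_N -> bool) (f : N.-tuple R -> R) (M : R) : 0 <= t ->
 msr f -> bdd f M ->
 (EG N (fun x => f (scl t b x))-EG N f)^+2 <=
 Vr (gauss N) f*(expR (\sum_i (b i)%:R*(t^+2/2))-1).
move=> t0 mf fM; set m := Ex _ f.
have fm x : `|f x-m| <= M+M.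
 by apply: ler_normB_via; apply: lerD => //; exact: Ex_bound.
have mfm : msr (fun x => f x-m) by apply: measurable_funB => //; exact: measurable_cst.
have If : IG N f by exact: intg_bounded mf fM.
have lM x : `|lrN t b x| <= Num.sqrt (1+t)^+N.
 by have /andP[h1 h2] := lrN_bounds b x t0; rewrite ger0_norm.
have ml := msr_lrN t b.
have Il : IG N (lrN t b) by exact: intg_bounded ml lM.
have E1 : EG N (lrN t b) = 1.
 have n1 (x : N.-tuple R) : `|1 : R| <= 1 by rewrite normr1.
 rewrite -[RHS](Ex_cst (gauss N) 1) (gauss_scale b t0 (measurable_cst (1 : R)) n1).
 by apply: Ex_eq => x; rewrite mul1r.
have Ifl : IG N (fun x => (f x-m) * lrN t b x).
 apply: (intg_bnd ((M+M)*Num.sqrt (1+t)^+N)); first exact: measurable_funM.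
 by move=> x; rewrite normrM; apply: ler_pM.
have -> : EG N (fun x => f (scl t b x))-m = EG N (fun x => (f x-m)*(lrN t b x-1)).
 transitivity (EG N (fun x => (f x-m) * lrN t b x-(f x-m))); last first.
  by apply: Ex_eq => x; ring.
 rewrite ExB//; last by apply: intgB => //; exact: intg_cst.
 rewrite (ExB If (intg_cst _ _)) Ex_cst -/m subrr subr0.
 rewrite -(@gauss_scale N t b (fun x => f x-m) (M+M))// ExB ?Ex_cst//; last exact: intg_cst.
 apply: (intg_bnd M) => //; exact: (measurableT_comp mf (msr_coordscl _ _)).
have I1 : IG N (fun x => lrN t b x-1) by apply: intgB => //; exact: intg_cst.
have m1 := intg_meas I1.
have l2 x : `|lrN t b x-1| <= Num.sqrt (1+t)^+N+1.
 by apply: ler_normB_via; rewrite normr1 lerD2r.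
have sq0 : 0 <= Num.sqrt (1+t)^+N by rewrite exprn_ge0// sqrtr_ge0.
have I2 : IG N (fun x => (lrN t b x-1)^+2).
 apply: (intg_bnd ((Num.sqrt (1+t)^+N+1)^+2)); first exact: measurable_funX.
 by move=> x; rewrite normrX lerXn2r ?nnegrE// addr_ge0.
apply: le_trans (Ex_CS mfm m1 fm I2 I1) _; apply: ler_wpM2l; first exact: Vr_ge0.
have := @VrE _ _ _ (gauss N) _ _ ml lM.
rewrite /Vr E1 expr1n => ->.
by rewrite lerD2r; exact: Ex_lrN_sq.
Qed.

End likelihood_ratio.

Ltac measurable_leaf8 := first [ measurable_leaf7 | exact: msr_lr | exact: msr_lrN | exact: msr_coordscl ].
Ltac measurable_leaf ::= measurable_leaf8.

(** * Lower bound on the variance *)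

Section variance_lower_bound.
Variables (R : realType) (n : nat).
Hypothesis n4 : (4 <= n)%N.
Notation tp := ((n+n).-tuple R).
Notation G := (gauss (R := R) (n+n)).
Notation hx := (@hx R n).

Let n0 : (0 < n)%N. exact: leq_trans n4. Qed.
Let nR : 0 < n%:R :> R. by rewrite ltr0n. Qed.

Lemma E_scf_gen (w : 'I_n -> R) t t' : 0 < covf w 0 ->
 Ex G (fun x => scf (dot (trig w t) x) (dot (trig w t') x)) =
 acos (covf w (t-t')/covf w 0)/pi.
move=> V0; have p0 := @pi_gt0 R.
have ms u : msr (fun x : tp => sgr (dot (trig w u) x)) by [].
have I : intg G (fun x => sgr (dot (trig w t) x)*sgr (dot (trig w t') x)).
 apply: (intg_bnd 1); first exact: measurable_funM.
 by move=> x; rewrite normrM !sgr_norm mulr1.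
transitivity (Ex G (fun x => 2^-1-2^-1*(sgr (dot (trig w t) x)*sgr (dot (trig w t') x)))).
 by apply: Ex_eq => x; rewrite /scf; field.
rewrite ExB ?Ex_cst ?ExZ//; [|exact: intg_cst|exact: intgZ].
rewrite (@sign_corr R _ _ _ (covf w 0)) ?trig_nsq// trig_inner.
by rewrite -mulrA; move: (_/pi) => q; field.
Qed.

Let m := n./2.
(** At this size the likelihood ratio keeps a bounded second moment while the mean number of sign
    changes moves by order sqrt n. *)
Let t : R := (Num.sqrt n%:R)^-1.
Let s : R := (Num.sqrt (1+t))^-1.

Let t0 : 0 < t. by []. Qed.
Let t2 : t^+2 = n%:R^-1. by rewrite exprVn sqr_sqrtr// ltW. Qed.
Let t1 : t <= 1.
by rewrite invf_le1 ?sqrtr_gt0// -{1}(sqrtr1 R) ler_wsqrtr// ler1n. Qed.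
Let s2 : s^+2 = (1+t)^-1. by rewrite exprVn sqr_sqrtr// addr_ge0 ltW. Qed.

(** The frequencies k < n/2, in both families. Shrinking these coefficients alone raises the root
    mean square frequency, and with it the mean number of zeros. *)
Definition low_half (i : 'I_(n+n)) : bool :=
 match fintype.split i with inl k => (k < m)%N | inr k => (k < m)%N end.

Let lowl k : low_half (lshift n k) = (k < m)%N.
by rewrite /low_half -[lshift n k]/(unsplit (inl k)) unsplitK. Qed.

Let lowr k : low_half (rshift n k) = (k < m)%N.
by rewrite /low_half -[rshift n k]/(unsplit (inr k)) unsplitK. Qed.

Let w (k : 'I_n) : R := @wunit R n k*(if (k < m)%N then s else 1).

Let hx_scl u x : hx u (scl t low_half x) = dot (trig w u) x.
rewrite -[hx u _]/(dot (trig (@wunit R n) u) _) /dot !sum_split2; apply: eq_bigr => k _.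
by rewrite !trig_lshift !trig_rshift !tnth_mktuple lowl lowr /w -/s; case: ifP => _; ring.
Qed.

Let sum_low (F : nat -> R) : \sum_(k < n) (k < m)%N%:R * F k = \sum_(k < m) F k.
have mn : (m <= n)%N by rewrite /m -divn2 leq_div.
rewrite (big_ord_widen n F mn) [RHS]big_mkcond/=; apply: eq_bigr => k _.
by case: (k < m)%N; rewrite ?mul1r ?mul0r.
Qed.

Let low_count : \sum_i (low_half i)%:R*(t^+2/2) <= 2^-1 :> R.
rewrite sum_split2 (eq_bigr (fun k : 'I_n => (k < m)%N%:R * t^+2)); last first.
 by move=> k _; rewrite lowl lowr; field.
rewrite (sum_low (fun=> t^+2)) sumr_const card_ord t2 -[leLHS]mulr_natl ler_pdivrMr//.
have : m%:R*2 <= n%:R :> R by rewrite -natrM ler_nat /m; lia.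
by lra.
Qed.

Let ep : R := 1-s^+2.
Let ep_bounds : t/2 <= ep < 1.
have h : 0 < 1+t by [].
rewrite /ep s2; apply/andP; split.
 rewrite -subr_ge0 (_ : _-_ = t*(1-t)/(2*(1+t))); last by field; rewrite gt_eqF.
 by rewrite divr_ge0 ?mulr_ge0 ?subr_ge0// ltW.
by rewrite ltrBlDr ltrDl invr_gt0.
Qed.

Let w2 k : w k^+2 = n%:R^-1*(1-ep*(k < m)%N%:R).
by rewrite /w exprMn wunit_sq// /ep; case: ifP => _; rewrite ?mulr1 ?mulr0; ring. Qed.

Let SS (p : nat) : R := \sum_(k < p) k%:R^+2.

Let covw : covf w 0 = n%:R^-1*(n%:R-ep * m%:R).
rewrite covf0 (eq_bigr (fun k : 'I_n => n%:R^-1*(1-ep*((k < m)%N%:R*1)))); last first.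
 by move=> k _; rewrite w2 mulr1.
rewrite -mulr_sumr big_split/= sumrN -mulr_sumr (sum_low (fun=> 1)) !sumr_const !card_ord.
by [].
Qed.

Let lamw : lam2 w = n%:R^-1*(SS n-ep*SS m).
rewrite /lam2 (eq_bigr (fun k : 'I_n => n%:R^-1*(k%:R^+2-ep*((k < m)%N%:R*k%:R^+2)))); last first.
 by move=> k _; rewrite w2; ring.
by rewrite -mulr_sumr big_split/= sumrN -mulr_sumr (sum_low (fun k => k%:R^+2)).
Qed.

Let mb : n%:R <= 3 * m%:R :> R /\ 2 * m%:R <= n%:R :> R.
have E := odd_double_half n; rewrite -/m in E.
by split; rewrite -natrM ler_nat; move: n4; rewrite -E -muln2; case: (odd n) => /=; lia.
Qed.

Let cov_pos : 0 < n%:R-ep * m%:R :> R /\ n%:R-ep * m%:R <= n%:R :> R.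
have [h1 h2] := mb; have /andP[e1 e2] := ep_bounds.
have e0 : 0 <= ep by apply: le_trans e1.
have m0 : 0 <= m%:R :> R by [].
have em : ep * m%:R <= 1 * m%:R by apply: ler_wpM2r => //; exact: ltW.
split; last by rewrite gerBl mulr_ge0.
by move: nR em h2; move: (ep * m%:R) => v; lra.
Qed.

Let V0 : 0 < covf w 0.
by rewrite covw mulr_gt0; case: cov_pos. Qed.

Let Kw : R := Num.sqrt (lam2 w/covf w 0).
Let K1 : R := kap0 R n.

Let lam_ge0 : 0 <= lam2 w/covf w 0.
by []. Qed.

Let Kw2 : Kw^+2 = (SS n-ep*SS m)/(n%:R-ep * m%:R).
have [c0 _] := cov_pos.
rewrite sqr_sqrtr// lamw covw; move: c0; move: (n%:R-ep * m%:R) (SS n-ep*SS m) => c a c0.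
by field; rewrite !gt_eqF.
Qed.

Let K12 : K1^+2 = SS n/n%:R.
rewrite kap0_sq /lam2 /SS mulrC mulr_sumr; apply: eq_bigr => k _.
by rewrite wunit_sq.
Qed.

(** The frequencies below m carry less than the fraction m/n of the sum of squares, by a margin of
    full order, as the closed formulas of [sum_sq_ord] show. *)
Let SSgap : n%:R^+4/18 <= m%:R*SS n-n%:R*SS m.
have hn := @sum_sq_ord R n; have hm := @sum_sq_ord R m.
have [h1 h2] := mb; rewrite -/(SS n) in hn; rewrite -/(SS m) in hm.
have n4R : 4 <= n%:R :> R by rewrite (ler_nat R 4).
have E : 6*(m%:R*SS n-n%:R*SS m) = m%:R*n%:R*((n%:R-m%:R)*(2*(n%:R+m%:R)-3)).
 rewrite (_ : 6*_ = m%:R*(6*SS n)-n%:R*(6*SS m)); last by ring.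
 by rewrite hn hm; ring.
have m2 : 2 <= m%:R :> R by rewrite (ler_nat R 2) /m geq_half_double.
move: E h1 h2 n4R nR m2; move: (n%:R : R) (m%:R : R) (m%:R*SS n-n%:R*SS m) => N M D E h1 h2 h4 N0 m2.
have A1 : N/3*N <= M*N by apply: ler_wpM2r; [exact: ltW|lra].
have A2 : N/2*(2*N) <= (N-M)*(2*(N+M)-3) by apply: ler_pM; lra.
have A3 : N/3*N*(N/2*(2*N)) <= M*N*((N-M)*(2*(N+M)-3)) by exact: ler_pM.
rewrite -E (_ : N/3*N*_ = 6*(N^+4/18)) in A3; last by field.
by lra.
Qed.

Let Kgap2 : ep*n%:R^+2/18 <= Kw^+2-K1^+2.
have [c0 c1] := cov_pos; have /andP[e1 e2] := ep_bounds.
have e0 : 0 <= ep by apply: le_trans e1.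
rewrite Kw2 K12.
have -> : (SS n-ep*SS m)/(n%:R-ep * m%:R)-SS n/n%:R =
  ep*(m%:R*SS n-n%:R*SS m)/(n%:R*(n%:R-ep * m%:R)).
 have c00 := lt0r_neq0 c0; have n00 := lt0r_neq0 nR.
 by move: c00 n00; move: (n%:R : R) (m%:R : R) (SS n) (SS m) (ep) => N M a b e c00 n00; field; rewrite c00 n00.
rewrite ler_pdivlMr ?mulr_gt0//.
apply: (le_via (ep*n%:R^+2/18*(n%:R*n%:R))).
 by apply: ler_wpM2l; [nneg|apply: ler_wpM2l => //; exact: ltW].
rewrite (_ : _*(n%:R*n%:R) = ep*(n%:R^+4/18)); last by field.
exact: ler_wpM2l.
Qed.

Let K1b : n%:R/3 <= K1 <= n%:R. exact: kap0_bounds. Qed.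

Let Kw_le : Kw <= n%:R.
rewrite -(@ler_pXn2r _ 2) ?sqrtr_ge0// sqr_sqrtr// ler_pdivrMr// covf0 mulr_sumr.
apply: ler_sum => k _; rewrite mulrC; apply: ler_wpM2r => //.
by apply: lerXn2r; rewrite ?nnegrE// ler_nat ltnW.
Qed.

Let Kgap : ep*n%:R/36 <= Kw-K1.
have /andP[k1 k2] := K1b; have kw := Kw_le; have g := Kgap2.
have /andP[e1 e2] := ep_bounds.
have e0 : 0 < ep by apply: lt_le_trans e1.
have kw0 : 0 <= Kw by [].
rewrite leNgt; apply/negP => h.
have k10 : 0 < K1 by apply: lt_le_trans k1.
have A : (Kw-K1)*(Kw+K1) < ep*n%:R/36*(2*n%:R).
 apply: (@lt_le_trans _ _ (ep*n%:R/36*(Kw+K1))).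
  by rewrite ltr_pM2r//; exact: ltr_wpDl.
 by apply: ler_wpM2l; [nneg|move: kw k2; move: (K1) (Kw) => *; lra].
suff : Kw^+2-K1^+2 < Kw^+2-K1^+2 by rewrite ltxx.
apply: lt_le_trans g; rewrite (_ : _-_ = (Kw-K1)*(Kw+K1)); last by ring.
by rewrite (_ : ep*n%:R^+2/18 = ep*n%:R/36*(2*n%:R))//; field.
Qed.

Let Kgap_sqrt : Num.sqrt n%:R/72 <= Kw-K1.
apply: le_trans Kgap; have /andP[e1 _] := ep_bounds.
have : t/2*n%:R <= ep*n%:R by apply: ler_wpM2r.
have -> : t/2*n%:R = Num.sqrt n%:R/2.
 rewrite /t -{2}(sqr_sqrtr (ltW nR)); have : 0 < Num.sqrt n%:R :> R by rewrite sqrtr_gt0.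
 by move: (Num.sqrt _) => q q0; field; rewrite gt_eqF.
by move: (ep*n%:R) (Num.sqrt _) => *; lra.
Qed.

Section grid.
Variable Q : nat.
Hypothesis Q16 : (16 <= Q)%N.
Let QR : 0 < Q%:R :> R. by rewrite ltr0n (leq_trans _ Q16). Qed.
Let de : R := 2*(pi/(n*Q)%:R).
Let y : R := n%:R * de.

Let yE : y = 2 * pi/Q%:R.
by rewrite /y /de natrM; move: (pi : R) (n%:R : R) (Q%:R : R) nR QR => p a b a0 b0; field; rewrite !gt_eqF. Qed.

Let y0 : 0 < y. by rewrite yE divr_gt0// mulr_gt0 pi_gt0. Qed.
Let de0 : 0 < de. by move: y0; rewrite /y pmulr_rgt0. Qed.
Let yh : y <= 1/2.
rewrite yE ler_pdivrMr//; have : 16 <= Q%:R :> R by rewrite (ler_nat R 16).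
by have := pi_lt4 R; lra.
Qed.

Let mscf a b : msr (fun x : tp => scf (hx a x) (hx b x)).
rewrite /scf; apply: measurable_funM; last exact: measurable_cst.
apply: measurable_funB; first exact: measurable_cst.
exact: measurable_funM.
Qed.

Let EN : Ex G (@NN R n (n*Q)) = (n*Q)%:R*(acos (covf (@wunit R n) de)/pi).
rewrite /NN Ex_sum => [|i]; last first.
 by apply: (intg_bnd 1); last by move=> x; have /andP[h1 h2] := scf_01 (hx (cpt R (n*Q) i) x) (hx (cpt R (n*Q) i.+1) x); rewrite ger0_norm.
rewrite (eq_bigr (fun=> acos (covf (@wunit R n) de)/pi)) => [|i _].
 by rewrite sumr_const card_ord -[LHS]mulr_natl.
by rewrite E_scf// cptS_pi opprD addrA subrr sub0r covfN.
Qed.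

Let ENw : Ex G (fun x => @NN R n (n*Q) (scl t low_half x)) =
 (n*Q)%:R*(acos (covf w de/covf w 0)/pi).
rewrite /NN Ex_sum => [|i]; last first.
 apply: (intg_bnd 1); last by move=> x; have /andP[h1 h2] := scf_01 (hx (cpt R (n*Q) i) (scl t low_half x)) (hx (cpt R (n*Q) i.+1) (scl t low_half x)); rewrite ger0_norm.
 exact: (measurableT_comp (mscf _ _) (msr_coordscl t low_half)).
rewrite (eq_bigr (fun=> acos (covf w de/covf w 0)/pi)) => [|i _].
 by rewrite sumr_const card_ord -[LHS]mulr_natl.
under Ex_eq do rewrite !hx_scl.
by rewrite E_scf_gen// cptS_pi opprD addrA subrr sub0r covfN.
Qed.

Let ac1 : acos (covf (@wunit R n) de) <= K1 * de+y^+3.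
have /andP[k1 k2] := K1b.
have k0 : 0 <= K1 by [].
have ky : K1 * de <= y by apply: ler_wpM2r.
have kd0 : 0 <= K1 * de by [].
have := @acos_upper R (covf (@wunit R n) de) (K1 * de).
rewrite kd0 (le_trans ky yh) => /(_ isT (rr_norm n4 de)).
have -> : 1-(K1 * de)^+2/2 = covf (@wunit R n) 0-lam2 (@wunit R n) * de^+2/2 by rewrite rr0// exprMn kap0_sq.
move=> /(_ (covf_lower _ _)) h; apply: le_trans h _; rewrite lerD2l.
exact: lerXn2r.
Qed.

Let acw : Kw * de-y^+3/4 <= acos (covf w de/covf w 0).
have /andP[k1 k2] := K1b; have kg := Kgap_sqrt.
have kw : n%:R/3 <= Kw.
 have : 0 <= Num.sqrt n%:R/72 :> R by [].
 by move: k1 kg; move: (K1) (Kw) => *; lra.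
have kyw : y/3 <= Kw * de.
 have : n%:R/3 * de <= Kw * de by apply: ler_wpM2r.
 by rewrite (_ : n%:R/3 * de = y/3)//; rewrite /y; field.
have kd0 : 0 < Kw * de by apply: lt_le_trans kyw.
have y40 : 0 <= y^+4/24 by [].
have rb : -1 <= covf w de/covf w 0 <= 1.
 rewrite -ler_norml normrM normfV (gtr0_norm V0) ler_pdivrMr// mul1r.
 exact: covf_norm.
have ru : covf w de/covf w 0 <= 1-(Kw * de)^+2/2+y^+4/24.
 rewrite ler_pdivrMr//; apply: le_trans (covf_upper n4 w de) _.
 rewrite (_ : (Kw * de)^+2 = lam2 w/covf w 0 * de^+2); last first.
  by rewrite exprMn (sqr_sqrtr lam_ge0 : Kw^+2 = _).
 rewrite -/y; apply: eq_ler.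
 by have v0 := lt0r_neq0 V0; field.
apply: le_trans (acos_lower kd0 y40 rb ru).
rewrite lerD2l lerN2 ler_pdivrMr//.
apply: (le_via (y^+3/4*(y/3))).
 by apply: eq_ler; field.
exact: ler_wpM2l kyw.
Qed.

(** Both means are nQ/pi times an angle, equal to a frequency times de up to a multiple of y^3. The
    gap of the frequencies contributes 2 (Kw - K1), and the errors sum to order n/Q^2. *)
Let mean_gap : Num.sqrt n%:R/36-160*n%:R/Q%:R^+2 <=
 Ex G (fun x => @NN R n (n*Q) (scl t low_half x))-Ex G (@NN R n (n*Q)).
have p0 := @pi_gt0 R.
rewrite EN ENw -mulrBr -mulrBl.
apply: (le_via ((n*Q)%:R*((Kw * de-y^+3/4-(K1 * de+y^+3))/pi))); last first.
 apply: ler_wpM2l => //; apply: ler_wpM2r => //.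
 by have := ac1; have := acw; move: (acos _) (acos _) => *; lra.
have -> : (n*Q)%:R*((Kw * de-y^+3/4-(K1 * de+y^+3))/pi) =
  2*(Kw-K1)-10*n%:R * pi^+2/Q%:R^+2.
 rewrite (_ : Kw * de-_-_ = (Kw-K1) * de-5/4*y^+3); last by field.
 rewrite yE /de natrM; move: p0 nR QR; move: (pi : R) (n%:R : R) (Q%:R : R) => p a b p0 a0 b0.
 by field; rewrite !gt_eqF.
have pp : pi^+2 <= 16 :> R.
 rewrite (_ : 16 = 4^+2 :> R); last by ring.
 by apply: lerXn2r; rewrite ?pi_ge0//; exact: (ltW (pi_lt4 R)).
have : 10*n%:R * pi^+2/Q%:R^+2 <= 160*n%:R/Q%:R^+2 :> R.
 rewrite ler_pM2r ?exprn_gt0// (_ : 160*n%:R = 10*n%:R*16); last by ring.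
 exact: ler_wpM2l.
by have := Kgap_sqrt; move: (Kw-K1) (_/_^+2) (_/_^+2) (Num.sqrt _) => *; lra.
Qed.

(** For Q >= 108 n the error 160 n/Q^2 is at most 1/72, so the means differ by at least sqrt n/72,
    and [variance_lower] applies with a last factor at most 1. *)
Lemma NN_var_lower : (108*n <= Q)%N -> n%:R/(72*72) <= Vr G (@NN R n (n*Q)).
move=> nQ.
have n1 : 1 <= n%:R :> R by rewrite ler1n.
have sn : 0 < Num.sqrt n%:R :> R by [].
have sn1 : 1 <= Num.sqrt n%:R :> R by rewrite -{1}(sqrtr1 R) ler_wsqrtr.
have h1 : 160*n%:R/Q%:R^+2 <= Num.sqrt n%:R/72 :> R.
 apply: (le_via (1/72)); last by rewrite ler_pM2r// invr_gt0.
 rewrite ler_pdivrMr ?exprn_gt0//.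
 have : (108*n%:R)^+2 <= Q%:R^+2 :> R by apply: lerXn2r; rewrite ?nnegrE// -natrM ler_nat.
 have : n%:R <= n%:R^+2 :> R by rewrite expr2 ler_peMl.
 rewrite (_ : (108*n%:R)^+2 = 108*108*n%:R^+2); last by ring.
 by move: (Q%:R^+2 : R) (n%:R : R) (n%:R^+2 : R) n1 => q a b *; lra.
have h2 := mean_gap.
have h3 : Num.sqrt n%:R/72 <= Ex G (fun x => @NN R n (n*Q) (scl t low_half x))-Ex G (@NN R n (n*Q)).
 by move: h1 h2; move: (Num.sqrt _) (_/_^+2) (_-Ex _ _) => *; lra.
have := variance_lower low_half (ltW t0) (NN_meas (n*Q)) (fun x => NN_bound (n*Q) x).
have e1 : expR (\sum_i (low_half i)%:R*(t^+2/2))-1 <= 1 :> R.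
 apply: (le_via (expR 2^-1-1)); first by rewrite lerD2r ler_expR.
 have h : 0 <= 2^-1 :> R by [].
 have := @expRN_le2 R _ h; rewrite expRN.
 have q0 := expR_gt0 (2^-1 : R).
 have := mulfV (lt0r_neq0 q0); have : 0 <= expR (2^-1 : R) by exact: ltW.
 have := @expR_ge1Dx R (- 2^-1); rewrite expRN.
 move: (expR _) q0 => q q0 a b c.
 have : q*(1 + - 2^-1) <= q*q^-1 by apply: ler_wpM2l.
 by rewrite c; lra.
have V00 := Vr_ge0 G (@NN R n (n*Q)).
move=> h4; have {}h4 := le_trans h4 (ler_wpM2l V00 e1).
rewrite mulr1 in h4; apply: le_trans h4.
have -> : n%:R/(72*72) = (Num.sqrt n%:R/72)^+2 :> R by rewrite expr_div_n sqr_sqrtr ?(ltW nR).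
by apply: lerXn2r => //; rewrite nnegrE ?divr_ge0 ?(ltW sn)//; apply: le_trans h3.
Qed.

End grid.

End variance_lower_bound.

(** Var N <= 2 Var Z + 2 Var(Z - N), and at level j = 40 + n the last variance is at most a quarter
    of the lower bound on Var N. *)
Lemma ZZ_var_lower (R : realType) (n : nat) : (4 <= n)%N ->
 n%:R/(4*(72*72)) <= Vr (gauss (n+n)) (@ZZ R n).
move=> n4; set G := gauss (n+n).
have [j nj p40] : exists2 j, (108*n <= (Qd j).+1)%N & 2^+40 <= 2^+j :> R.
 exists (40+n)%N; last by apply: ler_weXn2l; [rewrite (ler_nat R 1)|rewrite leq_addr].
 rewrite QdE expnD mulnA; apply: leq_mul; last exact: ltnW (ltn_expl _ _).
 by [].
have Q16 : (16 <= (Qd j).+1)%N by apply: leq_trans nj; apply: (@leq_trans (108*4)%N) => //; rewrite leq_mul2l n4 orbT.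
have h1 := NN_var_lower R n4 Q16 nj.
have h2 := ZZ_level_var R n4 j.
pose N := @NN R n (n*(Qd j).+1); rewrite -/N -/G in h1 h2.
have mD : msr (fun x => @ZZ R n x-N x) by apply: measurable_funB.
pose M : R := n.*2%:R+(n*(Qd j).+1)%:R.
have DM x : `|@ZZ R n x-N x| <= M by apply: ler_normB_via; apply: lerD; [exact: ZZ_norm|exact: NN_bound].
have ZM x : `|@ZZ R n x| <= M by apply: le_trans (@ZZ_norm R n x) _; rewrite lerDl.
have mD' : msr (fun x => -1*(@ZZ R n x-N x)) by [].
have DM' x : `|-1*(@ZZ R n x-N x)| <= M by rewrite mulN1r normrN.
have h3 := VrD_le G ltr01 (ZZ_meas n4) mD' ZM DM'.
rewrite (VrZ G (-1) mD DM) sqrrN expr1n mul1r invr1 in h3.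
rewrite (Vr_eq _ (g := N)) in h3; last by move=> x; ring.
have h4 : 2160*4096*n%:R/2^+j <= n%:R/(4*(72*72)) :> R.
 have p0 : 0 < 2^+j :> R by [].
 rewrite ler_pdivrMr// (_ : n%:R/(4*(72*72))*2^+j = n%:R*(2^+j/(4*(72*72)))); last by ring.
 rewrite (mulrC _ n%:R); apply: ler_wpM2l => //.
 by move: p40; clear; move: (2^+j : R) => p; lra.
move: h1 h2 h3 h4; clear; move: (2160*4096*n%:R/2^+j : R) (n%:R : R) (Vr G (@ZZ R n)) => v m a.
by move: (Vr _ _) (Vr _ _) => b c; lra.
Qed.

(** * Small increments along the semigroup *)

Section trig_taylor.
Variable R : realType.

Lemma cos_taylor (x : R) : `|cos x-(1-x^+2/2)| <= `|x|^+3.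
have h1 := cos_ge2 x; have h2 := cos_le4 x.
rewrite ger0_norm ?subr_ge0//; have [x1|x1] := leP `|x| 1.
 have : x^+4 <= `|x|^+3.
  rewrite (_ : x^+4 = `|x|^+3 * `|x|); last by rewrite -exprSr -normrX ger0_norm// (exprM _ 2 2) sqr_ge0.
  by rewrite ler_piMr// exprn_ge0.
 have : 0 <= `|x|^+3 by [].
 by lra.
have : x^+2 <= `|x|^+3 by rewrite -(sqr_normr x) exprS ler_peMl ?sqr_ge0// ltW.
have : cos x <= 1 by [].
have : 0 <= `|x|^+3 by [].
by lra.
Qed.

Lemma sin_taylor (x : R) : `|sin x-x| <= `|x|^+3.
have pos y : 0 <= y -> `|sin y-y| <= `|y|^+3 :> R.
 move=> y0; have h1 := sin_ge3 y0; have h2 := sin_lex y0.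
 have y3 : 0 <= y^+3 by [].
 by rewrite (ger0_norm y0) ler_norml; apply/andP; split; lra.
have [x0|x0] := leP 0 x; first exact: pos.
have := pos (- x); rewrite sinN normrN oppr_ge0 (ltW x0) => /(_ isT).
by rewrite -opprD normrN.
Qed.

End trig_taylor.

Section dilated_expectation.
Variables (R : realType) (n : nat).
Notation tp := (n.-tuple R).
Implicit Types f g : tp -> R.

Lemma intg_scl s f (M : R) : msr f -> bdd f M ->
 IG n (fun z => f (vlin s z 0 z)).
by move=> mf fM; exact: (intg_bounded _ (msr_scl s mf) (fun z => fM _)). Qed.

Lemma EwB s f g (M : R) : msr f -> msr g ->
 bdd f M -> bdd g M ->
 Ew s (fun x => f x-g x) = Ew s f-Ew s g.
by move=> mf mg fM gM; rewrite /Ew ExB//; [exact: intg_scl fM|exact: intg_scl gM]. Qed.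

Lemma EwZ s f (c M : R) : msr f -> bdd f M ->
 Ew s (fun x => c*f x) = c*Ew s f.
by move=> mf fM; rewrite /Ew ExZ//; exact: intg_scl fM. Qed.

Lemma Ew_cst s (c : R) : Ew s (fun _ : tp => c) = c.
exact: Ex_cst. Qed.

Lemma Ew_bound s f (M : R) : msr f -> bdd f M -> `|Ew s f| <= M.
by move=> mf fM; exact: (Ex_bound _ (msr_scl s mf) (fun z => fM _)). Qed.

Lemma Ew_eq s f g : f =1 g -> Ew s f = Ew s g.
by move=> h; rewrite (funext h). Qed.

Lemma Ew_near s f g (c M : R) : msr f -> msr g ->
 bdd f M -> bdd g M -> (forall x, `|f x-g x| <= c) ->
 `|Ew s f-Ew s g| <= c.
by move=> mf mg fM gM h; rewrite -(EwB s mf mg fM gM); apply: Ew_bound. Qed.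

Lemma Ew_dev s f (M V : R) : msr f -> bdd f M -> 0 <= V ->
 Ew s (fun x => f x^+2)-Ew s f^+2 <= V^+2 -> Ew s (fun x => `|f x-Ew s f|) <= V.
move=> mf fM V0 hV; set m := Ew s f.
have mm : `|m| <= M by exact: Ew_bound.
have M0 : 0 <= M by exact: le_trans mm.
have mD : msr (fun x => f x-m) by [].
have DM x : `|f x-m| <= M+M by apply: ler_normB_via; exact: lerD.
have mA : msr (fun x => `|f x-m|) by [].
have AM x : `|(`|f x-m|)| <= M+M by rewrite normr_id.
have := Ex_sqr_le (gauss n) (msr_scl s mA) (fun z => AM _).
rewrite -/(Ew s (fun x => `|f x-m|)) => h.
have A0 : 0 <= Ew s (fun x => `|f x-m|) by [].
rewrite -(@ler_pXn2r _ 2)//; apply: le_trans hV; apply: le_trans h _.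
apply: eq_ler.
rewrite -/(Ew s (fun x => `|f x-m|^+2)).
rewrite (@Ew_eq s _ (fun x => f x^+2-(2 * m*f x-m^+2))); last first.
 by move=> x; rewrite sqr_normr//; ring.
pose B := M^+2+(2 * M * M+M^+2).
have M2 : 0 <= M^+2 by [].
have MM : 0 <= 2 * M * M by [].
have f2 x : `|f x^+2| <= B by rewrite normrX /B; apply: (le_via (M^+2)); [apply: lerXn2r; rewrite ?nnegrE|lra].
have g1 x : `|2 * m*f x| <= B.
 rewrite !normrM (ger0_norm (ler0n _ 2)) /B; apply: (le_via (2 * M * M)); last by lra.
 by apply: ler_pM; rewrite ?mulr_ge0// ler_wpM2l.
have g2 (x : tp) : `|m^+2| <= B by rewrite normrX /B; apply: (le_via (M^+2)); [apply: lerXn2r; rewrite ?nnegrE|lra].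
have mg1 : msr (fun x => 2 * m*f x) by [].
have B0 : B <= B+B by rewrite lerDl.
rewrite (@EwB s _ _ (B+B)); last 4 first.
- by [].
- by [].
- by move=> x; exact: le_trans (f2 x) B0.
- by move=> x; apply: ler_normB_via; apply: lerD; [exact: g1|exact: (g2 x)].
have mc : msr (fun _ : tp => m^+2) by [].
rewrite (EwB s mg1 mc g1 g2).
by rewrite (EwZ _ _ mf fM) Ew_cst -/m; ring.
Qed.

End dilated_expectation.

Section increments.
Variables (R : realType) (n d : nat) (U : 'I_d -> 'I_n -> R) (K : R).
Notation tp := (n.-tuple R).
Hypothesis K0 : 0 <= K.

Let W k : R := EG n (fun z => @wt R n z^+k).
Let W_ge0 k : 0 <= W k.
by apply: Ex_ge0 => z; rewrite exprn_ge0// ltW// wt_gt0. Qed.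

(** With D the centred increment and q its linear part, |D| <= B e wt and |D - q| <= B e^2 wt. The
    constant depends on f through K alone, so it is the same at every step. *)
Definition incB : R := K*(\sum_l \sum_i `|U l i|)+K*n%:R+K*n%:R*W 1.
Let B := incB.

Let A0 : 0 <= K*(\sum_l \sum_i `|U l i|).
by []. Qed.
Let Kn0 : 0 <= K*n%:R. exact: mulr_ge0. Qed.
Let KW0 : 0 <= K*n%:R*W 1. exact: mulr_ge0. Qed.
Let B0 : 0 <= B. by []. Qed.

Variables (f : tp -> R) (xi : 'I_d -> tp -> R).
Hypothesis Cf : C11 U f xi K.

Definition gradv (y : tp) (i : 'I_n) : R := \sum_l xi l y*U l i.
Definition gradsq (y : tp) : R := \sum_i gradv y i^+2.

Variables (e : R) (y : tp).
Hypothesis e01 : 0 < e <= 1.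
Let e0 : 0 < e. by case/andP: e01. Qed.
Let e1 : e <= 1. by case/andP: e01. Qed.

Let mf : msr f. by case: Cf. Qed.
Let fK x : `|f x| <= K. by case: Cf. Qed.
Let F := avg e f y.
Let D z := f (vlin 1 y e z)-F.
Let q z := e * dot (gradv y) z.

Let wt0 (z : tp) : 0 <= wt z. exact: ltW (wt_gt0 z). Qed.

Let dot_grad z : dot (gradv y) z = \sum_l xi l y * dot (U l) z.
rewrite /dot /gradv; under eq_bigr do rewrite mulr_suml.
rewrite exchange_big/=; apply: eq_bigr => l _.
by rewrite mulr_sumr; apply: eq_bigr => i _; ring.
Qed.

Let rem z : `|f (vlin 1 y e z)-f y-q z| <= K*n%:R*(e^+2*wt z).
pose h := vlin e z 0 z.
have hE : vlin 1 y e z = vlin 1 y 1 h by apply: eq_from_tnth => i; rewrite !tnth_vlin; ring.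
have dh u : dot u h = e * dot u z by rewrite dot_vlin mul0r addr0.
have nh : nsq h = e^+2*nsq z.
 rewrite /nsq mulr_sumr; apply: eq_bigr => i _.
 by rewrite tnth_vlin mul0r addr0 exprMn.
have [_ _ _ _ /(_ y h)] := Cf.
rewrite -hE nh (_ : \sum_l xi l y * dot (U l) h = q z); last first.
 by rewrite /q dot_grad mulr_sumr; apply: eq_bigr => l _; rewrite dh; ring.
move=> h1; apply: le_trans h1 _; rewrite -mulrA; apply: ler_wpM2l => //.
rewrite mulrCA; apply: ler_wpM2l => //.
exact: nsq_le_wt.
Qed.

Let If : IG n (fun z => f (vlin 1 y e z)).
exact: (intg_bnd K). Qed.
Let Iq : IG n q. by apply: intgZ; exact: intg_dot. Qed.
Let Eq : EG n q = 0. by rewrite ExZ ?Ex_dot ?mulr0//; exact: intg_dot. Qed.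

Let Fy : `|F-f y| <= K*n%:R*W 1*e^+2.
have -> : F-f y = EG n (fun z => f (vlin 1 y e z)-f y-q z).
 rewrite ExB//; last by apply: intgB => //; exact: intg_cst.
 by rewrite Eq subr0 ExB ?Ex_cst//; exact: intg_cst.
have I1 : IG n (fun z : tp => K*n%:R*e^+2*wt z^+1) by apply: intgZ; exact: intg_wt.
have mD : msr (fun z => f (vlin 1 y e z)-f y-q z).
 exact: (intg_meas (intgB (intgB If (intg_cst _ (f y))) Iq)).
apply: le_trans (Ex_abs_le mD I1 _) _; last first.
 by rewrite ExZ; [apply: eq_ler; rewrite /W; ring|exact: intg_wt].
by move=> z; rewrite expr1 -mulrA; exact: rem.
Qed.

Let Dq z : `|D z-q z| <= B*(e^+2*wt z).
have -> : D z-q z = (f (vlin 1 y e z)-f y-q z)-(F-f y) by rewrite /D; ring.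
apply: ler_normB_via.
have w1 := wt_ge1 z; have e2 : 0 <= e^+2 by exact: sqr_ge0.
have h1 := rem z; have h2 := Fy.
have h3 : K*n%:R*W 1*e^+2 <= K*n%:R*W 1*(e^+2*wt z) by apply: ler_wpM2l => //; rewrite ler_peMr.
have ew : 0 <= e^+2*wt z by [].
have h4 : 0 <= K*(\sum_l \sum_i `|U l i|)*(e^+2*wt z) by [].
by rewrite /B /incB !mulrDl; lra.
Qed.

Let qb z : `|q z| <= K*(\sum_l \sum_i `|U l i|)*(e*wt z).
rewrite /q normrM (gtr0_norm e0) mulrCA; apply: ler_wpM2l => //.
apply: le_trans (dot_le_wt _ _) _; apply: ler_wpM2r => //.
apply: (le_via (\sum_i \sum_l K * `|U l i|)).
 apply: ler_sum => i _; apply: le_trans (ler_norm_sum _ _ _) _.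
 apply: ler_sum => l _; rewrite normrM; apply: ler_wpM2r => //.
 by case: Cf.
by rewrite exchange_big/= mulr_sumr; apply: ler_sum => l _; rewrite mulr_sumr.
Qed.

Let e2w (z : tp) : e^+2*wt z <= e*wt z.
by apply: ler_wpM2r => //; rewrite expr2 ler_piMl// ltW. Qed.

Let Db z : `|D z| <= B*(e*wt z).
have -> : D z = (f (vlin 1 y e z)-f y-q z)-(F-f y)+q z by rewrite /D; ring.
apply: ler_normD_via; have h1 := qb z.
have h2 := rem z; have h3 := Fy; have h4 := e2w z.
have h5 : `|f (vlin 1 y e z)-f y-q z-(F-f y)| <= K*n%:R*(e*wt z)+K*n%:R*W 1*(e*wt z).
 apply: ler_normB_via; apply: lerD.
  by apply: le_trans h2 _; apply: ler_wpM2l.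
 apply: le_trans h3 _; apply: ler_wpM2l => //; apply: le_trans h4.
 by rewrite ler_peMr ?sqr_ge0// wt_ge1.
by rewrite /B /incB !mulrDl; lra.
Qed.

Let Bew0 (z : tp) : 0 <= B*(e*wt z). by []. Qed.

Let qB z : `|q z| <= B*(e*wt z).
apply: le_trans (qb z) _; apply: ler_wpM2r => //.
by rewrite /B /incB -addrA lerDl addr_ge0.
Qed.

Let ID : IG n D. by apply: intgB => //; exact: intg_cst. Qed.
Let ED : EG n D = 0.
by rewrite ExB ?Ex_cst//; [rewrite -/(avg e f y) subrr|exact: intg_cst]. Qed.

(** The variance of f(y + e z) over z; to leading order it is e^2 |grad f(y)|^2. *)
Definition decr : R := avg e (fun x => f x^+2) y-avg e f y^+2.

Let Dbound z : `|D z| <= K+K.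
by apply: ler_normB_via; apply: lerD => //; exact: avg_bound. Qed.

Let ID2 : IG n (fun z => D z^+2).
apply: (intg_bnd ((K+K)^+2)); first by apply: measurable_funX; exact: intg_meas ID.
by move=> z; rewrite normrX lerXn2r ?nnegrE// addr_ge0.
Qed.

Let decrE : decr = EG n (fun z => D z^+2).
have I2 : IG n (fun z => f (vlin 1 y e z)^+2).
 apply: (intg_bnd (K^+2)); first by apply: measurable_funX; exact: intg_meas If.
 by move=> z; rewrite normrX lerXn2r.
rewrite (@Ex_eq _ _ _ _ _ (fun z => f (vlin 1 y e z)^+2-(2 * F*f (vlin 1 y e z)-F^+2))) => [|z]; last by rewrite /D; ring.
rewrite ExB//; last by apply: intgB; [exact: intgZ|exact: intg_cst].
rewrite ExB; [|exact: intgZ|exact: intg_cst].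
by rewrite ExZ// Ex_cst /decr -/(avg e f y) -/F /avg; ring.
Qed.

Lemma decr_ge0 : 0 <= decr.
by rewrite decrE; apply: Ex_ge0 => z. Qed.

Lemma decr_grad : `|decr-e^+2 * gradsq y| <= 2*B^+2*W 2*e^+3.
have [Iq2' Eq2'] := Ex_dot_sq (gradv y).
have Iq2 : IG n (fun z => q z^+2).
 rewrite (_ : (fun z => _) = fun z => e^+2 * dot (gradv y) z^+2); first exact: intgZ.
 by apply/funext => z; rewrite /q exprMn.
have Eq2 : EG n (fun z => q z^+2) = e^+2 * gradsq y.
 rewrite (@Ex_eq _ _ _ _ _ (fun z => e^+2 * dot (gradv y) z^+2)) => [|z]; last by rewrite /q exprMn.
 by rewrite ExZ// Eq2'.
rewrite decrE -Eq2 -ExB//.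
have I1 : IG n (fun z : tp => 2*B^+2*e^+3*wt z^+2) by apply: intgZ; exact: intg_wt.
apply: le_trans (Ex_abs_le (intg_meas (intgB ID2 Iq2)) I1 _) _; last first.
 by rewrite ExZ; [apply: eq_ler; rewrite /W; ring|exact: intg_wt].
move=> z; rewrite subr_sqr normrM.
have -> : 2*B^+2*e^+3*wt z^+2 = B*(e^+2*wt z)*(B*(e*wt z)+B*(e*wt z)) by ring.
apply: ler_pM => //; apply: ler_normD_via.
exact: lerD.
Qed.

Lemma decr_le : decr <= B^+2*W 2*e^+2.
rewrite decrE; have I1 : IG n (fun z : tp => B^+2*e^+2*wt z^+2) by apply: intgZ; exact: intg_wt.
apply: le_trans (Ex_le ID2 I1 _) _; last first.
 by rewrite ExZ; [apply: eq_ler; rewrite /W; ring|exact: intg_wt].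
move=> z; rewrite -(sqr_normr (D z)) (_ : _*wt z^+2 = (B*(e*wt z))^+2); last by ring.
exact: lerXn2r.
Qed.

(** The addition formula around the average, with cos and sin of the centred increment expanded: the
    increment has mean zero and second moment [decr]. *)
Lemma cos_step (lam th : R) :
 `|avg e (fun x => cos (lam*f x+th)) y-cos (lam*avg e f y+th)*(1-lam^+2 * decr/2)| <=
 2*(`|lam|^+3*B^+3*W 3)*e^+3.
rewrite -/F; pose a := lam * F+th.
have mD := intg_meas ID.
have mcos : msr (fun z => cos (lam*D z)) by [].
have msin : msr (fun z => sin (lam*D z)) by [].
have cos1 (x : R) : `|cos x| <= 1 by rewrite ler_norml cos_geN1 cos_le1.
have sin1 (x : R) : `|sin x| <= 1 by rewrite ler_norml sin_geN1 sin_le1.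
have Ic : IG n (fun z => cos (lam*D z)) by exact: (intg_bounded _ mcos (fun z => cos1 _)).
have Is : IG n (fun z => sin (lam*D z)) by exact: (intg_bounded _ msin (fun z => sin1 _)).
pose rc z := cos (lam*D z)-(1-(lam*D z)^+2/2).
pose rs z := sin (lam*D z)-lam*D z.
have ID2l : IG n (fun z => lam^+2/2*D z^+2) by exact: intgZ.
have Irc : IG n rc.
 rewrite (_ : rc = fun z => cos (lam*D z)-(1-lam^+2/2*D z^+2)); last first.
  by apply/funext => z; rewrite /rc; ring.
 by apply: intgB => //; apply: intgB => //; exact: intg_cst.
have Irs : IG n rs by apply: intgB => //; exact: intgZ.
have Erc : EG n rc = EG n (fun z => cos (lam*D z))-(1-lam^+2 * decr/2).
 rewrite (@Ex_eq _ _ _ _ rc (fun z => cos (lam*D z)-(1-lam^+2/2*D z^+2))) => [|z]; last by rewrite /rc; ring.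
 rewrite ExB//; last by apply: intgB => //; exact: intg_cst.
 by rewrite ExB//; [rewrite Ex_cst ExZ// -decrE; congr (_-_); ring|exact: intg_cst].
have Ers : EG n rs = EG n (fun z => sin (lam*D z)) by rewrite ExB//; [rewrite ExZ// ED mulr0 subr0|exact: intgZ].
have -> : avg e (fun x => cos (lam*f x+th)) y =
  cos a*EG n (fun z => cos (lam*D z))-sin a*EG n (fun z => sin (lam*D z)).
 rewrite -!ExZ// -ExB; [|exact: intgZ|exact: intgZ].
 apply: Ex_eq => z; rewrite -cosD /a /D; congr cos; ring.
have -> : cos a*EG n (fun z => cos (lam*D z))-sin a*EG n (fun z => sin (lam*D z)) -
  cos a*(1-lam^+2 * decr/2) = cos a*EG n rc-sin a*EG n rs by rewrite Erc Ers; ring.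
have I3 : IG n (fun z : tp => `|lam|^+3*B^+3*e^+3*wt z^+3) by apply: intgZ; exact: intg_wt.
have E3 : EG n (fun z : tp => `|lam|^+3*B^+3*e^+3*wt z^+3) = `|lam|^+3*B^+3*W 3*e^+3 by rewrite ExZ; [rewrite /W; ring|exact: intg_wt].
have lD z : `|lam*D z|^+3 <= `|lam|^+3*B^+3*e^+3*wt z^+3.
 rewrite (_ : _*wt z^+3 = (`|lam|*(B*(e*wt z)))^+3); last by ring.
 apply: lerXn2r => //.
 by rewrite normrM; apply: ler_wpM2l.
have hc : `|EG n rc| <= `|lam|^+3*B^+3*W 3*e^+3.
 rewrite -E3; apply: Ex_abs_le (intg_meas Irc) I3 _ => z.
 exact: le_trans (cos_taylor _) (lD z).
have hs : `|EG n rs| <= `|lam|^+3*B^+3*W 3*e^+3.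
 rewrite -E3; apply: Ex_abs_le (intg_meas Irs) I3 _ => z.
 exact: le_trans (sin_taylor _) (lD z).
apply: ler_normB_via.
rewrite (_ : 2*_*e^+3 = `|lam|^+3*B^+3*W 3*e^+3 + `|lam|^+3*B^+3*W 3*e^+3); last by ring.
by apply: lerD; rewrite normrM; [apply: le_trans hc|apply: le_trans hs]; rewrite ler_piMl.
Qed.

End increments.

(** * Poincare inequality for Lipschitz functions *)

Section poincare.
Variables (R : realType) (n d : nat) (U : 'I_d -> 'I_n -> R).
Notation tp := (n.-tuple R).

Definition lipschitz_sq (g : tp -> R) (Lam : R) :=
 forall y h, (g (vlin 1 y 1 h)-g y)^+2 <= Lam^+2*nsq h.

Lemma avg_sub e (g : tp -> R) (M : R) y h : msr g -> bdd g M ->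
 avg e g (vlin 1 y 1 h)-avg e g y = avg e (fun x => g (vlin 1 x 1 h)-g x) y.
move=> mg gM; rewrite /avg -ExB.
- by apply: Ex_eq => z; rewrite vlin_comm.
- exact: (intg_bnd M).
- exact: (intg_bnd M).
Qed.

Lemma msr_translate (g : tp -> R) h : msr g ->
 msr (fun x => g (vlin 1 x 1 h)).
by [].
Qed.

Lemma lipschitz_sq_avg e (g : tp -> R) Lam (M : R) : msr g -> bdd g M ->
 lipschitz_sq g Lam -> lipschitz_sq (avg e g) Lam.
move=> mg gM lg y h; rewrite (avg_sub _ _ _ mg gM).
have mD : msr (fun x => g (vlin 1 x 1 h)-g x) by exact: measurable_funB.
have DM x : `|g (vlin 1 x 1 h)-g x| <= M+M by apply: ler_normB_via; exact: lerD.
have mS := msr_shift e y mD.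
apply: le_trans (Ex_sqr_le (gauss n) mS (fun z => DM _)) _.
have mS2 : msr (fun z => (g (vlin 1 (vlin 1 y e z) 1 h)-g (vlin 1 y e z))^+2) by [].
have b z : 0 <= (g (vlin 1 (vlin 1 y e z) 1 h)-g (vlin 1 y e z))^+2 <= Lam^+2*nsq h by rewrite sqr_ge0 lg.
by have /andP[] := Ex_between (gauss n) mS2 b.
Qed.

(** The expansion is tested in the direction t grad g, with t small. *)
Lemma gradsq_lipschitz g zeta K Lam : C11 U g zeta K -> 0 <= Lam -> lipschitz_sq g Lam ->
 forall y, gradsq U zeta y <= Lam^+2.
move=> Cg L0 lg y; have K0 := C11_ge0 Cg.
set V := gradsq U zeta y; have V0 : 0 <= V by apply: sumr_ge0 => i _; exact: sqr_ge0.
have key (t : R) : 0 < t -> V <= Lam*Num.sqrt V+K * t*V.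
 move=> t0; pose h : tp := [tuple t * gradv U zeta y i | i < n].
 have nh : nsq h = t^+2*V by rewrite /nsq /V /gradsq mulr_sumr; apply: eq_bigr => i _; rewrite tnth_mktuple exprMn.
 have dh : \sum_l zeta l y * dot (U l) h = t*V.
  rewrite /V /gradsq mulr_sumr; under eq_bigr do rewrite /dot mulr_sumr.
  rewrite exchange_big/=; apply: eq_bigr => i _.
  rewrite tnth_mktuple (_ : t*_^+2 = (t * gradv U zeta y i)*\sum_l zeta l y*U l i).
   by rewrite mulr_sumr; apply: eq_bigr => l _; ring.
  by rewrite -/(gradv U zeta y i); ring.
 have [_ _ _ _ /(_ y h)] := Cg; rewrite dh nh => h1.
 have h2 : `|g (vlin 1 y 1 h)-g y| <= Lam*(t*Num.sqrt V).
  rewrite -(@ler_pXn2r _ 2)//.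
  rewrite sqr_normr// !exprMn sqr_sqrtr//.
  by have := lg y h; rewrite nh.
 have : t*V <= Lam*(t*Num.sqrt V)+K*(t^+2*V).
  move: h1 h2; rewrite !ler_norml => /andP[a1 a2] /andP[b1 b2].
  by move: a1 b2; move: (g _-g _) (t*V) (Lam*_) (K*_) => *; lra.
 rewrite (_ : Lam*(t*_)+_ = t*(Lam*Num.sqrt V+K * t*V)); last by ring.
 by rewrite ler_pM2l.
have VL : V <= Lam*Num.sqrt V.
 rewrite leNgt; apply/negP => lt; pose t := (V-Lam*Num.sqrt V)/(2*(K*V+1)).
 have p1 : 0 < 2*(K*V+1) by rewrite mulr_gt0// ltr_wpDl// mulr_ge0.
 have t0 : 0 < t by rewrite divr_gt0// subr_gt0.
 have hk := key t t0; suff : t < t by rewrite ltxx.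
 move: hk.
 have tE : t*(2*(K*V+1)) = V-Lam*Num.sqrt V by rewrite /t divfK// gt_eqF.
 have : K * t*V+t = t*(K*V+1) by ring.
 have tE2 : V-Lam*Num.sqrt V = 2*(t*(K*V+1)) by rewrite -tE; ring.
 have KtV : 0 <= K * t*V by [].
 move: tE2 KtV; clearbody t; move: (t*(K*V+1)) (K * t*V) (Lam*_) => *; lra.
have [V00|Vp] := eqVneq V 0; first by rewrite V00 sqr_ge0.
have Vgt : 0 < V by rewrite lt_neqAle eq_sym Vp.
have s0 : 0 < Num.sqrt V by [].
have sL : Num.sqrt V <= Lam by rewrite -(ler_pM2r s0) -expr2 sqr_sqrtr.
rewrite -(sqr_sqrtr V0); apply: lerXn2r => //; by rewrite nnegrE// ltW.
Qed.

Lemma sqrt_step N (e : R) : Num.sqrt (N.+1%:R*e^+2) = Num.sqrt (Num.sqrt (N%:R*e^+2)^+2+e^+2).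
rewrite sqr_sqrtr => //.
by rewrite -natr1 mulrDl mul1r.
Qed.

(** The variance at time s^2 + e^2 is that of the averaged function at time s^2 plus the mean of
    [decr], which is at most e^2 Lam^2 + D e^3. *)
Lemma poincare_iter (K Lam : R) : 0 <= K -> 0 <= Lam -> exists2 D : R, 0 <= D &
 forall N e g zeta, C11 U g zeta K -> lipschitz_sq g Lam -> 0 < e <= 1 ->
 Ew (Num.sqrt (N%:R*e^+2)) (fun x => g x^+2)-Ew (Num.sqrt (N%:R*e^+2)) g^+2 <=
 N%:R*(e^+2*Lam^+2+D*e^+3).
move=> K0 L0; pose D := 2 * incB U K^+2*EG n (fun z => @wt R n z^+2).
have W0 : 0 <= EG n (fun z => @wt R n z^+2) by [].
have D0 : 0 <= D by [].
exists D => //; elim=> [|N IH] e g zeta Cg lg e01.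
 have [mg _ _ _ _] := Cg.
 by rewrite !mul0r sqrtr0 !Ew0// ?subrr.
have [mg _ gK _ _] := Cg.
have g2K x : `|g x^+2| <= K^+2 by rewrite normrX lerXn2r.
have mg2 : msr (fun x => g x^+2) by [].
set s := Num.sqrt (N%:R*e^+2); have s0 : 0 <= s by exact: sqrtr_ge0.
rewrite sqrt_step -/s -(Ew_avg e s0 mg gK) -(Ew_avg e s0 mg2 g2K).
have := IH e _ _ (C11_avg e Cg) (lipschitz_sq_avg e mg gK lg) e01; rewrite -/s.
have ma := msr_avg e mg gK; have aK x := avg_bound e x mg gK.
have ma2 := msr_avg e mg2 g2K; have a2K x := avg_bound e x mg2 g2K.
have aa2 x : `|avg e g x^+2| <= K^+2 by rewrite normrX lerXn2r.
have maa : msr (fun x => avg e g x^+2) by [].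
have : Ew s (avg e (fun x => g x^+2))-Ew s (fun x => avg e g x^+2) <= e^+2*Lam^+2+D*e^+3.
 rewrite -(EwB s ma2 maa a2K aa2); apply: le_trans (ler_norm _) _.
 apply: Ew_bound => [|x]; first exact: measurable_funB.
 have h1 := decr_grad K0 Cg x e01; have h2 := gradsq_lipschitz Cg L0 lg x.
 have h3 := decr_ge0 K0 Cg e x.
 rewrite -/(decr g e x) ger0_norm//.
 have e2 : 0 <= e^+2 by [].
 have := ler_wpM2l e2 h2; move: h1; rewrite -/D ler_norml => /andP[_].
 by move: (decr g e x) (e^+2 * gradsq U zeta x) (e^+2*Lam^+2) (D*e^+3) => *; lra.
rewrite -natr1 mulrDl mul1r.
by move=> h1 h2; have := lerD h2 h1; rewrite [X in X <= _](addrC (_-_)) addrA subrK.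
Qed.

Lemma poincare g (Lam s : R) : gsm U g -> 0 <= Lam -> lipschitz_sq g Lam -> 0 <= s <= 1 ->
 Ew s (fun x => g x^+2)-Ew s g^+2 <= Lam^+2.
move=> [zeta [K Cg]] L0 lg /andP[s0 s1].
have K0 := C11_ge0 Cg; have [D D0 it] := poincare_iter K0 L0.
have [->|sn0] := eqVneq s 0.
 have [mg _ _ _ _] := Cg; rewrite !Ew0 ?subrr ?sqr_ge0//; exact: measurable_funX.
have sp : 0 < s by rewrite lt_neqAle eq_sym sn0.
apply/ler_addgt0Pr => del del0.
have [N hN] := @small_step R D del del0.
pose e := s/Num.sqrt N.+1%:R.
have q0 : 0 < Num.sqrt N.+1%:R :> R by [].
have q1 : 1 <= Num.sqrt N.+1%:R :> R by rewrite -{1}(sqrtr1 R) ler_wsqrtr// ler1n.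
have e0 : 0 < e by [].
have eq : e <= (Num.sqrt N.+1%:R)^-1 by rewrite /e ler_piMl// invr_ge0 ltW.
have e1 : e <= 1 by apply: le_trans eq _; rewrite invf_le1.
have e2 : N.+1%:R*e^+2 = s^+2 by rewrite /e expr_div_n sqr_sqrtr// mulrC divfK.
have e01 : 0 < e <= 1 by rewrite e0 e1.
have := it N.+1 e g zeta Cg lg e01; rewrite e2 sqrtr_sqr (ger0_norm s0) => h.
apply: le_trans h _.
rewrite mulrDr mulrA e2 (_ : N.+1%:R*(D*e^+3) = N.+1%:R*e^+2*(D*e)); last by ring.
rewrite e2; have s21 : s^+2 <= 1 by rewrite exprn_ile1.
apply: lerD; first by rewrite ler_piMl// sqr_ge0.
apply: le_trans hN; apply: (le_via (D*e)); last by apply: ler_wpM2l.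
by rewrite ler_piMl// mulr_ge0 ltW.
Qed.

End poincare.

(** * Normal approximation for functions of a Gaussian vector *)

Section gaussian_clt.
Variables (R : realType) (n d : nat) (U : 'I_d -> 'I_n -> R) (K L H : R).
Notation tp := (n.-tuple R).
Hypotheses (K0 : 0 <= K) (L0 : 0 <= L) (H0 : 0 <= H).

Definition nrm (a : 'I_n -> R) : R := Num.sqrt (\sum_i a i^+2).

(* The last two clauses say, in dual form, that the gradient is bounded by [L]
  and [H]-Lipschitz; this form is stable under averaging. *)
Definition clt_class (f : tp -> R) := exists xi : 'I_d -> tp -> R,
 [/\ C11 U f xi K, (forall l, gsm U (xi l)),
 (forall y a, `|\sum_l xi l y*(\sum_i U l i*a i)| <= L*nrm a) &
 (forall y h a, `|\sum_l (xi l (vlin 1 y 1 h)-xi l y)*(\sum_i U l i*a i)| <=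
   H*Num.sqrt (nsq h)*nrm a)].

Lemma clt_class_avg e f : clt_class f -> clt_class (avg e f).
case=> xi [Cf gxi b1 b2]; exists (fun l => avg e (xi l)).
have [mf mxi fK xiK _] := Cf.
have Ixi l y (c : R) : IG n (fun z => c*xi l (vlin 1 y e z)) by apply: intgZ; apply: (intg_bnd K).
have lin (c : 'I_d -> R) y : \sum_l avg e (xi l) y*c l = EG n (fun z => \sum_l c l*xi l (vlin 1 y e z)).
 rewrite Ex_sum => [|l] => //.
 apply: eq_bigr => l _; rewrite ExZ 1?mulrC//.
 exact: (intg_bnd K).
have mlin (c : 'I_d -> R) y : msr (fun z => \sum_l c l*xi l (vlin 1 y e z)) by [].
split.
- exact: C11_avg.
- by move=> l; have [zeta [K' C']] := gxi l; exists (fun l => avg e (zeta l)), K'; exact: C11_avg.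
- move=> y a; rewrite lin; apply: Ex_bound => // z.
 by have := b1 (vlin 1 y e z) a; congr (`|_| <= _); apply: eq_bigr => l _; rewrite mulrC.
- move=> y h a.
 rewrite (eq_bigr (fun l => avg e (fun x => xi l (vlin 1 x 1 h)-xi l x) y*(\sum_i U l i*a i))); last first.
  by move=> l _; rewrite (avg_sub _ _ _ (mxi l) (xiK l)).
 have mD l : msr (fun x => xi l (vlin 1 x 1 h)-xi l x) by exact: measurable_funB.
 have DM l x : `|xi l (vlin 1 x 1 h)-xi l x| <= K+K by apply: ler_normB_via; exact: lerD.
 have ID l (c : R) : IG n (fun z => c*(xi l (vlin 1 (vlin 1 y e z) 1 h)-xi l (vlin 1 y e z))) by apply: intgZ; exact: (intg_bounded _ (msr_shift e y (mD l)) (fun z => DM l _)).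
 rewrite (_ : \sum_l _ = EG n (fun z => \sum_l (\sum_i U l i*a i) *
   (xi l (vlin 1 (vlin 1 y e z) 1 h)-xi l (vlin 1 y e z)))); last first.
  rewrite Ex_sum => [|l] => //.
  apply: eq_bigr => l _; rewrite ExZ 1?mulrC//.
  exact: (intg_bounded _ (msr_shift e y (mD l)) (fun z => DM l _)).
 apply: Ex_bound => [|z]; first by apply: measurable_sum => l; exact: intg_meas (ID l _).
 by have := b2 (vlin 1 y e z) h a; congr (`|_| <= _); apply: eq_bigr => l _; rewrite mulrC.
Qed.

Lemma dual_grad (xi : 'I_d -> R) (a : 'I_n -> R) :
 \sum_l xi l*(\sum_i U l i*a i) = \sum_i (\sum_l xi l*U l i)*a i.
under eq_bigr do rewrite mulr_sumr.
rewrite exchange_big/=; apply: eq_bigr => i _; rewrite mulr_suml.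
by apply: eq_bigr => l _; rewrite mulrA.
Qed.

Lemma dual_bound (v : 'I_n -> R) (c : R) : 0 <= c ->
 (forall a, `|\sum_i v i*a i| <= c*nrm a) -> \sum_i v i^+2 <= c^+2.
move=> c0 /(_ v); set V := \sum_i v i^+2.
have V0 : 0 <= V by [].
rewrite /nrm -/V ger0_norm// => h.
have [V00|Vp] := eqVneq V 0; first by rewrite V00 sqr_ge0.
have s0 : 0 < Num.sqrt V by rewrite sqrtr_gt0 lt_neqAle eq_sym Vp.
have sL : Num.sqrt V <= c by rewrite -(ler_pM2r s0) -expr2 sqr_sqrtr.
rewrite -(sqr_sqrtr V0); apply: lerXn2r => //; by rewrite nnegrE// ltW.
Qed.

(** |x|^2 - |y|^2 is the scalar product of x - y, of norm at most H |h|, and x + y, of norm at most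
    2 L. *)
Lemma gradsq_class f xi : C11 U f xi K -> (forall l, gsm U (xi l)) ->
 (forall y a, `|\sum_l xi l y*(\sum_i U l i*a i)| <= L*nrm a) ->
 (forall y h a, `|\sum_l (xi l (vlin 1 y 1 h)-xi l y)*(\sum_i U l i*a i)| <=
   H*Num.sqrt (nsq h)*nrm a) ->
 gsm U (gradsq U xi) /\ lipschitz_sq (gradsq U xi) (2*H*L).
move=> Cf gxi b1 b2; split.
 have -> : gradsq U xi = fun y => \sum_l \sum_l' (\sum_i U l i*U l' i)*(xi l y*xi l' y).
  apply/funext => y; rewrite /gradsq /gradv.
  transitivity (\sum_i \sum_l \sum_l' (U l i*U l' i)*(xi l y*xi l' y)).
   apply: eq_bigr => i _; rewrite expr2 mulr_suml; apply: eq_bigr => l _.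
   by rewrite mulr_sumr; apply: eq_bigr => l' _; ring.
  rewrite exchange_big/=; apply: eq_bigr => l _; rewrite exchange_big/=; apply: eq_bigr => l' _.
  by rewrite mulr_suml.
 apply: gsm_sum => l; apply: gsm_sum => l'; apply: gsm_scale; exact: gsm_mul.
move=> y h.
have gL x : \sum_i gradv U xi x i^+2 <= L^+2 by apply: dual_bound => // a; rewrite -dual_grad.
have nh0 : 0 <= nsq h by [].
pose w i := gradv U xi (vlin 1 y 1 h) i-gradv U xi y i.
pose w' i := gradv U xi (vlin 1 y 1 h) i+gradv U xi y i.
have wb : \sum_i w i^+2 <= H^+2*nsq h.
 rewrite -[nsq h](sqr_sqrtr nh0) -exprMn; apply: dual_bound => //.
 move=> a; have := b2 y h a; rewrite dual_grad; congr (`|_| <= _); apply: eq_bigr => i _.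
 by rewrite /w /gradv -sumrB; congr (_*_); apply: eq_bigr => l _; ring.
have w'b : \sum_i w' i^+2 <= 4*L^+2.
 apply: (le_via (\sum_i (2 * gradv U xi (vlin 1 y 1 h) i^+2+2 * gradv U xi y i^+2))).
  apply: ler_sum => i _; rewrite /w' -subr_ge0.
  rewrite (_ : _-_ = (gradv U xi (vlin 1 y 1 h) i-gradv U xi y i)^+2); last by ring.
  by [].
 by rewrite big_split/= -!mulr_sumr; have := gL y; have := gL (vlin 1 y 1 h); lra.
have -> : gradsq U xi (vlin 1 y 1 h)-gradsq U xi y = \sum_i w i*w' i by rewrite /gradsq -sumrB; apply: eq_bigr => i _; rewrite /w /w'; ring.
apply: le_trans (sum_CS _ _) _.
rewrite (_ : _*nsq h = H^+2*nsq h*(4*L^+2)); last by ring.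
exact: ler_pM.
Qed.

Lemma exp_quadratic (x : R) : 0 <= x -> `|(1-x)-expR (- x)| <= x^+2.
move=> x0; have h1 := expRN_le2 x0; have h2 := expR_ge1Dx (- x).
by rewrite ler_norml; have := sqr_ge0 x; move=> h3; apply/andP; split; lra.
Qed.

(** Three replacements. The averaged cosine is expanded with the local variance [decr]. Then [decr]
    becomes its mean, at the cost of e^2 times the mean deviation of |grad f|^2, which the Poincare
    inequality bounds by 2 H L. Finally 1 - x becomes exp(-x). Only the second error is of order e^2
    and survives the iteration. *)
Lemma clt_step (lam : R) : exists2 D : R, 0 <= D & forall f s e th, clt_class f -> 0 <= s <= 1 -> 0 < e <= 1 ->
 `|Ew (Num.sqrt (s^+2+e^+2)) (fun x => cos (lam*f x+th)) -
  expR (- (lam^+2*(Ew (Num.sqrt (s^+2+e^+2)) (fun x => f x^+2)-Ew s (fun x => avg e f x^+2))/2)) *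
  Ew s (fun x => cos (lam*avg e f x+th))| <= lam^+2*H*L*e^+2+D*e^+3.
pose W k : R := EG n (fun z => @wt R n z^+k).
have W0 k : 0 <= W k by apply: Ex_ge0 => z; rewrite exprn_ge0// ltW// wt_gt0.
pose B := incB U K.
have B0 : 0 <= B by [].
pose D1 := 2*(`|lam|^+3*B^+3*W 3%N).
pose D2 := 2*B^+2*W 2%N.
pose D3 := lam^+2*(B^+2*W 2%N)/2.
have D10 : 0 <= D1 by [].
have D20 : 0 <= D2 by [].
have D30 : 0 <= D3 by [].
exists (D1+lam^+2*D2+D3^+2).
 by [].
move=> f s e th cf s01 e01; have /andP[s0 s1] := s01; have /andP[e0 e1] := e01.
have [xi [Cf gxi b1 b2]] := cf; have [gg lg] := gradsq_class Cf gxi b1 b2.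
have [mf _ fK _ _] := Cf.
have mF := msr_avg e mf fK; have FK x := avg_bound e x mf fK.
have f2K x : `|f x^+2| <= K^+2 by rewrite normrX lerXn2r.
have mf2 : msr (fun x => f x^+2) by [].
have mF2 : msr (fun x => avg e f x^+2) by [].
have F2K x : `|avg e f x^+2| <= K^+2 by rewrite normrX lerXn2r.
have cos1 (x : R) : `|cos x| <= 1 by rewrite ler_norml cos_geN1 cos_le1.
have mcos (g : tp -> R) : msr g -> msr (fun x => cos (lam * g x+th)) by [].
have mc := mcos _ mf; have mC := mcos _ mF.
set s' := Num.sqrt _.
rewrite -(Ew_avg e s0 mc (fun x => cos1 _)) -(Ew_avg e s0 mf2 f2K).
have ma2 := msr_avg e mf2 f2K; have a2K x := avg_bound e x mf2 f2K.
rewrite -[_-Ew s (fun x => avg e f x^+2)](EwB s ma2 mF2 a2K F2K).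
pose dd x := decr f e x; rewrite -[Ew s (fun x => _-_)]/(Ew s dd).
pose db := Ew s dd; rewrite -/db.
have md : msr dd by exact: measurable_funB.
have dB x : 0 <= dd x <= B^+2*W 2%N*e^+2 by rewrite /dd (decr_ge0 K0 Cf)/=; exact: (decr_le K0 Cf x e01).
have dM x : `|dd x| <= K^+2+K^+2 by apply: ler_normB_via; apply: lerD.
have /andP[db0 db1] : 0 <= db <= B^+2*W 2%N*e^+2.
 exact: Ex_between (msr_scl s md) (fun z => dB _).
pose C x := cos (lam*avg e f x+th).
pose T1 := Ew s (avg e (fun x => cos (lam*f x+th))).
pose T2 := Ew s (fun x => C x*(1-lam^+2 * dd x/2)).
pose T3 := (1-lam^+2 * db/2)*Ew s C.
rewrite -/T1 -[Ew s (fun x => cos _)]/(Ew s C).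
have e3 : 0 <= e^+3 by [].
have lam20 : 0 <= lam^+2 by [].
have mac := msr_avg e mc (fun x => cos1 _); have acM x := avg_bound e x mc (fun x => cos1 _).
pose M2 := 1+lam^+2*(K^+2+K^+2)/2.
have M21 : 1 <= M2 by rewrite /M2 lerDl divr_ge0// mulr_ge0// addr_ge0// sqr_ge0.
have mW : msr (fun x => C x*(1-lam^+2 * dd x/2)) by [].
have WM x : `|C x*(1-lam^+2 * dd x/2)| <= M2.
 rewrite normrM -[M2]mul1r; apply: ler_pM => //; first exact: cos1.
 apply: ler_normB_via; rewrite normr1 lerD2l 2!normrM (ger0_norm lam20).
 by rewrite (ger0_norm (x := 2^-1)) ?invr_ge0//; apply: ler_wpM2r; [rewrite invr_ge0|apply: ler_wpM2l].
have h1 : `|T1-T2| <= D1*e^+3.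
 apply: (@Ew_near _ _ s _ _ _ M2) => // [x|x]; first exact: le_trans (acM x) M21.
 exact: (cos_step K0 Cf x e01).
have h2 : `|T2-T3| <= lam^+2*H*L*e^+2+lam^+2*D2*e^+3.
 have CM x : `|C x| <= 1 by exact: cos1.
 have -> : T2-T3 = lam^+2/2*Ew s (fun x => C x*(db-dd x)).
  have mCd : msr (fun x => C x*(db-dd x)).
   by apply: measurable_funM => //; apply: measurable_funB.
  have CdM x : `|C x*(db-dd x)| <= `|db| + (K^+2+K^+2).
   rewrite normrM -[leRHS]mul1r; apply: ler_pM => //.
   by apply: ler_normB_via; rewrite lerD2l.
  rewrite /T3 -(EwZ _ _ mC CM) -(EwZ _ _ mCd CdM) /T2.
  pose M3 := M2 + `|1-lam^+2 * db/2|.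
  have mC3 : msr (fun x => (1-lam^+2 * db/2)*C x) by [].
  rewrite -(@EwB _ _ s _ _ M3)//; last 2 first.
  - by move=> x; apply: le_trans (WM x) _; rewrite lerDl.
  - move=> x; rewrite normrM; apply: (le_via (`|1-lam^+2 * db/2|*1)); first by apply: ler_wpM2l.
   by rewrite mulr1 lerDr.
  by apply: Ew_eq => x; rewrite /C; ring.
 pose g := gradsq U xi; pose gb := Ew s g.
 have [zeta [K' Cg]] := gg; have [mg _ gK _ _] := Cg.
 have HL0 : 0 <= 2*H*L by [].
 have dev : Ew s (fun x => `|g x-gb|) <= 2*H*L by apply: (Ew_dev mg gK) => //; exact: (poincare gg HL0 lg s01).
 have near x : `|dd x-e^+2 * g x| <= D2*e^+3 by exact: (decr_grad K0 Cf x e01).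
 have meg : msr (fun x => e^+2 * g x) by [].
 have egK x : `|e^+2 * g x| <= e^+2*K' by rewrite normrM (ger0_norm (sqr_ge0 e)); apply: ler_wpM2l.
 have K'0 := C11_ge0 Cg.
 have db' : `|db-e^+2 * gb| <= D2*e^+3.
  rewrite /gb -(EwZ _ _ mg gK); apply: (@Ew_near _ _ s _ _ _ ((K^+2+K^+2)+e^+2*K')) => // x.
   by apply: le_trans (dM x) _; rewrite lerDl mulr_ge0// sqr_ge0.
  by apply: le_trans (egK x) _; rewrite lerDr addr_ge0// sqr_ge0.
 have mA : msr (fun x => `|g x-gb|) by [].
 have AM x : `|(`|g x-gb|)| <= K' + `|gb| by rewrite normr_id; apply: ler_normB_via; rewrite lerD2r.
 have pw x : `|C x*(db-dd x)| <= e^+2 * `|g x-gb| + 2*(D2*e^+3).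
  rewrite normrM; apply: (le_via (1 * `|db-dd x|)); first by apply: ler_wpM2r.
  rewrite mul1r (_ : db-dd x = (db-e^+2 * gb)-(dd x-e^+2 * g x)+e^+2*(gb-g x)); last by ring.
  apply: ler_normD_via; rewrite normrM (ger0_norm (sqr_ge0 e)) (distrC gb).
  have := ler_normB (db-e^+2 * gb) (dd x-e^+2 * g x); have := near x.
  by move: db'; move: (`|_-_-_|) (e^+2 * `|_|) (`|_-_|) (`|_-_|) (D2*_) => *; lra.
 have mR : msr (fun x => e^+2 * `|g x-gb| + 2*(D2*e^+3)) by [].
 have IR : IG n (fun z => e^+2 * `|g (vlin s z 0 z)-gb| + 2*(D2*e^+3)) by apply: intgD; [apply: intgZ; exact: intg_scl mA AM|exact: intg_cst].
 have mCd : msr (fun x => C x*(db-dd x)).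
  by apply: measurable_funM => //; apply: measurable_funB => //; exact: measurable_cst.
 have fin := Ex_abs_le (msr_scl s mCd) IR (fun z => pw _).
 have finE : EG n (fun z => e^+2 * `|g (vlin s z 0 z)-gb| + 2*(D2*e^+3)) =
   e^+2*Ew s (fun x => `|g x-gb|)+2*(D2*e^+3).
  rewrite /Ew ExD; [rewrite Ex_cst; congr (_+_); rewrite ExZ//; exact: intg_scl mA AM| |exact: intg_cst].
  by apply: intgZ; exact: intg_scl mA AM.
 rewrite finE in fin.
 rewrite normrM ger0_norm => //.
 have l20 : 0 <= lam^+2/2 by [].
 apply: le_trans (ler_wpM2l l20 fin) _.
 have := ler_wpM2l (sqr_ge0 e) dev.
 move=> h3; have h4 := ler_wpM2l l20 h3.
 rewrite mulrDr (_ : lam^+2*H*L*e^+2 = lam^+2/2*(e^+2*(2*H*L))); last by field.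
 by apply: lerD; [exact: h4|apply: eq_ler; field].
have h3 : `|T3-expR (- (lam^+2 * db/2))*Ew s C| <= D3^+2*e^+3.
 have x0 : 0 <= lam^+2 * db/2 by [].
 rewrite /T3 -mulrBl normrM.
 have C1 : `|Ew s C| <= 1 by apply: Ew_bound => // x; exact: cos1.
 apply: (le_via ((lam^+2 * db/2)^+2*1)).
  by apply: ler_pM => //; exact: exp_quadratic.
 rewrite mulr1; apply: (le_via ((D3*e^+2)^+2)).
  have D3e : 0 <= D3*e^+2 by [].
  apply: lerXn2r => //.
  rewrite /D3 (_ : _/2*e^+2 = lam^+2*(B^+2*W 2%N*e^+2)/2); last by ring.
  by apply: ler_wpM2r; [rewrite invr_ge0|apply: ler_wpM2l].
 rewrite exprMn -exprM; apply: ler_wpM2l => //.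
 by rewrite (exprS e 3) ler_piMl.
rewrite (_ : T1-_ = (T1-T2)+(T2-T3)+(T3-expR (- (lam^+2 * db/2))*Ew s C)); last by ring.
apply: ler_normD_via; rewrite mulrDl.
have := ler_normD (T1-T2) (T2-T3); rewrite mulrDl.
by move: h1 h2 h3; move: (`|_+_|) (`|_-_|) (`|_-_|) (`|_-_|) (D1*_) (D3^+2*_) (_*D2*_) (_*e^+2) => *; lra.
Qed.

(** The exponential factors multiply, and the mean local variances in their exponents add up to the
    variance of f at the final time. *)
Lemma clt_iter (lam : R) : exists2 D : R, 0 <= D & forall N f e th, clt_class f -> 0 < e <= 1 ->
 N%:R*e^+2 <= 1 ->
 `|Ew (Num.sqrt (N%:R*e^+2)) (fun x => cos (lam*f x+th)) -
  expR (- (lam^+2*(Ew (Num.sqrt (N%:R*e^+2)) (fun x => f x^+2)-Ew (Num.sqrt (N%:R*e^+2)) f^+2)/2)) *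
  cos (lam*Ew (Num.sqrt (N%:R*e^+2)) f+th)| <= N%:R*(lam^+2*H*L*e^+2+D*e^+3).
have [D D0 step] := clt_step lam; exists D => //; elim=> [|N IH] f e th cf e01 hN.
 have [xi [[mf _ _ _ _] _ _ _]] := cf.
 rewrite !mul0r sqrtr0 !Ew0 ?subrr ?mulr0 ?mul0r ?oppr0 ?expR0 ?mul1r ?subrr ?normr0//.
have [xi [[mf _ fK _ _] _ _ _]] := cf.
have NN : N%:R*e^+2 <= N.+1%:R*e^+2 :> R.
 by apply: ler_wpM2r; [exact: sqr_ge0|rewrite ler_nat].
have N1 : N%:R*e^+2 <= 1 by exact: le_trans hN.
have Ne0 : 0 <= N%:R*e^+2 by rewrite mulr_ge0// sqr_ge0.
rewrite sqrt_step; set s := Num.sqrt (N%:R*e^+2) in IH *.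
have s0 : 0 <= s by exact: sqrtr_ge0.
have s1 : s <= 1 by rewrite -(sqrtr1 R) ler_wsqrtr.
have s01 : 0 <= s <= 1 by rewrite s0 s1.
have h1 := step f s e th cf s01 e01.
have h2 := IH _ e th (clt_class_avg e cf) e01 N1; rewrite -/s in h2.
set s' := Num.sqrt (s^+2+e^+2) in h1 *.
have E : Ew s (avg e f) = Ew s' f by exact: (Ew_avg e s0 mf fK).
rewrite E in h2.
set a := Ew s' (fun x => f x^+2) in h1 *; set b := Ew s (fun x => avg e f x^+2) in h1 h2.
set c := Ew s' f^+2 in h2 *; set A := Ew s' (fun x => cos _) in h1 *.
set A' := Ew s (fun x => cos _) in h1 h2; set q := cos _ in h2 *.
have ab : 0 <= a-b.
 have f2K x : `|f x^+2| <= K^+2 by rewrite normrX lerXn2r ?nnegrE.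
 have mf2 : msr (fun x => f x^+2) by exact: measurable_funX.
 have ma := msr_avg e mf fK; have aK x := avg_bound e x mf fK.
 have ma2 := msr_avg e mf2 f2K; have a2K x := avg_bound e x mf2 f2K.
 have aa2 x : `|avg e f x^+2| <= K^+2 by rewrite normrX lerXn2r ?nnegrE.
 have maa : msr (fun x => avg e f x^+2) by exact: measurable_funX.
 rewrite /a -(Ew_avg e s0 mf2 f2K) -/s /b -(EwB s ma2 maa a2K aa2).
 by apply: Ex_ge0 => z; have [xi' [Cf' _ _ _]] := cf; exact: (decr_ge0 K0 Cf' e (vlin s z 0 z)).
have -> : expR (- (lam^+2*(a-c)/2)) = expR (- (lam^+2*(a-b)/2))*expR (- (lam^+2*(b-c)/2)).
 by rewrite -expRD; congr expR; field.
set x := expR (- (lam^+2*(a-b)/2)) in h1 *; set z := expR (- (lam^+2*(b-c)/2)) in h2 *.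
have x0 : 0 <= x by exact: expR_ge0.
have x1 : x <= 1.
 by rewrite -expR0 ler_expR oppr_le0 divr_ge0// mulr_ge0// sqr_ge0.
have -> : A-x*z*q = (A-x*A')+x*(A'-z*q) by ring.
apply: ler_normD_via; rewrite normrM (ger0_norm x0) -natr1 mulrDl mul1r addrC.
apply: lerD => //; apply: le_trans h2.
by rewrite ler_piMl.
Qed.

Lemma gaussian_clt (lam th : R) f : clt_class f ->
 `|EG n (fun x => cos (lam*f x+th)) -
  expR (- (lam^+2*Vr (gauss n) f/2))*cos (lam*EG n f+th)| <= lam^+2*H*L.
move=> cf; have [D D0 it] := clt_iter lam.
apply/ler_addgt0Pr => del del0.
have [N hN] := @small_step R D del del0.
pose e : R := (Num.sqrt N.+1%:R)^-1.
have q0 : 0 < Num.sqrt N.+1%:R :> R by [].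
have e0 : 0 < e by [].
have e1 : e <= 1 by rewrite invf_le1// -{1}(sqrtr1 R) ler_wsqrtr// ler1n.
have e2 : N.+1%:R*e^+2 = 1 by rewrite exprVn sqr_sqrtr// divff.
have e01 : 0 < e <= 1 by rewrite e0 e1.
have := it N.+1 f e th cf e01; rewrite e2 lexx sqrtr1 => /(_ isT).
have [xi [[mf _ fK _ _] _ _ _]] := cf.
rewrite !Ew1 -(VrE (gauss n) mf fK) => h; apply: le_trans h _.
rewrite mulrDr mulrCA e2 mulr1 (_ : N.+1%:R*(D*e^+3) = N.+1%:R*e^+2*(D*e)); last by ring.
by rewrite e2 mul1r lerD2l.
Qed.

End gaussian_clt.

Ltac measurable_rule ::= first [ apply: msr_vlin | apply: msr_shift | apply: msr_scl | apply: msr_translate ].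

(** * Smoothed sign changes and their normal approximation *)

Section smooth_sign_changes.
Variables (R : realType) (N m : nat) (u v : 'I_m -> 'I_N -> R) (kap B : R).
Notation tp := (N.-tuple R).
Hypotheses (kap0 : 0 <= kap) (B0 : 0 <= B).
Hypotheses (u1 : forall i, \sum_j u i j^+2 <= 1) (v1 : forall i, \sum_j v i j^+2 <= 1).
Hypothesis bu : forall a : 'I_N -> R, \sum_i (\sum_j u i j*a j)^+2 <= B*\sum_j a j^+2.
Hypothesis bv : forall a : 'I_N -> R, \sum_i (\sum_j v i j*a j)^+2 <= B*\sum_j a j^+2.

Let psi (x : R) : R := sigm (kap*x).
Let dpsi (x : R) : R := dsigm (kap*x)*kap.
Let ddpsi (x : R) : R := ddsigm (kap*x)*kap*kap.

Let der_scaled (f df : R -> R) (x : R) : (forall x, der f x (df x)) ->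
 der (fun t => f (kap * t)) x (df (kap*x)*kap).
move=> h; apply: der_eq; first by apply: der_comp; [apply: der_scale; exact: der_id|exact: h].
by rewrite mulr1.
Qed.

Let der_scaledM (f df : R -> R) (c x : R) : (forall x, der f x (df x)) ->
 der (fun t => f (kap * t)*c) x (df (kap*x)*kap*c).
move=> h; rewrite (_ : (fun t => _) = fun t => c*f (kap * t)); last by apply/funext => t; rewrite mulrC.
by apply: der_eq; [apply: der_scale; exact: der_scaled h|rewrite mulrC].
Qed.

Let dpsi_der x : der psi x (dpsi x). exact: der_scaled (@der_sigm R). Qed.
Let ddpsi_der x : der dpsi x (ddpsi x). exact: der_scaledM (@der_dsigm R). Qed.

Let psi1 x : `|psi x| <= 1. exact: sigm_norm. Qed.

Let le_half_scale (a c : R) : `|a| <= 2^-1 -> 0 <= c -> `|a*c| <= c.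
move=> h c0; rewrite normrM (ger0_norm c0) ler_piMl//; apply: le_trans h _.
by rewrite invf_le1// ler1n.
Qed.

Let dpsi_norm x : `|dpsi x| <= kap.
exact: le_half_scale (dsigm_norm _) kap0. Qed.

Let k20 : 0 <= kap^+2. exact: sqr_ge0. Qed.
Let k30 : 0 <= kap^+3. exact: exprn_ge0. Qed.

Let ddpsi_norm x : `|ddpsi x| <= kap^+2.
rewrite /ddpsi -mulrA -expr2; exact: le_half_scale (ddsigm_norm _) k20. Qed.

Let psi_lip a b : `|psi b-psi a| <= kap * `|b-a|.
exact: (taylor1_norm dpsi_der dpsi_norm). Qed.

Let dpsi_lip a b : `|dpsi b-dpsi a| <= kap^+2 * `|b-a|.
exact: (taylor1_norm ddpsi_der ddpsi_norm). Qed.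

Let psi_taylor a b : `|psi b-psi a-dpsi a*(b-a)| <= kap^+2*(b-a)^+2.
exact: (taylor2_norm dpsi_der ddpsi_der ddpsi_norm). Qed.

Let dpsi_taylor a b : `|dpsi b-dpsi a-ddpsi a*(b-a)| <= kap^+3*(b-a)^+2.
apply: (@taylor2_norm _ _ _ (fun x => dddsigm (kap*x)*kap*kap*kap)) => [x|x|x].
- by [].
- rewrite (_ : ddpsi = fun t => ddsigm (kap * t)*(kap*kap)); last by apply/funext => t; rewrite mulrA.
 by apply: der_eq; [exact: der_scaledM (@der_ddsigm R)|rewrite mulrA].
- rewrite -!mulrA -expr2 -exprS normrM (ger0_norm k30) ler_piMl//; exact: dddsigm_norm.
Qed.

Let mpsi : msr psi. exact: (der_meas dpsi_der). Qed.
Let mdpsi : msr dpsi. exact: (der_meas ddpsi_der). Qed.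
Let mddpsi : msr ddpsi.
rewrite (_ : ddpsi = fun t => ddsigm (kap * t)*(kap*kap)); last by apply/funext => t; rewrite mulrA.
exact: (der_meas (fun x => der_scaledM _ _ (@der_ddsigm R))).
Qed.

Definition pairU (l : 'I_(m+m)) : 'I_N -> R :=
 match fintype.split l with inl i => u i | inr i => v i end.

Let pairUl i : pairU (lshift m i) = u i.
by rewrite /pairU; case: splitP => [j|k] /= E; [congr u; exact: val_inj|have := ltn_ord i; rewrite E; lia]. Qed.
Let pairUr i : pairU (rshift m i) = v i.
rewrite /pairU; case: splitP => [j|k] /= E; first by have := ltn_ord j; rewrite -E; lia.
by congr v; apply: val_inj; apply/eqP; rewrite -(eqn_add2l m) E.
Qed.

Let a_ i (y : tp) := dot (u i) y.
Let b_ i (y : tp) := dot (v i) y.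

Definition pairxi (l : 'I_(m+m)) (y : tp) : R :=
 match fintype.split l with
 | inl i => - 2^-1*(dpsi (a_ i y) * psi (b_ i y))
 | inr i => - 2^-1*(psi (a_ i y) * dpsi (b_ i y))
 end.

Let pairxil i : pairxi (lshift m i) = fun y => - 2^-1*(dpsi (a_ i y) * psi (b_ i y)).
by apply/funext => y; rewrite /pairxi; case: splitP => [j|k] /= E; [rewrite (_ : j = i)//; exact: val_inj|have := ltn_ord i; rewrite E; lia].
Qed.
Let pairxir i : pairxi (rshift m i) = fun y => - 2^-1*(psi (a_ i y) * dpsi (b_ i y)).
apply/funext => y; rewrite /pairxi; case: splitP => [j|k] /= E; first by have := ltn_ord j; rewrite -E; lia.
by rewrite (_ : k = i)//; apply: val_inj; apply/eqP; rewrite -(eqn_add2l m) E.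
Qed.

Definition smooth_changes (y : tp) : R := \sum_i scT kap (a_ i y) (b_ i y).

Let dotnsq i (h : tp) : a_ i h^+2 <= nsq h /\ b_ i h^+2 <= nsq h.
have h0 := nsq_ge0 h.
by split; (apply: le_trans (dot_CS _ _) _); rewrite ler_piMl.
Qed.

Let pair_taylor a b al be :
 `|psi (a+al) * psi (b+be)-psi a * psi b-(dpsi a * psi b*al+psi a * dpsi b*be)| <=
 2*kap^+2*(al^+2+be^+2).
have h1 := psi_taylor a (a+al); have h2 := psi_taylor b (b+be).
have h3 := psi_lip a (a+al); have h4 := psi_lip b (b+be).
rewrite (_ : a+al-a = al) in h1 h3; last by ring.
rewrite (_ : b+be-b = be) in h2 h4; last by ring.
set A := psi (a+al) in h1 h3 *; set A' := psi a in h1 h3 *.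
set C := psi (b+be) in h2 h4 *; set C' := psi b in h2 h4 *.
rewrite (_ : _-_-_ = C'*(A-A'-dpsi a*al)+A'*(C-C'-dpsi b*be)+(A-A')*(C-C')); last by ring.
have t1 : `|C'*(A-A'-dpsi a*al)| <= kap^+2*al^+2 by rewrite normrM; apply: le_trans h1; rewrite ler_piMl// /C'.
have t2 : `|A'*(C-C'-dpsi b*be)| <= kap^+2*be^+2 by rewrite normrM; apply: le_trans h2; rewrite ler_piMl// /A'.
have t3 : `|(A-A')*(C-C')| <= kap^+2*(al^+2+be^+2).
 rewrite normrM; apply: (le_via (kap * `|al|*(kap * `|be|))); first exact: ler_pM.
 rewrite (_ : kap * `|al|*_ = kap^+2*(`|al| * `|be|)); last by ring.
 apply: ler_wpM2l => //; rewrite -(sqr_normr al) -(sqr_normr be).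
 have := sqr_ge0 (`|al| - `|be|); have := sqr_ge0 (`|al| + `|be|); lra.
apply: ler_normD_via; have := ler_normD (C'*(A-A'-dpsi a*al)) (A'*(C-C'-dpsi b*be)).
by move: t1 t2 t3; move: (`|_+_|) (`|_*_|) (`|_*_|) (`|_*_|) => *; lra.
Qed.

Definition pairK : R := m%:R+kap+m%:R*(2*kap^+2).

Let sum_pair (y : tp) (c : 'I_(m+m) -> R) : \sum_l pairxi l y*c l =
 \sum_i-2^-1*(dpsi (a_ i y) * psi (b_ i y)*c (lshift m i)+psi (a_ i y) * dpsi (b_ i y)*c (rshift m i)).
by rewrite sum_split2; apply: eq_bigr => i _; rewrite pairxil pairxir; ring. Qed.

Let mdot (w : 'I_N -> R) (phi : R -> R) : msr phi -> msr (fun y : tp => phi (dot w y)).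
by []. Qed.

Let mxi l : msr (pairxi l).
by rewrite /pairxi; case: (fintype.split l) => i; (apply: measurable_funM; first exact: measurable_cst); apply: measurable_funM; exact: mdot.
Qed.

Let xi_norm l y : `|pairxi l y| <= kap.
have h a b : `|a| <= kap -> `|b| <= 1 -> `|- 2^-1*(a*b)| <= kap.
 move=> ha hb; rewrite mulNr normrN normrM ger0_norm ?invr_ge0//.
 have : `|a*b| <= kap by rewrite normrM -[kap]mulr1; apply: ler_pM.
 by have := normr_ge0 (a*b); lra.
rewrite /pairxi; case: (fintype.split l) => i; first exact: h.
by rewrite [psi _*_]mulrC; exact: h.
Qed.

Lemma C11_smooth_changes : C11 pairU smooth_changes pairxi pairK.
split.
- apply: measurable_sum => i; apply: measurable_funM; last exact: measurable_cst.
 apply: measurable_funB; first exact: measurable_cst.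
 by apply: measurable_funM; [exact: (mdot (u i) mpsi)|exact: (mdot (v i) mpsi)].
- by [].
- move=> y; apply: (le_via m%:R); last by rewrite /pairK -addrA lerDl addr_ge0// mulr_ge0// mulr_ge0.
 rewrite -[m%:R]mulr1 -[X in X%:R]card_ord -sum1_card natr_sum mulr_suml.
 apply: le_trans (ler_norm_sum _ _ _) _; apply: ler_sum => i _; rewrite mulr1.
 have h : `|psi (a_ i y) * psi (b_ i y)| <= 1 by rewrite normrM -[1]mulr1; apply: ler_pM.
 move: h; rewrite /scT -/(psi _) -/(psi _) !ler_norml => /andP[h1 h2]; move: h1 h2.
 by move: (psi _ * psi _) => p *; apply/andP; split; lra.
- move=> l y; apply: le_trans (xi_norm l y) _.
 by rewrite /pairK addrAC lerDr addr_ge0// mulr_ge0 mulr_ge0.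
- move=> y h; rewrite sum_pair /smooth_changes -!sumrB.
 have h0 := nsq_ge0 h.
 apply: (le_via (\sum_(i < m) 2*kap^+2*nsq h)); last first.
  rewrite sumr_const card_ord -(mulr_natl _ m) mulrA; apply: ler_wpM2r => //.
  by rewrite /pairK lerDr addr_ge0.
 apply: le_trans (ler_norm_sum _ _ _) _; apply: ler_sum => i _.
 rewrite pairUl pairUr /a_ /b_ !dot_vlin !mul1r -/(a_ i y) -/(b_ i y) -/(a_ i h) -/(b_ i h).
 have := pair_taylor (a_ i y) (b_ i y) (a_ i h) (b_ i h).
 rewrite /scT -/(psi _) -/(psi _) -/(psi _) -/(psi _).
 have [d1 d2] := dotnsq i h.
 set A := psi _ * psi _; set A' := psi _ * psi _; set D := dpsi _*_*_+_.
 rewrite (_ : (1-A)/2-(1-A')/2 - - 2^-1*D = - 2^-1*(A-A'-D)); last by field.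
 rewrite mulNr normrN normrM (ger0_norm (_ : 0 <= 2^-1)) ?invr_ge0// => t.
 have := ler_wpM2l (_ : 0 <= 2*kap^+2) (lerD d1 d2) => /(_ (mulr_ge0 (ler0n _ _) k20)).
 by move=> h1; have := le_trans t h1; rewrite mulrDr; move: (`|A-A'-D|) (2*kap^+2*nsq h) => *; lra.
Qed.

Let gsm_psi l : gsm pairU (fun y => psi (dot (pairU l) y)).
exact: gsm_sigm. Qed.

Let gsm_dpsi l : gsm pairU (fun y => dpsi (dot (pairU l) y)).
apply: (@gsm_dot R N _ pairU l dpsi ddpsi (kap+kap^+2+kap^+3)) => //.
- by move=> x; apply: le_trans (dpsi_norm x) _; rewrite -addrA lerDl addr_ge0.
- by move=> x; apply: le_trans (ddpsi_norm x) _; rewrite addrAC lerDr addr_ge0.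
- by move=> a b; apply: le_trans (dpsi_taylor a b) _; apply: ler_wpM2r; [exact: sqr_ge0|rewrite lerDr addr_ge0].
Qed.

Lemma gsm_pairxi l : gsm pairU (pairxi l).
have e i : dot (u i) = dot (pairU (lshift m i)) by rewrite pairUl.
have e' i : dot (v i) = dot (pairU (rshift m i)) by rewrite pairUr.
rewrite -(splitK l); case: (fintype.split l) => i /=.
 by rewrite pairxil; apply: gsm_scale; apply: gsm_mul; rewrite /a_ /b_ ?e ?e'.
by rewrite pairxir; apply: gsm_scale; apply: gsm_mul; rewrite /a_ /b_ ?e ?e'.
Qed.

Let weighted (w p : 'I_m -> R) (a : 'I_N -> R) (W : R) : 0 <= W ->
 \sum_i p i^+2 <= B*\sum_j a j^+2 -> \sum_i w i^+2 <= W^+2 ->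
 `|\sum_i w i * p i| <= W*Num.sqrt B*nrm a.
move=> W0 hp hw; have a0 : 0 <= \sum_j a j^+2 by apply: sumr_ge0 => j _; exact: sqr_ge0.
have r0 : 0 <= W*Num.sqrt B*nrm a by [].
rewrite -(@ler_pXn2r _ 2)// sqr_normr//; apply: le_trans (sum_CS _ _) _.
rewrite !exprMn /nrm !sqr_sqrtr// -mulrA; apply: ler_pM => //; apply: sumr_ge0 => i _; exact: sqr_ge0.
Qed.

Lemma pairxi_bound y (a : 'I_N -> R) :
 `|\sum_l pairxi l y*(\sum_j pairU l j*a j)| <= kap*Num.sqrt m%:R*Num.sqrt B*nrm a.
rewrite sum_pair.
have W0 : 0 <= kap*Num.sqrt m%:R by [].
have bnd (w : 'I_m -> R) : bdd w kap -> \sum_i w i^+2 <= (kap*Num.sqrt m%:R)^+2.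
 move=> h; rewrite exprMn sqr_sqrtr// mulrC -[X in X%:R]card_ord -sum1_card natr_sum mulr_suml.
 apply: ler_sum => i _; rewrite mul1r -(sqr_normr (w i)); apply: lerXn2r; rewrite ?nnegrE//; exact: h.
have t1 := weighted W0 (bu a) (bnd (fun i => dpsi (a_ i y) * psi (b_ i y)) _).
have t2 := weighted W0 (bv a) (bnd (fun i => psi (a_ i y) * dpsi (b_ i y)) _).
have /t1 {}t1 : forall i, `|dpsi (a_ i y) * psi (b_ i y)| <= kap.
 by move=> i; rewrite normrM -[kap]mulr1; apply: ler_pM.
have /t2 {}t2 : forall i, `|psi (a_ i y) * dpsi (b_ i y)| <= kap.
 by move=> i; rewrite normrM -[kap]mul1r; apply: ler_pM.
rewrite -mulr_sumr mulNr normrN normrM (ger0_norm (_ : 0 <= 2^-1)) ?invr_ge0// big_split/=.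
under eq_bigr do rewrite pairUl; under [X in _+X]eq_bigr do rewrite pairUr.
have := ler_normD (\sum_i dpsi (a_ i y) * psi (b_ i y)*(\sum_j u i j*a j))
 (\sum_i psi (a_ i y) * dpsi (b_ i y)*(\sum_j v i j*a j)).
by move: t1 t2; move: (`|_|) (`|_|) (`|_|) (_*nrm a) => *; lra.
Qed.

Lemma pairxi_lipschitz y h (a : 'I_N -> R) :
 `|\sum_l (pairxi l (vlin 1 y 1 h)-pairxi l y)*(\sum_j pairU l j*a j)| <=
 2*kap^+2*B*Num.sqrt (nsq h)*nrm a.
set y' := vlin 1 y 1 h; have h0 := nsq_ge0 h.
have da i : a_ i y'-a_ i y = a_ i h by rewrite /a_ dot_vlin; ring.
have db i : b_ i y'-b_ i y = b_ i h by rewrite /b_ dot_vlin; ring.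
pose w1 i := dpsi (a_ i y') * psi (b_ i y')-dpsi (a_ i y) * psi (b_ i y).
pose w2 i := psi (a_ i y') * dpsi (b_ i y')-psi (a_ i y) * dpsi (b_ i y).
have -> : \sum_l (pairxi l y'-pairxi l y)*(\sum_j pairU l j*a j) =
  - 2^-1*(\sum_i w1 i*(\sum_j u i j*a j)+\sum_i w2 i*(\sum_j v i j*a j)).
 rewrite sum_split2 -big_split mulr_sumr/=; apply: eq_bigr => i _.
 by rewrite !pairxil !pairxir pairUl pairUr /w1 /w2; ring.
pose W := 2*kap^+2*Num.sqrt B*Num.sqrt (nsq h).
have W0 : 0 <= W by [].
have sqW (w : 'I_m -> R) : (forall i, `|w i| <= kap^+2*(`|a_ i h| + `|b_ i h|)) -> \sum_i w i^+2 <= W^+2.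
 move=> hw; rewrite /W 2!exprMn !sqr_sqrtr//.
 apply: (le_via (\sum_i 2*(kap^+2)^+2*(a_ i h^+2+b_ i h^+2))).
  apply: ler_sum => i _; rewrite -(sqr_normr (w i)).
  apply: (le_via ((kap^+2*(`|a_ i h| + `|b_ i h|))^+2)).
   exact: lerXn2r.
  rewrite exprMn (mulrC 2) -(mulrA _ 2); apply: ler_wpM2l => //.
  rewrite -(sqr_normr (a_ i h)) -(sqr_normr (b_ i h)).
  by have := sqr_ge0 (`|a_ i h| - `|b_ i h|); lra.
 rewrite -mulr_sumr big_split/=.
 have := bu (fun j => tnth h j); have := bv (fun j => tnth h j); rewrite -/(nsq h) => h1 h2.
 have := ler_wpM2l (_ : 0 <= 2*(kap^+2)^+2) (lerD h2 h1).
 rewrite mulr_ge0 ?sqr_ge0// => /(_ isT) h3; apply: le_trans h3 _.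
 by apply: eq_ler; ring.
have wb (x x' z z' p q : R) : `|x| <= kap -> `|z'| <= 1 -> `|x-x'| <= kap^+2 * p -> `|z-z'| <= kap*q ->
  `|x*z-x'*z'| <= kap^+2*(p+q).
 move=> hx hz h1 h2; rewrite (_ : _-_ = (x-x')*z'+x*(z-z')); last by ring.
 apply: ler_normD_via; rewrite !normrM mulrDr; apply: lerD.
  by apply: le_trans h1; rewrite ler_piMr.
 by rewrite expr2 -mulrA; apply: ler_pM.
have t1 : `|\sum_i w1 i*(\sum_j u i j*a j)| <= W*Num.sqrt B*nrm a.
 apply: weighted => //; apply: sqW => i; apply: wb => //.
  by have := dpsi_lip (a_ i y) (a_ i y'); rewrite da.
 by have := psi_lip (b_ i y) (b_ i y'); rewrite db.
have t2 : `|\sum_i w2 i*(\sum_j v i j*a j)| <= W*Num.sqrt B*nrm a.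
 apply: weighted => //; apply: sqW => i; rewrite /w2 (mulrC (psi _)) (mulrC (psi (a_ i y))) [`|a_ i h| + _]addrC.
 apply: wb => //.
  by have := dpsi_lip (b_ i y) (b_ i y'); rewrite db.
 by have := psi_lip (a_ i y) (a_ i y'); rewrite da.
rewrite (_ : 2*kap^+2*B*Num.sqrt (nsq h)*nrm a = W*Num.sqrt B*nrm a); last first.
 by rewrite /W -{1}(sqr_sqrtr B0); ring.
rewrite mulNr normrN normrM (ger0_norm (_ : 0 <= 2^-1)) ?invr_ge0//.
have := ler_normD (\sum_i w1 i*(\sum_j u i j*a j)) (\sum_i w2 i*(\sum_j v i j*a j)).
by move: t1 t2; move: (`|_|) (`|_|) (`|_|) (_*nrm a) => *; lra.
Qed.

(** The gradient is bounded by L = kap sqrt(m B) and Lipschitz with constant H = 2 kap^2 B, B being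
    the Bessel constant of the vectors. L grows like sqrt m and H does not grow, so lam^2 H L is
    small for lam of order 1/sqrt m. *)
Lemma smooth_changes_clt (lam th : R) :
 `|EG N (fun x => cos (lam*smooth_changes x+th)) -
  expR (- (lam^+2*Vr (gauss N) smooth_changes/2))*cos (lam*EG N smooth_changes+th)| <=
 lam^+2*(2*kap^+2*B)*(kap*Num.sqrt m%:R*Num.sqrt B).
have K0 : 0 <= pairK by [].
have L0 : 0 <= kap*Num.sqrt m%:R*Num.sqrt B by [].
have H0 : 0 <= 2*kap^+2*B by [].
apply: (@gaussian_clt R N _ pairU pairK _ _ K0 L0 H0).
exists pairxi; split.
- exact: C11_smooth_changes.
- exact: gsm_pairxi.
- exact: pairxi_bound.
- exact: pairxi_lipschitz.
Qed.

End smooth_sign_changes.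

(** * Approximation of the zeros by a smoothed count, uniformly in n *)

Section smoothed_counts.
Variables (R : realType) (n : nat).
Hypothesis n4 : (4 <= n)%N.
Notation tp := ((n+n).-tuple R).
Notation G := (gauss (R := R) (n+n)).
Notation hx := (@hx R n).
Let n0 : (0 < n)%N. by lia. Qed.

(** The dual form of [mesh_upper]: the left side S is the scalar product of a with a combination of
    the vectors whose squared norm is at most Q S, so S^2 <= Q S |a|^2. *)
Lemma mesh_bessel Q' (c : R) (a : 'I_(n+n) -> R) :
 \sum_(i < n*Q'.+1) (\sum_j trig (@wunit R n) (cpt R (n*Q'.+1) i+c) j*a j)^+2 <=
 Q'.+1%:R*\sum_j a j^+2.
set Q := Q'.+1.
pose t (q : 'I_Q) : R := pi *+ 2*(q%:R/(n*Q)%:R)+c.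
pose p (s : R) := \sum_j trig (@wunit R n) s j*a j.
have E (q : 'I_Q) (j : 'I_n) : cpt R (n*Q) (j*Q+q)+c = mesh (t q) j.
 rewrite /mesh /t /cpt natrD !natrM; field.
 by rewrite !pnatr_eq0 -!lt0n n0.
rewrite (sum_grid n Q (fun i => p (cpt R (n*Q) i+c)^+2)).
under eq_bigr => q _ do under eq_bigr => j _ do rewrite E.
set S := \sum_q _; set A := \sum_j a j^+2.
have A0 : 0 <= A by [].
have S0 : 0 <= S by [].
have := mesh_upper t (fun q j => p (mesh (t q) j)) n0; rewrite -/S.
set V := \sum_i _ => hV.
have SE : S = \sum_i (\sum_q \sum_(j < n) p (mesh (t q) j) * trig (@wunit R n) (mesh (t q) j) i)*a i.
 rewrite /S; under [RHS]eq_bigr do rewrite mulr_suml.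
 rewrite [RHS]exchange_big/=; apply: eq_bigr => q _; under [RHS]eq_bigr do rewrite mulr_suml.
 rewrite [RHS]exchange_big/=; apply: eq_bigr => j _.
 by rewrite expr2 {2}/p mulr_sumr; apply: eq_bigr => i _; rewrite mulrA.
have h : S^+2 <= (Q%:R*S)*A by rewrite {1}SE; apply: le_trans (sum_CS _ _) _; apply: ler_wpM2r.
have [->|Sn0] := eqVneq S 0 => //.
have Sp : 0 < S by rewrite lt_neqAle eq_sym Sn0.
by rewrite -(ler_pM2r Sp) -expr2 mulrAC.
Qed.

Definition TT (Q' : nat) (kap : R) : tp -> R := csum Q' (fun a _ c => scT kap a c).

Lemma TT_clt Q' (kap lam th : R) : 0 <= kap ->
 `|Ex G (fun x => cos (lam*TT Q' kap x+th)) -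
  expR (- (lam^+2*Vr G (TT Q' kap)/2))*cos (lam*Ex G (TT Q' kap)+th)| <=
 lam^+2*(2*kap^+2*Q'.+1%:R)*(kap*Num.sqrt (n*Q'.+1)%:R*Num.sqrt Q'.+1%:R).
move=> kap0; set m := (n*Q'.+1)%N.
pose u (i : 'I_m) := trig (@wunit R n) (cpt R m i).
pose v (i : 'I_m) := trig (@wunit R n) (cpt R m i+2*(pi/m%:R)).
have u1 i : \sum_j u i j^+2 <= 1 by rewrite trig_unit.
have v1 i : \sum_j v i j^+2 <= 1 by rewrite trig_unit.
have bu a : \sum_i (\sum_j u i j*a j)^+2 <= Q'.+1%:R*\sum_j a j^+2.
 apply: le_trans (mesh_bessel Q' 0 a); apply: eq_ler.
 by apply: eq_bigr => i _; rewrite addr0.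
have bv a : \sum_i (\sum_j v i j*a j)^+2 <= Q'.+1%:R*\sum_j a j^+2.
 exact: mesh_bessel.
exact: (smooth_changes_clt kap0 (ler0n R Q'.+1) u1 v1 bu bv lam th).
Qed.

Lemma TT_meas Q' kap : msr (TT Q' kap).
apply: measurable_sum => i; apply: measurable_funM; last exact: measurable_cst.
apply: measurable_funB; first exact: measurable_cst.
by apply: measurable_funM; (apply: (measurableT_comp (@msr_sigm R)); apply: measurable_funM; [exact: measurable_cst|exact: msr_dot]).
Qed.

Lemma scT_norm (kap a c : R) : `|scT kap a c| <= 1.
have : `|sigm (kap*a)*sigm (kap*c)| <= 1 by rewrite normrM -[1]mulr1; apply: ler_pM => //; exact: sigm_norm.
rewrite /scT; move: (_*sigm _) => z; rewrite !ler_norml => /andP[h1 h2].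
by apply/andP; split; lra.
Qed.

Lemma TT_bound Q' kap x : `|TT Q' kap x| <= (n*Q'.+1)%:R.
rewrite -[leRHS]mulr1 -[X in X%:R]card_ord -sum1_card natr_sum mulr_suml.
apply: le_trans (ler_norm_sum _ _ _) _; apply: ler_sum => i _; rewrite mulr1; exact: scT_norm.
Qed.

(** For |y| <= 1/r the bump term exceeds the trivial bound 4. Beyond, the argument of the sigmoid
    has size at least r and [sigm_sgr] gives an error at most 2/r. *)
Lemma sigm_sgr_bump (r y : R) : 1 <= r ->
 (sigm (r^+3*y)-sgr y)^+2 <= 4*(expR 1*bump r^-1 y)+4/r.
move=> r1; have r0 : 0 < r by exact: lt_le_trans r1.
have eb : 0 <= expR 1*bump r^-1 y by [].
have ri : 0 <= 4/r by [].
have [yr|ry] := leP `|y| r^-1.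
 have : 1 <= expR 1*bump r^-1 y.
  rewrite leNgt; apply/negP => h; have ri0 : 0 < r^-1 by rewrite invr_gt0.
  by have := bump_lt1 ri0 h; rewrite ltNge yr.
 have : (sigm (r^+3*y)-sgr y)^+2 <= 4.
  rewrite (_ : 4 = 2^+2); last by ring.
  rewrite -(sqr_normr (_-_)); apply: lerXn2r; rewrite ?nnegrE//.
  by apply: ler_normB_via; rewrite sgr_norm; have := sigm_norm (r^+3*y); lra.
 by lra.
have r30 : 0 < r^+3 by [].
have yp : 0 < `|y| by apply: lt_trans ry.
have y0 : r^+3*y != 0 by apply: mulf_neq0; [rewrite gt_eqF|rewrite normr_gt0 in yp].
have := sigm_sgr y0; rewrite (sgr_pmul y r30) => h.
apply: (le_via (4/r)); last by rewrite lerDr mulr_ge0.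
have h2 : `|sigm (r^+3*y)-sgr y| <= 2/r.
 apply: le_trans h _; rewrite normrM (gtr0_norm r30) ler_pM2l// lef_pV2 ?mulr_gt0//.
 have : r^+3*r^-1 <= r^+3 * `|y| by rewrite ler_pM2l// ltW.
 apply: le_trans; rewrite exprSr -mulrA divff ?gt_eqF// mulr1 expr2.
 by rewrite ler_peMl// ltW.
rewrite -(sqr_normr (_-_)); apply: (le_via ((2/r)^+2)).
 exact: lerXn2r.
rewrite expr_div_n (_ : 2^+2 = 4 :> R); last by ring.
by apply: ler_wpM2l => //; rewrite lef_pV2 ?exprn_gt0// expr2 ler_peMl// ltW.
Qed.

Definition vcst : R := 4*expR 1+4.

(** The difference of products is split as (z1 - s1) z2 + s1 (z2 - s2), so that signs are replaced
    by sigmoids at one point at a time. *)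
Lemma smoothing_error Q' (r : R) i : 1 <= r ->
 Ex G (fun x => cell_fun Q' (fun a _ c => scf a c-scT (r^+3) a c) i x^+2) <= vcst/r.
move=> r1; have r0 : 0 < r by exact: lt_le_trans r1.
set t1 := cpt R (n*Q'.+1) i; set t2 := t1+2*(pi/(n*Q'.+1)%:R).
pose g t x := 4*(expR 1*bump r^-1 (hx t x))+4/r.
have mb t : msr (fun x => bump r^-1 (hx t x)) by [].
have Ib t : intg G (fun x => bump r^-1 (hx t x)) by apply: (intg_bnd 1) => // x; exact: bump_norm.
have Ieb t : intg G (fun x => 4*(expR 1*bump r^-1 (hx t x))) by apply: intgZ; exact: intgZ.
have Ig t : intg G (g t) by apply: intgD => //; exact: intg_cst.
have Eg t : Ex G (g t) <= vcst/r.
 rewrite /g ExD//; last exact: intg_cst.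
 rewrite ExZ; last exact: intgZ.
 rewrite ExZ// Ex_cst /vcst (mulrDl (4*_)); apply: lerD => //; rewrite -[leRHS]mulrA; apply: ler_wpM2l => //.
 by apply: ler_wpM2l; [exact: expR_ge0|apply: E_bump; rewrite ?invr_gt0].
have mc : msr (cell_fun Q' (fun a _ c => scf a c-scT (r^+3) a c) i : tp -> R).
 have mh (t : R) := msr_hx (n := n) t.
 apply: measurable_funB; (apply: measurable_funM; last exact: measurable_cst);
  (apply: measurable_funB; first exact: measurable_cst); apply: measurable_funM.
 - by [].
 - by [].
 - by [].
 - by [].
have pw x : cell_fun Q' (fun a _ c => scf a c-scT (r^+3) a c) i x^+2 <= 2^-1 * g t1 x+2^-1 * g t2 x.
 rewrite /cell_fun -/t1 -/t2 /scf /scT.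
 have h1 := sigm_sgr_bump (hx t1 x) r1; have h2 := sigm_sgr_bump (hx t2 x) r1.
 rewrite -/(g t1 x) in h1; rewrite -/(g t2 x) in h2.
 have := sgr_norm (hx t1 x); have := sigm_norm (r^+3*hx t2 x).
 move: h1 h2; move: (g t1 x) (g t2 x) => g1 g2.
 move: (sgr (hx t1 x)) (sgr (hx t2 x)) (sigm (_*hx t1 x)) (sigm (_*hx t2 x)) => s1 s2 z1 z2 h1 h2 hz2 hs1.
 rewrite (_ : _-_ = 2^-1*((z1-s1)*z2+s1*(z2-s2))); last by field.
 have e1 : ((z1-s1)*z2)^+2 <= g1.
  rewrite exprMn; apply: le_trans h1; rewrite ler_piMr ?sqr_ge0//.
  by rewrite -(sqr_normr z2) exprn_ile1.
 have e2 : (s1*(z2-s2))^+2 <= g2.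
  rewrite exprMn; apply: le_trans h2; rewrite ler_piMl ?sqr_ge0//.
  by rewrite -(sqr_normr s1) hs1 expr1n.
 move: e1 e2; move: ((z1-s1)*z2) (s1*(z2-s2)) => p q e1 e2.
 by rewrite exprMn; have := sqr_ge0 (p-q); lra.
apply: le_trans (ler_norm _) _.
have := @Ex_abs_le _ _ _ G _ (fun x => 2^-1 * g t1 x+2^-1 * g t2 x) (measurable_funX 2 mc).
rewrite ExD ?ExZ//; try exact: intgZ.
move=> /(_ (intgD (intgZ _ (Ig t1)) (intgZ _ (Ig t2)))) h.
apply: le_trans (h _) _; first by move=> x; rewrite ger0_norm ?sqr_ge0//; exact: pw.
by move: (Eg t1) (Eg t2); move: (Ex G (g t1)) (Ex G (g t2)) (vcst/r) => e1 e2 w h1 h2; clear -h1 h2; lra.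
Qed.

Lemma NN_TT_var Q' (r : R) : (4 <= Q'.+1)%N -> 1 <= r ->
 Vr G (fun x => NN (n*Q'.+1) x-TT Q' (r^+3) x) <= 8640*n%:R*Q'.+1%:R^+2*(vcst/r).
move=> Q4 r1; apply: le_trans (diff_var n4 Q4 (fun i => smoothing_error Q' i r1)).
apply: eq_ler; apply: Vr_eq => x.
by rewrite NN_csum /TT /csum -sumrB.
Qed.

End smoothed_counts.

(** The level Q is chosen first, to make the missed pairs of sign changes negligible, then the
    sharpness r^3 for that Q; neither depends on n. *)
Lemma smooth_approximation (R : realType) (eps : R) : 0 < eps -> exists Q' kap, 0 <= kap /\
 forall n, (4 <= n)%N -> Vr (gauss (n+n)) (fun x => @ZZ R n x-TT Q' kap x) <= eps*n%:R.
move=> e0; have [j hj] : exists j, 2*(2160*4096)/2^+j <= eps/2.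
 pose j := Num.truncn (4*(2160*4096)/eps); exists j.
 have h : 4*(2160*4096)/eps <= 2^+j by apply: le_trans (ltW (truncnS_gt _)) _; rewrite -/j -natrX ler_nat; exact: ltn_expl.
 have p : 0 < 2^+j :> R by [].
 rewrite ler_pdivrMr; move: h; rewrite ler_pdivrMr// => h.
 by rewrite mulrAC; move: h; rewrite (mulrC (2^+j)); clear; move: (eps*_) => *; lra.
pose Q := (Qd j).+1; pose A : R := 2*(8640*Q%:R^+2*vcst R).
have v0 : 0 <= vcst R by [].
have A0 : 0 <= A by [].
pose r : R := 1+2*A/eps.
have r1 : 1 <= r by rewrite /r lerDl.
have r0 : 0 < r by [].
exists (Qd j), (r^+3); split => //.
move=> n n4.
have Q4 : (4 <= Q)%N by apply: leq_trans (Qd8 j).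
have h1 := ZZ_level_var R n4 j; have h2 := NN_TT_var n4 Q4 r1.
have nR : 0 <= n%:R :> R by [].
rewrite (@Vr_eq _ _ _ _ _ (fun x => (@ZZ R n x-NN (n*Q) x)+(NN (n*Q) x-TT (Qd j) (r^+3) x))); last first.
 by move=> x; ring.
have mZ := @ZZ_meas R n n4; have mN := @NN_meas R n (n*Q); have mT := @TT_meas R n (Qd j) (r^+3).
pose M : R := n.*2%:R+(n*Q)%:R+(n*Q)%:R.
apply: (le_via ((1+1)*Vr (gauss (n+n)) (fun x => @ZZ R n x-NN (n*Q) x) +
 (1+1^-1)*Vr (gauss (n+n)) (fun x => NN (n*Q) x-TT (Qd j) (r^+3) x))).
 apply: (@VrD_le _ _ _ _ _ _ M) => //; try exact: measurable_funB.
  by move=> x; apply: ler_normB_via; rewrite /M -addrA; apply: lerD; [exact: ZZ_norm|apply: le_trans (NN_bound _ _) _; rewrite lerDl].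
 by move=> x; apply: ler_normB_via; rewrite /M -addrA; apply: (le_via ((n*Q)%:R+(n*Q)%:R)); [apply: lerD; [exact: NN_bound|exact: TT_bound]|rewrite lerDr].
rewrite invr1.
have k1 : (1+1)*(2160*4096*n%:R/2^+j) <= eps/2*n%:R.
 rewrite (_ : (1+1)*_ = 2*(2160*4096)/2^+j*n%:R); first exact: ler_wpM2r.
 by move: (2^+j)^-1 => p; ring.
have k2 : (1+1)*(8640*n%:R*Q%:R^+2*(vcst R/r)) <= eps/2*n%:R.
 rewrite (_ : (1+1)*_ = A/r*n%:R); last by rewrite /A; move: r^-1 => p; ring.
 apply: ler_wpM2r => //; rewrite ler_pdivrMr// /r mulrDr.
 rewrite (_ : eps/2*(2*A/eps) = A); last by field; rewrite gt_eqF.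
 by rewrite lerDr mulr1 divr_ge0// ltW.
apply: le_trans (lerD (ler_wpM2l _ h1) (ler_wpM2l _ h2)) _ => //.
by apply: le_trans (lerD k1 k2) _; rewrite -mulrDl -splitr.
Qed.

Ltac measurable_leaf9 := first [ measurable_leaf8 | exact: TT_meas ].
Ltac measurable_leaf ::= measurable_leaf9.

(** * Central limit theorem tested on cosines *)

Section cosine_limit.

Lemma cos_lipschitz (R : realType) (x y : R) : `|cos x-cos y| <= `|x-y|.
have dc z : der (@cos R) z (- sin z) by apply: der_eq; [apply: der_cos; exact: der_id|rewrite mulr1].
have ds (z : R) : `|- sin z| <= 1 by rewrite normrN ler_norml sin_geN1 sin_le1.
by have := taylor1_norm dc ds y x; rewrite mul1r.
Qed.

Lemma measurable_cos_affine d (T : measurableType d) (R : realType) (X : T -> R) (lam th : R) :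
 msr X -> msr (fun x => cos (lam*X x+th)).
by [].
Qed.

Lemma cos_norm_le1 (R : realType) (x : R) : `|cos x| <= 1.
by rewrite ler_norml cos_geN1 cos_le1. Qed.

(** cos is 1-Lipschitz, and the mean of the absolute centred difference is at most its standard
    deviation z s. *)
Lemma Ex_cos_near d (T : measurableType d) (R : realType) (P : probability T R) (X Y : T -> R) (M lam th s z : R) :
 msr X -> msr Y -> bdd X M -> bdd Y M ->
 0 < s -> 0 <= z -> Vr P (fun x => X x-Y x) <= z^+2*s^+2 ->
 `|Ex P (fun x => cos (lam*((X x-Ex P X)/s)+th))-Ex P (fun x => cos (lam*((Y x-Ex P Y)/s)+th))| <=
 `|lam|*z.
move=> mX mY XM YM s0 z0 hV.
have IX := intg_bounded P mX XM; have IY := intg_bounded P mY YM.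
set D := fun x => X x-Y x-(Ex P X-Ex P Y).
have mXY : msr (fun x => X x-Y x) by exact: measurable_funB.
have mD : msr D by [].
have DM x : `|D x| <= M+M + `|Ex P X-Ex P Y| by apply: ler_normB_via; rewrite lerD2r; apply: ler_normB_via; exact: lerD.
have mA : msr (fun x => `|D x|) by [].
have IA : intg P (fun x => `|D x|) by apply: (intg_bnd (M+M + `|Ex P X-Ex P Y|)) => // x; rewrite normr_id.
have EA : Ex P (fun x => `|D x|) <= z*s.
 have A0 : 0 <= Ex P (fun x => `|D x|) by [].
 rewrite -(@ler_pXn2r _ 2)//.
 apply: le_trans (@Ex_sqr_le _ _ _ P _ (M+M + `|Ex P X-Ex P Y|) mA _) _ => [x|]; first by rewrite normr_id.
 rewrite exprMn; apply: le_trans hV; rewrite /Vr ExB//; apply: eq_ler.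
 by apply: Ex_eq => x; rewrite sqr_normr.
have mc (W : T -> R) : msr W -> msr (fun x => cos (lam*((W x-Ex P W)/s)+th)) by [].
have Ic (W : T -> R) : msr W -> intg P (fun x => cos (lam*((W x-Ex P W)/s)+th)).
 by move=> mW; apply: (intg_bnd 1); [exact: mc|move=> x; exact: cos_norm_le1].
rewrite -(ExB (Ic _ mX) (Ic _ mY)).
apply: (le_via (Ex P (fun x => `|lam| / s * `|D x|))).
 apply: Ex_abs_le; [by apply: measurable_funB; exact: mc|exact: intgZ|].
 move=> x; apply: le_trans (cos_lipschitz _ _) _.
 rewrite (_ : lam*((X x-Ex P X)/s)+th-(lam*((Y x-Ex P Y)/s)+th) = lam/s*D x).
  by rewrite !normrM normfV (gtr0_norm s0).
 by rewrite /D; ring.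
rewrite ExZ// -mulrA; apply: ler_wpM2l => //.
by rewrite mulrC ler_pdivrMr.
Qed.

Lemma exp_lipschitz (R : realType) (a b : R) : 0 <= a -> 0 <= b -> `|expR (- a)-expR (- b)| <= `|a-b|.
wlog ab : a b/a <= b.
 move=> H a0 b0; have [ab|/ltW ba] := leP a b; first exact: H.
 by rewrite distrC (distrC a); exact: H.
move=> a0 b0; rewrite ger0_norm; last by rewrite subr_ge0 ler_expR lerN2.
rewrite distrC ger0_norm ?subr_ge0//.
have -> : expR (- b) = expR (- a)*expR (- (b-a)) by rewrite -expRD; congr expR; ring.
have h := expR_ge1Dx (- (b-a)); have e0 := expR_ge0 (- a).
have e1 : expR (- a) <= 1 by rewrite -expR0 ler_expR oppr_le0.
rewrite -{1}[expR (- a)]mulr1 -mulrBr; apply: (le_via (expR (- a)*(b-a))).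
 by apply: ler_wpM2l; lra.
by rewrite ler_piMl// subr_ge0.
Qed.

(** Each variable is the other plus a difference, taken with the weights 1+z and 1+1/z; since
    (1+1/z) z^2 = z^2 + z, the error stays linear in z. *)
Lemma Vr_ratio d (T : measurableType d) (R : realType) (P : probability T R) (X Y : T -> R) (M s2 z : R) :
 msr X -> msr Y -> bdd X M -> bdd Y M ->
 Vr P X = s2 -> 0 < s2 -> 0 < z <= 1 -> Vr P (fun x => X x-Y x) <= z^+2*s2 ->
 `|Vr P Y/s2-1| <= 3*z.
move=> mX mY XM YM Es s0 /andP[z0 z1] hV.
have mD : msr (fun x => X x-Y x) by exact: measurable_funB.
have M0 : 0 <= M by apply: le_trans (normr_ge0 _) (XM point).
have M2 : M <= M+M by rewrite lerDl.
have DM x : `|X x-Y x| <= M+M by apply: ler_normB_via; exact: lerD.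
have h1 : Vr P X <= (1+z)*Vr P Y+(1+z^-1)*Vr P (fun x => X x-Y x).
 rewrite (@Vr_eq _ _ _ _ X (fun x => Y x+(X x-Y x))); last by move=> x; rewrite addrC subrK.
 by apply: (@VrD_le _ _ _ _ _ _ (M+M)) => // x; exact: le_trans (YM x) M2.
have h2 : Vr P Y <= (1+z)*Vr P X+(1+z^-1)*Vr P (fun x => X x-Y x).
 have := VrZ P (-1) mD DM; rewrite sqrrN expr1n mul1r => <-.
 rewrite (@Vr_eq _ _ _ _ Y (fun x => X x + -1*(X x-Y x))); last by move=> x; ring.
 apply: (@VrD_le _ _ _ _ _ _ (M+M)) => //.
 - by move=> x; exact: le_trans (XM x) M2.
 - by move=> x; rewrite mulN1r normrN.
have k : (1+z^-1)*Vr P (fun x => X x-Y x) <= (z^+2+z)*s2.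
 have p : 0 <= 1+z^-1 by [].
 apply: le_trans (ler_wpM2l p hV) _; rewrite mulrA mulrDl mul1r expr2 mulrA mulVf ?gt_eqF// mul1r.
 by [].
move: h1 h2; rewrite Es => h1 h2.
set V := Vr P Y in h1 h2 *; set W := (1+z^-1)*_ in h1 h2 k.
have zs : 0 <= z*s2 by [].
have zz : z^+2*s2 <= z*s2 by apply: ler_wpM2r; [exact: ltW|rewrite expr2 ler_piMl// ltW].
rewrite mulrDl in k.
have s2n : s2 != 0 by [].
rewrite (_ : V/s2-1 = (V-s2)/s2); last by move: (V) => v; field.
rewrite normrM normfV (gtr0_norm s0) ler_pdivrMr// ler_norml.
have p1 : 0 < 1+z by [].
apply/andP; split; last by move: h2 k zz zs; rewrite mulrDl mul1r; move: (W) (V); clear => *; lra.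
rewrite -(ler_pM2l p1).
have e : (1+z)*(- (3*z*s2)) = - (3*(z*s2))-3*(z^+2*s2) by ring.
have e' : (1+z)*(V-s2) = (1+z)*V-s2-z*s2 by ring.
have zz0 : 0 <= z^+2*s2 by [].
by rewrite e e'; move: h1 k zs zz0; move: ((1+z)*V) (W); clear => *; lra.
Qed.

End cosine_limit.

(** Three errors: from the zeros to the smoothed count, the normal approximation of that count, and
    the ratio of the variances. The first and third are multiples of z, fixed beforehand; with Q and
    kap fixed accordingly, the second is of order n^(-1/2) because the variance is at least n/c. *)
Lemma zeros_cos_clt (R : realType) (lam th del : R) : 0 < del -> exists N, forall n, (N <= n)%N -> (4 <= n)%N ->
 `|EG (n+n) (fun x => cos (lam*((@ZZ R n x-EG (n+n) (@ZZ R n))/Num.sqrt (Vr (gauss (n+n)) (@ZZ R n)))+th)) -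
  expR (- (lam^+2/2))*cos th| <= del.
move=> del0; pose c : R := 4*(72*72).
have c0 : 0 < c by [].
have l20 : 0 <= lam^+2 by [].
have q0 : 0 < `|lam| + 2 * lam^+2+1 by rewrite ltr_wpDl// addr_ge0 mulr_ge0.
pose z : R := Num.min 1 (del/2/(`|lam| + 2 * lam^+2+1)).
have z0 : 0 < z by rewrite lt_min ltr01 divr_gt0// divr_gt0.
have z1 : z <= 1 by rewrite ge_min lexx.
have z01 : 0 < z <= 1 by rewrite z0 z1.
have zd : (`|lam| + 2 * lam^+2)*z <= del/2.
 apply: (le_via ((`|lam| + 2 * lam^+2+1)*z)); first by rewrite ler_pM2r// lerDl.
 by rewrite mulrC -ler_pdivlMr// ge_min lexx orbT.
have eps0 : 0 < z^+2/c by [].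
have [Q' [kap [kap0 app]]] := smooth_approximation eps0.
set Q := Q'.+1 in app.
pose D := lam^+2*c*(2*kap^+3*Q%:R^+2).
have D0 : 0 <= D by [].
have [N hN] := @small_step R D (del/2) (divr_gt0 del0 (ltr0n R 2)).
exists N.+1 => n nN n4; set G := gauss (n+n); set Z := @ZZ R n; set T := @TT R n Q' kap.
have nR : 0 < n%:R :> R by rewrite ltr0n; exact: leq_trans n4.
have mZ : msr Z := @ZZ_meas R n n4.
have mT : msr T := @TT_meas R n Q' kap.
pose M : R := n.*2%:R+(n*Q)%:R.
have ZM x : `|Z x| <= M by apply: le_trans (ZZ_norm _) _; rewrite lerDl.
have TM x : `|T x| <= M by apply: le_trans (TT_bound _ _ _) _; rewrite lerDr.
have Vlow : n%:R/c <= Vr G Z by exact: ZZ_var_lower.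
set s2 := Vr G Z in Vlow *; set s := Num.sqrt s2.
have s20 : 0 < s2 by apply: lt_le_trans Vlow.
have s0 : 0 < s by [].
have ss : s^+2 = s2 by rewrite sqr_sqrtr// ltW.
have Vd : Vr G (fun x => Z x-T x) <= z^+2*s2 by apply: le_trans (app n n4) _; rewrite mulrAC -mulrA; apply: ler_wpM2l.
have t1 : `|Ex G (fun x => cos (lam*((Z x-Ex G Z)/s)+th))-Ex G (fun x => cos (lam*((T x-Ex G T)/s)+th))| <= `|lam|*z by apply: (Ex_cos_near lam th mZ mT ZM TM s0 (ltW z0)); rewrite ss.
have t2 := @TT_clt R n n4 Q' kap (lam/s) (th-lam/s*Ex G T) kap0.
rewrite -/G -/T -/Q in t2.
rewrite (@Ex_eq _ _ _ G _ (fun x => cos (lam*((T x-Ex G T)/s)+th))) in t2; last first.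
 by move=> x; congr cos; ring.
rewrite (_ : lam/s*Ex G T+(th-lam/s*Ex G T) = th) in t2; last by ring.
have t2b : (lam/s)^+2*(2*kap^+2*Q%:R)*(kap*Num.sqrt (n*Q)%:R*Num.sqrt Q%:R) <= del/2.
 apply: le_trans hN; rewrite natrM sqrtrM//.
 have Qs : Num.sqrt Q%:R*Num.sqrt Q%:R = Q%:R :> R by rewrite -expr2 sqr_sqrtr.
 have nn : Num.sqrt n%:R^+2 = n%:R :> R by rewrite sqr_sqrtr// ltW.
 have sn : 0 < Num.sqrt n%:R :> R by [].
 have iv : s2^-1 <= c/n%:R by rewrite -[leRHS]invrK invf_div lef_pV2 ?posrE// divr_gt0.
 rewrite (_ : _*_*_ = lam^+2*(2*kap^+3*Q%:R)*(Num.sqrt Q%:R*Num.sqrt Q%:R)*Num.sqrt n%:R*s2^-1); last first.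
  by rewrite exprMn exprVn ss; ring.
 rewrite Qs; apply: (le_via (lam^+2*(2*kap^+3*Q%:R)*Q%:R*Num.sqrt n%:R*(c/n%:R))).
  exact: ler_wpM2l.
 apply: (le_via (D/Num.sqrt n%:R)).
  rewrite /D; apply: eq_ler.
  have sn' : Num.sqrt n%:R != 0 :> R by [].
  by move: (n%:R : R) (Num.sqrt n%:R) nn sn' => m r <- r0; field.
 apply: ler_wpM2l => //; rewrite lef_pV2 ?sqrtr_gt0//.
 by apply: ler_wsqrtr; rewrite ler_nat.
have t3 : `|expR (- ((lam/s)^+2*Vr G T/2))*cos th-expR (- (lam^+2/2))*cos th| <= 2 * lam^+2*z.
 rewrite -mulrBl normrM; apply: (le_via (`|(lam/s)^+2*Vr G T/2-lam^+2/2|*1)).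
  apply: ler_pM => //; last exact: cos_norm_le1.
  have q2 : 0 <= (lam/s)^+2*Vr G T by apply: mulr_ge0; [exact: sqr_ge0|exact: Vr_ge0].
  exact: exp_lipschitz.
 rewrite mulr1 exprMn exprVn ss (_ : _-_ = lam^+2/2*(Vr G T/s2-1)); last by ring.
 have l2 : 0 <= lam^+2/2 by [].
 rewrite normrM (ger0_norm l2).
 apply: le_trans (ler_wpM2l l2 (Vr_ratio mZ mT ZM TM erefl s20 z01 Vd)) _.
 have : 0 <= lam^+2*z by [].
 by rewrite (_ : lam^+2/2*(3*z) = 3/2*(lam^+2*z)); [rewrite -mulrA; lra|ring].
rewrite mulrDl in zd.
move: t1 t2 t2b t3 zd.
set A := Ex G _; set B := Ex G _; set C := expR _*_; set E := expR _*_ => t1 t2 t2b t3 zd.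
rewrite (_ : A-E = (A-B)+(B-C)+(C-E)); last by ring.
apply: ler_normD_via; have := ler_normD (A-B) (B-C); have := le_trans t2 t2b.
by move: t1 t3 zd; move: (`|_+_|) (`|_-_|) (`|_-_|) (`|_-_|) (`|lam|*z) (2*_*z) => *; lra.
Qed.

(** * Characteristic function of the standard Gaussian *)

Section gaussian_characteristic_function.
Variable R : realType.

Let mcos (lam th : R) : msr (fun x : R => cos (lam*x+th)).
exact: measurable_cos_affine (@measurable_id _ R setT). Qed.

Let mcos0 (lam : R) : msr (fun x : R => cos (lam*x)).
by []. Qed.

Let msin0 (lam : R) : msr (fun x : R => sin (lam*x)).
by []. Qed.

Let Icos (lam : R) : intg gam (fun x : R => cos (lam*x)).
by apply: (intg_bnd 1) => // x; exact: cos_norm_le1. Qed.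

Let sin1 (x : R) : `|sin x| <= 1. by rewrite ler_norml sin_geN1 sin_le1. Qed.

Let Isin (lam : R) : intg gam (fun x : R => sin (lam*x)).
exact: (intg_bnd 1). Qed.

Let ch (lam : R) : R := Ex gam (fun x : R => cos (lam*x)).

Let Esin (lam : R) : Ex gam (fun x : R => sin (lam*x)) = 0.
have := Ex_gam_opp (msin0 lam) (fun x => sin1 _).
rewrite (@Ex_eq _ _ _ _ _ (fun x => - sin (lam*x))); last by move=> x; rewrite mulrN sinN.
by rewrite ExN// => /eqP; rewrite eq_sym -addr_eq0 -mulr2n mulrn_eq0/= => /eqP.
Qed.

Let ch_mul (a b : R) : 0 <= a -> ch (Num.sqrt (a^+2+b^+2)) = ch a*ch b.
move=> a0.
have mc1 : msr (fun x : R => cos x) by [].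
rewrite /ch -(gam_comb b a0 mc1 (fun x => cos_norm_le1 x)).
rewrite (@Ex_eq _ _ _ _ _ (fun x => ch b*cos (a*x))); first by rewrite ExZ// mulrC.
move=> x; rewrite (@Ex_eq _ _ _ _ _ (fun y => cos (a*x)*cos (b*y)-sin (a*x)*sin (b*y))); last first.
 by move=> y; rewrite cosD.
by rewrite ExB ?ExZ ?Esin ?mulr0 ?subr0 1?mulrC//; exact: intgZ.
Qed.

Let ch_pow (a : R) N : 0 <= a -> ch (Num.sqrt (N%:R*a^+2)) = ch a^+N.
move=> a0; elim: N => [|N IH].
 rewrite mul0r sqrtr0 expr0 /ch (@Ex_eq _ _ _ _ _ (fun=> 1)) ?Ex_cst// => x.
 by rewrite mul0r cos0.
by rewrite sqrt_step ch_mul ?sqrtr_ge0// IH exprSr.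
Qed.

Lemma exprn_lipschitz (x y : R) N : `|x| <= 1 -> `|y| <= 1 -> `|x^+N-y^+N| <= N%:R * `|x-y|.
move=> x1 y1; elim: N => [|N IH]; first by rewrite !expr0 subrr normr0 mul0r.
rewrite !exprS (_ : x*_-_ = x*(x^+N-y^+N)+(x-y)*y^+N); last by ring.
apply: ler_normD_via; rewrite -[N.+1%:R]natr1 [leRHS]mulrDl mul1r !normrM; apply: lerD.
 by apply: le_trans IH; rewrite ler_piMl.
by rewrite ler_piMr// normrX exprn_ile1.
Qed.

Let cube_int : intg gam (fun x : R => `|x|^+3).
apply: (@intg_gam_le _ _ 1 2); first by apply: measurable_funX; exact: (@normr_measurable R setT).
move=> x; rewrite ger0_norm ?exprn_ge0// mul1r -(sqr_normr x).
have : 0 <= `|x| by []. move: (`|x|) => y y0.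
have [y1|y1] := leP y 1.
 apply: (le_via 1); first by rewrite exprn_ile1.
 by rewrite exprn_ege1// lerDl sqr_ge0.
apply: (le_via (y^+4)); first by rewrite ler_weXn2l// ltW.
by rewrite (exprM y 2 2); apply: lerXn2r; rewrite ?sqr_ge0// lerDr.
Qed.

(** [ch_pow] gives ch(lam) = ch(lam/sqrt N)^N, and near 0 both ch(a) and exp(-a^2/2) are 1 - a^2/2
    up to order a^3; the N factors leave an error of order N^(-1/2). *)
Let ch_exp_pos (lam : R) : 0 <= lam -> ch lam = expR (- (lam^+2/2)).
move=> l0; pose K3 := Ex gam (fun x : R => `|x|^+3).
have K30 : 0 <= K3 by [].
have local a : 0 <= a -> `|ch a-expR (- (a^+2/2))| <= a^+3*K3+a^+4.
 move=> a0.
 have h1 : `|ch a-(1-a^+2/2)| <= a^+3*K3.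
  have Iq : intg gam (fun x : R => a^+2/2*x^+2) by apply: intgZ; exact: intg_gam_sq.
  have Iq1 : intg gam (fun x : R => 1-a^+2/2*x^+2) by apply: intgB => //; exact: intg_cst.
  have -> : 1-a^+2/2 = Ex gam (fun x : R => 1-a^+2/2*x^+2).
   rewrite ExB//; last exact: intg_cst.
   by rewrite Ex_cst ExZ ?Ex_gam_sq ?mulr1//; exact: intg_gam_sq.
  rewrite /ch -ExB// /K3 -ExZ//; apply: Ex_abs_le.
  - by apply: measurable_funB => //; exact: intg_meas Iq1.
  - exact: intgZ.
  - move=> x; have := cos_taylor (a*x); rewrite normrM (ger0_norm a0) !exprMn.
   by rewrite (_ : a^+2/2*x^+2 = a^+2*x^+2/2)//; ring.
 have a20 : 0 <= a^+2/2 by [].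
 have h2 := exp_quadratic a20.
 have h3 : (a^+2/2)^+2 <= a^+4.
  rewrite (exprM a 2 2); apply: lerXn2r; rewrite ?sqr_ge0//.
  by have := sqr_ge0 a; lra.
 have := ler_normD (ch a-(1-a^+2/2)) (1-a^+2/2-expR (- (a^+2/2))).
 by rewrite addrA subrK; move: h1 h2 h3; move: (`|_|) (`|_|) (`|_|) (_*K3) => *; lra.
have c1 a : `|ch a| <= 1 by apply: Ex_bound => // x; exact: cos_norm_le1.
apply/eqP; rewrite -subr_eq0 -normr_le0; apply/ler_addgt0Pr => del del0; rewrite add0r.
pose D := lam^+3*K3+lam^+4.
have D1 : 0 <= lam^+3*K3 by [].
have D2 : 0 <= lam^+4 by [].
have [N hN] := @small_step R D del del0; apply: le_trans hN.
set q := Num.sqrt N.+1%:R; have q0 : 0 < q by rewrite sqrtr_gt0.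
have q1 : 1 <= q by rewrite -(sqrtr1 R) ler_wsqrtr// ler1n.
have qq : q^+2 = N.+1%:R by rewrite sqr_sqrtr.
pose a := lam/q; have a0 : 0 <= a by rewrite divr_ge0// ltW.
have Na : N.+1%:R*a^+2 = lam^+2 by rewrite -qq /a; field.
have e1 : ch lam = ch a^+N.+1 by rewrite -ch_pow// Na sqrtr_sqr ger0_norm.
have e2 : expR (- (lam^+2/2)) = expR (- (a^+2/2))^+N.+1 by rewrite -expRM_natl -Na; congr expR; ring.
have ex : `|expR (- (a^+2/2))| <= 1 by rewrite ger0_norm ?expR_ge0// -expR0 ler_expR oppr_le0 divr_ge0// sqr_ge0.
rewrite e1 e2; apply: le_trans (exprn_lipschitz N.+1 (c1 a) ex) _.
apply: le_trans (ler_wpM2l (ler0n R N.+1) (local a a0)) _.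
rewrite mulrDr /D mulrDl; apply: lerD.
 rewrite (_ : N.+1%:R*(a^+3*K3) = lam^+3*K3/q)//.
 by rewrite -qq /a; field.
rewrite (_ : N.+1%:R*a^+4 = lam^+4/q*q^-1).
 by rewrite ler_piMr ?invf_le1// divr_ge0 ltW.
by rewrite -qq /a; field.
Qed.

Lemma Ex_gam_cos (lam th : R) : Ex gam (fun x : R => cos (lam*x+th)) = expR (- (lam^+2/2))*cos th.
have chE : ch lam = expR (- (lam^+2/2)).
 have [l0|/ltW l0] := leP 0 lam; first exact: ch_exp_pos.
 rewrite -sqrrN -ch_exp_pos ?oppr_ge0//; apply: Ex_eq => x; by rewrite mulNr cosN.
rewrite (@Ex_eq _ _ _ _ _ (fun x => cos th*cos (lam*x)-sin th*sin (lam*x))); last first.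
 by move=> x; rewrite cosD; ring.
by rewrite (ExB (intgZ _ (Icos _)) (intgZ _ (Isin _))) !ExZ// Esin mulr0 subr0 mulrC -chE.
Qed.

End gaussian_characteristic_function.

(** * Bernstein polynomials *)

Section bernstein.
Variable R : realType.
Implicit Types (phi psi : nat -> R) (u : R).

(** Bernstein polynomial of the sequence phi: the mean of phi at the number of successes in N
    independent trials of probability u, by conditioning on one trial. *)
Fixpoint bern (N : nat) phi u : R :=
 if N is N'.+1 then u*bern N' (phi \o succn) u+(1-u)*bern N' phi u else phi 0%N.

Lemma bern_lin N phi psi u (a b : R) :
 bern N (fun k => a * phi k+b * psi k) u = a*bern N phi u+b*bern N psi u.
elim: N phi psi => [//|N IH] phi psi /=.
by rewrite (IH (phi \o succn) (psi \o succn)) IH; ring.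
Qed.

Lemma bern_cst N (c : R) u : bern N (fun=> c) u = c.
by elim: N => [//|N IH] /=; rewrite /comp/= IH; ring. Qed.

Lemma bern_le N phi psi u : 0 <= u <= 1 -> (forall k, (k <= N)%N -> phi k <= psi k) ->
 bern N phi u <= bern N psi u.
move=> /andP[u0 u1]; elim: N phi psi => [|N IH] phi psi h /=; first exact: h.
apply: lerD; apply: ler_wpM2l; rewrite ?subr_ge0//; apply: IH => k kN; first exact: h.
by apply: h; exact: leqW.
Qed.

Lemma bern_moment N (c : R) u :
 bern N (fun k => (k%:R+c)^+2) u = N%:R*(u*(1-u))+(N%:R*u+c)^+2.
elim: N c => [|N IH] c /=; first by rewrite !mul0r !add0r.
have -> : bern N ((fun k => (k%:R+c)^+2) \o succn) u = bern N (fun k => (k%:R+(1+c))^+2) u by congr bern; apply/funext => k /=; rewrite -natr1 addrA.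
by rewrite !IH -natr1; ring.
Qed.

(** The number of successes has variance N u (1-u), which turns the quadratic error into at most
    C/N. *)
Lemma bern_near N phi u (x e C : R) : (0 < N)%N -> 0 <= u <= 1 -> 0 <= C ->
 (forall k, (k <= N)%N -> `|x-phi k| <= e+C*(u-k%:R/N%:R)^+2) ->
 `|x-bern N phi u| <= e+C/N%:R.
move=> N0 u01 C0 h; have NR : 0 < N%:R :> R by rewrite ltr0n.
pose psi k : R := e*1+(C/N%:R^+2)*(k%:R + - (N%:R*u))^+2.
have psiE k : psi k = e+C*(u-k%:R/N%:R)^+2 by rewrite /psi; field.
have bpsi : bern N psi u <= e+C/N%:R.
 rewrite /psi (bern_lin N (fun=> 1) (fun k => (k%:R + - (N%:R*u))^+2)) bern_cst bern_moment mulr1 lerD2l.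
 rewrite subrr expr0n/= addr0.
 rewrite (_ : C/N%:R^+2*(N%:R*(u*(1-u))) = C/N%:R*(u*(1-u))); last by field; rewrite gt_eqF.
 have /andP[u0 u1] := u01.
 by rewrite ler_piMr ?(ltW NR)// mulr_ile1 ?subr_ge0// lerBlDr lerDl.
have l : bern N phi u <= bern N (fun k => x*1+1 * psi k) u.
 apply: bern_le => // k kN; rewrite psiE mulr1 mul1r.
 by have := h k kN; rewrite ler_norml => /andP[h1 _]; move: h1; move: (C*_) => *; lra.
have r : bern N (fun k => x*1+(-1) * psi k) u <= bern N phi u.
 apply: bern_le => // k kN; rewrite psiE mulr1 mulN1r.
 by have := h k kN; rewrite ler_norml => /andP[_ h1]; move: h1; move: (C*_) => *; lra.
rewrite (bern_lin N (fun=> 1) psi u x 1) bern_cst mul1r mulr1 in l.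
rewrite (bern_lin N (fun=> 1) psi u x (-1)) bern_cst mulN1r mulr1 in r.
move: bpsi l r; move: (bern N psi u) (bern N phi u) (C/_) => *.
by rewrite ler_norml; apply/andP; split; lra.
Qed.

End bernstein.

(** * Approximation of continuous functions by polynomials in a slow sine *)

Section asin_modulus.
Variable R : realType.

(** sin y - sin z = 2 cos((y+z)/2) sin((y-z)/2). As |y| <= 1/2 and |z| < 2, the half sum and half
    difference are at most 5/4 in size, where the cosine is at least 1/5. *)
Lemma sin_expansion (y z : R) : `|y| <= 2^-1 -> `|z| <= pi/2 -> `|y-z| <= 8 * `|sin y-sin z|.
move=> hy hz; have p2 : pi/2 < 2 :> R := @pihalf_lt2 R.
pose s := (y+z)/2; pose d := (y-z)/2.
have yE : y = s+d by rewrite /s /d; field.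
have zE : z = s-d by rewrite /s /d; field.
have s1 : `|s| <= 5/4.
 rewrite /s normrM (ger0_norm (_ : 0 <= 2^-1)) ?invr_ge0//; have := ler_normD y z.
 by move: hy hz; move: (`|y|) (`|z|) (`|y+z|) => *; lra.
have d1 : `|d| <= 5/4.
 rewrite /d normrM (ger0_norm (_ : 0 <= 2^-1)) ?invr_ge0//; have := ler_normB y z.
 by move: hy hz; move: (`|y|) (`|z|) (`|y-z|) => *; lra.
have E : sin y-sin z = 2*(cos s*sin d) by rewrite [in sin y]yE [in sin z]zE sinD sinB; ring.
have cs : 5^-1 <= cos s.
 have := cos_ge2 s; rewrite -(sqr_normr s).
 have : `|s|^+2 <= (5/4)^+2 by apply: lerXn2r.
 by rewrite expr_div_n; lra.
have sd : 7/10 * `|d| <= `|sin d|.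
 have -> : `|sin d| = `|sin `|d| |.
  by have [d0|d0] := leP 0 d; rewrite ?(ger0_norm d0)// (ltr0_norm d0) sinN normrN.
 apply: le_trans (ler_norm _); apply: le_trans (sin_ge3 (normr_ge0 d)).
 have h : `|d|^+2 <= (5/4)^+2 by apply: lerXn2r.
 have := ler_wpM2l (normr_ge0 d) h; rewrite -exprS expr_div_n; have := normr_ge0 d; lra.
rewrite E !normrM (ger0_norm (ler0n _ 2)) (ger0_norm (_ : 0 <= cos s)); last by apply: le_trans cs; rewrite invr_ge0.
have -> : `|y-z| = 2 * `|d| by rewrite /d normrM (ger0_norm (_ : 0 <= 2^-1)) ?invr_ge0//; field.
have := ler_pM _ _ cs sd; rewrite invr_ge0 ler0n mulr_ge0 ?divr_ge0// => /(_ isT isT).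
by move: (cos s*_) => t; have := normr_ge0 d; lra.
Qed.

(** Only x is confined to the segment: in [trig_approx] the sample point near x may lie outside
    [-B/2, B/2]. *)
Lemma continuous_modulus (f : R -> R) (a b e : R) : continuous f -> 0 < e ->
 exists2 eta, 0 < eta & forall x y, a <= x <= b -> `|x-y| < eta -> `|f x-f y| <= e.
move=> cf e0.
have e20 : 0 < e/2 by [].
have /compact_near_coveringP := @segment_compact R a b.
move=> /(_ R (0 : R)^'+ (fun eta x => forall y, `|x-y| < eta -> `|f x-f y| <= e)) H.
have {}H : \forall eta \near (0 : R)^'+, forall x, `[a, b]%classic x -> forall y, `|x-y| < eta -> `|f x-f y| <= e.
 apply: H => x xab; have /cvgrPdist_lt/(_ _ e20) := cf x.
 move=> /nbhs_ballP[r /= r0 hr].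
 have r2 : 0 < r/2 by [].
 near=> x' eta => /= y xy.
 have hx' : `|x-x'| < r/2 by [].
 have he : eta <= r/2 by near: eta; exact: nbhs_right_le.
 have b1 : ball x r x' by rewrite /ball/=.
 have b2 : ball x r y.
  rewrite /ball/= (_ : x-y = (x-x')+(x'-y)); last by ring.
  apply: le_lt_trans (ler_normD _ _) _; have := lt_le_trans xy he; lra.
 have := hr _ b1; have := hr _ b2; rewrite (_ : f x'-f y = (f x-f y)-(f x-f x')); last by ring.
 move=> h1 h2; apply: ler_normB_via; lra.
have [eta /= [h1 h2]] : exists eta, 0 < eta /\ forall x, `[a, b]%classic x -> forall y, `|x-y| < eta -> `|f x-f y| <= e.
 have : \forall eta \near (0 : R)^'+, 0 < eta /\ forall x, `[a, b]%classic x -> forall y, `|x-y| < eta -> `|f x-f y| <= e by near=> eta; split; [near: eta; exact: nbhs_right_gt|near: eta; exact: H].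
 by move=> /filter_ex[eta ?]; exists eta.
by exists eta => // x y xab; apply: h2.
Unshelve. all: by end_near.
Qed.

(** f is sampled at the points B asin(2k/N - 1), so that u = (1 + sin(y/B))/2 is the Bernstein
    variable. For |y| > B/2 the trivial error 2M is covered by the quadratic term, which a second
    moment will control. *)
Lemma trig_approx (f : R -> R) (M B e : R) : continuous f -> bdd f M -> 0 < B -> 0 < e ->
 exists N phi, forall y,
 `|f y-bern N phi ((1+sin (B^-1*y))/2)| <= e+8 * M/B^+2*y^+2.
move=> cf fM B0 e0; have M0 : 0 <= M by exact: le_trans (fM 0).
have e20 : 0 < e/2 by [].
have [eta eta0 he] := @continuous_modulus f (- (B/2)) (B/2) (e/2) cf e20.
pose C := 2^+9 * M*B^+2/eta^+2.
have C0 : 0 <= C by [].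
pose N := (Num.truncn (C/(e/2))).+1.
have NR : 0 < N%:R :> R by [].
have CN : C/N%:R <= e/2 by rewrite ler_pdivrMr// mulrC -ler_pdivrMr// ltW// truncnS_gt.
pose as_ k : R := asin (2*(k%:R/N%:R)-1).
have as_def k : (k <= N)%N -> - (pi/2) <= as_ k <= pi/2 /\ sin (as_ k) = 2*(k%:R/N%:R)-1.
 move=> kN; apply: asin_def.
 have k0 : 0 <= k%:R/N%:R :> R by [].
 have k1 : k%:R/N%:R <= 1 :> R by rewrite ler_pdivrMr// mul1r ler_nat.
 by apply/andP; split; lra.
exists N, (fun k => f (B*as_ k)) => y.
set u := (1+_)/2.
have u01 : 0 <= u <= 1.
 have := sin_geN1 (B^-1*y); have := sin_le1 (B^-1*y); rewrite /u => *; apply/andP; split; lra.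
have y20 : 0 <= 8 * M/B^+2*y^+2 by [].
have [yB|By] := leP `|y| (B/2); last first.
 have b1 : `|f y-bern N (fun k => f (B*as_ k)) u| <= 2 * M+0/N%:R.
  apply: bern_near => // k kN; rewrite mul0r addr0; apply: ler_normB_via.
  by rewrite mulr2n mulrDl mul1r; apply: lerD.
 apply: le_trans b1 _; rewrite mul0r addr0.
 have : 2 * M <= 8 * M/B^+2*y^+2.
  rewrite mulrAC ler_pdivlMr ?exprn_gt0// -(sqr_normr y).
  have : (B/2)^+2 <= `|y|^+2 by apply: lerXn2r; rewrite ?divr_ge0// ltW.
  by rewrite expr_div_n => h; have := ler_wpM2l M0 h; lra.
 by lra.
apply: (le_via (e/2+C/N%:R)); last by lra.
apply: bern_near => // k kN; have [/andP[a1 a2] sa] := as_def k kN.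
have yab : - (B/2) <= y <= B/2 by rewrite -ler_norml.
have [near_|far] := ltP `|y-B*as_ k| eta.
 by apply: le_trans (he _ _ yab near_) _; rewrite lerDl mulr_ge0// sqr_ge0.
have az : `|as_ k| <= pi/2 by rewrite ler_norml a1 a2.
have ay : `|B^-1*y| <= 2^-1.
 rewrite normrM normfV (gtr0_norm B0) mulrC ler_pdivrMr; lra.
have h := sin_expansion ay az; rewrite sa in h.
have uE : sin (B^-1*y)-(2*(k%:R/N%:R)-1) = 2*(u-k%:R/N%:R) by rewrite /u; field.
rewrite uE normrM (ger0_norm (ler0n _ 2)) in h.
have h2 : eta <= B*(16 * `|u-k%:R/N%:R|).
 apply: le_trans far _; rewrite (_ : y-B*as_ k = B*(B^-1*y-as_ k)); last by field; rewrite gt_eqF.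
 rewrite normrM (gtr0_norm B0) ler_pM2l//; apply: le_trans h _; lra.
apply: (le_via (2 * M)).
 by apply: ler_normB_via; rewrite mulr2n mulrDl mul1r; apply: lerD.
rewrite -[leLHS]add0r; apply: lerD => //.
have h3 : eta^+2 <= (B*(16 * `|u-k%:R/N%:R|))^+2 by exact: lerXn2r.
rewrite !exprMn sqr_normr// in h3.
rewrite /C mulrAC ler_pdivlMr ?exprn_gt0//.
have := ler_wpM2l (_ : 0 <= 2 * M) h3; rewrite mulr_ge0// => /(_ isT) h4.
by apply: le_trans h4 _; apply: eq_ler; ring.
Qed.

End asin_modulus.

(** * From cosines to bounded continuous functions *)

Section weak_convergence.
Context d (T : measurableType d) (R : realType) (P : probability T R) (X : nat -> T -> R).
Hypothesis mX : forall n, msr (X n).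
Hypothesis cvg_cos : forall lam th : R,
 Ex P (fun w => cos (lam*X n w+th)) @[n --> \oo] --> Ex gam (fun x : R => cos (lam*x+th)).

Let test (f : R -> R) :=
 [/\ msr f, (exists M, forall x, `|f x| <= M) &
  Ex P (fun w => f (X n w)) @[n --> \oo] --> Ex gam f].

Let test_lin (f g : R -> R) (a b : R) : test f -> test g -> test (fun x => a*f x+b * g x).
move=> [mf [M fM] cf] [mg [M' gM] cg].
have If : intg gam f by exact: intg_bounded fM.
have Ig : intg gam g by exact: intg_bounded gM.
have IfX n : intg P (fun w => f (X n w)).
 exact: (intg_bounded _ (measurableT_comp mf (mX n)) (fun w => fM _)).
have IgX n : intg P (fun w => g (X n w)).
 exact: (intg_bounded _ (measurableT_comp mg (mX n)) (fun w => gM _)).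
split.
- by [].
- exists (`|a| * M + `|b| * M') => x; apply: ler_normD_via; rewrite !normrM.
 by apply: lerD; apply: ler_wpM2l.
- rewrite ExD ?ExZ//; try exact: intgZ.
 rewrite (_ : (fun n => _) = fun n => a*Ex P (fun w => f (X n w))+b*Ex P (fun w => g (X n w))); last first.
  by apply/funext => n; rewrite ExD ?ExZ//; exact: intgZ.
 by apply: cvgD; apply: cvgMl_tmp.
Qed.

Let test_eq (f g : R -> R) : f =1 g -> test f -> test g.
by move=> /funext ->. Qed.

(** The additional cosine factor closes the induction: multiplying by sin(c x) replaces its
    frequency lam by lam + c and lam - c, with a phase shift of pi/2. *)
Let test_bern (c : R) N phi : forall lam th : R,
 test (fun x => cos (lam*x+th)*bern N phi ((1+sin (c*x))/2)).
elim: N phi => [|N IH] phi lam th /=.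
 have : test (fun x => cos (lam*x+th)).
  split; last exact: cvg_cos.
   by [].
  by exists 1 => x; exact: cos_norm_le1.
 move=> t; apply: test_eq (test_lin (phi 0%N) 0 t t) => x; ring.
have ps th' : forall lam' (x : R), cos (lam'*x+(th'-pi/2)) = sin (lam'*x+th').
 by move=> lam' x; rewrite addrA cosBpihalf.
have step psi : test (fun x => cos (lam*x+th)*(sin (c*x)*bern N psi ((1+sin (c*x))/2))).
 have := test_lin (2^-1) (- 2^-1) (IH psi (lam+c) (th-pi/2)) (IH psi (lam-c) (th-pi/2)).
 apply: test_eq => x; rewrite !ps.
 rewrite (_ : (lam+c)*x+th = (lam*x+th)+c*x); last by ring.
 rewrite (_ : (lam-c)*x+th = (lam*x+th)-c*x); last by ring.
 by rewrite sinD sinB; field.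
have t1 := test_lin (2^-1) (2^-1) (IH (phi \o succn) lam th) (step (phi \o succn)).
have t2 := test_lin (2^-1) (- 2^-1) (IH phi lam th) (step phi).
by apply: test_eq (test_lin 1 1 t1 t2) => x; field.
Qed.

Hypothesis moment : forall n, intg P (fun w => X n w^+2) /\ Ex P (fun w => X n w^+2) <= 1.

(** The second moments, at most 1 for X_n and for the limit alike, control the quadratic error of
    [trig_approx] once B is large; this takes the place of tightness. *)
Lemma weak_convergence (f : R -> R) (M : R) : continuous f -> bdd f M ->
 Ex P (fun w => f (X n w)) @[n --> \oo] --> Ex gam f.
move=> cf fM; have M0 : 0 <= M by exact: le_trans (fM 0).
have mf : msr f by exact: continuous_measurable_fun.
apply/cvgrPdist_le => e e0; have e5 : 0 < e/5 by rewrite divr_gt0.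
pose B : R := 1+8 * M/(e/5).
have B1 : 1 <= B by rewrite /B lerDl.
have B0 : 0 < B by exact: lt_le_trans B1.
have hB : 8 * M/B^+2 <= e/5.
 rewrite ler_pdivrMr ?exprn_gt0// -ler_pdivrMl// [leLHS]mulrC; apply: (le_via B).
  by rewrite /B lerDr.
 by rewrite expr2 ler_peMl// ltW.
have [N [phi h]] := trig_approx cf fM B0 e5.
set p := fun y => bern N phi ((1+sin (B^-1*y))/2).
have [mp [Mp pM] cp] : test p by apply: test_eq (test_bern (B^-1) N phi 0 0) => x; rewrite mul0r addr0 cos0 mul1r.
have q0 : 0 <= 8 * M/B^+2 by [].
have gen d' (T' : measurableType d') (Q : probability T' R) (Y : T' -> R) : msr Y ->
  intg Q (fun w => Y w^+2) -> Ex Q (fun w => Y w^+2) <= 1 ->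
  `|Ex Q (fun w => f (Y w))-Ex Q (fun w => p (Y w))| <= e/5+e/5.
 move=> mY IY EY.
 have mfY := measurableT_comp mf mY; have mpY := measurableT_comp mp mY.
 have IfY : intg Q (fun w => f (Y w)) by exact: (intg_bounded _ mfY (fun w => fM _)).
 have IpY : intg Q (fun w => p (Y w)) by exact: (intg_bounded _ mpY (fun w => pM _)).
 have Iq : intg Q (fun w => 8 * M/B^+2*Y w^+2) by exact: intgZ.
 rewrite -ExB//; apply: (le_via (Ex Q (fun w => e/5+8 * M/B^+2*Y w^+2))).
  apply: Ex_abs_le => [||w] => //.
  by apply: intgD => //; exact: intg_cst.
 rewrite ExD//; last exact: intg_cst.
 rewrite Ex_cst lerD2l ExZ//; apply: le_trans hB.
 by rewrite ler_piMr.
have hg := @gen _ _ gam (fun x : R => x) (@measurable_id _ R setT) (@intg_gam_sq R).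
rewrite Ex_gam_sq lexx in hg; have {}hg := hg isT.
move/cvgrPdist_le : cp => /(_ _ e5) cp.
near=> n.
have [IX EX] := moment n; have hX := gen _ _ P (X n) (mX n) IX EX.
have hp : `|Ex gam p-Ex P (fun w => p (X n w))| <= e/5 by near: n.
move: hg hX hp; set a := Ex gam _; set b := Ex gam _; set c := Ex P _; set g := Ex P _ => h1 h2 h3.
rewrite (_ : a-c = (a-b)+(b-g)-(c-g)); last by ring.
apply: ler_normB_via; have := ler_normD (a-b) (b-g).
by move: h1 h2 h3; move: (`|_+_|) (`|a-b|) (`|c-g|) (`|b-g|) => *; lra.
Unshelve. all: by end_near.
Qed.

End weak_convergence.

(** * Rectangles determine laws on tuples *)

Section rectangles.
Variable R : realType.

Definition rect N (B : 'I_N -> set R) : set (N.-tuple R) := [set x | forall i, B i (tnth x i)].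

Lemma rectE N (B : 'I_N -> set R) : rect B = \bigcap_i ((fun x => tnth x i) @^-1` B i).
by apply/seteqP; split => [x h i _|x h i]; [exact: h|exact: h]. Qed.

Lemma measurable_rect N (B : 'I_N -> set R) : (forall i, measurable (B i)) -> measurable (rect B).
move=> mB; rewrite rectE; apply: fin_bigcap_measurable => [|i _] => //.
by rewrite -[X in measurable X]setTI; exact: (measurable_tnth i measurableT (mB i)).
Qed.

Lemma rect_generates N (A : set (N.-tuple R)) : measurable A ->
 <<s [set A | exists2 B : 'I_N -> set R, (forall i, measurable (B i)) & A = rect B] >> A.
apply: sub_sigma_algebra2; elim/big_ind: _ => [X []|X Y hX hY Z [/hX|/hY]//|i _ X] //.
move=> [D mD <-]; exists (fun j => if j == i then D else setT).
 by move=> j; case: ifP => _ //; exact: measurableT.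
rewrite setTI; apply/seteqP; split => x /= h.
 by move=> j; case: eqVneq => [->|].
by have := h i; rewrite eqxx.
Qed.

Lemma gauss_rect N (B : 'I_N -> set R) : (forall i, measurable (B i)) ->
 gauss N (rect B) = (\prod_i gam (B i))%E.
elim: N B => [|N IH] B mB.
 rewrite big_ord0 /= diracE mem_set// => -[]//.
rewrite big_ord_recl -IH//.
have -> : gauss N.+1 (rect B) = (gam \x gauss N)%E (@consT R N @^-1` rect B) by [].
rewrite (_ : _ @^-1` _ = B ord0 `*` rect (fun i => B (lift ord0 i))).
 by rewrite product_measure1E//; exact: measurable_rect.
apply/seteqP; split => -[t x] /= h.
 by split => [|i]; [have := h ord0; rewrite tnth_cons0|have := h (lift ord0 i); rewrite tnth_consS].
move=> i; have [h1 h2] := h; case: (unliftP ord0 i) => [j|] -> => //.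
by rewrite tnth_consS.
Qed.

(** Rectangles are stable under intersection and generate the sigma-algebra of tuples. *)
Lemma eqlaw_rect d (T : measurableType d) (P : probability T R) N (phi : T -> N.-tuple R) :
 msr phi ->
 (forall B : 'I_N -> set R, (forall i, measurable (B i)) -> P (phi @^-1` rect B) = gauss N (rect B)) ->
 eqlaw P (gauss N) phi idfun.
move=> mphi h.
pose phiF : {mfun T >-> N.-tuple R} := HB.pack phi (isMeasurableFun.Build _ _ _ _ phi mphi).
have eqm A : measurable A -> distribution P phiF A = gauss N A.
 move=> /rect_generates; apply: (@g_sigma_algebra_measure_unique _ _ _ _ _ (fun=> setT)).
 - by move=> _ [B mB ->]; exact: measurable_rect.
 - move=> _; exists (fun=> setT); [by move=> i; exact: measurableT|by apply/esym/seteqP; split].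
 - by apply/seteqP; split => // x _; exists 0%N.
 - move=> _ _ [B mB ->] [C mC ->]; exists (fun i => B i `&` C i).
   by move=> i; exact: measurableI.
  apply/seteqP; split => x /=; first by move=> [h1 h2] i; split.
  by move=> h1; split => i; case: (h1 i).
 - by move=> _ [B mB ->]; exact: h.
 - move=> _; change (P (phi @^-1` setT) < +oo)%E.
  by rewrite preimage_setT probability_setT ltry.
move=> f M mf fM; rewrite /Ex /Rintegral; congr fine.
have mfe : msr (EFin \o f) by exact/measurable_EFinP.
rewrite [RHS](eq_measure_integral (distribution P phiF)); last by move=> A mA _; exact/esym/eqm.
rewrite (integral_distribution (X := phiF) (f := EFin \o f))//.
exact: (intg_bounded P (measurableT_comp mf mphi) (fun x => fM _)).
Qed.

End rectangles.

(** * Law of the coefficient vector *)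

Section coefficients.
Context d (T : measurableType d) (R : realType) (P : probability T R).
Variables (a b : nat -> {RV P >-> R}).
Hypotheses (ha : iid_std_gaussian P a) (hb : iid_std_gaussian P b).
Hypothesis hab : independent_families P a b.
Variable n : nat.

Definition coefs (w : T) : (n+n).-tuple R :=
 [tuple match fintype.split i with inl k => a k w | inr k => b k w end | i < n+n].

Let coefsl w k : tnth (coefs w) (lshift n k) = a k w.
by rewrite tnth_mktuple; case: splitP => [j|j] /= E; [congr (a _ w)|have := ltn_ord k; rewrite E; lia]. Qed.

Let coefsr w k : tnth (coefs w) (rshift n k) = b k w.
rewrite tnth_mktuple; case: splitP => [j|j] /= E; first by have := ltn_ord j; rewrite -E; lia.
by congr (b _ w); apply/eqP; rewrite -(eqn_add2l n) E.
Qed.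

Lemma measurable_coefs : msr coefs.
apply/measurable_fun_tnthP => i; case: (fintype.splitP i) => k Ek.
 have E : (fun w => tnth (coefs w) i) = a k by apply/funext => w; rewrite -coefsl; congr tnth; exact: val_inj.
 by rewrite -[X in measurable_fun _ X]/(fun w => tnth (coefs w) i) E.
have E : (fun w => tnth (coefs w) i) = b k.
 apply/funext => w; rewrite -coefsr; congr tnth; exact: val_inj.
by rewrite -[X in measurable_fun _ X]/(fun w => tnth (coefs w) i) E.
Qed.

(** Extends a family of sets on ['I_n] to all of nat by the full space, the form in which
    [mutually_independent] takes its sets. *)
Let cut (B : 'I_n -> set R) (k : nat) : set R := if insub k is Some i then B i else setT.

Let measurable_cut B : (forall i, measurable (B i)) -> forall k, measurable (cut B k).
by move=> mB k; rewrite /cut; case: insubP => //= _ _; exact: measurableT. Qed.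

Let cutE B (i : 'I_n) : cut B i = B i.
by rewrite /cut valK. Qed.

Import mathcomp.finmap.finmap.

Let J := finmap.seq_fset tt (iota 0 n).

Let inJ (k : nat) : (k \in J) = (k < n)%N.
by rewrite finmap.seq_fsetE mem_iota. Qed.

Let prodJ (F : nat -> \bar R) : (\prod_(k <- J) F k)%E = (\prod_(k < n) F k)%E.
rewrite (perm_big _ (finmap.seq_fset_perm _ _)) undup_id ?iota_uniq//=.
by rewrite -[iota 0 n]/(iota 0 n) -(big_mkord xpredT F) /index_iota subn0.
Qed.

Let block (X : nat -> {RV P >-> R}) B : (forall i, measurable (B i)) -> iid_std_gaussian P X ->
 P (\bigcap_(k in [set` J]) X k @^-1` cut B k) = (\prod_(k < n) gam (B k))%E /\
 sigma_of X (\bigcap_(k in [set` J]) X k @^-1` cut B k).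
move=> mB [iX gX]; split.
 rewrite (iX J _ (measurable_cut mB)) prodJ; apply: eq_bigr => k _; rewrite cutE.
 exact: (gX k (B k) (mB k)).
apply: (@fin_bigcap_measurable _ (g_sigma_algebraType (\bigcup_i preimage_set_system setT (X i) (@measurable _ R)))).
 by [].
move=> k _; apply: sub_sigma_algebra; exists k => //; exists (cut B k); first exact: measurable_cut.
by rewrite setTI.
Qed.

(** A rectangle splits into an event of the sequence a and one of b. Independence of the two
    families separates them, and mutual independence within each family gives the product of the
    marginals. *)
Lemma coefs_law : eqlaw P (gauss (n+n)) coefs idfun.
apply: eqlaw_rect => [|B mB]; first exact: measurable_coefs.
pose Bl i := B (lshift n i); pose Br i := B (rshift n i).
have [Pa Sa] := block (B := Bl) (fun i => mB _) ha.
have [Pb Sb] := block (B := Br) (fun i => mB _) hb.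
rewrite gauss_rect// big_split_ord/= -/(Bl _) -Pa -Pb -(hab Sa Sb); congr (P _).
apply/seteqP; split => w /=.
 move=> h; split => k /=; rewrite inJ => kn.
  by rewrite (cutE Bl (Ordinal kn)); have := h (lshift n (Ordinal kn)); rewrite coefsl.
 by rewrite (cutE Br (Ordinal kn)); have := h (rshift n (Ordinal kn)); rewrite coefsr.
move=> [h1 h2] i; rewrite -(splitK i); case: (fintype.split i) => k /=.
 by rewrite coefsl; have := h1 k; rewrite /= inJ ltn_ord cutE; apply.
by rewrite coefsr; have := h2 k; rewrite /= inJ ltn_ord cutE; apply.
Qed.

Lemma trig_zeros_coefs w : trig_zeros a b n w = @ZZ R n (coefs w).
rewrite /trig_zeros /ZZ; congr nb_zeros; apply/funext => t.
rewrite hx_split /trig_process mulr_sumr; apply: eq_bigr => k _.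
by rewrite coefsl coefsr.
Qed.

End coefficients.

(** * The two assertions for the random polynomials *)

Section zeros_of_random_polynomials.
Context d (T : measurableType d) (R : realType) (P : probability T R).
Variables (a b : nat -> {RV P >-> R}).
Hypotheses (ha : iid_std_gaussian P a) (hb : iid_std_gaussian P b).
Hypothesis hab : independent_families P a b.

Let Z (n : nat) : {RV P >-> R} := trig_zeros a b n.

Let ExE (f : T -> R) : fine 'E_P[f] = Ex P f.
by rewrite unlock. Qed.

Let VE (f : T -> R) : fine 'V_P[f] = Vr P f.
rewrite /variance covariance.unlock ExE; apply: Ex_eq => w.
by rewrite -(ExE f) expr2.
Qed.

Let coefs_Ex n (g : (n+n).-tuple R -> R) (M : R) : msr g -> bdd g M ->
 Ex P (fun w => g (coefs a b n w)) = EG (n+n) g.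
by move=> mg gM; exact: (coefs_law ha hb hab mg gM). Qed.

Let ZE n w : Z n w = @ZZ R n (coefs a b n w). exact: trig_zeros_coefs. Qed.

Let Z_norm n w : `|Z n w| <= n.*2%:R. by rewrite ZE; exact: ZZ_norm. Qed.

Let EZ n : (4 <= n)%N -> Ex P (Z n) = EG (n+n) (@ZZ R n).
move=> n4; rewrite -(coefs_Ex (ZZ_meas n4) (@ZZ_norm R n)); apply: Ex_eq => w; exact: ZE.
Qed.

Let VZ n : (4 <= n)%N -> Vr P (Z n) = Vr (gauss (n+n)) (@ZZ R n).
move=> n4; rewrite /Vr EZ//; set m := Ex _ (@ZZ R n).
have mg : msr (fun x => (@ZZ R n x-m)^+2) by [].
rewrite -(@coefs_Ex _ _ ((n.*2%:R + `|m|)^+2) mg); first by apply: Ex_eq => w; rewrite ZE.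
move=> x; rewrite normrX; apply: lerXn2r; rewrite ?addr_ge0//.
by apply: ler_normB_via; rewrite lerD2r; exact: ZZ_norm.
Qed.

Let standardizeE n w : standardize P (Z n) w = (Z n w-Ex P (Z n))/Num.sqrt (Vr P (Z n)).
by rewrite /standardize ExE VE. Qed.

(** The estimates on the zeros hold for n >= 4; a shift of the index does not affect the limit. *)
Let X n := standardize P (Z (n+4)).

Lemma zeros_cvg_in_distribution :
 cvg_in_distribution P (fun n => standardize P (Z n)) (normal_prob 0 1).
move=> f cf [M0 [_ /(_ (M0+1))]]; rewrite ltrDl ltr01 => /(_ isT) fM.
have {}fM x : `|f x| <= M0+1 by exact: fM.
have mf : msr f by exact: continuous_measurable_fun.
have mX n : msr (X n) by [].
have IZ n : intg P (Z n) /\ intg P (fun x => (Z n x-Ex P (Z n))^+2).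
 exact: (Vr_bound P (measurable_funPT (Z n)) (Z_norm n)).
have X2 n w : X n w^+2 = (Num.sqrt (Vr P (Z (n+4)))^+2)^-1*(Z (n+4) w-Ex P (Z (n+4)))^+2 by rewrite /X standardizeE exprMn exprVn mulrC.
have moment n : intg P (fun w => X n w^+2) /\ Ex P (fun w => X n w^+2) <= 1.
 have [_ I2] := IZ (n+4)%N; rewrite (funext (X2 n)); split; first exact: intgZ.
 rewrite ExZ// sqr_sqrtr ?Vr_ge0// -/(Vr P (Z (n+4))).
 (* The second moment is V^-1 V, which is 0 if the variance V vanishes and 1 otherwise. *)
 by have [->|h] := eqVneq (Vr P (Z (n+4))) 0; [rewrite mulr0|rewrite mulVf].
have cX (lam th : R) :
  Ex P (fun w => cos (lam*X n w+th)) @[n --> \oo] --> Ex gam (fun x : R => cos (lam*x+th)).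
 rewrite Ex_gam_cos; apply/cvgrPdist_le => e e0.
 have [N hN] := zeros_cos_clt lam th e0.
 near=> n; have n4 : (4 <= n+4)%N by rewrite leq_addl.
 have nN : (N <= n+4)%N by apply: leq_trans (leq_addr 4 n); near: n; exact: nbhs_infty_ge.
 rewrite distrC; apply: le_trans (hN _ nN n4); apply: eq_ler.
 congr (`|_-_|); set E := EG _ (@ZZ R _); set V := Vr (gauss _) (@ZZ R _).
 have mg : msr (fun x => cos (lam*((@ZZ R (n+4) x-E)/Num.sqrt V)+th)) by exact: measurable_cos_affine.
 rewrite -(coefs_Ex mg (fun x => cos_norm_le1 _)); apply: Ex_eq => w.
 by rewrite /X standardizeE EZ// VZ// ZE.
have main := weak_convergence mX cX moment cf fM.
have gE : (\int[normal_prob 0 1]_x (f x)%:E)%E = (Ex gam f)%:E.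
 have If : intg gam f by exact: intg_bounded fM.
 rewrite /Ex /Rintegral fineK; last exact: integrable_fin_num If.
 rewrite (integral_distribution (X := @idR R) (f := EFin \o f))//; first exact/measurable_EFinP.
 exact: (intg_bounded (normal_prob 0 1) mf fM).
rewrite gE -(cvg_shiftn 4).
have IfX n : intg P (f \o X n).
 exact: (intg_bounded P (measurableT_comp mf (mX n)) (fun w => fM _)).
have EX n : ('E_P[f \o X n])%E = (Ex P (fun w => f (X n w)))%:E by rewrite expectation.unlock /Ex /Rintegral fineK//; exact: integrable_fin_num (IfX n).
rewrite [X in X @ _ --> _](_ : _ = fun n => (Ex P (fun w => f (X n w)))%:E); last first.
 by apply/funext => n; rewrite -EX.
by apply: cvg_EFin => //; near=> n.
Unshelve. all: by end_near.
Qed.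

(** For u <= K the asserted bound exceeds 1. For n < 512 and u > K = 2 sqrt 512 the event is empty,
    because the deviation is at most 2n < sqrt n u. Otherwise [zero_tail] applies with an integer
    exponent q >= p, which suffices since u >= 1. *)
Lemma zeros_tail (p : R) : 2 <= p -> exists C : R, forall (n : nat) (omega : R), (0 < n)%N -> 0 < omega ->
 (P [set w | (n%:R * omega <= `|Z n w-fine 'E_P[Z n]|)%R] <= (C/(Num.sqrt n%:R * omega) `^ p)%:E)%E.
move=> p2; pose q := (Num.truncn p).+1.
have pq : p <= q%:R by exact/ltW/truncnS_gt.
have [C0 C00 tail] := zero_tail R q.
pose K : R := 2*Num.sqrt 512.
have K1 : 1 <= K.
 have : 1 <= Num.sqrt 512 :> R by rewrite -{1}(sqrtr1 R) ler_wsqrtr//; lra.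
 by rewrite /K; lra.
have Kp : 0 <= K `^ p by exact: powR_ge0.
exists (C0+K `^ p) => n om n0 om0; rewrite ExE.
set u := Num.sqrt n%:R * om; set S := [set w | _].
have nR : 0 < n%:R :> R by rewrite ltr0n.
have sn : 0 < Num.sqrt n%:R :> R by rewrite sqrtr_gt0.
have u0 : 0 < u by rewrite mulr_gt0.
have nu : Num.sqrt n%:R*u = n%:R * om by rewrite /u mulrA -expr2 sqr_sqrtr// ltW.
have up0 : 0 < u `^ p by exact: powR_gt0.
have [uK|Ku] := leP u K.
 apply: (le_via 1%E).
  apply: probability_le1; apply: measurable_ge_set.
  apply: (measurableT_comp (@normr_measurable R setT)); apply: measurable_funB => //.
 rewrite lee_fin ler_pdivlMr// mul1r; apply: (le_via (K `^ p)); last by rewrite lerDr.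
 by apply: ge0_ler_powR; rewrite ?nnegrE ?(ltW u0)//; lra.
have [n512|n512] := leqP 512 n; last first.
 suff -> : S = set0 by rewrite measure0 lee_fin divr_ge0 ?addr_ge0// ltW.
 apply/seteqP; split => // w; rewrite /S/= leNgt => /negP; apply.
 have Zb (x : T) : 0 <= Z n x <= n.*2%:R by rewrite ZE; exact: ZZ_bounds.
 have Eb := Ex_between P (measurable_funPT (Z n)) Zb.
 have zz : `|Z n w-Ex P (Z n)| <= n.*2%:R.
  have /andP[z0 z1] := Zb w; have /andP[e0 e1] := Eb.
  move: z0 z1 e0 e1; move: (Z n w) (Ex P (Z n)) => x y *.
  by rewrite ler_norml; apply/andP; split; lra.
 apply: (le_lt_trans zz); rewrite -muln2 natrM -nu; apply: (@lt_trans _ _ (Num.sqrt n%:R*K)); last by rewrite ltr_pM2l.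
 rewrite -{1}[n%:R](sqr_sqrtr (ltW nR)) expr2 -mulrA ltr_pM2l// /K mulrC ltr_pM2l// ltr_sqrt ?ltr0n//.
 by rewrite ltr_nat.
have n4 : (4 <= n)%N by exact: leq_trans n512.
have u1 : 1 <= u by exact: le_trans (ltW Ku).
pose A : set ((n+n).-tuple R) := [set x | Num.sqrt n%:R*u <= `|@ZZ R n x-EG (n+n) (@ZZ R n)|].
have mA : measurable A.
 apply: measurable_ge_set; apply: (measurableT_comp (@normr_measurable R setT)).
 by apply: measurable_funB; [exact: ZZ_meas|exact: measurable_cst].
have SA : S = coefs a b n @^-1` A by apply/seteqP; split => w; rewrite /S /A/= nu EZ// ZE.
rewrite SA (eqlaw_measure (@measurable_coefs _ _ _ P a b n) _ (coefs_law ha hb hab (n := n)) mA); last exact: measurable_id.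
rewrite preimage_id -[X in (X <= _)%E]fineK ?fin_num_measure// lee_fin.
apply: le_trans (tail n n512 u u1) _.
apply: (le_via (C0/u `^ p)).
 apply: ler_wpM2l => //; rewrite lef_pV2 ?posrE ?exprn_gt0//.
 by rewrite -powR_mulrn ?(ltW u0)// ler_powR.
by apply: ler_wpM2r; [rewrite invr_ge0 ltW|rewrite lerDl].
Qed.

End zeros_of_random_polynomials.

Theorem corollary1p2 (R : realType) (d : measure_display) (T : measurableType d)
    (P : probability T R) (a b : nat -> {RV P >-> R})
    (ha : iid_std_gaussian P a) (hb : iid_std_gaussian P b)
    (hab : independent_families P a b) :
  let Z (n : nat) : {RV P >-> R} := trig_zeros a b n in
  cvg_in_distribution P (fun n => standardize P (Z n)) (normal_prob 0 1) /\
  (forall p : R, 2 <= p ->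
    exists C : R, forall (n : nat) (omega : R), (0 < n)%N -> 0 < omega ->
      (P [set w | (n%:R * omega <= `|Z n w - fine 'E_P[Z n]|)%R] <=
        (C / (Num.sqrt n%:R * omega) `^ p)%:E)%E).
Proof.
split; first exact: zeros_cvg_in_distribution ha hb hab.
exact: zeros_tail ha hb hab.
Qed.
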